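(* Let $N$ be a $4$-dimensional neutral space form with constant sectional curvature $L_0$, $M$ a Lorentz surface and $F:M\to N$ a time-like and conformal immersion satisfying $K\equiv L_0$ and $R^{\perp}\equiv0$. Let $\lambda,\gamma,k_\pm,X_\pm,Y_\pm,t_-,\rho,f_+,f_-$ be the functions attached to $F$ as in the context, and put $$A:=(f_+)_v(f_-)_u+(f_-)_v(f_+)_u,\qquad A':=(f_+)_v(f_-)_u-(f_-)_v(f_+)_u .$$ Then $F$ satisfies $k_\pm\neq0,\pm1$ and $X_+^2Y_-^2-X_-^2Y_+^2\neq0$ if and only if $\lambda$ with (i) $\lambda_{uu}-\lambda_{vv}+L_0e^{2\lambda}=0$, and $\gamma,t_-,\rho,f_+,f_-$ satisfy, with $\delta\in\{1,-1\}$, (ii) $t_-\neq0$; (iii) $AA'=(f_+)_v^2(f_-)_u^2-(f_-)_v^2(f_+)_u^2\neq0$; (iv) either $$\begin{bmatrix}(f_-)_u\\ (f_-)_v\end{bmatrix}=\begin{bmatrix}\delta\cosh\rho&\sinh\rho\\ \sinh\rho&\delta\cosh\rho\end{bmatrix}\begin{bmatrix}(f_+)_u\\ -(f_+)_v\end{bmatrix}\quad\text{or}\quad \begin{bmatrix}(f_-)_u\\ (f_-)_v\end{bmatrix}=\begin{bmatrix}\delta\cosh\rho&\sinh\rho\\ \sinh\rho&\delta\cosh\rho\end{bmatrix}\begin{bmatrix}(f_+)_v\\ -(f_+)_u\end{bmatrix};$$ (v) $$\begin{bmatrix}\gamma_u\\ \gamma_v\end{bmatrix}=\begin{bmatrix}(t_-)_u\\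 (t_-)_v\end{bmatrix}-\delta\frac{\frac{\partial(f_+,\rho)}{\partial(u,v)}}{\frac{\partial(f_+,f_-)}{\partial(u,v)}}\begin{bmatrix}(f_-)_u\\ (f_-)_v\end{bmatrix}-\frac1{A'}\begin{bmatrix}2(f_+)_u(f_-)_u & -A\\ A & -2(f_+)_v(f_-)_v\end{bmatrix}\begin{bmatrix}\lambda_u\\ \lambda_v\end{bmatrix}.$$ In addition, for functions $\lambda,\gamma,t_-,\rho,f_+,f_-$ satisfying (i)–(v) on a simply connected open set $O$ of the $uv$-plane, there exists a time-like and conformal immersion $F$ of $O$ into $N$ with $K\equiv L_0$, $R^{\perp}\equiv0$ such that the second fundamental form does not satisfy the linearly dependent condition, and which is unique up to an isometry of $N$.
   Context: $E^n_k$ is $\mathbb R^n$ with the flat metric with $k$ minus signs. $N$ is taken to be $E^4_2$ if $L_0=0$, $\{x\in E^5_2:\langle x,x\rangle=1/L_0\}$ if $L_0>0$, $\{x\in E^5_3:\langle x,x\rangle=1/L_0\}$ if $L_0<0$; $h$ is its (signature $(2,2)$) metric and $\nabla$ its Levi-Civita connection. $K$ is the curvature of the induced metric $g$ and $R^{\perp}$ the curvature tensor of the normal connection $\nabla^{\perp}$. Everything is expressed in local coordinates $(u,v)$ compatible with the paracomplex structure of $M$, with $g=e^{2\lambda}(du^2-dv^2)$; $T_1=dF(\partial_u)$, $T_2=dF(\partial_v)$; $N_1,N_2$ are normal vector fields with $h(N_1,N_1)=-h(N_2,N_2)=e^{2\lambda}$, $h(N_1,N_2)=0$. The real functions $\alpha_k,\beta_k$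 ($k=1,2,3$), $\mu_l$ ($l=1,2$) are defined by: the normal components of $\nabla_{T_1}T_1$, $\nabla_{T_1}T_2$, $\nabla_{T_2}T_2$ are $\alpha_1N_1+\beta_1N_2$, $\alpha_2N_1+\beta_2N_2$, $\alpha_3N_1+\beta_3N_2$; and $\nabla^{\perp}_{T_1}N_1=\lambda_uN_1+\mu_1N_2$, $\nabla^{\perp}_{T_1}N_2=\mu_1N_1+\lambda_uN_2$, $\nabla^{\perp}_{T_2}N_1=\lambda_vN_1+\mu_2N_2$, $\nabla^{\perp}_{T_2}N_2=\mu_2N_1+\lambda_vN_2$. Since $R^{\perp}\equiv0$, there is a function $\gamma$ with $\gamma_u=\mu_1$, $\gamma_v=\mu_2$. Put $W_\pm=\alpha_2\pm\beta_1$, $X_\pm=\alpha_2\pm\beta_3$, $Y_\pm=\beta_2\pm\alpha_1$, $Z_\pm=\beta_2\pm\alpha_3$. For $F$ with $K\equiv L_0$, $R^\perp\equiv0$ one has $W_\pm X_\pm-Y_\pm Z_\pm=0$, and it is supposed that there exist functions $k_\pm$ with $(W_\pm,Z_\pm)=k_\pm(Y_\pm,X_\pm)$. The functions $f_\pm$ are functions with $X_\pm=\pm\frac{(f_\pm)_v}{\sqrt{|k_\pm^2-1|}}$, $Y_\pm=\frac{(f_\pm)_u}{\sqrt{|k_\pm^2-1|}}$; they satisfy $(f_+)_u^2-(f_+)_v^2=\varepsilon((f_-)_u^2-(f_-)_v^2)$ for some $\varepsilon\in\{1,-1\}$, and $\rho$ is the function defined by the first relation in (iv) if $\varepsilon=1$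 and by the second if $\varepsilon=-1$; $t_-=\frac12\log\left|\frac{k_--1}{k_-+1}\right|$. With $\alpha=(\alpha_1,\alpha_2,\alpha_3)$, $\beta=(\beta_1,\beta_2,\beta_3)$, the second fundamental form satisfies the linearly dependent condition if one of the following holds: $\cosh t\,\alpha+\sinh t\,\beta=0$ for a function $t$ of $(u,v)$; $\sinh t\,\alpha+\cosh t\,\beta=0$ for a function $t$ of $(u,v)$; $\alpha+\varepsilon\beta=0$ for some $\varepsilon\in\{1,-1\}$. $\partial(p,q)/\partial(u,v)=p_uq_v-p_vq_u$. In the last assertion, the immersion $F$ is the one obtained from the given functions by taking a function $k_-$ with $t_-=\frac12\log\left|\frac{k_--1}{k_-+1}\right|$ (so $k_-=\frac{1+\varepsilon'e^{2t_-}}{1-\varepsilon'e^{2t_-}}$ with $\varepsilon'=1$ or $-1$), putting $B:=(f_+)_u(f_-)_u+(f_+)_v(f_-)_v$, $k_+:=\frac{Bk_-+A}{Ak_-+B}$, $\mu_1:=\gamma_u$, $\mu_2:=\gamma_v$, and defining $X_\pm,Y_\pm,W_\pm,Z_\pm$ and from them $\alpha_k,\beta_k$ by the formulas above; uniqueness refers to the immersion with these data.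
   Formalization: In the equivalence, t_- ≠ δρ (i.e. k_+ ≠ 0) is added to (i)–(v), which alone allow k_+ = 0. In the last assertion F has data f_+, σf_- for some sign σ = ±1, as f_- itself can give inconsistent α, β; k_- is chosen with Ak_- + B ≠ 0. *)

(* Defs.v *)
From HB Require Import structures.
From mathcomp Require Import all_boot all_order all_algebra.
From mathcomp Require Import all_classical all_reals all_analysis.
Set Implicit Arguments.
Unset Strict Implicit.
Unset Printing Implicit Defensive.
Import Order.TTheory GRing.Theory Num.Theory.
Import numFieldNormedType.Exports.
Local Open Scope classical_set_scope.
Local Open Scope ring_scope.

Notation plane R := (R * R)%type.

(* For maps between finite-dimensional spaces this is the usual class C^k:
   all iterated directional derivatives up to order k exist (in the Frechet
   sense) and are continuous. *)
Fixpoint Ck (R : realType) (V W : normedModType R) (k : nat) (O : set V)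
    (f : V -> W) : Prop :=
  if k is k'.+1 then
    (forall x, O x -> differentiable f x) /\ (forall v, Ck k' O ('D_v f))
  else forall x, O x -> {for x, continuous f}.

Definition smooth (R : realType) (V W : normedModType R) (O : set V)
    (f : V -> W) : Prop := forall k, Ck k O f.

Definition du (R : realType) (W : normedModType R) (f : plane R -> W) :
  plane R -> W := 'D_((1, 0) : plane R) f.

Definition dv (R : realType) (W : normedModType R) (f : plane R -> W) :
  plane R -> W := 'D_((0, 1) : plane R) f.

(* Index 0 is u and index 1 is v. *)
Definition dcoord (R : realType) (W : normedModType R) (i : 'I_2)
    (f : plane R -> W) : plane R -> W := if i == ord0 then du f else dv f.

Definition jacobian (R : realType) (f g : plane R -> R) (p : plane R) : R :=
  du f p * dv g p - dv f p * du g p.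

Definition cosh (R : realType) (x : R) : R := (expR x + expR (- x)) / 2.
Definition sinh (R : realType) (x : R) : R := (expR x - expR (- x)) / 2.

Definition unit_segment (R : realType) : set R := [set x | 0 <= x <= 1].

Definition path_connected (R : realType) (O : set (plane R)) : Prop :=
  forall a b, O a -> O b -> exists c : R -> plane R,
    [/\ {within @unit_segment R, continuous c},
        forall s, unit_segment s -> O (c s), c 0 = a & c 1 = b].

(* Null-homotopy of every loop, with the base point fixed. *)
Definition simply_connected (R : realType) (O : set (plane R)) : Prop :=
  [/\ O !=set0, path_connected O &
    forall c : R -> plane R,
      {within @unit_segment R, continuous c} ->
      (forall s, unit_segment s -> O (c s)) -> c 0 = c 1 ->
      exists H : plane R -> plane R,
        [/\ {within @unit_segment R `*` @unit_segment R, continuous H},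
            forall s t, unit_segment s -> unit_segment t -> O (H (s, t)),
            forall s, unit_segment s -> H (s, 0) = c s,
            forall s, unit_segment s -> H (s, 1) = c 0 &
            forall t, unit_segment t -> H (0, t) = c 0 /\ H (1, t) = c 0]].

Definition ambient_dim (R : realType) (L0 : R) : nat :=
  if L0 == 0 then 4%N else 5%N.

Definition ambient_index (R : realType) (L0 : R) : nat :=
  if L0 < 0 then 3%N else 2%N.

Definition inner (R : realType) (L0 : R) (x y : 'rV[R]_(ambient_dim L0)) : R :=
  \sum_(i < ambient_dim L0)
     (-1) ^+ (i < ambient_index L0)%N * x ord0 i * y ord0 i.

Definition spaceform (R : realType) (L0 : R) : set 'rV[R]_(ambient_dim L0) :=
  if L0 == 0 then setT else [set x | inner x x = L0^-1].

(* The factor L0 makes the condition void in the flat case. *)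
Definition tangent (R : realType) (L0 : R) (x xi : 'rV[R]_(ambient_dim L0)) :
  Prop := L0 * inner x xi = 0.

(* The space form is a closed submanifold of the ambient space, so that its
   smooth self-maps are the restrictions of smooth ambient maps. *)
Definition spaceform_isometry (R : realType) (L0 : R)
    (phi : 'rV[R]_(ambient_dim L0) -> 'rV[R]_(ambient_dim L0)) : Prop :=
  [/\ smooth setT phi,
      forall x, @spaceform R L0 x -> @spaceform R L0 (phi x),
      exists2 psi : 'rV[R]_(ambient_dim L0) -> 'rV[R]_(ambient_dim L0),
        smooth setT psi &
        forall x, @spaceform R L0 x ->
          [/\ @spaceform R L0 (psi x), psi (phi x) = x & phi (psi x) = x] &
      forall x xi eta, @spaceform R L0 x -> tangent x xi -> tangent x eta ->
        inner ('D_xi phi x) ('D_eta phi x) = inner xi eta].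

Definition congruent_on (R : realType) (L0 : R) (O : set (plane R))
    (F F' : plane R -> 'rV[R]_(ambient_dim L0)) : Prop :=
  exists2 phi, spaceform_isometry phi & forall p, O p -> F' p = phi (F p).

Definition metric (R : realType) (L0 : R)
    (F : plane R -> 'rV[R]_(ambient_dim L0)) (p : plane R) : 'M[R]_2 :=
  \matrix_(i, j) inner (dcoord i F p) (dcoord j F p).

(* christoffel g i j l is the component along d_l of nabla_{d_i} d_j. *)
Definition christoffel (R : realType) (g : plane R -> 'M[R]_2) (i j l : 'I_2)
    (p : plane R) : R :=
  2^-1 * \sum_(m < 2) (invmx (g p)) l m *
    (dcoord i (fun q => g q j m) p + dcoord j (fun q => g q i m) p
     - dcoord m (fun q => g q i j) p).

(* riemann g i j k l is the component along d_l of R(d_i, d_j) d_k, with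
   R(X, Y) = [nabla_X, nabla_Y] - nabla_[X, Y]. *)
Definition riemann (R : realType) (g : plane R -> 'M[R]_2) (i j k l : 'I_2)
    (p : plane R) : R :=
  dcoord i (christoffel g j k l) p - dcoord j (christoffel g i k l) p
  + \sum_(m < 2) (christoffel g j k m p * christoffel g i m l p
                  - christoffel g i k m p * christoffel g j m l p).

Definition gauss_curvature (R : realType) (g : plane R -> 'M[R]_2)
    (p : plane R) : R :=
  (\sum_(l < 2) riemann g ord0 ord_max ord_max l p * g p l ord0)
  / \det (g p).

(* Levi-Civita connection of the space form along F: the orthogonal projection
   of the flat derivative, the position vector F being normal to the space form
   with <F, F> = 1 / L0. *)
Definition nabla (R : realType) (L0 : R)
    (F : plane R -> 'rV[R]_(ambient_dim L0)) (i : 'I_2)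
    (V : plane R -> 'rV[R]_(ambient_dim L0)) (p : plane R) :
  'rV[R]_(ambient_dim L0) :=
  dcoord i V p - (L0 * inner (dcoord i V p) (F p)) *: F p.

Definition normal_part (R : realType) (L0 : R)
    (F : plane R -> 'rV[R]_(ambient_dim L0)) (p : plane R)
    (x : 'rV[R]_(ambient_dim L0)) : 'rV[R]_(ambient_dim L0) :=
  x - \sum_(i < 2) \sum_(j < 2)
        ((invmx (metric F p)) i j * inner x (dcoord i F p)) *: dcoord j F p.

Definition normal_field (R : realType) (L0 : R) (O : set (plane R))
    (F xi : plane R -> 'rV[R]_(ambient_dim L0)) : Prop :=
  smooth O xi /\
  forall p, O p -> [/\ tangent (F p) (xi p), inner (du F p) (xi p) = 0 &
                       inner (dv F p) (xi p) = 0].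

Definition second_ff (R : realType) (L0 : R)
    (F : plane R -> 'rV[R]_(ambient_dim L0)) (i j : 'I_2) (p : plane R) :
  'rV[R]_(ambient_dim L0) := normal_part F p (nabla F i (dcoord j F) p).

Definition nabla_perp (R : realType) (L0 : R)
    (F : plane R -> 'rV[R]_(ambient_dim L0)) (i : 'I_2)
    (xi : plane R -> 'rV[R]_(ambient_dim L0)) (p : plane R) :
  'rV[R]_(ambient_dim L0) := normal_part F p (nabla F i xi p).

Definition flat_normal (R : realType) (L0 : R) (O : set (plane R))
    (F : plane R -> 'rV[R]_(ambient_dim L0)) : Prop :=
  forall xi, normal_field O F xi -> forall p, O p ->
    nabla_perp F ord0 (nabla_perp F ord_max xi) p
    - nabla_perp F ord_max (nabla_perp F ord0 xi) p = 0.

(* Time-like conformal immersion of O into the space form, with induced metric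
   e^(2 lam) (du^2 - dv^2). *)
Record conformal_immersion (R : realType) (L0 : R) (O : set (plane R))
    (F : plane R -> 'rV[R]_(ambient_dim L0)) (lam : plane R -> R) : Prop := {
  immersion_smooth : smooth O F;
  immersion_in : forall p, O p -> @spaceform R L0 (F p);
  lam_smooth : smooth O lam;
  immersion_conformal : forall p, O p ->
    [/\ inner (du F p) (du F p) = expR (2 * lam p),
        inner (dv F p) (dv F p) = - expR (2 * lam p) &
        inner (du F p) (dv F p) = 0]
}.

Record normal_frame (R : realType) (L0 : R) (O : set (plane R))
    (F : plane R -> 'rV[R]_(ambient_dim L0)) (lam : plane R -> R)
    (N1 N2 : plane R -> 'rV[R]_(ambient_dim L0)) : Prop := {
  normal_field1 : normal_field O F N1;
  normal_field2 : normal_field O F N2;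
  normal_gram : forall p, O p ->
    [/\ inner (N1 p) (N1 p) = expR (2 * lam p),
        inner (N2 p) (N2 p) = - expR (2 * lam p) &
        inner (N1 p) (N2 p) = 0]
}.

Record coeffs (R : realType) := Coeffs {
  al1 : plane R -> R; al2 : plane R -> R; al3 : plane R -> R;
  be1 : plane R -> R; be2 : plane R -> R; be3 : plane R -> R;
  mu1 : plane R -> R; mu2 : plane R -> R
}.

Record coeffs_of (R : realType) (L0 : R) (O : set (plane R))
    (F : plane R -> 'rV[R]_(ambient_dim L0)) (lam : plane R -> R)
    (N1 N2 : plane R -> 'rV[R]_(ambient_dim L0)) (D : coeffs R) : Prop := {
  second_ff_coeffs : forall p, O p ->
    [/\ second_ff F ord0 ord0 p = al1 D p *: N1 p + be1 D p *: N2 p,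
        second_ff F ord0 ord_max p = al2 D p *: N1 p + be2 D p *: N2 p &
        second_ff F ord_max ord_max p = al3 D p *: N1 p + be3 D p *: N2 p];
  nabla_perp_coeffs : forall p, O p ->
    [/\ nabla_perp F ord0 N1 p = du lam p *: N1 p + mu1 D p *: N2 p,
        nabla_perp F ord0 N2 p = mu1 D p *: N1 p + du lam p *: N2 p,
        nabla_perp F ord_max N1 p = dv lam p *: N1 p + mu2 D p *: N2 p &
        nabla_perp F ord_max N2 p = mu2 D p *: N1 p + dv lam p *: N2 p]
}.

(* In the next definitions the sign s is 1 for the index + and -1 for the
   index -. *)
Definition Wpm (R : realType) (s : R) (D : coeffs R) (p : plane R) : R :=
  al2 D p + s * be1 D p.
Definition Xpm (R : realType) (s : R) (D : coeffs R) (p : plane R) : R :=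
  al2 D p + s * be3 D p.
Definition Ypm (R : realType) (s : R) (D : coeffs R) (p : plane R) : R :=
  be2 D p + s * al1 D p.
Definition Zpm (R : realType) (s : R) (D : coeffs R) (p : plane R) : R :=
  be2 D p + s * al3 D p.

(* Since x / 0 = 0, f_def forces X and Y to vanish where k = 1 or k = -1. *)
Record signed_data (R : realType) (s : R) (O : set (plane R)) (D : coeffs R)
    (k f : plane R -> R) : Prop := {
  k_smooth : smooth O k;
  f_smooth : smooth O f;
  k_def : forall p, O p ->
    Wpm s D p = k p * Ypm s D p /\ Zpm s D p = k p * Xpm s D p;
  f_def : forall p, O p ->
    Xpm s D p = s * (dv f p / Num.sqrt `|k p ^+ 2 - 1|) /\
    Ypm s D p = du f p / Num.sqrt `|k p ^+ 2 - 1|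
}.

Record attached (R : realType) (L0 : R) (O : set (plane R))
    (F : plane R -> 'rV[R]_(ambient_dim L0)) (lam : plane R -> R)
    (N1 N2 : plane R -> 'rV[R]_(ambient_dim L0)) (D : coeffs R)
    (gam kp km fp fm : plane R -> R) : Prop := {
  attached_immersion : conformal_immersion O F lam;
  attached_frame : normal_frame O F lam N1 N2;
  attached_coeffs : coeffs_of O F lam N1 N2 D;
  gam_smooth : smooth O gam;
  gam_def : forall p, O p -> du gam p = mu1 D p /\ dv gam p = mu2 D p;
  attached_plus : signed_data 1 O D kp fp;
  attached_minus : signed_data (-1) O D km fm
}.

Definition linearly_dependent (R : realType) (O : set (plane R))
    (D : coeffs R) : Prop :=
  let vanishes (a b : plane R -> R) := forall p, O p ->
    [/\ a p * al1 D p + b p * be1 D p = 0,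
        a p * al2 D p + b p * be2 D p = 0 &
        a p * al3 D p + b p * be3 D p = 0] in
  [\/ exists t : plane R -> R,
        vanishes (fun p => cosh (t p)) (fun p => sinh (t p)),
      exists t : plane R -> R,
        vanishes (fun p => sinh (t p)) (fun p => cosh (t p)) |
      exists2 e : R, e = 1 \/ e = -1 & vanishes (fun=> 1) (fun=> e)].

Definition tfun (R : realType) (k : plane R -> R) (p : plane R) : R :=
  2^-1 * ln `|(k p - 1) / (k p + 1)|.

Definition coefA (R : realType) (fp fm : plane R -> R) (p : plane R) : R :=
  dv fp p * du fm p + dv fm p * du fp p.
Definition coefA' (R : realType) (fp fm : plane R -> R) (p : plane R) : R :=
  dv fp p * du fm p - dv fm p * du fp p.
Definition coefB (R : realType) (fp fm : plane R -> R) (p : plane R) : R :=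
  du fp p * du fm p + dv fp p * dv fm p.

Record structure_equations (R : realType) (L0 : R) (O : set (plane R))
    (delta : R) (lam gam t rho fp fm : plane R -> R) : Prop := {
  eq_i : forall p, O p ->
    du (du lam) p - dv (dv lam) p + L0 * expR (2 * lam p) = 0;
  eq_ii : forall p, O p -> t p != 0;
  eq_iii : forall p, O p -> coefA fp fm p * coefA' fp fm p != 0;
  eq_iv :
    (forall p, O p ->
       du fm p = delta * cosh (rho p) * du fp p + sinh (rho p) * - dv fp p /\
       dv fm p = sinh (rho p) * du fp p + delta * cosh (rho p) * - dv fp p)
    \/
    (forall p, O p ->
       du fm p = delta * cosh (rho p) * dv fp p + sinh (rho p) * - du fp p /\
       dv fm p = sinh (rho p) * dv fp p + delta * cosh (rho p) * - du fp p);
  eq_v : forall p, O p ->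
    du gam p = du t p
      - delta * (jacobian fp rho p / jacobian fp fm p) * du fm p
      - (coefA' fp fm p)^-1 *
        (2 * du fp p * du fm p * du lam p - coefA fp fm p * dv lam p) /\
    dv gam p = dv t p
      - delta * (jacobian fp rho p / jacobian fp fm p) * dv fm p
      - (coefA' fp fm p)^-1 *
        (coefA fp fm p * du lam p - 2 * dv fp p * dv fm p * dv lam p)
}.

Definition kplus (R : realType) (km fp fm : plane R -> R) (p : plane R) : R :=
  (coefB fp fm p * km p + coefA fp fm p)
  / (coefA fp fm p * km p + coefB fp fm p).

(* The choices of k_- compatible with t for which kplus is defined. *)
Definition admissible (R : realType) (O : set (plane R))
    (t km fp fm : plane R -> R) : Prop :=
  smooth O km /\
  forall p, O p ->
    t p = tfun km p /\ coefA fp fm p * km p + coefB fp fm p != 0.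

(* Main.v *)
Require Import Defs.
From HB Require Import structures.
From mathcomp Require Import all_boot all_order all_algebra.
From mathcomp Require Import all_classical all_reals all_analysis.
From mathcomp Require Import ring lra.
Set Implicit Arguments.
Unset Strict Implicit.
Unset Printing Implicit Defensive.
Import Order.TTheory GRing.Theory Num.Theory.
Import numFieldNormedType.Exports.
Local Open Scope classical_set_scope.
Local Open Scope ring_scope.

(** Let P, Q be the null derivatives f_u - f_v, f_u + f_v of f_+, and P', Q' the
    null derivatives f_u + f_v, f_u - f_v of f_-; put s_+- for the square root of
    |k_+-^2 - 1|.

    The quantities W, X, Y, Z of both signs are built from the same alpha and
    beta, so that X_+ + X_- = W_+ + W_- and Y_+ + Y_- = Z_+ + Z_-. In terms of the
    potentials these two relations decouple ([null_relations]):
      (k_+ + 1) P / s_+ = - (k_- + 1) P' / s_-,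
      (k_+ - 1) Q / s_+ = - (k_- - 1) Q' / s_-.
    Their product is P' Q' = e P Q with a constant sign e ([null_product]). The
    ratio P' / P has no zero, because 2 A = Q P' - P Q' has none, and writing it
    as e m with m = delta e^(delta rho) gives P' = e m P, Q' = Q / m, which is (iv).
    Their quotient is t_+ = t_- - delta rho ([tval_relation]). This explains (ii),
    (iii), (iv) and the condition t_- <> delta rho, which says that k_+ has no
    zero. Equation (i) is K = L0, since the curvature of e^(2 lam) (du^2 - dv^2) is
    - e^(-2 lam) (lam_uu - lam_vv) ([gauss_curvature_conformal]).

    For (v), each of the two pairs of Codazzi equations collapses to one scalar
    equation ([codazzi_potential]),
      f_v (gamma_u - t_u) - f_u (gamma_v - t_v) = -+ (lam_u f_u - lam_v f_v),
    because dk = (k^2 - 1) dt absorbs the derivatives of the square root. The two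
    equations are linear in d gamma with determinant - A', and (v) is their
    solution ([solve_connection]).

    Conversely, k_+ is defined so that the two null relations hold, up to one
    sign that is put on f_- ([kplus_sign]); reading the above backwards, the
    potentials determine alpha and beta, and the Gauss, Ricci and Codazzi
    equations hold ([built_compatibility]). They say that the linear system for
    the frame F, dF(d_u), dF(d_v), N1, N2 is flat ([conn_flat]), and a flat system on
    a simply connected open set has a solution with any initial value
    ([flat_system_solution]): locally by Picard iteration in one variable and
    then in the other, globally by continuation along paths. The Gram matrix of
    a solution satisfies a homogeneous linear system together with the values
    expected of it, so that it keeps the values of an adapted initial frame
    ([gram_propagates]), and F is the required immersion. For two immersions with
    the same data, an isometry of the space form carries one frame at a point
    to the other, and both frames solve the same system ([frame_congruence]).

    If a combination of alpha and beta vanished at a point, then either k_+ would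
    be 1 or -1 there or X_+ Y_- would equal X_- Y_+ up to sign, that is A A' = 0
    ([independent_forms]). *)

(** * Preliminaries in one variable *)

Lemma is_derive_continuous (R : realType) (f : R -> R) (x l : R) :
  is_derive x 1 f l -> {for x, continuous f}.
Proof.
by move=> [df _]; apply/differentiable_continuous/derivable1_diffP.
Qed.

Lemma mean_value (R : realType) (f f' : R -> R) (a b : R) :
  (forall x, Num.min a b <= x <= Num.max a b -> is_derive x 1 f (f' x)) ->
  exists2 c, Num.min a b <= c <= Num.max a b & f b - f a = f' c * (b - a).
Proof.
wlog ab : a b / a <= b => [hw|].
  have /orP[ab|ba] := le_total a b; first exact: hw.
  rewrite minC maxC => /(hw _ _ ba)[c cab e]; exists c => //.
  by rewrite -opprB e -mulrN opprB.
rewrite (min_l ab) (max_r ab) => df.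
have [||c] := @MVT_segment R f f' a b ab.
- by move=> x; rewrite in_itv/= => /andP[ax xb]; apply: df; rewrite !ltW.
- apply: derivable_within_continuous => x; rewrite in_itv/= => xab.
  by have [] := df x xab.
- by rewrite in_itv/= => cab e; exists c.
Qed.

(** On a compact interval this is the fundamental theorem of calculus; the
    integrals from - N, normalised to vanish at 0, agree where they are both
    defined and glue to a primitive on the whole line. *)
Lemma antiderivative (R : realType) (g : R -> R) : continuous g ->
  exists G : R -> R, forall x : R, is_derive x 1 G (g x).
Proof.
move=> cg.
have H (N : nat) : exists G : R -> R, forall x : R, - N%:R < x -> is_derive x 1 G (g x).
  exists (fun x => (\int[lebesgue_measure]_(t in `[(- N%:R)%R, x]) g t)%R) => x Nx.
  have [||d e] := @continuous_FTC1_closed R g (- N%:R) x (x + 1) _ _ Nx (cg x).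
  - by rewrite ltrDl.
  - apply: continuous_compact_integrable; first exact: segment_compact.
    exact: continuous_subspaceT.
  - by rewrite derive1E in e; exact: (DeriveDef d e).
have [G HG] := choice H.
have glue (M N : nat) x : - N%:R < x -> (0 < N)%N -> (N <= M)%N ->
    G M x - G M 0 = G N x - G N 0.
  move=> Nx N0 NM.
  have N0' : - N%:R < 0 :> R by rewrite oppr_lt0 ltr0n.
  have MN : - M%:R <= - N%:R :> R by rewrite lerN2 ler_nat.
  have [y yx|c _] := @mean_value R (G M \- G N) (fun=> 0) 0 x.
    have Ny : - N%:R < y.
      by case/andP: yx => + _; apply: lt_le_trans; rewrite lt_min N0' Nx.
    rewrite -[0](subrr (g y)); apply: is_deriveB; last exact: HG.
    by apply: HG; exact: le_lt_trans Ny.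
  by rewrite mul0r /=; lra.
pose n (x : R) := (Num.truncn `|x|).+2.
exists (fun x => G (n x) x - G (n x) 0) => x.
have nP (y : R) : - (n y)%:R < y - 1.
  have := truncnS_gt `|y|; rewrite /n -natr1 => h.
  have := ler_norm (- y); rewrite normrN; lra.
have e : \forall y \near x, G (n x) y - G (n x) 0 = G (n y) y - G (n y) 0.
  near=> y.
  have xy : - (n x)%:R < y.
    apply: lt_trans (nP x) _; rewrite ltrBlDr -ltrBlDl.
    have : `|x - y| < 1 by near: y; apply: cvgr_dist_lt.
    by move=> /(le_lt_trans (ler_norm _)).
  have yy : - (n y)%:R < y by apply: lt_trans (nP y) _; rewrite ltrBlDr ltrDl.
  by have [nxy|/ltnW nyx] := leqP (n x) (n y); [symmetry|]; apply: glue.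
apply: near_eq_is_derive e _.
rewrite -[g x]subr0; apply: is_deriveB.
by apply: HG; apply: lt_trans (nP x) _; rewrite ltrBlDr ltrDl.
Unshelve. all: by end_near. Qed.

(** The limit is obtained as a supremum: the lower bounds f k - 2 C / 2^k
    increase with k and the upper bounds f k + 2 C / 2^k decrease. *)
Lemma geometric_limit (R : realType) (T : Type) (f : nat -> T -> R) (C : R) :
  (forall k t, `|f k.+1 t - f k t| <= C / 2 ^+ k) ->
  exists l : T -> R, forall k t, `|l t - f k t| <= 2 * (C / 2 ^+ k).
Proof.
move=> hf.
pose w k := C / 2 ^+ k.
have wS k : w k.+1 = w k / 2 by rewrite /w exprS invfM mulrA mulrAC.
have w0 (t : T) k : 0 <= w k by apply: le_trans (hf k t).
have lo t : {homo (fun k => f k t - 2 * w k) : j k / (j <= k)%N >-> j <= k}.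
  apply: homo_leq => [//|? ? ?|k]; first exact: le_trans.
  by have := hf k t; rewrite -/(w k) ler_norml wS; have := w0 t k; lra.
have hi t : {homo (fun k => f k t + 2 * w k) : j k / (j <= k)%N >-> k <= j}.
  apply: homo_leq => [//|x y z|k]; first by move=> ? /le_trans; apply.
  by have := hf k t; rewrite -/(w k) ler_norml wS; have := w0 t k; lra.
have lohi t j k : f j t - 2 * w j <= f k t + 2 * w k.
  apply: le_trans (lo t j (maxn j k) (leq_maxl _ _)) _.
  apply: le_trans (hi t k (maxn j k) (leq_maxr _ _)).
  by have := w0 t (maxn j k); lra.
exists (fun t => sup (range (fun k => f k t - 2 * w k))) => k t.
rewrite ler_norml; apply/andP; split.
  rewrite lerBrDl; apply: sup_upper_bound; last by exists k.
  split; first by exists (f 0%N t - 2 * w 0%N); exists 0%N.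
  by exists (f 0%N t + 2 * w 0%N) => _ [j _ <-]; exact: lohi.
rewrite lerBlDl; apply: ge_sup; first by exists (f 0%N t - 2 * w 0%N); exists 0%N.
by move=> _ [j _ <-]; exact: lohi.
Qed.

Definition clamp (R : realType) (a b t : R) : R := Num.max a (Num.min t b).

Lemma clampP (R : realType) (a b t : R) : a <= b -> a <= clamp a b t <= b.
Proof. by move=> ab; rewrite /clamp le_max lexx ge_max ab ge_min lexx orbT. Qed.

Lemma clamp_id (R : realType) (a b t : R) : a <= t <= b -> clamp a b t = t.
Proof. by move=> /andP[at_ tb]; rewrite /clamp min_l// max_r. Qed.

Lemma continuous_clamp (R : realType) (a b : R) : continuous (clamp a b).
Proof.
move=> t; apply: (@continuous_max R R (fun=> a) (fun t => Num.min t b)).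
  exact: cst_continuous.
by apply: (@continuous_min R R id (fun=> b)); [exact: cvg_id|exact: cst_continuous].
Qed.

(** * Linear ordinary differential equations *)

Lemma pow2_bound_lt (R : realType) (B e : R) : 0 < e -> exists k, B / 2 ^+ k < e.
Proof.
move=> e0; exists (Num.truncn (B / e)).+1.
rewrite ltr_pdivrMr ?exprn_gt0// mulrC -ltr_pdivrMr//.
apply: (@lt_trans _ _ (Num.truncn (B / e)).+1%:R); first exact: truncnS_gt.
by rewrite -natrX ltr_nat ltn_expl.
Qed.

Lemma pow2_bound_eq0 (R : realType) (B x : R) :
  (forall k, `|x| <= B / 2 ^+ k) -> x = 0.
Proof.
move=> h; apply/eqP; rewrite -normr_le0 leNgt; apply/negP => x0.
by have [k] := pow2_bound_lt B x0; rewrite ltNge h.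
Qed.

Lemma cvg_sumr (R : realType) (I : finType) (T : topologicalType) (f : I -> T -> R)
    (x : T) : (forall i, {for x, continuous (f i)}) ->
  {for x, continuous (fun y => \sum_i f i y)}.
Proof.
move=> cf; rewrite /prop_for /continuous_at; apply: cvg_big => [|i _]; last exact: cf.
by move=> y; apply: cvgD; [exact: cvg_fst|exact: cvg_snd].
Qed.

(** A form of Gronwall's inequality on an interval so short that the growth
    factor is at most 2: the mean value theorem at a point where the sum of the
    norms is maximal. *)
Lemma small_interval_estimate (R : realType) (I : finType) (e d : I -> R -> R)
    (a b K eps t0 t : R) :
  (forall s, a < s < b -> forall i, is_derive s 1 (e i) (d i s)) ->
  (forall s, a < s < b -> forall i, `|d i s| <= K * (\sum_j `|e j s|) + eps) ->
  0 <= K -> #|I|%:R * K * (b - a) <= 2^-1 -> a < t0 < b -> a < t < b ->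
  \sum_i `|e i t| <= 2 * (\sum_i `|e i t0| + #|I|%:R * (b - a) * eps).
Proof.
move=> de dB K0 small /andP[at0 t0b] /andP[at_ tb].
set m := Num.min t0 t; set M := Num.max t0 t.
have sub s : m <= s <= M -> a < s < b.
  move=> /andP[ms sM]; apply/andP; split.
    by apply: lt_le_trans ms; rewrite lt_min at0.
  by apply: le_lt_trans sM _; rewrite gt_max t0b.
have mM : m <= M by rewrite ge_min le_max lexx.
pose S s := \sum_i `|e i s|.
have [|tau tauI tauM] := @EVT_max R S m M mM.
  apply: continuous_in_subspaceT => s; rewrite inE/= in_itv/= => /sub sI.
  apply: (@cvg_sumr R I R (fun i s => `|e i s|)) => i; apply: cvg_norm.
  exact: is_derive_continuous (de s sI i).
have tauI' : m <= tau <= M by rewrite in_itv in tauI.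
have Stau s : m <= s <= M -> S s <= S tau by move=> h; apply: tauM; rewrite in_itv.
have t0I : m <= t0 <= M by rewrite ge_min le_max lexx.
have tI : m <= t <= M by rewrite ge_min le_max lexx !orbT.
suff H : S tau <= 2 * (S t0 + #|I|%:R * (b - a) * eps) by apply: le_trans (Stau t tI) H.
have ba : 0 <= b - a by rewrite subr_ge0 ltW// (lt_trans at0).
have sub' s : Num.min t0 tau <= s <= Num.max t0 tau -> m <= s <= M.
  move=> /andP[h1 h2]; move/andP: tauI' => [mt tM]; move/andP: t0I => [mt0 t0M].
  apply/andP; split; first by apply: le_trans h1; rewrite le_min mt0.
  by apply: le_trans h2 _; rewrite ge_max t0M.
have Hi i : `|e i tau| <= `|e i t0| + (K * S tau + eps) * (b - a).
  have [s /sub' sI|xi /sub' xiI E] := @mean_value R (e i) (d i) t0 tau _.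
    exact: de (sub s sI) i.
  have -> : e i tau = e i t0 + d i xi * (tau - t0) by rewrite -E addrC subrK.
  apply: le_trans (ler_normD _ _) _; rewrite lerD2l normrM.
  apply: ler_pM => //.
    apply: le_trans (dB xi (sub _ xiI) i) _; rewrite lerD2r ler_wpM2l//.
    exact: Stau.
  have := sub _ tauI'; rewrite ler_norml; lra.
have {}Hi : S tau <= S t0 + #|I|%:R * ((K * S tau + eps) * (b - a)).
  rewrite /S; apply: le_trans (ler_sum _ (fun i _ => Hi i)) _.
  by rewrite big_split/= sumr_const lerD2l -[leLHS]mulr_natl lexx.
have S0 : 0 <= S tau by apply: sumr_ge0 => i _.
have := ler_wpM2r S0 small; rewrite mulrDl mulrDr in Hi; lra.
Qed.

Section picard.
Variables (R : realType) (I : finType) (A : I -> I -> R -> R) (M a b t0 : R).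
Variable c : I -> R.
Hypotheses (at0 : a < t0) (t0b : t0 < b).
Hypothesis contA : forall i j, continuous (A i j).
Hypothesis boundA : forall i j t, `|A i j t| <= M.
Hypothesis small : #|I|%:R * M * (b - a) <= 2^-1.

Notation clamp := (clamp a b).

Let clamp_dist t : `|clamp t - t0| <= b - a.
Proof.
have /andP[] := clampP t (ltW (lt_trans at0 t0b)).
by rewrite ler_norml; move: (at0) (t0b); lra.
Qed.

Let clamp_id t : a < t < b -> clamp t = t.
Proof. by move=> /andP[h1 h2]; rewrite clamp_id ?ltW. Qed.

Let prim (g : R -> R) : R -> R :=
  if pselect (continuous g) is left h then sval (cid (antiderivative h)) else 0.

Let primP (g : R -> R) (t : R) : continuous g -> is_derive t 1 (prim g) (g t).
Proof. by move=> cg; rewrite /prim; case: pselect => // h; case: cid. Qed.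

Let field (u : I -> R -> R) (i : I) (t : R) : R := \sum_j A i j t * u j t.

Let fieldC (u : I -> R -> R) : (forall i, continuous (u i)) -> forall i, continuous (field u i).
Proof.
move=> cu i t; apply: (@cvg_sumr R I R (fun j t => A i j t * u j t)) => j.
by apply: cvgM; [exact: contA|exact: cu].
Qed.

(* Outside of the interval the integral is frozen, so that the iterates are
   defined and bounded on the whole line. *)
Let T (u : I -> R -> R) (i : I) (t : R) : R :=
  c i + (prim (field u i) (clamp t) - prim (field u i) t0).

Let TC (u : I -> R -> R) : (forall i, continuous (u i)) -> forall i, continuous (T u i).
Proof.
move=> cu i t; apply: cvgD; first exact: cvg_cst.
apply: cvgB; last exact: cvg_cst.
apply: continuous_comp; first exact: continuous_clamp.
have h := primP (clamp t) (@fieldC u cu i).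
exact: is_derive_continuous h.
Qed.

Let Y k := iter k T (fun i _ => c i).

Let YC k i : continuous (Y k i).
Proof.
elim: k i => [|k IH] i; first by move=> t; exact: cvg_cst.
exact: TC.
Qed.

Let M0 (i : I) : 0 <= M. Proof. exact: le_trans (boundA i i 0). Qed.

Let sup_diff (u v : I -> R -> R) (D : R) :
  (forall t, \sum_i `|u i t - v i t| <= D) ->
  forall i t, `|field u i t - field v i t| <= M * D.
Proof.
move=> uvD i t; rewrite -sumrB; apply: le_trans (ler_norm_sum _ _ _) _.
apply: le_trans (ler_wpM2l (M0 i) (uvD t)); rewrite mulr_sumr; apply: ler_sum => j _.
by rewrite -mulrBr normrM ler_wpM2r.
Qed.

Let incr (g : R -> R) (B : R) : (forall t, `|g t| <= B) -> continuous g ->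
  forall t, `|prim g (clamp t) - prim g t0| <= B * (b - a).
Proof.
move=> gB cg t; have [s _|x _ ->] := @mean_value R (prim g) g t0 (clamp t) _.
  exact: primP.
by rewrite normrM ler_pM//; exact: clamp_dist.
Qed.

Let prim_sub (u v : I -> R -> R) i (s : R) : (forall i, continuous (u i)) -> (forall i, continuous (v i)) ->
  is_derive s 1 (prim (field u i) \- prim (field v i)) (field u i s - field v i s).
Proof. by move=> cu cv; apply: is_deriveB; apply: primP; exact: fieldC. Qed.

Let T_lip (u v : I -> R -> R) (D : R) : (forall i, continuous (u i)) -> (forall i, continuous (v i)) ->
  (forall t, \sum_i `|u i t - v i t| <= D) ->
  forall i t, `|T u i t - T v i t| <= M * D * (b - a).
Proof.
move=> cu cv uvD i t.
have -> : T u i t - T v i t =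
    (prim (field u i) \- prim (field v i)) (clamp t)
    - (prim (field u i) \- prim (field v i)) t0 by rewrite /T/=; ring.
have [s _|x _ ->] := @mean_value R (prim (field u i) \- prim (field v i))
  (fun s => field u i s - field v i s) t0 (clamp t) _.
  exact: prim_sub.
by rewrite normrM ler_pM ?sup_diff//; exact: clamp_dist.
Qed.

Let C := 2^-1 * \sum_i `|c i|.

Let sum_half (x : I -> R) (D : R) : 0 <= D -> (forall i, x i <= M * D * (b - a)) ->
  \sum_i x i <= 2^-1 * D.
Proof.
move=> D0 xD; apply: le_trans (ler_sum _ (fun i _ => xD i)) _.
rewrite sumr_const -mulr_natl; have := ler_wpM2r D0 small; lra.
Qed.

Let Ystep k t : \sum_i `|Y k.+1 i t - Y k i t| <= C / 2 ^+ k.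
Proof.
elim: k t => [|k IH] t.
  rewrite expr0 divr1; apply: sum_half; first exact: sumr_ge0.
  move=> i; have -> : Y 1 i t - Y 0 i t =
    prim (field (Y 0) i) (clamp t) - prim (field (Y 0) i) t0.
    by rewrite /Y/= /T; ring.
  apply: incr; last exact/fieldC/YC.
  move=> s; apply: le_trans (ler_norm_sum _ _ _) _.
  rewrite mulr_sumr; apply: ler_sum => j _.
  by rewrite normrM ler_wpM2r.
have -> : C / 2 ^+ k.+1 = 2^-1 * (C / 2 ^+ k) by rewrite exprS invfM mulrCA.
apply: sum_half; last by move=> i; apply: T_lip; [exact: (@YC k.+1)|exact: (@YC k)|exact: IH].
by apply: le_trans (IH t); exact: sumr_ge0.
Qed.

(** The smallness of the interval makes the Picard iteration contract by the
    factor 1/2. *)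
Lemma picard_solution : exists y : I -> R -> R, (forall i, y i t0 = c i) /\
  forall t : R, a < t < b -> forall i, is_derive t 1 (y i) (\sum_j A i j t * y j t).
Proof.
have [|l0 Hl] := @geometric_limit R (R * I)%type (fun k p => Y k p.2 p.1) C.
  move=> k [t i]/=; apply: le_trans (Ystep k t).
  by rewrite (bigD1 i)//= lerDl sumr_ge0.
pose l i t := l0 (t, i).
have {}Hl k i t : `|l i t - Y k i t| <= 2 * (C / 2 ^+ k) by exact: (Hl k (t, i)).
have lC i : continuous (l i).
  move=> t; apply/cvgrPdist_lt => eps e0.
  have [k ke] := pow2_bound_lt (2 * C) (divr_gt0 e0 (ltr0n _ 3)).
  near=> s.
  have Yk : `|Y k i t - Y k i s| < eps / 3.
    near: s; have /cvgrPdist_lt := @YC k i t.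
    by apply; rewrite divr_gt0.
  have := Hl k i t; have := Hl k i s; rewrite mulrA.
  move: Yk ke; rewrite !ltr_norml !ler_norml; lra.
have lT i t : l i t = T l i t.
  apply/eqP; rewrite -subr_eq0; apply/eqP.
  pose B := 2 * C + M * (#|I|%:R * (2 * C)) * (b - a).
  apply: (@pow2_bound_eq0 R B) => k.
  have h : `|T (Y k) i t - T l i t| <= M * (#|I|%:R * (2 * C) / 2 ^+ k) * (b - a).
    apply: T_lip => //.
    move=> s; have h j : `|Y k j s - l j s| <= 2 * (C / 2 ^+ k) by rewrite distrC Hl.
    apply: le_trans (ler_sum _ (fun j _ => h j)) _.
    by rewrite sumr_const -[leLHS]mulr_natl !mulrA lexx.
  have -> : l i t - T l i t = (l i t - Y k.+1 i t) + (T (Y k) i t - T l i t).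
    by rewrite -/(Y k.+1) /= addrA subrK.
  apply: le_trans (ler_normD _ _) _.
  have hk : 2 * (C / 2 ^+ k.+1) <= 2 * C / 2 ^+ k.
    have C0 : 0 <= C by rewrite mulr_ge0// sumr_ge0.
    rewrite exprS invfM; have : 0 <= C / 2 ^+ k by rewrite divr_ge0 ?exprn_ge0.
    lra.
  apply: le_trans (lerD (le_trans (Hl k.+1 i t) hk) h) _.
  by rewrite le_eqVlt; apply/orP; left; apply/eqP; rewrite /B; ring.
exists l; split=> [i|t tab i].
  by rewrite lT /T clamp_id ?subrr ?addr0// at0.
have e : \forall s \near t, c i + (prim (field l i) s - prim (field l i) t0) = l i s.
  near=> s; rewrite lT /T clamp_id//; near: s.
  by apply: near_in_itvoo; rewrite in_itv.
apply: near_eq_is_derive e _.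
rewrite -[X in is_derive _ _ _ X]add0r -[X in is_derive _ _ _ (_ + X)]subr0.
by apply: is_deriveD; apply: is_deriveB; exact: (primP _ (@fieldC l lC i)).
Unshelve. all: by end_near. Qed.

End picard.

(** * Flat linear systems on a box *)

Lemma is_deriveP (R : realType) (f : R -> R) (x l : R) :
  is_derive x 1 f l <-> (h^-1 * (f (x + h) - f x) @[h --> 0^'] --> l).
Proof.
have e : (fun h : R => h^-1 *: (f (h *: 1 + x) - f x)) =
         (fun h : R => h^-1 * (f (x + h) - f x)).
  by apply/funext => h; rewrite [h *: 1]mulr1 (addrC h).
split=> [[/cvg_ex[/= k]]|fl].
  rewrite /derive e => fk; rewrite (cvg_lim _ fk)// => <-; exact: fk.
apply: DeriveDef; first by apply/cvg_ex; exists l; rewrite /= e.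
by rewrite /derive e; exact: cvg_lim fl.
Qed.

Lemma is_derive_sumr (R : realType) (V : normedModType R) (I : finType)
    (f : I -> V -> R) (df : I -> R) (x v : V) :
  (forall i, is_derive x v (f i) (df i)) ->
  is_derive x v (fun s => \sum_i f i s) (\sum_i df i).
Proof.
move=> dfi; elim: (index_enum I) => [|i r IH].
  rewrite big_nil; under eq_fun do rewrite big_nil.
  exact: is_derive_cst.
rewrite big_cons; under eq_fun do rewrite big_cons.
exact: is_deriveD.
Qed.

Lemma is_derive_mulr (R : realType) (V : normedModType R) (f g : V -> R)
    (x v : V) (df dg : R) :
  is_derive x v f df -> is_derive x v g dg ->
  is_derive x v (fun s => f s * g s) (df * g x + f x * dg).
Proof.
move=> hf hg.
have -> : df * g x + f x * dg = f x *: dg + g x *: df.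
  by rewrite addrC /GRing.scale/= [df * _]mulrC.
exact: is_deriveM.
Qed.

Lemma continuous_pairing (T U V : topologicalType) (f : T -> U) (g : T -> V) (t : T) :
  {for t, continuous f} -> {for t, continuous g} ->
  {for t, continuous (fun x => (f x, g x))}.
Proof. by move=> cf cg; exact: (cvg_pair cf cg). Qed.

(** Solutions of dy = O1 y du + O2 y dv, with both equations read along the
    coordinate lines, since this is the form in which the ordinary theory
    produces them. *)
Definition solution_on (R : realType) (I : finType) (O1 O2 : I -> I -> plane R -> R)
    (U : set (plane R)) (y : I -> plane R -> R) : Prop :=
  forall q, U q -> forall i,
    is_derive q.1 1 (fun s => y i (s, q.2)) (\sum_j O1 i j q * y j q) /\
    is_derive q.2 1 (fun s => y i (q.1, s)) (\sum_j O2 i j q * y j q).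

Definition obox (R : realType) (a1 b1 a2 b2 : R) : set (plane R) :=
  [set q | a1 < q.1 < b1 /\ a2 < q.2 < b2].

Definition cbox (R : realType) (a1 b1 a2 b2 : R) : set (plane R) :=
  [set q | a1 <= q.1 <= b1 /\ a2 <= q.2 <= b2].

Section flat_box.
Variables (R : realType) (I : finType) (O1 O2 O1v O2u : I -> I -> plane R -> R).
Variables (a1 b1 a2 b2 M : R).
Notation cbox := (cbox a1 b1 a2 b2).
Notation box := (obox a1 b1 a2 b2).
Hypothesis M0 : 0 <= M.
Hypothesis cont1 : forall i j q, cbox q -> {for q, continuous (O1 i j)}.
Hypothesis cont2 : forall i j q, cbox q -> {for q, continuous (O2 i j)}.
Hypothesis bound1 : forall i j q, cbox q -> `|O1 i j q| <= M.
Hypothesis bound2 : forall i j q, cbox q -> `|O2 i j q| <= M.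
Hypothesis bound2u : forall i j q, cbox q -> `|O2u i j q| <= M.
Hypothesis d1 : forall i j q, box q ->
  is_derive q.2 1 (fun s => O1 i j (q.1, s)) (O1v i j q).
Hypothesis d2 : forall i j q, box q ->
  is_derive q.1 1 (fun s => O2 i j (s, q.2)) (O2u i j q).
Hypothesis lip2u : forall i j u u' v, box (u, v) -> box (u', v) ->
  `|O2u i j (u', v) - O2u i j (u, v)| <= M * `|u' - u|.
Hypothesis flat : forall i j q, box q ->
  O1v i j q + \sum_k O1 i k q * O2 k j q = O2u i j q + \sum_k O2 i k q * O1 k j q.
Hypothesis small1 : #|I|%:R * M * (b1 - a1) <= 2^-1.
Hypothesis small2 : #|I|%:R * M * (b2 - a2) <= 2^-1.

Let clamp_id a b (t : R) : a < t < b -> clamp a b t = t.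
Proof. by move=> /andP[h1 h2]; rewrite clamp_id ?ltW. Qed.

(** A solution is built by integrating first along v = v0 and then along the
    vertical lines. Only the equation in u is in question. The error of the
    difference quotient, h^-1 (y (u + h) - y u) - O1 y, satisfies by flatness
    a linear equation in v up to terms of order h, and it tends to 0 at
    v = v0. *)
Lemma box_solution (q0 : plane R) (c : I -> R) : box q0 ->
  exists2 y, solution_on O1 O2 box y & forall i, y i q0 = c i.
Proof.
case: q0 => u0 v0 -[/= u0I v0I].
have /andP[au0 u0b] := u0I; have /andP[av0 v0b] := v0I.
have ab1 := lt_trans au0 u0b; have ab2 := lt_trans av0 v0b.
have [x [x0 xd]] : exists x : I -> R -> R, (forall i, x i u0 = c i) /\
    forall t : R, a1 < t < b1 -> forall i,
    is_derive t 1 (x i) (\sum_j O1 i j (t, v0) * x j t).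
  have cb t : cbox (clamp a1 b1 t, v0) by split => /=; [exact/clampP/ltW|rewrite !ltW].
  have [||x [x0 xd]] := @picard_solution R I
    (fun i j t => O1 i j (clamp a1 b1 t, v0)) M a1 b1 u0 c au0 u0b _ _ small1.
  - move=> i j t; apply: (@continuous_comp _ _ _ (fun t => (clamp a1 b1 t, v0))).
      by apply: continuous_pairing; [exact: continuous_clamp|exact: cst_continuous].
    exact: cont1.
  - by move=> i j t; exact: bound1.
  - exists x; split=> // t tab i; have := xd t tab i.
    by rewrite clamp_id.
have /choice[z zP] : forall u, exists z : I -> R -> R, a1 < u < b1 ->
    (forall i, z i v0 = x i u) /\
    forall t : R, a2 < t < b2 -> forall i,
    is_derive t 1 (z i) (\sum_j O2 i j (u, t) * z j t).
  move=> u; have [ub|] := pselect (a1 < u < b1); last by exists (fun _ _ => 0).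
  have cb t : cbox (u, clamp a2 b2 t).
    by split => /=; [have /andP[? ?] := ub; rewrite !ltW|exact/clampP/ltW].
  have [||w [w0 wd]] := @picard_solution R I
    (fun i j t => O2 i j (u, clamp a2 b2 t)) M a2 b2 v0 (fun i => x i u) av0 v0b _ _ small2.
  - move=> i j t; apply: (@continuous_comp _ _ _ (fun t => (u, clamp a2 b2 t))).
      by apply: continuous_pairing; [exact: cst_continuous|exact: continuous_clamp].
    exact: cont2.
  - by move=> i j t; exact: bound2.
  - exists w => _; split=> // t tab i; have := wd t tab i.
    by rewrite clamp_id.
pose y i (q : plane R) := z q.1 i q.2.
have yv q : box q -> forall i,
    is_derive q.2 1 (fun s => y i (q.1, s)) (\sum_j O2 i j q * y j q).
  by case: q => u v [/= uI vI] i; exact: (zP u uI).2.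
have y0 u i : a1 < u < b1 -> y i (u, v0) = x i u.
  by move=> uI; exact: (zP u uI).1.
exists y; last by move=> i; rewrite y0.
move=> [u v] [/= uI vI] i; split; last exact: (yv (u, v)).
pose w j v' := \sum_k O1 j k (u, v') * y k (u, v').
pose Q h j v' := h^-1 * (y j (u + h, v') - y j (u, v')) - w j v'.
pose N := 4 * \sum_i `|c i|.
pose C := M * N + #|I|%:R * M * M * N.
have N0 : 0 <= N by rewrite mulr_ge0// sumr_ge0.
have bnd (A : I -> I -> plane R -> R) (e : I -> R) q j : 
    (forall j k, `|A j k q| <= M) -> `|\sum_k A j k q * e k| <= M * \sum_k `|e k|.
  move=> AM; apply: le_trans (ler_norm_sum _ _ _) _.
  by rewrite mulr_sumr; apply: ler_sum => k _; rewrite normrM ler_wpM2r.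
have boxc q : box q -> cbox q.
  by case=> /andP[? ?] /andP[? ?]; split; rewrite !ltW.
have yN v' : a2 < v' < b2 -> \sum_j `|y j (u, v')| <= N.
  move=> v'I.
  have h1 := @small_interval_estimate R I (fun j s => y j (u, s))
    (fun j s => \sum_k O2 j k (u, s) * y k (u, s)) a2 b2 M 0 v0 v' _ _ M0 small2 v0I v'I.
  have h2 := @small_interval_estimate R I x
    (fun j s => \sum_k O1 j k (s, v0) * x k s) a1 b1 M 0 u0 u _ _ M0 small1 u0I uI.
  have {}h1 := h1 (fun s sI j => yv (u, s) (conj uI sI) j).
  have {}h2 := h2 (fun s sI j => xd s sI j).
  have {}h1 : \sum_j `|y j (u, v')| <= 2 * \sum_j `|y j (u, v0)|.
    rewrite mulr0 addr0 in h1; apply: h1 => s sI j.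
    by rewrite addr0; apply: bnd => *; apply: bound2; exact: boxc.
  have {}h2 : \sum_j `|x j u| <= 2 * \sum_j `|x j u0|.
    rewrite mulr0 addr0 in h2; apply: h2 => s sI j.
    by rewrite addr0; apply: bnd => *; apply: bound1; exact: boxc.
  have e1 : \sum_j `|y j (u, v0)| = \sum_j `|x j u|.
    by apply: eq_bigr => j _; rewrite y0.
  have e2 : \sum_j `|x j u0| = \sum_j `|c j| by apply: eq_bigr => j _; rewrite x0.
  rewrite /N; lra.
have key h : h != 0 -> a1 < u + h < b1 ->
    \sum_j `|Q h j v| <= 2 * (\sum_j `|Q h j v0| + #|I|%:R * (b2 - a2) * (C * `|h|)).
  move=> h0 uhI.
  pose dQ j s := h^-1 * (\sum_k O2 j k (u + h, s) * y k (u + h, s)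
    - \sum_k O2 j k (u, s) * y k (u, s))
    - \sum_k (O1v j k (u, s) * y k (u, s)
              + O1 j k (u, s) * \sum_l O2 k l (u, s) * y l (u, s)).
  apply: (@small_interval_estimate R I (Q h) dQ a2 b2 M (C * `|h|)) => //.
  - move=> s sI j; apply: is_deriveB.
      apply: is_deriveZ; apply: is_deriveB.
        by have := yv (u + h, s) (conj uhI sI) j.
      by have := yv (u, s) (conj uI sI) j.
    apply: (is_derive_sumr (f := fun k s => O1 j k (u, s) * y k (u, s))) => k.
    apply: is_derive_mulr; first exact: (@d1 j k (u, s)).
    exact: (yv (u, s)).
  - move=> s sI j.
    have bus : box (u, s) by [].
    have bhs : box (u + h, s) by [].
    have mvt j' k : exists2 x', box (x', s) /\ `|x' - u| <= `|h| &
        O2 j' k (u + h, s) - O2 j' k (u, s) = h * O2u j' k (x', s).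
      have sub x' : Num.min u (u + h) <= x' <= Num.max u (u + h) ->
          box (x', s) /\ `|x' - u| <= `|h|.
        have [hp|hp] := leP 0 h.
          rewrite min_l ?max_r ?lerDl// => /andP[? ?]; split; first by split => //=; lra.
          rewrite !ger0_norm//; lra.
        have e : u + h <= u by rewrite gerDl ltW.
        rewrite (min_r e) (max_l e) => /andP[? ?]; split; first by split => //=; lra.
        rewrite (ltr0_norm hp) ler0_norm; lra.
      have [x' /sub[x'b _]|x' /sub x'P e] := @mean_value R (fun x' => O2 j' k (x', s))
        (fun x' => O2u j' k (x', s)) u (u + h) _.
        exact: (@d2 j' k (x', s)).
      by exists x' => //; rewrite e mulrC addrAC subrr add0r.
    have dO2 j' k : `|O2 j' k (u + h, s) - O2 j' k (u, s)| <= M * `|h|.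
      have [x' [x'b _] ->] := mvt j' k.
      by rewrite normrM mulrC ler_wpM2r// bound2u//; exact: boxc.
    have dO2u k : `|h^-1 * (O2 j k (u + h, s) - O2 j k (u, s)) - O2u j k (u, s)|
        <= M * `|h|.
      have [x' [x'b x'h] ->] := mvt j k; rewrite mulKf//.
      by apply: le_trans (lip2u _ _ bus x'b) _; rewrite ler_wpM2l.
    have -> : dQ j s = \sum_k O2 j k (u + h, s) * Q h k s
      + \sum_k (h^-1 * (O2 j k (u + h, s) - O2 j k (u, s)) - O2u j k (u, s)) * y k (u, s)
      + \sum_k (O2 j k (u + h, s) - O2 j k (u, s)) * w k s.
      have fl : \sum_k (O1v j k (u, s) * y k (u, s)
              + O1 j k (u, s) * \sum_l O2 k l (u, s) * y l (u, s)) =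
          \sum_k (O2u j k (u, s) * y k (u, s) + O2 j k (u, s) * w k s).
        rewrite !big_split/=.
        have ex (A B : I -> I -> plane R -> R) : \sum_k A j k (u, s) *
            (\sum_l B k l (u, s) * y l (u, s)) =
            \sum_l (\sum_k A j k (u, s) * B k l (u, s)) * y l (u, s).
          under eq_bigr do rewrite mulr_sumr.
          rewrite exchange_big/=; apply: eq_bigr => l _; rewrite mulr_suml.
          by apply: eq_bigr => k _; rewrite mulrA.
        rewrite ex /w (ex O2 O1) -!big_split/=; apply: eq_bigr => k _.
        by rewrite -!mulrDl flat.
      rewrite /dQ fl -sumrB mulr_sumr -sumrB -!big_split/=; apply: eq_bigr => k _.
      by rewrite /Q; ring.
    apply: le_trans (ler_normD _ _) _.
    apply: le_trans (lerD (ler_normD _ _) (lexx _)) _.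
    rewrite -addrA; apply: lerD; first by apply: bnd => *; apply: bound2; exact: boxc.
    have -> : C * `|h| = M * `|h| * N + #|I|%:R * (M * `|h| * (M * N)) by rewrite /C; ring.
    apply: lerD.
      apply: le_trans (ler_norm_sum _ _ _) _.
      apply: le_trans (ler_wpM2l _ (yN s sI)); last by rewrite mulr_ge0.
      by rewrite mulr_sumr; apply: ler_sum => k _; rewrite normrM ler_wpM2r.
    apply: le_trans (ler_norm_sum _ _ _) _.
    rewrite mulr_natl -sumr_const; apply: ler_sum => k _.
    rewrite normrM; apply: ler_pM => //.
    apply: (@le_trans _ _ (M * \sum_l `|y l (u, s)|)); last by rewrite ler_wpM2l// yN.
    by apply: bnd => *; apply: bound1; exact: boxc.
have nearI : \forall h \near 0^', a1 < u + h < b1.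
  have /andP[au ub] := uI.
  near=> h.
  have h1 : `|h| < u - a1 by near: h; apply: dnbhs0_lt; rewrite subr_gt0.
  have h2 : `|h| < b1 - u by near: h; apply: dnbhs0_lt; rewrite subr_gt0.
  move: h1 h2; rewrite !ltr_norml; lra.
apply/is_deriveP.
suff H : Q h i v @[h --> 0^'] --> (0 : R).
  have -> : \sum_j O1 i j (u, v) * y j (u, v) = 0 + w i v by rewrite add0r.
  have -> : (fun h => h^-1 * (y i (u + h, v) - y i (u, v))) = (fun h => Q h i v + w i v).
    by apply/funext => h; rewrite /Q subrK.
  by apply: cvgD => //; exact: cvg_cst.
pose B h := 2 * (\sum_j `|Q h j v0| + #|I|%:R * (b2 - a2) * (C * `|h|)).
pose E : R := 2 * (\sum_(j : I) `|0 : R| + #|I|%:R * (b2 - a2) * (C * `|0 : R|)).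
have E0 : E = 0 by rewrite /E normr0 big1// !mulr0 addr0 mulr0.
have B0 : B h @[h --> 0^'] --> E.
  apply: cvgM; first exact: cvg_cst.
  apply: cvgD; last first.
    apply: cvgM; first exact: cvg_cst.
    apply: cvgM; first exact: cvg_cst.
    by apply: cvg_norm; exact: nbhs_dnbhs.
  apply: cvg_big => [|j _].
    by move=> q; apply: cvgD; [exact: cvg_fst|exact: cvg_snd].
  apply: cvg_norm.
  have e : \forall h \near 0^', h^-1 * (x j (u + h) - x j u) - w j v0 = Q h j v0.
    by near=> h; rewrite /Q !y0//; near: h; exact: nearI.
  apply: cvg_trans; first by apply: near_eq_cvg; exact: e.
  suff h0 : h^-1 * (x j (u + h) - x j u) - w j v0 @[h --> 0^'] --> w j v0 - w j v0.
    by rewrite subrr in h0.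
  apply: cvgB; last exact: cvg_cst.
  have -> : w j v0 = \sum_k O1 j k (u, v0) * x k u.
    by apply: eq_bigr => k _; rewrite y0.
  by apply/is_deriveP; exact: xd.
rewrite E0 in B0; apply/norm_cvg0P.
apply: (@squeeze_cvgr _ _ _ _ (fun=> 0) B); [|exact: cvg_cst|exact: B0].
near=> h.
rewrite normr_ge0/=; apply: le_trans (key h _ _); last 2 first.
- near: h; exact: nbhs_dnbhs_neq.
- by near: h; exact: nearI.
by rewrite (bigD1 i)//= lerDl sumr_ge0.
Unshelve. all: by end_near. Qed.
End flat_box.

(** * Calculus on open subsets of the plane *)

Lemma differentiable_expansion (R : realType) (V W : normedModType R) (f : V -> W)
    (df : {linear V -> W}) (x : V) : continuous df ->
  (forall e : R, 0 < e -> \forall h \near 0, `|f (h + x) - f x - df h| <= e * `|h|) ->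
  differentiable f x.
Proof.
move=> cdf fdf; apply/diff_locallyP.
have H : f \o shift x = cst (f x) + df +o_ (0 : V) id.
  apply/eqaddoP => e e0; apply: filterS (fdf e e0) => h /=.
  by rewrite !fctE opprD addrA.
have -> : 'd f x = df :> (V -> W) by exact: diff_unique.
by [].
Qed.

Lemma differentiable_near_eq (R : realType) (V W : normedModType R) (f g : V -> W) (x : V) :
  (\forall y \near x, f y = g y) -> differentiable f x -> differentiable g x.
Proof.
move=> fg df; have [cdf /eqaddoP fE] := (diff_locallyP x f).1 df.
apply: (@differentiable_expansion _ _ _ _ ('d f x)) => // e e0.
have fx := nbhs_singleton fg.
have sh : \forall h \near (0 : V), f (h + x) = g (h + x).
  by have := fg; rewrite (near_shift 0); apply: filterS => h /=; rewrite subr0.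
apply: filterS2 sh (fE e e0) => h <-.
by rewrite -fx -addrA -opprD.
Qed.

Lemma is_derive_u (R : realType) (f : plane R -> R) (p : plane R) (l : R) :
  is_derive p (1, 0) f l <-> is_derive p.1 1 (fun s => f (s, p.2)) l.
Proof.
have e : (fun h : R => h^-1 *: (f (h *: (1, 0) + p) - f p)) =
         (fun h : R => h^-1 *: (f (h *: 1 + p.1, p.2) - f (p.1, p.2))).
  apply/funext => h; case: p => u v /=; congr (_ *: (f _ - _)).
  by congr pair; rewrite /= [_ *: 0]mulr0 add0r.
split=> -[d <-]; apply: DeriveDef; rewrite /derivable ?/derive.
- by rewrite -e; exact: d.
- by rewrite -e.
- by rewrite e; exact: d.
- by rewrite e.
Qed.

Lemma is_derive_v (R : realType) (f : plane R -> R) (p : plane R) (l : R) :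
  is_derive p (0, 1) f l <-> is_derive p.2 1 (fun s => f (p.1, s)) l.
Proof.
have e : (fun h : R => h^-1 *: (f (h *: (0, 1) + p) - f p)) =
         (fun h : R => h^-1 *: (f (p.1, h *: 1 + p.2) - f (p.1, p.2))).
  apply/funext => h; case: p => u v /=; congr (_ *: (f _ - _)).
  by congr pair; rewrite /= [_ *: 0]mulr0 add0r.
split=> -[d <-]; apply: DeriveDef; rewrite /derivable ?/derive.
- by rewrite -e; exact: d.
- by rewrite -e.
- by rewrite e; exact: d.
- by rewrite e.
Qed.

Lemma ball_plane (R : realType) (p q : plane R) (r : R) :
  ball p r q <-> `|p.1 - q.1| < r /\ `|p.2 - q.2| < r.
Proof. by []. Qed.

Lemma mean_value_ball (R : realType) (x0 r : R) (f f' : R -> R) (a b : R) :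
  `|x0 - a| < r -> `|x0 - b| < r ->
  (forall x, `|x0 - x| < r -> is_derive x 1 f (f' x)) ->
  exists2 c, `|x0 - c| < r & f b - f a = f' c * (b - a).
Proof.
move=> ar br df.
have sub x : Num.min a b <= x <= Num.max a b -> `|x0 - x| < r.
  rewrite le_max ge_min => /andP[/orP h1 /orP h2].
  move: ar br; rewrite !ltr_norml; case: h1 => h1; case: h2 => h2; lra.
have [x /sub /df//|c /sub cr e] := @mean_value R f f' a b _.
by exists c.
Qed.

(** The increment is split into a horizontal and a vertical one, and the mean
    value theorem is applied to each. *)
Lemma continuous_partials_differentiable (R : realType) (f a b : plane R -> R)
    (p : plane R) :
  (\forall q \near p, is_derive (q : plane R).1 1 (fun s => f (s, q.2)) (a q) /\
                      is_derive q.2 1 (fun s => f (q.1, s)) (b q)) ->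
  {for p, continuous a} -> {for p, continuous b} -> differentiable f p.
Proof.
move=> fab ca cb.
pose L (h : plane R) : R := a p * h.1 + b p * h.2.
have Llin : linear L by move=> k x y; rewrite /L/= /GRing.scale/=; ring.
pose LM := GRing.isLinear.Build _ _ _ _ L Llin.
pose Lf : {linear plane R -> R} := HB.pack L LM.
apply: (@differentiable_expansion _ _ _ _ Lf).
  move=> h; rewrite /continuous_at/=; apply: cvgD; apply: cvgM; try exact: cvg_cst.
    exact: cvg_fst.
  exact: cvg_snd.
move=> e e0; have e2 : 0 < e / 2 by rewrite divr_gt0.
have /nbhs_ballP[r /= r0 rP] : \forall q \near p,
    (is_derive (q : plane R).1 1 (fun s => f (s, q.2)) (a q) /\
     is_derive q.2 1 (fun s => f (q.1, s)) (b q)) /\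
    (`|a p - a q| < e / 2 /\ `|b p - b q| < e / 2).
  near=> q; split; [by near: q|split; near: q].
    by move/cvgrPdist_lt : ca; apply.
  by move/cvgrPdist_lt : cb; apply.
have near0 : \forall h \near (0 : plane R), ball (0 : plane R) r h by exact: nbhsx_ballx.
apply: filterS near0 => -[h k] [hr0 kr0].
have hr : `|h| < r by rewrite -normrN -[- h]add0r; exact: hr0.
have kr : `|k| < r by rewrite -normrN -[- k]add0r; exact: kr0.
case: p ca cb fab rP @L Llin LM @Lf => u v _ _ _ rP L Llin LM Lf /=.
have ar : `|u - u| < r by rewrite subrr normr0.
have br : `|v - v| < r by rewrite subrr normr0.
have hr' : `|u - (h + u)| < r by rewrite opprD addrCA subrr addr0 normrN.
have kr' : `|v - (k + v)| < r by rewrite opprD addrCA subrr addr0 normrN.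
have [x xr|x xr e1] := @mean_value_ball R u r (fun s => f (s, k + v))
  (fun s => a (s, k + v)) u (h + u) ar hr' _.
  exact: (rP (x, k + v) (conj xr kr')).1.1.
have [y yr|y yr e3] := @mean_value_ball R v r (fun s => f (u, s))
  (fun s => b (u, s)) v (k + v) br kr' _.
  exact: (rP (u, y) (conj ar yr)).1.2.
have [_ [ax _]] := rP (x, k + v) (conj xr kr').
have [_ [_ by_]] := rP (u, y) (conj ar yr).
have -> : f ((h, k) + (u, v)) - f (u, v) - (a (u, v) * h + b (u, v) * k) =
   (a (x, k + v) - a (u, v)) * h + (b (u, y) - b (u, v)) * k.
  have -> : f ((h, k) + (u, v)) = f (h + u, k + v) by [].
  move: e1 e3; rewrite !addrK; lra.
apply: le_trans (ler_normD _ _) _; rewrite !normrM.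
have nh : `|h| <= `|(h, k) : plane R| by rewrite /Num.norm/= le_max lexx.
have nk : `|k| <= `|(h, k) : plane R| by rewrite /Num.norm/= le_max lexx orbT.
rewrite (splitr e) mulrDl; apply: lerD; apply: ler_pM => //.
  by rewrite distrC ltW.
by rewrite distrC ltW.
Unshelve. all: by end_near. Qed.

Section Ck_calculus.
Variables (R : realType) (O : set (plane R)).
Hypothesis openO : open O.
Implicit Types (f g : plane R -> R) (k : nat).

Let nearO p : O p -> \forall q \near p, O q.
Proof. by move=> Op; apply: open_nbhs_nbhs; split. Qed.

Lemma Ck_differentiable f k p : Ck k.+1 O f -> O p -> differentiable f p.
Proof. by case=> + _; apply. Qed.

Lemma Ck_ext f g k : (forall p, O p -> f p = g p) -> Ck k O f -> Ck k O g.
Proof.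
elim: k f g => [|k IH] f g fg; rewrite /=.
  move=> cf p Op; have := cf p Op; rewrite /prop_for /continuous_at (fg p Op).
  apply: cvg_trans; apply: near_eq_cvg; near=> q; apply: fg.
  by near: q; exact: nearO.
move=> [df Dk]; split=> [p Op|v].
  apply: differentiable_near_eq (df p Op); near=> q; apply: fg.
  by near: q; exact: nearO.
apply: IH (Dk v) => p Op; apply: near_eq_derive; near=> q; apply: fg.
by near: q; exact: nearO.
Unshelve. all: by end_near. Qed.

Lemma CkS f k : Ck k.+1 O f -> Ck k O f.
Proof.
elim: k f => [|k IH] f [df Dk].
  by move=> p Op; apply: differentiable_continuous; exact: df.
by split=> // v; apply: IH.
Qed.

Lemma Ck_cst (c : R) k : Ck k O (fun=> c).
Proof.
elim: k c => [|k IH] c; first by move=> p _; exact: cst_continuous.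
split=> [p _|v]; first exact: differentiable_cst.
by apply: (Ck_ext _ (IH 0)) => p _; rewrite (derive_cst c).
Qed.

Lemma is_derive_diff f p v : differentiable f p -> is_derive p v f ('D_v f p).
Proof. by move=> df; apply: derivableP; exact: diff_derivable. Qed.

Lemma CkD f g k : Ck k O f -> Ck k O g -> Ck k O (fun p => f p + g p).
Proof.
elim: k f g => [|k IH] f g.
  by move=> cf cg p Op; apply: cvgD; [exact: cf|exact: cg].
move=> [df Df] [dg Dg]; split=> [p Op|v].
  by apply: differentiableD; [exact: df|exact: dg].
apply: (Ck_ext _ (IH _ _ (Df v) (Dg v))) => p Op.
by rewrite deriveD//; apply: diff_derivable; [exact: df|exact: dg].
Qed.

Lemma CkM f g k : Ck k O f -> Ck k O g -> Ck k O (fun p => f p * g p).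
Proof.
elim: k f g => [|k IH] f g.
  by move=> cf cg p Op; apply: cvgM; [exact: cf|exact: cg].
move=> Cf Cg; have [df Df] := Cf; have [dg Dg] := Cg; split=> [p Op|v].
  by apply: differentiableM; [exact: df|exact: dg].
apply: (Ck_ext _ (CkD (IH _ _ (Df v) (CkS Cg)) (IH _ _ (CkS Cf) (Dg v)))) => p Op.
symmetry; apply: derive_val; apply: is_derive_mulr.
  by apply: is_derive_diff; exact: df.
by apply: is_derive_diff; exact: dg.
Qed.

Lemma is_derive_comp1 (h : R -> R) (dh : R) f p v :
  is_derive (f p) 1 h dh -> differentiable f p ->
  is_derive p v (fun q => h (f q)) (dh * 'D_v f p).
Proof.
move=> [dhp hE] dfp.
have dhp' : differentiable h (f p) by apply/derivable1_diffP.
have dc : differentiable (h \o f) p by exact: differentiable_comp.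
apply: DeriveDef; first by apply: diff_derivable; exact: dc.
rewrite -[LHS]/('D_v (h \o f) p) deriveE// diff_comp//= -(deriveE v dfp) -hE.
rewrite (@deriveE _ _ _ h (f p) (1 : R) dhp') mulrC.
have -> : 'd h (f p) ('D_v f p) = 'd h (f p) ('D_v f p *: (1 : R)).
  by rewrite [_ *: _]mulr1.
by rewrite linearZ.
Qed.

(** The derivative h' is passed as a separate function, so that smoothness of
    h \o f follows by induction once h' is expressed through h or through
    functions already known to be smooth. *)
Lemma Ck_comp (h h' : R -> R) f k :
  (forall j, Ck j O f) ->
  (forall p, O p -> is_derive (f p) 1 h (h' (f p))) ->
  Ck k O (fun p => h' (f p)) -> Ck k.+1 O (fun p => h (f p)).
Proof.
move=> Cf hd Ch; split=> [p Op|v].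
  apply: differentiable_comp; first exact: (Ck_differentiable (Cf 1%N)).
  by apply/derivable1_diffP; have [] := hd p Op.
have Df : Ck k O ('D_v f) by have [_] := Cf k.+1; apply.
apply: (Ck_ext _ (CkM Ch Df)) => p Op.
symmetry; apply: derive_val; apply: is_derive_comp1; first exact: hd.
exact: (Ck_differentiable (Cf 1%N)).
Qed.

Lemma smooth_ext f g : (forall p, O p -> f p = g p) -> smooth O f -> smooth O g.
Proof. by move=> fg sf k; exact: Ck_ext fg (sf k). Qed.

Lemma smooth_cst (c : R) : smooth O (fun=> c).
Proof. by move=> k; exact: Ck_cst. Qed.

Lemma smoothD f g : smooth O f -> smooth O g -> smooth O (fun p => f p + g p).
Proof. by move=> sf sg k; exact: CkD. Qed.

Lemma smoothM f g : smooth O f -> smooth O g -> smooth O (fun p => f p * g p).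
Proof. by move=> sf sg k; exact: CkM. Qed.

Lemma smoothN f : smooth O f -> smooth O (fun p => - f p).
Proof.
move=> sf; apply: smooth_ext (smoothM (smooth_cst (-1)) sf) => p _.
by rewrite mulN1r.
Qed.

Lemma smoothB f g : smooth O f -> smooth O g -> smooth O (fun p => f p - g p).
Proof. by move=> sf sg; exact: smoothD (smoothN sg). Qed.

Lemma smoothZ (c : R) f : smooth O f -> smooth O (fun p => c * f p).
Proof. by move=> sf; exact: smoothM (smooth_cst c) sf. Qed.

Lemma smooth_sum (I : finType) (f : I -> plane R -> R) :
  (forall i, smooth O (f i)) -> smooth O (fun p => \sum_i f i p).
Proof.
move=> sf; elim: (index_enum I) => [|i r IH].
  by under eq_fun do rewrite big_nil; exact: smooth_cst.
by under eq_fun do rewrite big_cons; exact: smoothD.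
Qed.

Lemma smooth_derive v f : smooth O f -> smooth O ('D_v f).
Proof. by move=> sf k; have [_] := sf k.+1; apply. Qed.

Lemma smooth_du f : smooth O f -> smooth O (du f).
Proof. exact: smooth_derive. Qed.

Lemma smooth_dv f : smooth O f -> smooth O (dv f).
Proof. exact: smooth_derive. Qed.

Lemma smooth_differentiable f p : smooth O f -> O p -> differentiable f p.
Proof. by move=> sf; exact: (Ck_differentiable (sf 1%N)). Qed.

Lemma smooth_continuous f p : smooth O f -> O p -> {for p, continuous f}.
Proof. by move=> sf; exact: (sf 0%N). Qed.

Lemma smooth_is_derive v f p : smooth O f -> O p -> is_derive p v f ('D_v f p).
Proof. by move=> sf Op; apply: is_derive_diff; exact: smooth_differentiable. Qed.

Lemma smooth_expR f : smooth O f -> smooth O (fun p => expR (f p)).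
Proof.
move=> sf; elim=> [|k IH]; last exact: (@Ck_comp expR expR).
move=> p Op; apply: continuous_comp; first exact: smooth_continuous.
exact: continuous_expR.
Qed.

Lemma smooth_deriveD f g p v : smooth O f -> smooth O g -> O p ->
  'D_v (fun q => f q + g q) p = 'D_v f p + 'D_v g p.
Proof.
move=> sf sg Op; apply: derive_val.
by apply: is_deriveD; exact: smooth_is_derive.
Qed.

Lemma smooth_deriveM f g p v : smooth O f -> smooth O g -> O p ->
  'D_v (fun q => f q * g q) p = 'D_v f p * g p + f p * 'D_v g p.
Proof.
move=> sf sg Op; apply: derive_val.
by apply: is_derive_mulr; exact: smooth_is_derive.
Qed.

Lemma smooth_deriveZ (a : R) f p v : smooth O f -> O p ->
  'D_v (fun q => a * f q) p = a * 'D_v f p.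
Proof.
move=> sf Op; have sa : smooth O (fun=> a) by exact: smooth_cst.
apply: etrans (smooth_deriveM v sa sf Op) _.
have -> : 'D_v (fun=> a) p = 0 by exact: (derive_cst a).
by rewrite mul0r add0r.
Qed.

Lemma smooth_derive_exp2 f p v : smooth O f -> O p ->
  'D_v (fun q => expR (2 * f q)) p = 2 * 'D_v f p * expR (2 * f p).
Proof.
move=> sf Op; have e1 := is_derive_comp1 v (is_derive_expR (2 * f p))
  (smooth_differentiable (smoothZ 2 sf) Op).
have e2 := smooth_deriveZ 2 v sf Op.
by rewrite (@derive_val _ _ _ _ _ _ _ e1) mulrC; congr (_ * _); exact: e2.
Qed.

Lemma smoothV f : smooth O f -> (forall p, O p -> f p != 0) ->
  smooth O (fun p => (f p)^-1).
Proof.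
move=> sf f0; elim=> [|k IH].
  by move=> p Op; apply: cvgV; [exact: f0|exact: smooth_continuous].
apply: (@Ck_comp (fun x => x^-1) (fun x => - (x^-1 * x^-1))) => //.
  move=> p Op; apply: is_derive_eq; first by apply: is_deriveV; exact: f0.
  by rewrite /GRing.scale/= mulr1 -invfM -expr2.
apply: (Ck_ext _ (CkM (Ck_cst (-1) k) (CkM IH IH))) => p _.
by rewrite mulN1r.
Qed.

Lemma smooth_div f g : smooth O f -> smooth O g -> (forall p, O p -> g p != 0) ->
  smooth O (fun p => f p / g p).
Proof. by move=> sf sg g0; apply: smoothM => //; exact: smoothV. Qed.

Lemma is_derive_ln_norm (x : R) : x != 0 -> is_derive x 1 (fun y => ln `|y|) x^-1.
Proof.
move=> x0; have [xp|xn|/eqP] := ltgtP x 0; last by rewrite (negPf x0).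
  have e : \forall y \near x, ln (- y) = ln `|y|.
    by near=> y; rewrite ltr0_norm//; near: y; exact: lt_nbhsl.
  apply: near_eq_is_derive e _.
  have -> : x^-1 = (- x)^-1 * (-1) by rewrite invrN mulrN1 opprK.
  have hN : is_derive x 1 (fun y : R => - y) (-1) by exact: (is_deriveNid x (1 : R)).
  have hl : is_derive (- x) 1 (@ln R) (- x)^-1 by apply: is_derive1_ln; rewrite oppr_gt0.
  exact: (@is_derive1_comp R (@ln R) (fun y : R => - y) _ _ _ hl hN).
have e : \forall y \near x, ln y = ln `|y|.
  by near=> y; rewrite gtr0_norm//; near: y; exact: lt_nbhsr.
by apply: near_eq_is_derive e _; exact: is_derive1_ln.
Unshelve. all: by end_near. Qed.

Lemma smooth_ln_norm f : smooth O f -> (forall p, O p -> f p != 0) ->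
  smooth O (fun p => ln `|f p|).
Proof.
move=> sf f0; elim=> [|k _].
  move=> p Op; apply: (@continuous_comp _ _ _ f (fun y => ln `|y|)).
    exact: smooth_continuous.
  exact: is_derive_continuous (is_derive_ln_norm (f0 p Op)).
apply: (@Ck_comp (fun y => ln `|y|) (fun x => x^-1)) => //.
  by move=> p Op; apply: is_derive_ln_norm; exact: f0.
exact: smoothV.
Qed.

Lemma sqrt_norm_expR (x : R) : x != 0 -> Num.sqrt `|x| = expR (2^-1 * ln `|x|).
Proof.
move=> x0; have xp : 0 < `|x| by rewrite normr_gt0.
apply: (@pexpIrn _ 2); rewrite ?nnegrE ?sqrtr_ge0 ?expR_ge0//.
rewrite sqr_sqrtr// -expRM_natl mulrA divff// mul1r lnK//.
Qed.

Lemma smooth_sqrt_norm f : smooth O f -> (forall p, O p -> f p != 0) ->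
  smooth O (fun p => Num.sqrt `|f p|).
Proof.
move=> sf f0.
apply: smooth_ext (smooth_expR (smoothZ 2^-1 (smooth_ln_norm sf f0))) => p Op.
by rewrite sqrt_norm_expR// f0.
Qed.

Lemma derive_plane f p (v : plane R) : differentiable f p ->
  'D_v f p = v.1 * du f p + v.2 * dv f p.
Proof.
move=> df; rewrite /du /dv !deriveE//.
have {1}-> : v = v.1 *: ((1, 0) : plane R) + v.2 *: ((0, 1) : plane R).
  by case: v => a b; congr pair; rewrite /= /GRing.scale/= ?mulr1 ?mulr0 ?addr0 ?add0r.
by rewrite linearD !linearZ.
Qed.

(** Schwarz' theorem: both mixed derivatives are the limit of the second
    difference on small squares. *)
Lemma du_dvC f p : smooth O f -> O p -> du (dv f) p = dv (du f) p.
Proof.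
move=> sf Op.
have suv := smooth_du (smooth_dv sf); have svu := smooth_dv (smooth_du sf).
apply/eqP; rewrite -subr_eq0 -normr_le0; apply/ler_addgt0Pr => e e0; rewrite add0r.
have e2 : 0 < e / 2 by rewrite divr_gt0.
have nuv : \forall q \near p, `|du (dv f) p - du (dv f) q| < e / 2.
  by move/cvgrPdist_lt : (smooth_continuous suv Op) => /(_ _ e2).
have nvu : \forall q \near p, `|dv (du f) p - dv (du f) q| < e / 2.
  by move/cvgrPdist_lt : (smooth_continuous svu Op) => /(_ _ e2).
have /nbhs_ballP[r /= r0] : \forall q \near p, O q /\
    (`|du (dv f) p - du (dv f) q| < e / 2 /\ `|dv (du f) p - dv (du f) q| < e / 2).
  exact: (filterI (nearO Op) (filterI nuv nvu)).
clear nuv nvu.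
move=> rP.
case: p Op rP => u v Op rP.
pose h := r / 2; have h0 : 0 < h by rewrite divr_gt0.
have hh (x : R) : x + h - x = h by rewrite addrAC subrr add0r.
have c0 (x : R) : `|x - x| < r by rewrite subrr normr0.
have ch (x : R) : `|x - (x + h)| < r by rewrite opprD addrA subrr sub0r normrN gtr0_norm// /h; lra.
clearbody h.
have du_ g x y : smooth O g -> `|u - x| < r -> `|v - y| < r ->
    is_derive x 1 (fun s => g (s, y)) (du g (x, y)).
  move=> sg xr yr; apply: (is_derive_u g (x, y) _).1; apply: smooth_is_derive => //.
  by have [] := rP (x, y) (conj xr yr).
have dv_ g x y : smooth O g -> `|u - x| < r -> `|v - y| < r ->
    is_derive y 1 (fun s => g (x, s)) (dv g (x, y)).
  move=> sg xr yr; apply: (is_derive_v g (x, y) _).1; apply: smooth_is_derive => //.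
  by have [] := rP (x, y) (conj xr yr).
pose D := f (u + h, v + h) - f (u, v + h) - (f (u + h, v) - f (u, v)).
have [x1 [y1 [x1r y1r D1]]] : exists x y, [/\ `|u - x| < r, `|v - y| < r &
    D = dv (du f) (x, y) * h * h].
  have [x xr|x xr e1] := @mean_value_ball R u r (fun s => f (s, v + h) - f (s, v))
    (fun s => du f (s, v + h) - du f (s, v)) u (u + h) (c0 u) (ch u) _.
    by apply: is_deriveB; apply: du_.
  have [y yr|y yr e3] := @mean_value_ball R v r (fun s => du f (x, s))
    (fun s => dv (du f) (x, s)) v (v + h) (c0 v) (ch v) _.
    by apply: dv_; [exact: smooth_du|exact: xr|].
  exists x, y; split; [exact: xr|exact: yr|]; move: e1.
  by rewrite e3 (hh u) (hh v) => <-; rewrite /D; ring.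
have [x2 [y2 [x2r y2r D2]]] : exists x y, [/\ `|u - x| < r, `|v - y| < r &
    D = du (dv f) (x, y) * h * h].
  have [y yr|y yr e1] := @mean_value_ball R v r (fun s => f (u + h, s) - f (u, s))
    (fun s => dv f (u + h, s) - dv f (u, s)) v (v + h) (c0 v) (ch v) _.
    by apply: is_deriveB; apply: dv_.
  have [x xr|x xr e3] := @mean_value_ball R u r (fun s => dv f (s, y))
    (fun s => du (dv f) (s, y)) u (u + h) (c0 u) (ch u) _.
    by apply: du_; [exact: smooth_dv| |exact: yr].
  exists x, y; split; [exact: xr|exact: yr|]; move: e1.
  by rewrite e3 (hh v) (hh u) => <-; rewrite /D; ring.
have E : dv (du f) (x1, y1) = du (dv f) (x2, y2).
  have hn0 : h != 0 by rewrite gt_eqF.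
  by have /(mulIf hn0)/(mulIf hn0) := etrans (esym D1) D2.
have [_ [_ /ltW H1]] := rP (x1, y1) (conj x1r y1r).
have [_ [/ltW H2 _]] := rP (x2, y2) (conj x2r y2r).
rewrite E in H1; rewrite (splitr e).
apply: le_trans (ler_distD (du (dv f) (x2, y2)) _ _) _.
by apply: lerD; [exact: H2|rewrite distrC; exact: H1].
Unshelve. all: by end_near. Qed.

End Ck_calculus.

(** * Linear systems on small boxes *)

Lemma term_lt_sum2 (R : realType) (I : finType) (x : I -> I -> R) (i j : I) :
  (forall i j, 0 <= x i j) -> x i j < 1 + \sum_i \sum_j x i j.
Proof.
move=> x0; rewrite (bigD1 i)//= (bigD1 j)//=.
have h1 : 0 <= \sum_(k | k != j) x i k by rewrite sumr_ge0.
have h2 : 0 <= \sum_(k | k != i) \sum_l x k l.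
  by rewrite sumr_ge0// => k _; rewrite sumr_ge0.
lra.
Qed.

(** Boxes that are small enough for [small_interval_estimate] in both
    directions. *)
Definition tame (R : realType) (I : finType) (O1 O2 : I -> I -> plane R -> R)
    (a1 b1 a2 b2 : R) : Prop :=
  exists M : R, [/\ 0 <= M,
    forall q i j, obox a1 b1 a2 b2 q -> `|O1 i j q| <= M /\ `|O2 i j q| <= M,
    #|I|%:R * M * (b1 - a1) <= 2^-1 & #|I|%:R * M * (b2 - a2) <= 2^-1].

Section tame_boxes.
Variables (R : realType) (I : finType) (O1 O2 : I -> I -> plane R -> R).

Lemma tame_unique a1 b1 a2 b2 (y z : I -> plane R -> R) (p q : plane R) :
  tame O1 O2 a1 b1 a2 b2 ->
  solution_on O1 O2 (obox a1 b1 a2 b2) y -> solution_on O1 O2 (obox a1 b1 a2 b2) z ->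
  obox a1 b1 a2 b2 p -> obox a1 b1 a2 b2 q ->
  (forall i, y i p = z i p) -> forall i, y i q = z i q.
Proof.
move=> [M [M0 MO s1 s2]] hy hz.
case: p => u v [/= uI vI]; case: q => u' v' [/= uI' vI'] yz i.
have bnd (A : I -> I -> plane R -> R) (q : plane R) j :
    (forall j k : I, `|A j k q| <= M) ->
    `|\sum_k A j k q * y k q - \sum_k A j k q * z k q|
      <= M * (\sum_k `|y k q - z k q|) + 0.
  move=> AM; rewrite addr0 -sumrB; apply: le_trans (ler_norm_sum _ _ _) _.
  rewrite mulr_sumr; apply: ler_sum => k _.
  by rewrite -mulrBr normrM ler_wpM2r.
have h1 : \sum_j `|y j (u', v) - z j (u', v)| <=
    2 * (\sum_j `|y j (u, v) - z j (u, v)| + #|I|%:R * (b1 - a1) * 0).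
  apply: (@small_interval_estimate R I (fun j s => y j (s, v) - z j (s, v))
    (fun j s => \sum_k O1 j k (s, v) * y k (s, v) - \sum_k O1 j k (s, v) * z k (s, v))
    a1 b1 M) => // s sI j.
    by apply: is_deriveB; [exact: (hy (s, v) (conj sI vI) j).1|exact: (hz (s, v) (conj sI vI) j).1].
  by apply: bnd => j' k; exact: (MO (s, v) j' k (conj sI vI)).1.
have h2 : \sum_j `|y j (u', v') - z j (u', v')| <=
    2 * (\sum_j `|y j (u', v) - z j (u', v)| + #|I|%:R * (b2 - a2) * 0).
  apply: (@small_interval_estimate R I (fun j s => y j (u', s) - z j (u', s))
    (fun j s => \sum_k O2 j k (u', s) * y k (u', s) - \sum_k O2 j k (u', s) * z k (u', s))
    a2 b2 M) => // s sI j.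
    by apply: is_deriveB; [exact: (hy (u', s) (conj uI' sI) j).2|exact: (hz (u', s) (conj uI' sI) j).2].
  by apply: bnd => j' k; exact: (MO (u', s) j' k (conj uI' sI)).2.
have e0 : \sum_j `|y j (u, v) - z j (u, v)| = 0.
  by apply: big1 => j _; rewrite yz subrr normr0.
rewrite e0 !mulr0 addr0 mulr0 in h1.
apply/eqP; rewrite -subr_eq0 -normr_le0.
apply: le_trans (_ : _ <= \sum_j `|y j (u', v') - z j (u', v')|) _.
  by rewrite (bigD1 i)//= lerDl sumr_ge0.
by apply: le_trans h2 _; rewrite mulr0 addr0 mulr_ge0_le0.
Qed.

(** Two solutions on different boxes agree on the intersection, which is again
    a box and inherits the bounds of the first one. *)
Lemma tame_agree a1 b1 a2 b2 c1 d1 c2 d2 (y z : I -> plane R -> R) (p q : plane R) :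
  tame O1 O2 a1 b1 a2 b2 ->
  solution_on O1 O2 (obox a1 b1 a2 b2) y -> solution_on O1 O2 (obox c1 d1 c2 d2) z ->
  obox a1 b1 a2 b2 p -> obox c1 d1 c2 d2 p ->
  obox a1 b1 a2 b2 q -> obox c1 d1 c2 d2 q ->
  (forall i, y i p = z i p) -> forall i, y i q = z i q.
Proof.
move=> tb hy hz bp cp bq cq.
pose m1 := Num.max a1 c1; pose n1 := Num.min b1 d1.
pose m2 := Num.max a2 c2; pose n2 := Num.min b2 d2.
have sub r : obox m1 n1 m2 n2 r <-> obox a1 b1 a2 b2 r /\ obox c1 d1 c2 d2 r.
  rewrite /obox/= /m1 /n1 /m2 /n2 !lt_min !gt_max.
  split=> [[/andP[/andP[-> ->] /andP[-> ->]] /andP[/andP[-> ->] /andP[-> ->]]]//|].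
  by move=> [[/andP[-> ->] /andP[-> ->]] [/andP[-> ->] /andP[-> ->]]].
apply: (@tame_unique m1 n1 m2 n2).
- have [M [M0 MO s1 s2]] := tb; exists M; split=> //.
  + by move=> r i j /sub[rb _]; exact: MO.
  + apply: le_trans s1; rewrite ler_wpM2l ?mulr_ge0//.
    by rewrite lerB// ?ge_min ?le_max lexx.
  + apply: le_trans s2; rewrite ler_wpM2l ?mulr_ge0//.
    by rewrite lerB// ?ge_min ?le_max lexx.
- by move=> r /sub[rb _]; exact: hy.
- by move=> r /sub[_ rc]; exact: hz.
- exact/sub.
- exact/sub.
Qed.

Lemma obox_open a1 b1 a2 b2 (q : plane R) : obox a1 b1 a2 b2 q ->
  \forall q' \near q, obox a1 b1 a2 b2 q'.
Proof.
case: q => u v [/= uI vI].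
have h1 : \forall s \near u, a1 < s < b1.
  by have := @near_in_itvoo R a1 b1 u; rewrite in_itv => /(_ uI); apply: filterS => s; rewrite in_itv.
have h2 : \forall s \near v, a2 < s < b2.
  by have := @near_in_itvoo R a2 b2 v; rewrite in_itv => /(_ vI); apply: filterS => s; rewrite in_itv.
by exists ([set s | a1 < s < b1], [set s | a2 < s < b2]); [split|move=> [s t] /= []].
Qed.

Lemma small_box (p : plane R) (P : set (plane R)) (K : R) :
  0 <= K -> (\forall q \near p, P q) -> exists a1 b1 a2 b2,
  [/\ obox a1 b1 a2 b2 p, cbox a1 b1 a2 b2 `<=` P,
    K * (b1 - a1) <= 2^-1 & K * (b2 - a2) <= 2^-1].
Proof.
move=> K0 /nbhs_ballP[r /= r0 rP].
pose L := 4 * (K + 1).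
have L0 : 0 < L by rewrite mulr_gt0// ltr_wpDl.
pose e := Num.min (r / 2) L^-1.
have e0 : 0 < e by rewrite lt_min divr_gt0//= invr_gt0.
have small : K * (e + e) <= 2^-1.
  have eL : e <= L^-1 by rewrite ge_min lexx orbT.
  have : L * e <= 1 by rewrite -(divff (lt0r_neq0 L0)) ler_wpM2l// ltW.
  rewrite /L; nra.
have er : e <= r / 2 by rewrite ge_min lexx.
clearbody e; case: p rP => u v rP.
have ebox x : x + e - (x - e) = e + e :> R by ring.
exists (u - e), (u + e), (v - e), (v + e); split; rewrite ?ebox//.
- by split => /=; rewrite gtrBl ltrDl e0.
- case=> x y [/= /andP[h1 h2] /andP[h3 h4]]; apply: rP; apply/ball_plane => /=.
  by rewrite !ltr_norml; split; apply/andP; split; lra.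
Qed.

Lemma sub_cbox a1 b1 a2 b2 : obox a1 b1 a2 b2 `<=` @cbox R a1 b1 a2 b2.
Proof. by move=> q [/andP[? ?] /andP[? ?]]; split; rewrite !ltW. Qed.

Lemma near_bounded (G : I -> I -> plane R -> R) (p : plane R) :
  (forall i j, {for p, continuous (G i j)}) ->
  exists2 M, 0 <= M & \forall q \near p, forall i j, `|G i j q| <= M.
Proof.
move=> cG; pose M := 1 + \sum_i \sum_j `|G i j p|.
have M0 : 0 <= M by rewrite addr_ge0// sumr_ge0// => i _; rewrite sumr_ge0.
exists M => //.
have GMij i j : \forall q \near p, `|G i j q| <= M.
  have GpM : `|G i j p| < M.
    exact: (term_lt_sum2 (x := fun i j => `|G i j p|) _ _ (fun i j => normr_ge0 (G i j p))).
  have h : \forall q \near p, `|G i j q| < M.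
    exact: (cvgr_lt `|G i j p| (cvg_norm (cG i j)) M GpM).
  by apply: filterS h => q /ltW.
have H i : \forall q \near p, forall j, `|G i j q| <= M.
  exact: (filter_forall _ (GMij i)).
exact: (filter_forall _ H).
Qed.

Variable O : set (plane R).
Hypothesis openO : open O.

Let nearO p : O p -> \forall q \near p, O q.
Proof. by move=> Op; apply: open_nbhs_nbhs; split. Qed.

Lemma tame_nbhs p : O p ->
  (forall i j, {for p, continuous (O1 i j)}) -> (forall i j, {for p, continuous (O2 i j)}) ->
  exists a1 b1 a2 b2,
  [/\ obox a1 b1 a2 b2 p, obox a1 b1 a2 b2 `<=` O & tame O1 O2 a1 b1 a2 b2].
Proof.
move=> Op /near_bounded[M1 M10 n1] /near_bounded[M2 M20 n2].
have nM : 0 <= #|I|%:R * (M1 + M2) by rewrite mulr_ge0// addr_ge0.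
have [a1 [b1 [a2 [b2 [bp sub s1 s2]]]]] := small_box nM (filterI (nearO Op) (filterI n1 n2)).
exists a1, b1, a2, b2; split=> //.
  by move=> q /sub_cbox/sub[].
exists (M1 + M2); split=> //; first exact: addr_ge0.
move=> q i j /sub_cbox/sub[_ [/(_ i j) h1 /(_ i j) h2]].
by split; [apply: le_trans h1 _; rewrite lerDl|apply: le_trans h2 _; rewrite lerDr].
Qed.

Hypothesis smooth1 : forall i j, smooth O (O1 i j).
Hypothesis smooth2 : forall i j, smooth O (O2 i j).
Hypothesis flat : forall i j p, O p ->
  dv (O1 i j) p + \sum_k O1 i k p * O2 k j p = du (O2 i j) p + \sum_k O2 i k p * O1 k j p.

Lemma tame_box p : O p -> exists a1 b1 a2 b2,
  [/\ obox a1 b1 a2 b2 p, obox a1 b1 a2 b2 `<=` O, tame O1 O2 a1 b1 a2 b2 &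
    forall (q : plane R) (c : I -> R), obox a1 b1 a2 b2 q ->
      exists2 y, solution_on O1 O2 (obox a1 b1 a2 b2) y & forall i, y i q = c i].
Proof.
move=> Op.
have bounded (G : I -> I -> plane R -> R) : (forall i j, smooth O (G i j)) ->
    exists2 M, 0 <= M & \forall q \near p, forall i j, `|G i j q| <= M.
  by move=> sG; apply: near_bounded => i j; exact: smooth_continuous (sG i j) Op.
have su i j := smooth_du (smooth2 i j).
have suu i j := smooth_du (su i j).
have [M1 M10 n1] := bounded _ smooth1.
have [M2 M20 n2] := bounded _ smooth2.
have [M3 M30 n3] := bounded _ su.
have [M4 M40 n4] := bounded _ suu.
pose M := M1 + M2 + (M3 + M4).
have M0 : 0 <= M by rewrite !addr_ge0.
have nM : 0 <= #|I|%:R * M by rewrite mulr_ge0.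
have [a1 [b1 [a2 [b2 [bp sub0 s1 s2]]]]] := small_box nM
  (filterI (nearO Op) (filterI (filterI n1 n2) (filterI n3 n4))).
have subO q : cbox a1 b1 a2 b2 q -> O q by move=> /sub0[].
have bd1 i j q : cbox a1 b1 a2 b2 q -> `|O1 i j q| <= M.
  move=> /sub0[_ [[/(_ i j) h _] _]]; apply: le_trans h _.
  by rewrite /M -addrA lerDl !addr_ge0.
have bd2 i j q : cbox a1 b1 a2 b2 q -> `|O2 i j q| <= M.
  move=> /sub0[_ [[_ /(_ i j) h] _]]; apply: le_trans h _.
  by rewrite /M addrAC lerDr !addr_ge0.
have bd3 i j q : cbox a1 b1 a2 b2 q -> `|du (O2 i j) q| <= M.
  move=> /sub0[_ [_ [/(_ i j) h _]]]; apply: le_trans h _.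
  by rewrite /M addrCA lerDl !addr_ge0.
have bd4 i j q : cbox a1 b1 a2 b2 q -> `|du (du (O2 i j)) q| <= M.
  move=> /sub0[_ [_ [_ /(_ i j) h]]]; apply: le_trans h _.
  by rewrite /M addrA lerDr !addr_ge0.
clearbody M.
exists a1, b1, a2, b2; split; [exact: bp|by move=> q /sub_cbox/subO| |].
- exists M; split; [exact: M0| |exact: s1|exact: s2] => q i j /sub_cbox qb.
  by split; [exact: bd1|exact: bd2].
- move=> q c qb.
  apply: (@box_solution R I O1 O2 (fun i j => dv (O1 i j)) (fun i j => du (O2 i j))
      a1 b1 a2 b2 M M0 _ _ bd1 bd2 bd3 _ _ _ _ s1 s2 q c qb).
  + by move=> i j q' /subO Oq'; exact: smooth_continuous (smooth1 i j) Oq'.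
  + by move=> i j q' /subO Oq'; exact: smooth_continuous (smooth2 i j) Oq'.
  + move=> i j q' /sub_cbox/subO Oq'; apply: (is_derive_v _ _ _).1.
    exact: smooth_is_derive (smooth1 i j) Oq'.
  + move=> i j q' /sub_cbox/subO Oq'; apply: (is_derive_u _ _ _).1.
    exact: smooth_is_derive (smooth2 i j) Oq'.
  + move=> i j s s' t [/= sI tI] [/= s'I _].
    have btw x : Num.min s s' <= x <= Num.max s s' -> obox a1 b1 a2 b2 (x, t).
      move: sI s'I => /andP[h1 h2] /andP[h3 h4] /andP[h5 h6]; split=> //=; apply/andP; split.
        by apply: lt_le_trans h5; rewrite lt_min h1.
      by apply: le_lt_trans h6 _; rewrite gt_max h2.
    have [x /btw/sub_cbox/subO Ox|x /btw/sub_cbox xI ->] := @mean_value R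
        (fun x => du (O2 i j) (x, t)) (fun x => du (du (O2 i j)) (x, t)) s s' _.
      apply: (is_derive_u _ (x, t) _).1.
      exact: (smooth_is_derive (1, 0) (su i j) Ox).
    by rewrite normrM ler_wpM2r//; exact: bd4.
  + by move=> i j q' /sub_cbox/subO Oq'; exact: flat.
Qed.
End tame_boxes.

(** * Continuation along paths *)

Lemma locally_constant (R : realType) (P : R -> Prop) :
  (forall s, \forall s' \near s, P s' <-> P s) -> forall s t, P s -> P t.
Proof.
move=> lc s t Ps.
have opP : open [set x | P x].
  rewrite openE => x Px; rewrite /interior.
  by apply: filterS (lc x) => y [_]; apply.
have opN : open (~` [set x | P x]).
  rewrite openE => x Px; rewrite /interior.
  by apply: filterS (lc x) => y [h _] /h.
have cR : connected [set: R] by apply/connected_intervalP => x y _ _ z _.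
suff PT : [set x | P x] = [set: R] by rewrite -[P t]/([set x | P x] t) PT.
apply: cR; first by exists s.
- by exists [set x | P x] => //; rewrite setTI.
- by exists [set x | P x]; rewrite ?setTI//; rewrite -[X in closed X]setCK; exact: open_closedC.
Qed.

Lemma within_continuous_comp (S T U : topologicalType) (A : set T) (f : T -> U) (phi : S -> T) :
  {within A, continuous f} -> continuous phi -> (forall s, A (phi s)) ->
  continuous (f \o phi).
Proof.
move=> /subspace_continuousP cf cphi Aphi s.
apply: cvg_trans (cf _ (Aphi s)) => P.
rewrite /nbhs/= => /(cphi s); rewrite /nbhs/=.
by apply: filterS => x; apply; exact: Aphi.
Qed.

Lemma lt_convex (R : realType) (a b x y r : R) : 0 <= r -> r <= 1 ->
  a < x < b -> a < y < b -> a < y + r * (x - y) < b.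
Proof.
move=> r0; rewrite le_eqVlt => /predU1P[->|r1] /andP[ax xb] /andP[ay yb].
  by rewrite mul1r addrC subrK ax.
have h1 : 0 <= r * (x - a) by rewrite mulr_ge0// subr_ge0 ltW.
have h2 : 0 < (1 - r) * (y - a) by rewrite mulr_gt0// subr_gt0.
have h3 : 0 <= r * (b - x) by rewrite mulr_ge0// subr_ge0 ltW.
have h4 : 0 < (1 - r) * (b - y) by rewrite mulr_gt0// subr_gt0.
apply/andP; split; lra.
Qed.

Definition clamp01 (R : realType) (s : R) : R := clamp 0 1 s.

Lemma clamp01P (R : realType) (s : R) : 0 <= clamp01 s <= 1.
Proof. exact: clampP. Qed.

Lemma clamp01_id (R : realType) (s : R) : 0 <= s <= 1 -> clamp01 s = s.
Proof. exact: clamp_id. Qed.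

Lemma clamp01_le0 (R : realType) (s : R) : s <= 0 -> clamp01 s = 0.
Proof. by move=> s0; rewrite /clamp01 /clamp min_l ?max_l// (le_trans s0). Qed.

Lemma clamp01_ge1 (R : realType) (s : R) : 1 <= s -> clamp01 s = 1.
Proof. by move=> s1; rewrite /clamp01 /clamp min_r// max_r. Qed.

Lemma continuous_clamp01 (R : realType) : continuous (@clamp01 R).
Proof. exact: continuous_clamp. Qed.

(** Solutions on small boxes form a local system. A lift of a map c into O is a
    choice of values that is locally the restriction of one solution to c; lifts
    are determined by one value, exist along paths, and extend to homotopies, so
    that the values transported along loops are unchanged when O is simply
    connected. *)
Section monodromy.
Variables (R : realType) (I : finType) (O1 O2 : I -> I -> plane R -> R).
Variable O : set (plane R).
Hypothesis openO : open O.
Hypothesis local : forall p, O p -> exists a1 b1 a2 b2,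
  [/\ obox a1 b1 a2 b2 p, obox a1 b1 a2 b2 `<=` O, tame O1 O2 a1 b1 a2 b2 &
    forall (q : plane R) (c : I -> R), obox a1 b1 a2 b2 q ->
      exists2 y, solution_on O1 O2 (obox a1 b1 a2 b2) y & forall i, y i q = c i].

Definition lift_at (T : topologicalType) (c : T -> plane R) (Y : T -> I -> R) (s : T) :=
  exists a1 b1 a2 b2 y, [/\ tame O1 O2 a1 b1 a2 b2, obox a1 b1 a2 b2 (c s),
    solution_on O1 O2 (obox a1 b1 a2 b2) y &
    \forall s' \near s, forall i, Y s' i = y i (c s')].

Lemma lift_comp (S T : topologicalType) (c : T -> plane R) (Y : T -> I -> R)
    (phi : S -> T) (s : S) :
  {for s, continuous phi} -> lift_at c Y (phi s) -> lift_at (c \o phi) (Y \o phi) s.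
Proof.
move=> cphi [a1 [b1 [a2 [b2 [y [tb bc sy Yy]]]]]].
by exists a1, b1, a2, b2, y; split=> //; exact: (cphi _ Yy).
Qed.

Lemma lift_agree (T : topologicalType) (c : T -> plane R) (Y Z : T -> I -> R) (s : T) :
  {for s, continuous c} -> lift_at c Y s -> lift_at c Z s ->
  \forall s' \near s, Y s' = Z s' <-> Y s = Z s.
Proof.
move=> cc [a1 [b1 [a2 [b2 [y [tb bc sy Yy]]]]]] [c1 [d1 [c2 [d2 [z [td dc sz Zz]]]]]].
have nb := cc _ (obox_open bc); have nd := cc _ (obox_open dc).
have Ys := nbhs_singleton Yy; have Zs := nbhs_singleton Zz.
near=> s'.
have Ys' : forall i, Y s' i = y i (c s') by near: s'.
have Zs' : forall i, Z s' i = z i (c s') by near: s'.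
have bs' : obox a1 b1 a2 b2 (c s') by near: s'.
have ds' : obox c1 d1 c2 d2 (c s') by near: s'.
split=> e; apply/funext => i.
  rewrite Ys Zs; apply: (tame_agree tb sy sz bs' ds' bc dc) => j.
  by rewrite -Ys' -Zs' e.
rewrite Ys' Zs'; apply: (tame_agree tb sy sz bc dc bs' ds') => j.
by rewrite -Ys -Zs e.
Unshelve. all: by end_near. Qed.

Lemma lift_unique (c : R -> plane R) (Y Z : R -> I -> R) :
  continuous c -> (forall s, lift_at c Y s) -> (forall s, lift_at c Z s) ->
  forall s t, Y s = Z s -> Y t = Z t.
Proof.
move=> cc hY hZ; apply: (@locally_constant R (fun s => Y s = Z s)) => s.
by apply: lift_agree; [exact: cc|exact: hY|exact: hZ].
Qed.

Lemma lift_cst (T : topologicalType) (p : plane R) (y0 : I -> R) (s : T) :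
  O p -> lift_at (fun=> p) (fun=> y0) s.
Proof.
move=> /local[a1 [b1 [a2 [b2 [bp _ tb /(_ p y0 bp)[y sy yp]]]]]].
exists a1, b1, a2, b2, y; split=> //.
by apply: nearW => s' i; rewrite yp.
Qed.

Lemma lift_cst_unique (p : plane R) (Y : R -> I -> R) s t : O p ->
  (forall s, lift_at (fun=> p) Y s) -> Y s = Y t.
Proof.
move=> Op hY; have hc s' := @lift_cst R p (Y t) s' Op.
by apply: (lift_unique _ hY hc (s := t)) => // x; exact: cst_continuous.
Qed.

(** The set of the b such that a lift exists up to the parameter b is open and
    closed. Paths are parametrised by the whole line and constant outside of
    the unit interval, which avoids one-sided neighbourhoods. *)
Lemma path_lift (c : R -> plane R) (y0 : I -> R) :
  continuous c -> (forall s, O (c s)) ->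
  (forall s, s <= 0 -> c s = c 0) -> (forall s, 1 <= s -> c s = c 1) ->
  exists2 Y : R -> I -> R, forall s, lift_at c Y s & forall s, s <= 0 -> Y s = y0.
Proof.
move=> cc Oc c0 c1.
pose P b := exists2 Y : R -> I -> R, forall s, s <= b -> lift_at c Y s &
  forall s, s <= -1 -> Y s = y0.
have Pm1 : P (-1).
  have [a1 [b1 [a2 [b2 [bp _ tb /(_ _ y0 bp)[y sy yp]]]]]] := local (Oc 0).
  exists (fun=> y0) => // s s1; exists a1, b1, a2, b2, y; split=> //.
    by rewrite c0//; lra.
  near=> s' => i; rewrite c0 ?yp//.
  have : s' < 0 by near: s'; apply: lt_nbhsl; lra.
  exact: ltW.
have Pconst b : \forall b' \near b, P b' <-> P b.
  have [a1 [b1 [a2 [b2 [bp _ tb solve]]]]] := local (Oc b).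
  have /nbhs_ballP[e /= e0 eP] := cc b _ (obox_open bp).
  have ext x x' : ball b e x -> ball b e x' -> P x -> P x'.
    move=> xe x'e [Y Yl Y0].
    have [x'x|xx'] := leP x' x.
      by exists Y => // s sx'; apply: Yl; exact: le_trans x'x.
    have [y sy yx] := solve (c x) (Y x) (eP _ xe).
    exists (fun s => if s <= x then Y s else fun i => y i (c s)); last first.
      move=> s s1; case: leP => xs; first exact: Y0.
      have s0 : s <= 0 by lra.
      have x0 : x <= 0 by lra.
      have x1 : x <= -1 by lra.
      by apply/funext => i; rewrite (c0 s s0) -(c0 x x0) yx Y0.
    move=> s sx'; have [sx|xs|->] := ltgtP s x.
    - have [A1 [B1 [A2 [B2 [z [tz bz sz Yz]]]]]] := Yl s (ltW sx).
      exists A1, B1, A2, B2, z; split=> //.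
      near=> s'; have -> : s' <= x by near: s'; apply: filterS (lt_nbhsl sx) => t /ltW.
      by near: s'.
    - have bs : obox a1 b1 a2 b2 (c s).
        apply: eP; move: xe x'e; rewrite /ball/= !ltr_norml; lra.
      exists a1, b1, a2, b2, y; split=> //.
      near=> s'; rewrite leNgt; have -> // : x < s' by near: s'; exact: lt_nbhsr.
    - have [A1 [B1 [A2 [B2 [z [tz bz sz Yz]]]]]] := Yl x (lexx x).
      exists A1, B1, A2, B2, z; split=> //.
      have n1 := cc x _ (obox_open bz); have n2 := cc x _ (obox_open (eP _ xe)).
      near=> s'; case: leP => xs'; first by near: s'.
      move=> i; apply: (tame_agree tb sy sz (eP _ xe) bz) => //; try by near: s'.
      by move=> j; rewrite yx (nbhs_singleton Yz).
  have nbx : \forall b' \near b, ball b e b' by exact: nbhsx_ballx.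
  by apply: filterS nbx => b' b'e; split; apply: ext => //; exact: ballxx.
have [Y Yl Y0] := locally_constant Pconst (2 : R) Pm1.
pose phi (s : R) := Num.min s 2.
have cphi : continuous phi.
  by move=> s; apply: (@continuous_min R R id (fun=> 2)); [exact: cvg_id|exact: cst_continuous].
have Yphi s : lift_at c (Y \o phi) s.
  have -> : c = c \o phi.
    apply/funext => t; rewrite /= /phi; case: leP => // /ltW t2.
    by rewrite !(c1 t, c1 2)//; lra.
  by apply: lift_comp; [exact: cphi|apply: Yl; rewrite /phi ge_min lexx orbT].
exists (Y \o phi) => // s s0.
pose psi (s : R) := Num.min s 0.
have cpsi : continuous psi.
  by move=> t; apply: (@continuous_min R R id (fun=> 0)); [exact: cvg_id|exact: cst_continuous].
have h t : lift_at (fun=> c 0) ((Y \o phi) \o psi) t.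
  have -> : (fun=> c 0) = c \o psi.
    by apply/funext => x /=; rewrite [RHS]c0// /psi ge_min lexx orbT.
  by apply: lift_comp; [exact: cpsi|exact: Yphi].
have := lift_cst_unique s (-1) (Oc 0) h.
rewrite /= /psi min_l// => ->; rewrite min_l ?lerN10//.
by rewrite Y0// /phi min_l//; lra.
Unshelve. all: by end_near. Qed.

(** The lifts along the rows fit together: where the lift is locally a
    solution near (s1, t), uniqueness along the rows through nearby points
    propagates this to the whole row through t. *)
Lemma square_lift (H : plane R -> plane R) (y0 : I -> R) (c0 : plane R) :
  continuous H -> (forall q, O (H q)) ->
  (forall s t, s <= 0 -> H (s, t) = c0) ->
  (forall s t, 1 <= s -> H (s, t) = H (1, t)) ->
  exists2 Y : plane R -> I -> R, forall q, lift_at H Y q &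
    forall s t, s <= 0 -> Y (s, t) = y0.
Proof.
move=> cH OH H0 H1.
have row t : continuous (fun s => H (s, t)).
  move=> s; apply: (@continuous_comp _ _ _ (fun s : R => (s, t)) H); last exact: cH.
  by apply: continuous_pairing; [exact: cvg_id|exact: cst_continuous].
have /choice[Y YP] : forall t, exists Y : R -> I -> R,
    (forall s, lift_at (fun s => H (s, t)) Y s) /\ forall s, s <= 0 -> Y s = y0.
  move=> t; have [|||Y Yl Y0] := @path_lift (fun s => H (s, t)) y0 (row t) _ _ _.
  - by move=> s; exact: OH.
  - by move=> s s0; rewrite !H0.
  - by move=> s s1; rewrite H1.
  - by exists Y.
exists (fun q => Y q.2 q.1); last by move=> s t s0; exact: (YP t).2.
move=> [s t]; pose P s := lift_at H (fun q => Y q.2 q.1) (s, t).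
have Pm1 : P (-1).
  have Oc0 : O c0 by rewrite -(H0 0 0).
  have [a1 [b1 [a2 [b2 [y [tb bp sy yp]]]]]] := lift_cst y0 ((-1, t) : plane R) Oc0.
  have c0y := nbhs_singleton yp.
  exists a1, b1, a2, b2, y; split=> //; first by rewrite H0// lerN10.
  have nn : \forall q \near ((-1, t) : plane R), q.1 < 0.
    have h : \forall x \near (-1 : R), x < 0 by apply: lt_nbhsl; lra.
    by exists ([set x | x < 0], setT); [split => //; exact: filterT|move=> [x x'] []].
  by apply: filterS nn => -[x x'] /= /ltW x0 i; rewrite H0// (YP x').2// -c0y.
apply: (locally_constant _ s Pm1) => {}s.
have [a1 [b1 [a2 [b2 [y [tb bp sy Yy]]]]]] := (YP t).1 s.
have nb : \forall q \near ((s, t) : plane R), obox a1 b1 a2 b2 (H q).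
  exact: (cH (s, t) _ (obox_open bp)).
have /nbhs_ballP[e1 /= e10 e1P] := nb; have /nbhs_ballP[e2 /= e20 e2P] := Yy.
pose e := Num.min e1 e2; have e0 : 0 < e by rewrite lt_min e10.
have sub1 x x' : ball s e x -> ball t e x' -> obox a1 b1 a2 b2 (H (x, x')).
  move=> sx tx'; apply: e1P; split => /=; apply: (le_ball (e1 := e)) => //.
    by rewrite ge_min lexx.
  by rewrite ge_min lexx.
have sub2 x : ball s e x -> forall i, Y t x i = y i (H (x, t)).
  by move=> sx; apply: e2P; apply: (le_ball (e1 := e)) => //; rewrite ge_min lexx orbT.
have ext s1 s2 : ball s e s1 -> ball s e s2 -> P s1 -> P s2.
  move=> s1e s2e [A1 [B1 [A2 [B2 [z [tz bz sz Yz]]]]]].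
  have te : ball t e t by exact: ballxx.
  have nt : \forall x \near t, Y x s1 = fun i => y i (H (s1, x)).
    have cpair : {for t, continuous (fun x : R => (s1, x) : plane R)}.
      by apply: continuous_pairing; [exact: cst_continuous|exact: cvg_id].
    have n1 := cpair _ Yz; have n2 := cpair _ (cH (s1, t) _ (obox_open bz)).
    have n3 : \forall x \near t, ball t e x by exact: nbhsx_ballx.
    near=> x; have zx : forall i, Y x s1 i = z i (H (s1, x)) by near: x; exact: n1.
    have bx : obox A1 B1 A2 B2 (H (s1, x)) by near: x; exact: n2.
    have ex : ball t e x by near: x; exact: n3.
    apply/funext => i; rewrite zx.
    apply: (tame_agree tz sz sy bz (sub1 _ _ s1e te)).
    - exact: bx.
    - exact: sub1.
    - by move=> j; rewrite -sub2// (nbhs_singleton Yz).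
  have /nbhs_ballP[d /= d0 dP] : \forall x \near t, ball t e x /\ Y x s1 = fun i => y i (H (s1, x)).
    by apply: filterI => //; exact: nbhsx_ballx.
  exists a1, b1, a2, b2, y; split=> //; first exact: sub1.
  have ns : \forall q \near ((s2, t) : plane R), ball s e q.1 /\ ball t d q.2.
    exists ([set x | ball s e x], [set x | ball t d x]); last by move=> [x x'].
    split; last exact: nbhsx_ballx.
    by apply: open_nbhs_nbhs; split => //; exact: ball_open.
  apply: filterS ns => -[x x'] /= [xe /dP[x'e Ys1]].
  (* along the row through x', both lifts start at s1 and stay in the box up to x *)
  pose phi r := Num.max (Num.min s1 x) (Num.min r (Num.max s1 x)).
  have phie r : ball s e (phi r).
    have : Num.min s1 x <= phi r <= Num.max s1 x.
      have mM : Num.min s1 x <= Num.max s1 x by rewrite ge_min le_max lexx.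
      by rewrite /phi le_max lexx/= ge_max mM ge_min lexx orbT.
    move: (phi r) => w; rewrite ge_min le_max => /andP[/orP h1 /orP h2].
    move: s1e xe; rewrite /ball/= !ltr_norml; case: h1 => h1; case: h2 => h2; lra.
  have cphi : continuous phi.
    move=> r; apply: (@continuous_max R R (fun=> Num.min s1 x)
      (fun r => Num.min r (Num.max s1 x))); first exact: cst_continuous.
    by apply: (@continuous_min R R id (fun=> Num.max s1 x)); [exact: cvg_id|exact: cst_continuous].
  have phi1 : phi s1 = s1.
    have h1 : s1 <= Num.max s1 x by rewrite le_max lexx.
    have h2 : Num.min s1 x <= s1 by rewrite ge_min lexx.
    by rewrite /phi (min_l h1) (max_r h2).
  have phix : phi x = x.
    have h1 : x <= Num.max s1 x by rewrite le_max lexx orbT.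
    have h2 : Num.min s1 x <= x by rewrite ge_min lexx orbT.
    by rewrite /phi (min_l h1) (max_r h2).
  have cHphi : continuous (fun r => H (phi r, x')).
    by move=> r; apply: (@continuous_comp _ _ _ phi (fun s => H (s, x'))); [exact: cphi|exact: row].
  have l1 r : lift_at (fun r => H (phi r, x')) (Y x' \o phi) r.
    by apply: (lift_comp (c := fun s => H (s, x'))); [exact: cphi|exact: (YP x').1].
  have l2 r : lift_at (fun r => H (phi r, x')) (fun r i => y i (H (phi r, x'))) r.
    exists a1, b1, a2, b2, y; split=> //; first exact: sub1.
    by near=> r'.
  have := lift_unique cHphi l1 l2 (s := s1) x.
  by rewrite /= phi1 phix => /(_ Ys1) -> .
have nbx : \forall s' \near s, ball s e s' by exact: nbhsx_ballx.
by apply: filterS nbx => s' s'e; split; apply: ext => //; exact: ballxx.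
Unshelve. all: by end_near. Qed.

Hypothesis scO : simply_connected O.

(** The lift of a null-homotopy is constant along the three sides of the square
    that are mapped to the base point. *)
Lemma loop_lift (c : R -> plane R) (Y : R -> I -> R) :
  continuous c -> (forall s, O (c s)) ->
  (forall s, s <= 0 -> c s = c 0) -> (forall s, 1 <= s -> c s = c 1) ->
  c 0 = c 1 -> (forall s, lift_at c Y s) -> Y 1 = Y 0.
Proof.
move=> cc Oc c0 c1 c01 Yl.
have [_ _ /(_ c)] := scO; case => //.
- exact: continuous_subspaceT.
move=> H0 [cH0 OH0 Hb Ht Hlr].
pose H (q : plane R) := H0 (clamp01 q.1, clamp01 q.2).
have us (s : R) : unit_segment (clamp01 s) by exact: clamp01P.
have cH : continuous H.
  apply: (within_continuous_comp (phi := fun q : plane R => (clamp01 q.1, clamp01 q.2)) cH0); last by move=> q; split; exact: us.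
  move=> q.
  have h1 : {for q, continuous (fun q : plane R => clamp01 q.1)}.
    by apply: (continuous_comp (f := fst)); [exact: cvg_fst|exact: continuous_clamp01].
  have h2 : {for q, continuous (fun q : plane R => clamp01 q.2)}.
    by apply: (continuous_comp (f := snd)); [exact: cvg_snd|exact: continuous_clamp01].
  exact: continuous_pairing h1 h2.
have [|s t s0|s t s1|Z Zl Z0] := @square_lift H (Y 0) (c 0) cH.
- by move=> q; exact: OH0.
- by rewrite /H/= clamp01_le0//; exact: (Hlr _ (us t)).1.
- by rewrite /H/= clamp01_ge1// [in RHS]clamp01_ge1.
have le00 : (0 : R) <= 0 by []; have le11 : (1 : R) <= 1 by [].
have cfst (t : R) : continuous (fun s : R => (s, t) : plane R).
  by move=> s; apply: continuous_pairing; [exact: cvg_id|exact: cst_continuous].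
have csnd (s : R) : continuous (fun t : R => (s, t) : plane R).
  by move=> t; apply: continuous_pairing; [exact: cst_continuous|exact: cvg_id].
have bottom s : lift_at c (fun s => Z (s, 0)) s.
  have -> : c = H \o (fun s : R => (s, 0)).
    apply/funext => t; rewrite /= /H/= (clamp01_le0 le00) Hb//.
    have [t0|t0] := leP t 0; first by rewrite clamp01_le0// c0.
    have [t1|t1] := leP 1 t; first by rewrite clamp01_ge1// c1.
    by rewrite clamp01_id// !ltW.
  exact: (@lift_comp R (plane R) H Z (fun s : R => (s, 0)) s (@cfst 0 s) (Zl _)).
have right t : lift_at (fun=> c 0) (fun t => Z (1, t)) t.
  have -> : (fun=> c 0) = H \o (fun t : R => (1, t)).
    by apply/funext => x; rewrite /= /H/= clamp01_ge1//; case: (Hlr _ (us x)).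
  exact: (@lift_comp R (plane R) H Z (fun t : R => (1, t)) t (@csnd 1 t) (Zl _)).
have top s : lift_at (fun=> c 0) (fun s => Z (s, 1)) s.
  have -> : (fun=> c 0) = H \o (fun s : R => (s, 1)).
    by apply/funext => x; rewrite /= /H/= (clamp01_ge1 le11) Ht.
  exact: (@lift_comp R (plane R) H Z (fun s : R => (s, 1)) s (@cfst 1 s) (Zl _)).
rewrite (lift_unique cc Yl bottom (s := 0)); last by rewrite Z0.
rewrite (lift_cst_unique 0 1 (Oc 0) right) (lift_cst_unique 1 0 (Oc 0) top).
by rewrite Z0.
Qed.

(** The value at p is transported from p0 along a chosen path. Near p1 this
    agrees with one local solution, since the path to p1, the segment from p1
    to p and the reversed path from p form a loop. *)
Lemma global_solution (p0 : plane R) (y0 : I -> R) : O p0 ->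
  exists2 y, solution_on O1 O2 O y & forall i, y i p0 = y0 i.
Proof.
move=> Op0; have [_ pc _] := scO.
have /choice[c cP] : forall p, exists c : R -> plane R, O p ->
    [/\ continuous c, forall s, O (c s), forall s, s <= 0 -> c s = p0 &
      forall s, 1 <= s -> c s = p].
  move=> p; have [Op|] := pselect (O p); last by exists (fun=> p).
  have [c [cc Oc c0 c1]] := pc _ _ Op0 Op.
  exists (c \o @clamp01 R) => _; split.
  - apply: (within_continuous_comp cc); first exact: continuous_clamp01.
    by move=> s; exact: clamp01P.
  - by move=> s; apply: Oc; exact: clamp01P.
  - by move=> s s0; rewrite /= clamp01_le0.
  - by move=> s s1; rewrite /= clamp01_ge1.
have /choice[Y YP] : forall p, exists Y : R -> I -> R, O p ->
    (forall s, lift_at (c p) Y s) /\ Y 0 = y0.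
  move=> p; have [Op|] := pselect (O p); last by exists (fun _ _ => 0).
  have [cc Oc c0 c1] := cP p Op.
  have [||Y Yl Y0] := @path_lift (c p) y0 cc Oc.
  - by move=> s s0; rewrite !c0.
  - by move=> s s1; rewrite !c1.
  - by exists Y => _; rewrite Y0.
pose y i p := Y p 1 i.
have key p1 : O p1 -> exists a1 b1 a2 b2 z, [/\ obox a1 b1 a2 b2 p1,
    obox a1 b1 a2 b2 `<=` O, solution_on O1 O2 (obox a1 b1 a2 b2) z &
    forall p, obox a1 b1 a2 b2 p -> forall i, y i p = z i p].
  move=> Op1; have [a1 [b1 [a2 [b2 [bp1 bO tb solve]]]]] := local Op1.
  have [z sz zp1] := solve p1 (fun i => y i p1) bp1.
  exists a1, b1, a2, b2, z; split=> // p bp.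
  have Op := bO _ bp.
  have [ca Oa a0 a1'] := cP p1 Op1; have [cb Ob b0 b1'] := cP p Op.
  have [Yla Ya0] := YP p1 Op1; have [Ylb Yb0] := YP p Op.
  pose seg (s : R) : plane R := p1 + clamp01 s *: (p - p1).
  have seg0 s : s <= 0 -> seg s = p1 by move=> s0; rewrite /seg clamp01_le0// scale0r addr0.
  have seg1 s : 1 <= s -> seg s = p by move=> s1; rewrite /seg clamp01_ge1// scale1r addrC subrK.
  have cseg : continuous seg.
    move=> s; apply: cvgD; first exact: cvg_cst.
    by apply: cvgZr_tmp; exact: continuous_clamp01.
  have segb s : obox a1 b1 a2 b2 (seg s).
    have /andP[h0 h1] := clamp01P s; rewrite /seg; move: (clamp01 s) h0 h1 => r r0 r1.
    case: p p1 bp bp1 {Op Op1 zp1 ca Oa a0 a1' cb Ob b0 b1' Yla Ya0 Ylb Yb0 seg seg0 seg1 cseg}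
      => [u v] [u1 v1] [/= /andP[? ?] /andP[? ?]] [/= /andP[? ?] /andP[? ?]].
    by rewrite /obox/= /GRing.scale/=; split; apply: lt_convex => //; apply/andP.
  (* the loop, parametrised by the interval from 0 to 3 *)
  pose L (s : R) := c p1 s + (seg (s - 1) - p1) + (c p (3 - s) - p).
  pose l (s : R) := L (3 * s).
  have cl : continuous l.
    move=> s; have c3 : {for s, continuous (fun s : R => 3 * s)}.
      by apply: cvgM; [exact: cvg_cst|exact: cvg_id].
    apply: cvgD; first apply: cvgD.
    - by apply: (continuous_comp c3); exact: ca.
    - apply: cvgB; last exact: cvg_cst.
      apply: (@continuous_comp _ _ _ (fun s : R => 3 * s - 1) seg); last exact: cseg.
      by apply: cvgB => //; exact: cvg_cst.
    - apply: cvgB; last exact: cvg_cst.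
      apply: (@continuous_comp _ _ _ (fun s : R => 3 - 3 * s) (c p)); last exact: cb.
      by apply: cvgB => //; exact: cvg_cst.
  have L1 s : s <= 1 -> L s = c p1 s.
    move=> s1; rewrite /L seg0; last by lra.
    by rewrite b1' ?subrr ?addr0//; lra.
  have L2 s : 1 <= s <= 2 -> L s = seg (s - 1).
    move=> /andP[s1 s2]; rewrite /L a1'// b1'; last by lra.
    by rewrite subrr addr0 addrC subrK.
  have L3 s : 2 <= s -> L s = c p (3 - s).
    move=> s2; rewrite /L a1'; last by lra.
    rewrite seg1; last by lra.
    by rewrite [p1 + _]addrC subrK addrC subrK.
  have Ol s : O (l s).
    rewrite /l; have [h|h] := leP (3 * s) 1; first by rewrite L1.
    have [h'|h'] := leP (3 * s) 2; last by rewrite L3// ltW.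
    by rewrite L2 ?h' ?ltW//; apply: bO; exact: segb.
  have l0 s : s <= 0 -> l s = p0.
    by move=> s0; rewrite /l L1 ?a0//; lra.
  have l1 s : 1 <= s -> l s = p0.
    by move=> s0; rewrite /l L3 ?b0//; lra.
  have [||Z Zl Z0] := @path_lift l y0 cl Ol.
  - by move=> s s0; rewrite !l0.
  - by move=> s s1; rewrite !l1.
  have Z1 : Z 1 = y0.
    rewrite (@loop_lift l Z cl Ol) ?Z0//.
    - by move=> s s0; rewrite !l0.
    - by move=> s s1; rewrite !l1.
    - by rewrite l0 ?l1.
  have cphi (a b : R) : continuous (fun s : R => (a + b * clamp01 s) / 3).
    move=> s; apply: cvgM; last exact: cvg_cst.
    apply: cvgD; first exact: cvg_cst.
    by apply: cvgM; [exact: cvg_cst|exact: continuous_clamp01].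
  have Zc (a b : R) s : lift_at (fun s => L (a + b * clamp01 s)) (fun s => Z ((a + b * clamp01 s) / 3)) s.
    have -> : (fun s => L (a + b * clamp01 s)) = l \o (fun s => (a + b * clamp01 s) / 3).
      by apply/funext => x; rewrite /= /l; congr L; rewrite [RHS]mulrC divfK.
    by apply: lift_comp; [exact: cphi|exact: Zl].
  have e1 : Z (1 / 3) = Y p1 1.
    have h s : lift_at (c p1) (fun s => Z ((0 + 1 * clamp01 s) / 3)) s.
      have -> : c p1 = (fun s => L (0 + 1 * clamp01 s)); last exact: Zc.
      apply/funext => x; rewrite add0r mul1r L1; last by case/andP: (clamp01P x).
      have [t0|t0] := leP x 0; first by rewrite clamp01_le0// !a0.
      have [t1|t1] := leP 1 x; first by rewrite clamp01_ge1// !a1'.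
      by rewrite clamp01_id// !ltW.
    have := lift_unique ca h Yla (s := 0) 1.
    rewrite clamp01_le0// clamp01_ge1// mulr0 addr0 mul0r add0r mulr1; apply.
    by rewrite Z0 ?Ya0.
  have e2 : Z (2 / 3) = fun i => z i p.
    have h s : lift_at seg (fun s => Z ((1 + 1 * clamp01 s) / 3)) s.
      have -> : seg = (fun s => L (1 + 1 * clamp01 s)); last exact: Zc.
      apply/funext => x; have /andP[x0 x1] := clamp01P x.
      rewrite mul1r L2; last by lra.
      by rewrite addrAC subrr add0r /seg (clamp01_id (clamp01P x)).
    have h' s : lift_at seg (fun s i => z i (seg s)) s.
      exists a1, b1, a2, b2, z; split; [exact: tb|exact: segb|exact: sz|].
      by near=> s'.
    have := lift_unique cseg h h' (s := 0) 1.
    rewrite clamp01_le0// clamp01_ge1// mulr0 addr0 mulr1 (seg1 1 (lexx 1)) (seg0 0 (lexx 0)); apply.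
    by rewrite e1; apply/funext => i; rewrite zp1.
  have e3 : Z (2 / 3) = Y p 1.
    have h s : lift_at (c p) (fun s => Z ((3 + (-1) * clamp01 s) / 3)) s.
      have -> : c p = (fun s => L (3 + (-1) * clamp01 s)); last exact: Zc.
      apply/funext => x; have /andP[x0 x1] := clamp01P x.
      rewrite mulN1r L3; last by lra.
      rewrite opprD opprK addrA subrr add0r.
      have [t0|t0] := leP x 0; first by rewrite clamp01_le0// !b0.
      have [t1|t1] := leP 1 x; first by rewrite clamp01_ge1// !b1'.
      by rewrite clamp01_id// !ltW.
    have := lift_unique cb h Ylb (s := 0) 1.
    rewrite clamp01_le0// clamp01_ge1// mulr0 addr0 mulr1 divff//.
    have -> : 3 - 1 = 2 :> R by lra.
    by apply; rewrite Z1 Yb0.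
  by move=> i; rewrite /y -e3 e2.
exists y; last first.
  have [cc Oc c0 c1] := cP p0 Op0; have [Yl Y0] := YP p0 Op0.
  move=> i; rewrite /y (@loop_lift (c p0) (Y p0)) ?Y0//.
  - by move=> s s0; rewrite !c0.
  - by move=> s s1; rewrite !c1.
  - by rewrite c0 ?c1.
move=> p Op i; have [a1 [b1 [a2 [b2 [z [bp bO sz yz]]]]]] := key p Op.
have nb := obox_open bp.
have [z1 z2] := sz p bp i.
have -> : \sum_j O1 i j p * y j p = \sum_j O1 i j p * z j p.
  by apply: eq_bigr => j _; rewrite yz.
have -> : \sum_j O2 i j p * y j p = \sum_j O2 i j p * z j p.
  by apply: eq_bigr => j _; rewrite yz.
case: p Op bp nb z1 z2 {yz} (yz) => u v Op bp nb /= z1 z2 yz.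
split.
  have cp : {for u, continuous (fun s : R => (s, v) : plane R)}.
    by apply: continuous_pairing; [exact: cvg_id|exact: cst_continuous].
  have e : \forall s \near u, z i (s, v) = y i (s, v).
    have nbu : \forall s \near u, obox a1 b1 a2 b2 (s, v) by exact: (cp _ nb).
    by apply: filterS nbu => s bs; rewrite yz.
  exact: near_eq_is_derive e z1.
have cp : {for v, continuous (fun s : R => (u, s) : plane R)}.
  by apply: continuous_pairing; [exact: cst_continuous|exact: cvg_id].
have e : \forall s \near v, z i (u, s) = y i (u, s).
  have nbv : \forall s \near v, obox a1 b1 a2 b2 (u, s) by exact: (cp _ nb).
  by apply: filterS nbv => s bs; rewrite yz.
exact: near_eq_is_derive e z2.
Unshelve. all: by end_near. Qed.

End monodromy.

(** * Flat linear systems on simply connected sets *)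

(** Locally constant properties are constant. This is the form in which
    connectedness is used, and it follows both from topological connectedness
    and from path-connectedness. *)
Definition propagates (R : realType) (O : set (plane R)) : Prop :=
  forall P : plane R -> Prop,
    (forall p, O p -> \forall q \near p, P q <-> P p) ->
    forall p q, O p -> O q -> P p -> P q.

Lemma connected_propagates (R : realType) (O : set (plane R)) :
  open O -> connected O -> propagates O.
Proof.
move=> openO cO P lc p q Op Oq Pp.
have nearO x : O x -> \forall y \near x, O y by move=> Ox; apply: open_nbhs_nbhs; split.
have op : open [set x | O x /\ P x].
  rewrite openE => x [Ox Px]; rewrite /interior.
  by apply: filterS2 (nearO x Ox) (lc x Ox) => y Oy [_ h]; split=> //; exact: h.
have on : open [set x | O x /\ ~ P x].
  rewrite openE => x [Ox Px]; rewrite /interior.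
  by apply: filterS2 (nearO x Ox) (lc x Ox) => y Oy [h _]; split=> // /h.
have e : [set x | O x /\ P x] = O.
  apply: cO; first by exists p.
  - by exists [set x | O x /\ P x] => //; apply/seteqP; split=> x /= [] // ? [].
  - exists (~` [set x | O x /\ ~ P x]); first exact: open_closedC.
    apply/seteqP; split=> x /=; first by move=> [Ox Px]; split=> // -[].
    by move=> [Ox h]; split=> //; apply: contrapT => nP; apply: h.
have : [set x | O x /\ P x] q by rewrite e.
by case.
Qed.

Lemma path_connected_propagates (R : realType) (O : set (plane R)) :
  path_connected O -> propagates O.
Proof.
move=> pc P lc p q Op Oq Pp; have [c [cc Oc c0 c1]] := pc p q Op Oq.
have cc' : continuous (c \o @clamp01 R).
  apply: (within_continuous_comp cc); first exact: continuous_clamp01.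
  by move=> s; exact: clamp01P.
have e0 : (c \o @clamp01 R) 0 = p by rewrite /= clamp01_le0.
have e1 : (c \o @clamp01 R) 1 = q by rewrite /= clamp01_ge1.
rewrite -e1; apply: (@locally_constant R (fun s => P ((c \o @clamp01 R) s)) _ 0).
  move=> s; apply: (cc' s _ (lc _ _)); apply: Oc; exact: clamp01P.
by rewrite e0.
Qed.

Lemma propagates_sign (R : realType) (O : set (plane R)) (g : plane R -> R) p q :
  propagates O -> (forall x, O x -> {for x, continuous g}) ->
  (forall x, O x -> g x != 0) -> O p -> O q -> 0 < g p -> 0 < g q.
Proof.
move=> prop cg g0; apply: (prop (fun x => 0 < g x)) => x Ox.
have [gx|gx|/eqP] := ltgtP (g x) 0; last by rewrite (negPf (g0 x Ox)).
  have n : \forall y \near x, g y < 0 by exact: (cvgr_lt (g x) (cg x Ox) 0 gx).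
  by apply: filterS n => y gy; rewrite ltNge (ltW gy).
have n : \forall y \near x, 0 < g y by exact: (cvgr_gt (g x) (cg x Ox) 0 gx).
by apply: filterS n => y ->.
Qed.

Section linear_systems.
Variables (R : realType) (I : finType) (O1 O2 : I -> I -> plane R -> R).
Variable O : set (plane R).
Hypothesis openO : open O.
Hypothesis smooth1 : forall i j, smooth O (O1 i j).
Hypothesis smooth2 : forall i j, smooth O (O2 i j).

Let tame_at p : O p -> exists a1 b1 a2 b2,
  [/\ obox a1 b1 a2 b2 p, obox a1 b1 a2 b2 `<=` O & tame O1 O2 a1 b1 a2 b2].
Proof.
move=> Op; apply: tame_nbhs => // i j.
  exact: smooth_continuous (smooth1 i j) Op.
exact: smooth_continuous (smooth2 i j) Op.
Qed.

Lemma solution_unique (y z : I -> plane R -> R) p q : propagates O ->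
  solution_on O1 O2 O y -> solution_on O1 O2 O z -> O p -> O q ->
  (forall i, y i p = z i p) -> forall i, y i q = z i q.
Proof.
move=> prop hy hz; apply: (prop (fun x => forall i, y i x = z i x)) => x Ox.
have [a1 [b1 [a2 [b2 [bx sub tb]]]]] := tame_at Ox.
have sy : solution_on O1 O2 (obox a1 b1 a2 b2) y by move=> w /sub; exact: hy.
have sz : solution_on O1 O2 (obox a1 b1 a2 b2) z by move=> w /sub; exact: hz.
by apply: filterS (obox_open bx) => w bw; split; apply: (tame_unique tb sy sz).
Qed.

(** Being a solution only constrains the function along coordinate lines;
    joint continuity comes from the bounds on a small box. *)
Lemma solution_continuous (y : I -> plane R -> R) i p :
  solution_on O1 O2 O y -> O p -> {for p, continuous (y i)}.
Proof.
move=> hy Op; have [a1 [b1 [a2 [b2 [bp sub [M [M0 MO s1 s2]]]]]]] := tame_at Op.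
case: p Op bp => u v Op [/= uI vI].
pose N := 4 * \sum_j `|y j (u, v)|.
have bnd (A : I -> I -> plane R -> R) q j :
    (forall j k, `|A j k q| <= M) ->
    `|\sum_k A j k q * y k q| <= M * (\sum_k `|y k q|) + 0.
  move=> AM; rewrite addr0; apply: le_trans (ler_norm_sum _ _ _) _.
  by rewrite mulr_sumr; apply: ler_sum => k _; rewrite normrM ler_wpM2r.
have D1 (s t : R) j : a1 < s < b1 -> a2 < t < b2 ->
    is_derive s 1 (fun s => y j (s, t)) (\sum_k O1 j k (s, t) * y k (s, t)).
  by move=> sI tI; have Ost : O (s, t) := sub (s, t) (conj sI tI); exact: (hy (s, t) Ost j).1.
have D2 (s t : R) j : a1 < s < b1 -> a2 < t < b2 ->
    is_derive t 1 (fun t => y j (s, t)) (\sum_k O2 j k (s, t) * y k (s, t)).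
  by move=> sI tI; have Ost : O (s, t) := sub (s, t) (conj sI tI); exact: (hy (s, t) Ost j).2.
have yb1 s : a1 < s < b1 -> \sum_j `|y j (s, v)| <= 2 * \sum_j `|y j (u, v)|.
  move=> sI; have := @small_interval_estimate R I (fun j s => y j (s, v))
    (fun j s => \sum_k O1 j k (s, v) * y k (s, v)) a1 b1 M 0 u s _ _ M0 s1 uI sI.
  rewrite mulr0 addr0; apply=> t tI j; first exact: D1.
  by apply: bnd => j' k; exact: (MO (t, v) j' k (conj tI vI)).1.
have yb s t : a1 < s < b1 -> a2 < t < b2 -> \sum_j `|y j (s, t)| <= N.
  move=> sI tI; have := @small_interval_estimate R I (fun j t => y j (s, t))
    (fun j t => \sum_k O2 j k (s, t) * y k (s, t)) a2 b2 M 0 v t _ _ M0 s2 vI tI.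
  rewrite mulr0 addr0 => h; apply: le_trans (h _ _) _.
  - by move=> t' t'I j; exact: D2.
  - by move=> t' t'I j; apply: bnd => j' k; exact: (MO (s, t') j' k (conj sI t'I)).2.
  - by have := yb1 s sI; rewrite /N; lra.
have dist s t : a1 < s < b1 -> a2 < t < b2 ->
    `|y i (s, t) - y i (u, v)| <= M * N * (`|s - u| + `|t - v|).
  move=> sI tI.
  have bt (a b x x' z : R) : a < x < b -> a < x' < b ->
      Num.min x x' <= z <= Num.max x x' -> a < z < b.
    move=> /andP[h1 h2] /andP[h3 h4] /andP[h5 h6]; apply/andP; split.
      by apply: lt_le_trans h5; rewrite lt_min h1.
    by apply: le_lt_trans h6 _; rewrite gt_max h2.
  have bN A q : (forall j k, `|A j k q| <= M) -> \sum_k `|y k q| <= N ->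
      `|\sum_k A i k q * y k q| <= M * N.
    move=> AM yN; apply: le_trans (bnd A q i AM) _.
    by rewrite addr0 ler_wpM2l.
  have [x /(bt _ _ _ _ _ uI sI) xI|x /(bt _ _ _ _ _ uI sI) xI e1] :=
    @mean_value R (fun s => y i (s, v)) (fun s => \sum_k O1 i k (s, v) * y k (s, v)) u s _.
    exact: D1.
  have [x' /(bt _ _ _ _ _ vI tI) x'I|x' /(bt _ _ _ _ _ vI tI) x'I e2] :=
    @mean_value R (fun t => y i (s, t)) (fun t => \sum_k O2 i k (s, t) * y k (s, t)) v t _.
    exact: D2.
  have -> : y i (s, t) - y i (u, v) =
    (y i (s, v) - y i (u, v)) + (y i (s, t) - y i (s, v)) by ring.
  apply: le_trans (ler_normD _ _) _; rewrite e1 e2 [leRHS]mulrDr !normrM.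
  apply: lerD; apply: ler_wpM2r => //; apply: bN.
  - by move=> j k; exact: (MO (x, v) j k (conj xI vI)).1.
  - exact: yb.
  - by move=> j k; exact: (MO (s, x') j k (conj sI x'I)).2.
  - exact: yb.
apply/cvgrPdist_le => e e0.
have N0 : 0 <= N by rewrite mulr_ge0// sumr_ge0.
pose d := e / (2 * (M * N + 1)).
have MN0 : 0 < 2 * (M * N + 1) by rewrite mulr_gt0// ltr_wpDl// mulr_ge0.
have d0 : 0 < d by rewrite divr_gt0.
have nb : \forall q \near ((u, v) : plane R), obox a1 b1 a2 b2 q by apply: obox_open.
have nd : \forall q \near ((u, v) : plane R), ball (u, v) d q by exact: nbhsx_ballx.
apply: filterS2 nb nd => -[s t] [/= sI tI] /ball_plane[/= sd td].
rewrite distrC; apply: le_trans (dist s t sI tI) _.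
have -> : e = (M * N + 1) * (d + d).
  have MN1 := lt0r_neq0 MN0; rewrite /d; move: (M * N + 1) MN1 => K.
  by rewrite mulf_eq0 negb_or => /andP[_ K0]; field.
apply: ler_pM.
- by rewrite mulr_ge0.
- by rewrite addr_ge0.
- by rewrite lerDl.
- by apply: lerD; rewrite distrC ltW.
Qed.

Lemma solution_derive (y : I -> plane R -> R) i p : solution_on O1 O2 O y -> O p ->
  du (y i) p = \sum_j O1 i j p * y j p /\ dv (y i) p = \sum_j O2 i j p * y j p.
Proof.
move=> hy Op; have [h1 h2] := hy p Op i.
by split; apply: derive_val; [apply: (is_derive_u _ _ _).2|apply: (is_derive_v _ _ _).2].
Qed.

Lemma solution_differentiable (y : I -> plane R -> R) i p :
  solution_on O1 O2 O y -> O p -> differentiable (y i) p.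
Proof.
move=> hy Op.
apply: (@continuous_partials_differentiable R (y i) (fun q => \sum_j O1 i j q * y j q)
  (fun q => \sum_j O2 i j q * y j q)).
- have nO : \forall q \near p, O q by apply: open_nbhs_nbhs.
  by apply: filterS nO => q Oq; exact: hy.
- apply: (@cvg_sumr R I _ (fun j q => O1 i j q * y j q)) => j; apply: cvgM.
    exact: smooth_continuous (smooth1 i j) Op.
  exact: solution_continuous hy Op.
- apply: (@cvg_sumr R I _ (fun j q => O2 i j q * y j q)) => j; apply: cvgM.
    exact: smooth_continuous (smooth2 i j) Op.
  exact: solution_continuous hy Op.
Qed.

Lemma Ck_sum (f : I -> plane R -> R) k :
  (forall i, Ck k O (f i)) -> Ck k O (fun p => \sum_i f i p).
Proof.
move=> sf; elim: (index_enum I) => [|i r IH].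
  by under eq_fun do rewrite big_nil; exact: Ck_cst.
by under eq_fun do rewrite big_cons; exact: CkD.
Qed.

Lemma solution_smooth (y : I -> plane R -> R) i : solution_on O1 O2 O y -> smooth O (y i).
Proof.
move=> hy k; elim: k i => [|k IH] i.
  by move=> p Op; exact: solution_continuous hy Op.
split; first by move=> p Op; exact: solution_differentiable hy Op.
move=> w.
have C1 : Ck k O (fun q => \sum_j O1 i j q * y j q).
  by apply: Ck_sum => j; apply: CkM; [exact: openO|exact: smooth1|exact: IH].
have C2 : Ck k O (fun q => \sum_j O2 i j q * y j q).
  by apply: Ck_sum => j; apply: CkM; [exact: openO|exact: smooth2|exact: IH].
apply: (Ck_ext openO _ (CkD openO (CkM openO (Ck_cst openO w.1 k) C1)
  (CkM openO (Ck_cst openO w.2 k) C2))) => p Op.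
rewrite derive_plane; last exact: solution_differentiable hy Op.
by have [-> ->] := solution_derive i hy Op.
Qed.

Lemma smooth_solution (y : I -> plane R -> R) : (forall i, smooth O (y i)) ->
  (forall i p, O p -> du (y i) p = \sum_j O1 i j p * y j p /\
                      dv (y i) p = \sum_j O2 i j p * y j p) ->
  solution_on O1 O2 O y.
Proof.
move=> sy dy p Op i; have [<- <-] := dy i p Op.
split; [apply: (is_derive_u _ _ _).1|apply: (is_derive_v _ _ _).1].
  exact: smooth_is_derive (sy i) Op.
exact: smooth_is_derive (sy i) Op.
Qed.

(** The Frobenius theorem for linear systems. *)
Lemma flat_system_solution (p0 : plane R) (y0 : I -> R) :
  simply_connected O ->
  (forall i j p, O p ->
    dv (O1 i j) p + \sum_k O1 i k p * O2 k j p = du (O2 i j) p + \sum_k O2 i k p * O1 k j p) ->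
  O p0 ->
  exists y : I -> plane R -> R, [/\ forall i, smooth O (y i),
    forall i p, O p -> du (y i) p = \sum_j O1 i j p * y j p /\
                       dv (y i) p = \sum_j O2 i j p * y j p &
    forall i, y i p0 = y0 i].
Proof.
move=> sc flat Op0.
have [y hy y0E] := global_solution (tame_box openO smooth1 smooth2 flat) sc y0 Op0.
exists y; split=> //; first by move=> i; exact: solution_smooth.
by move=> i p Op; exact: solution_derive hy Op.
Qed.

End linear_systems.

(** * Calculus of vector-valued maps *)

Section row_calculus.
Variables (R : realType) (O : set (plane R)).
Hypothesis openO : open O.
Variable n : nat.
Implicit Types (V : plane R -> 'rV[R]_n).

Lemma differentiable_coordinate V p j :
  differentiable V p -> differentiable (fun q => V q ord0 j) p.
Proof.
move=> dV; apply: (@differentiable_comp _ _ _ _ V (fun x : 'rV[R]_n => x ord0 j)) => //.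
exact: differentiable_coord.
Qed.

Lemma differentiable_row V p :
  (forall j, differentiable (fun q => V q ord0 j) p) -> differentiable V p.
Proof.
move=> dV; have -> : V = \sum_j (fun q => V q ord0 j *: (delta_mx ord0 j : 'rV[R]_n)).
  by apply/funext => q; rewrite fct_sumE; exact: row_sum_delta.
by apply: differentiable_sum => j; exact: differentiableZl.
Qed.

Lemma derive_coordinate V p v j : differentiable V p ->
  ('D_v V p) ord0 j = 'D_v (fun q => V q ord0 j) p.
Proof. by move=> dV; rewrite derive_mx ?mxE//; exact: diff_derivable. Qed.

Lemma Ck_rowP V k : Ck k O V <-> forall j, Ck k O (fun p => V p ord0 j).
Proof.
elim: k V => [|k IH] V; split.
- move=> cV j p Op; apply: (@continuous_comp _ _ _ V (fun x : 'rV[R]_n => x ord0 j)).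
    exact: cV.
  exact: coord_continuous.
- move=> cV p Op; have -> : V = fun q => \sum_j V q ord0 j *: (delta_mx ord0 j : 'rV[R]_n).
    by apply/funext => q; exact: row_sum_delta.
  apply: cvg_big => [|j _]; last by apply: cvgZr_tmp; exact: cV.
  by move=> y; apply: cvgD; [exact: cvg_fst|exact: cvg_snd].
- move=> [dV DV] j; split=> [p Op|v]; first by apply: differentiable_coordinate; exact: dV.
  apply: (Ck_ext openO _ ((IH _).1 (DV v) j)) => p Op.
  by rewrite derive_coordinate//; exact: dV.
- move=> cV; have dV p : O p -> differentiable V p.
    by move=> Op; apply: differentiable_row => j; case: (cV j) => + _; apply.
  split=> // v; apply/IH => j; have [_ /(_ v) Dj] := cV j.
  apply: (Ck_ext openO _ Dj) => p Op.
  by rewrite derive_coordinate//; exact: dV.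
Qed.

Lemma smooth_rowP V : smooth O V <-> forall j, smooth O (fun p => V p ord0 j).
Proof.
split=> [sV j k|sV k]; first exact: ((Ck_rowP _ _).1 (sV k)).
by apply/Ck_rowP => j; exact: sV.
Qed.

Lemma smooth_row_differentiable V p : smooth O V -> O p -> differentiable V p.
Proof. by move=> sV Op; have [+ _] := sV 1%N; apply. Qed.

Lemma smooth_row_derive V v : smooth O V -> smooth O ('D_v V).
Proof. by move=> sV k; have [_] := sV k.+1; apply. Qed.

Lemma smooth_rowZ (a : plane R -> R) V :
  smooth O a -> smooth O V -> smooth O (fun p => a p *: V p).
Proof.
move=> sa /smooth_rowP sV; apply/smooth_rowP => j.
by apply: (smooth_ext openO _ (smoothM openO sa (sV j))) => p Op; rewrite mxE.
Qed.

Lemma derive_rowD V W p v : differentiable V p -> differentiable W p ->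
  'D_v (fun q => V q + W q) p = 'D_v V p + 'D_v W p.
Proof. by move=> dV dW; rewrite deriveD//; exact: diff_derivable. Qed.

Lemma derive_rowZ (a : plane R -> R) V p v : differentiable a p -> differentiable V p ->
  'D_v (fun q => a q *: V q) p = 'D_v a p *: V p + a p *: 'D_v V p.
Proof.
move=> da dV; apply/rowP => j.
have daV : differentiable (fun q => a q *: V q) p.
  apply: differentiable_row => k.
  have -> : (fun q => (a q *: V q) ord0 k) = (fun q => a q * V q ord0 k).
    by apply/funext => q; rewrite mxE.
  by apply: differentiableM => //; exact: differentiable_coordinate.
rewrite derive_coordinate// !mxE derive_coordinate//.
have -> : (fun q => (a q *: V q) ord0 j) = (fun q => a q * V q ord0 j).
  by apply/funext => q; rewrite mxE.
apply: derive_val; apply: is_derive_mulr; apply: is_derive_diff => //.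
exact: differentiable_coordinate.
Qed.

Lemma row_du_dvC V p : smooth O V -> O p -> du (dv V) p = dv (du V) p.
Proof.
move=> sV Op; apply/rowP => j; have sj := (smooth_rowP V).1 sV j.
have e v w : ('D_v ('D_w V) p) ord0 j = 'D_v ('D_w (fun q => V q ord0 j)) p.
  rewrite derive_coordinate; last first.
    exact: smooth_row_differentiable (smooth_row_derive w sV) Op.
  apply: near_eq_derive.
  have nO : \forall q \near p, O q by apply: open_nbhs_nbhs.
  apply: filterS nO => q Oq; apply: derive_coordinate.
  exact: smooth_row_differentiable sV Oq.
exact: (etrans (e (1, 0) (0, 1)) (etrans (du_dvC openO sj Op) (esym (e (0, 1) (1, 0))))).
Qed.

End row_calculus.

Section inner_product.
Variables (R : realType) (L0 : R).
Notation d := (ambient_dim L0).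
Implicit Types (x y z : 'rV[R]_d) (a b : R).

Lemma innerC x y : inner x y = inner y x.
Proof. by apply: eq_bigr => i _; rewrite mulrAC. Qed.

Lemma innerDl x y z : inner (x + y) z = inner x z + inner y z.
Proof. by rewrite -big_split; apply: eq_bigr => i _; rewrite mxE mulrDr mulrDl. Qed.

Lemma innerZl a x y : inner (a *: x) y = a * inner x y.
Proof.
by rewrite /inner mulr_sumr; apply: eq_bigr => i _; rewrite mxE mulrCA !mulrA.
Qed.

Lemma innerNl x y : inner (- x) y = - inner x y.
Proof. by rewrite -scaleN1r innerZl mulN1r. Qed.

Lemma innerBl x y z : inner (x - y) z = inner x z - inner y z.
Proof. by rewrite innerDl innerNl. Qed.

Lemma inner0l y : inner 0 y = 0.
Proof. by rewrite -(scale0r 0) innerZl mul0r. Qed.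

Lemma innerDr x y z : inner x (y + z) = inner x y + inner x z.
Proof. by rewrite innerC innerDl !(innerC x). Qed.

Lemma innerZr a x y : inner x (a *: y) = a * inner x y.
Proof. by rewrite innerC innerZl innerC. Qed.

Lemma innerNr x y : inner x (- y) = - inner x y.
Proof. by rewrite innerC innerNl innerC. Qed.

Lemma innerBr x y z : inner x (y - z) = inner x y - inner x z.
Proof. by rewrite innerDr innerNr. Qed.

Definition innerE := (innerDl, innerDr, innerBl, innerBr, innerNl, innerNr, innerZl, innerZr).

Variable O : set (plane R).
Hypothesis openO : open O.
Implicit Types V W : plane R -> 'rV[R]_d.

Lemma smooth_inner V W : smooth O V -> smooth O W ->
  smooth O (fun p => inner (V p) (W p)).
Proof.
move=> /(smooth_rowP openO) sV /(smooth_rowP openO) sW; apply: smooth_sum => // i.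
apply: (smoothM openO) (sW i) => //.
by apply: (smoothM openO) (sV i) => //; exact: smooth_cst.
Qed.

Lemma derive_inner V W p v : differentiable V p -> differentiable W p ->
  'D_v (fun q => inner (V q) (W q)) p =
  inner ('D_v V p) (W p) + inner (V p) ('D_v W p).
Proof.
move=> dV dW; rewrite /inner -big_split/=; apply: derive_val.
apply: (is_derive_sumr (f := fun (i : 'I_d) (q : plane R) =>
  (-1) ^+ (i < ambient_index L0)%N * V q ord0 i * W q ord0 i)) => i.
have hV := is_derive_diff v (differentiable_coordinate i dV).
have hW := is_derive_diff v (differentiable_coordinate i dW).
have := is_derive_mulr (is_derive_mulr (is_derive_cst ((-1) ^+ (i < ambient_index L0)%N : R) p v) hV) hW.
by rewrite mul0r add0r !derive_coordinate.
Qed.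

End inner_product.

(** * Gauss and Weingarten formulas *)

Lemma derive_ext (R : realType) (O : set (plane R)) (W : normedModType R)
    (f g : plane R -> W) p v : open O ->
  (forall q, O q -> f q = g q) -> O p -> 'D_v f p = 'D_v g p.
Proof.
move=> openO fg Op; apply: near_eq_derive.
have nO : \forall q \near p, O q by apply: open_nbhs_nbhs.
by apply: filterS nO => q Oq; exact: fg.
Qed.

Lemma ord2P (P : 'I_2 -> Prop) : P ord0 -> P ord_max -> forall i, P i.
Proof.
move=> P0 P1 [[|[|//]] h].
  by have -> : Ordinal h = ord0 by apply: val_inj.
by have -> : Ordinal h = ord_max by apply: val_inj.
Qed.

Lemma sum2E (R : nmodType) (F : 'I_2 -> R) : \sum_(i < 2) F i = F ord0 + F ord_max.
Proof.
rewrite big_ord_recl big_ord1; congr (_ + F _).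
exact: val_inj.
Qed.

Definition lorentz_mx (R : realType) (a : R) : 'M[R]_2 :=
  \matrix_(i, j) (if i == j then (if i == ord0 then a else - a) else 0).

Lemma invmx_lorentz (R : realType) (a : R) : a != 0 ->
  invmx (lorentz_mx a) = lorentz_mx a^-1.
Proof.
move=> a0; have h : lorentz_mx a *m lorentz_mx a^-1 = 1%:M.
  apply/matrixP => i j; rewrite !mxE sum2E !mxE.
  by move: i j; apply: ord2P; apply: ord2P;
    rewrite ?eqxx/= ?mulr0 ?mul0r ?addr0 ?add0r ?mulrNN ?divff.
have [ua _] := mulmx1_unit h.
by rewrite -[RHS]mul1mx -(mulVmx ua) -mulmxA h mulmx1.
Qed.

Lemma det_lorentz (R : realType) (a : R) : \det (lorentz_mx a) = - (a * a).
Proof. rewrite (expand_det_row _ ord0) sum2E /cofactor !det_mx11 !mxE/= mul0r addr0.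
by rewrite expr0 mul1r mulrN. Qed.

Lemma subrBA (V : zmodType) (x y z : V) : x - (y - z) = x - y + z.
Proof. by rewrite opprB addrCA addrC. Qed.

Lemma lorentz_projection (R : realType) (L0 : R) (T : 'I_2 -> 'rV[R]_(ambient_dim L0)) x (a : R) :
  \sum_(i < 2) \sum_(j < 2) (lorentz_mx a^-1 i j * inner x (T i)) *: T j =
  (inner x (T ord0) / a) *: T ord0 - (inner x (T ord_max) / a) *: T ord_max.
Proof.
rewrite !sum2E !mxE /= !mul0r !scale0r addr0 add0r mulNr scaleNr.
by rewrite ![_ * inner _ _]mulrC.
Qed.

Section frame_algebra.
Variables (R : realType) (L0 : R).
Local Notation vec := 'rV[R]_(ambient_dim L0).

Lemma gauss_formula_algebra (T1 T2 uu uv vu vv f : vec) (lu lv E : R) :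
  uv = vu -> inner T1 T1 = E -> inner T2 T2 = - E -> inner T1 T2 = 0 ->
  inner uu T1 + inner T1 uu = 2 * lu * E ->
  inner vu T1 + inner T1 vu = 2 * lv * E ->
  inner uv T2 + inner T2 uv = - (2 * lu * E) ->
  inner vv T2 + inner T2 vv = - (2 * lv * E) ->
  inner uu T2 + inner T1 uv = 0 -> inner vu T2 + inner T1 vv = 0 ->
  L0 * inner uu f = - (L0 * inner T1 T1) -> L0 * inner vu f = - (L0 * inner T1 T2) ->
  L0 * inner vv f = - (L0 * inner T2 T2) ->
  [/\ [/\ inner uu T1 = lu * E, inner uu T2 = - (lv * E) & L0 * inner uu f = - (L0 * E)],
      [/\ inner vu T1 = lv * E, inner vu T2 = - (lu * E) & L0 * inner vu f = 0] &
      [/\ inner vv T1 = lu * E, inner vv T2 = - (lv * E) & L0 * inner vv f = L0 * E]].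
Proof.
move=> -> TT1 TT2 TT3; rewrite !(innerC T1) !(innerC T2) => a1 a2 a3 a4 a5 a6 b1 b2 b3.
have e1 : inner uu T1 = lu * E by lra.
have e2 : inner vu T1 = lv * E by lra.
have e3 : inner vu T2 = - (lu * E) by lra.
have e4 : inner vv T2 = - (lv * E) by lra.
split; split=> //; try lra.
- by rewrite b1 TT1.
- by rewrite b2 TT3 mulr0 oppr0.
- by rewrite b3 TT2 mulrN opprK.
Qed.

(** Here S is the normal component of x. *)
Lemma solve_frame (x S T1 T2 f : vec) (E a b c : R) : E != 0 ->
  S = x - (inner x T1 / E) *: T1 + (inner x T2 / E) *: T2 - (L0 * inner x f) *: f ->
  inner x T1 = a * E -> inner x T2 = - (b * E) -> L0 * inner x f = c ->
  x = a *: T1 + b *: T2 + S + c *: f.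
Proof.
move=> E0 -> -> -> ->; rewrite mulNr !mulfK//.
by apply/rowP => j; rewrite !mxE; ring.
Qed.

Lemma solve_frame0 (x S T1 T2 f : vec) (E a b : R) : E != 0 ->
  S = x - (inner x T1 / E) *: T1 + (inner x T2 / E) *: T2 - (L0 * inner x f) *: f ->
  inner x T1 = a * E -> inner x T2 = - (b * E) -> L0 * inner x f = 0 ->
  x = a *: T1 + b *: T2 + S.
Proof.
by move=> E0 e1 e2 e3 e4; rewrite (solve_frame E0 e1 e2 e3 e4) scale0r addr0.
Qed.

Lemma inner_normal_frame (N x T1 T2 n1 n2 f : vec) (a b al be c : R) :
  inner N T1 = 0 -> inner N T2 = 0 -> L0 * inner f N = 0 ->
  x = a *: T1 + b *: T2 + (al *: n1 + be *: n2) + (L0 * c) *: f ->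
  inner N x = al * inner N n1 + be * inner N n2.
Proof.
move=> h1 h2 h3 ->; rewrite !innerDr !innerZr h1 h2 !mulr0 !add0r (innerC N f).
by rewrite mulrAC h3 mul0r addr0.
Qed.

End frame_algebra.

Section conformal.
Variables (R : realType) (L0 : R) (O : set (plane R)).
Hypothesis openO : open O.
Variables (F : plane R -> 'rV[R]_(ambient_dim L0)) (lam : plane R -> R).
Hypothesis conf : conformal_immersion O F lam.

Let sF : smooth O F. Proof. by have [] := conf. Qed.
Let slam : smooth O lam. Proof. by have [] := conf. Qed.
Let sdu : smooth O (du F). Proof. exact: smooth_row_derive sF. Qed.
Let sdv : smooth O (dv F). Proof. exact: smooth_row_derive sF. Qed.
Let diffF (V : plane R -> 'rV[R]_(ambient_dim L0)) p : smooth O V -> O p -> differentiable V p .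
Proof. exact: smooth_row_differentiable. Qed.

Lemma derive_inner_cst (V W : plane R -> 'rV[R]_(ambient_dim L0)) (c : plane R -> R) p v :
  smooth O V -> smooth O W -> (forall q, O q -> inner (V q) (W q) = c q) -> O p ->
  inner ('D_v V p) (W p) + inner (V p) ('D_v W p) = 'D_v c p.
Proof.
move=> sV sW VW Op; rewrite -(derive_inner v (diffF sV Op) (diffF sW Op)).
exact: derive_ext openO VW Op.
Qed.

Lemma position_norm p : L0 != 0 -> O p -> inner (F p) (F p) = L0^-1.
Proof.
move=> L0n Op; have [_ /(_ p Op) + _ _] := conf.
by rewrite /spaceform (negPf L0n).
Qed.

(** Multiplying by L0 twice makes the relation <F, F> = 1 / L0 hold in the flat
    case as well. *)
Lemma spaceform_norm p : O p -> L0 * (L0 * inner (F p) (F p)) = L0.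
Proof.
move=> Op; have [L00|L0n] := eqVneq L0 0.
  by rewrite [X in X * _]L00 mul0r.
by rewrite position_norm// divff ?mulr1.
Qed.

Lemma position_tangent p v : O p -> L0 * inner (F p) ('D_v F p) = 0.
Proof.
move=> Op; have [L00|L0n] := eqVneq L0 0.
  by rewrite [X in X * _]L00 mul0r.
have FF q : O q -> inner (F q) (F q) = L0^-1 by exact: position_norm.
have := derive_inner_cst v sF sF FF Op.
have -> : 'D_v (fun=> L0^-1) p = 0 by exact: (derive_cst (L0^-1)).
rewrite (innerC ('D_v F p)) => h.
suff -> : inner (F p) ('D_v F p) = 0 by rewrite mulr0.
by move: (inner _ _) h => x; lra.
Qed.

Lemma metricE p : O p -> metric F p = lorentz_mx (expR (2 * lam p)).
Proof.
move=> Op; have [_ _ _ /(_ p Op)[h1 h2 h3]] := conf.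
have e k : dcoord k F p = if k == ord0 then du F p else dv F p.
  by rewrite /dcoord; case: ifP.
apply/matrixP => i j; rewrite !mxE !e.
move: (du F p) (dv F p) (expR _) h1 h2 h3 => T1 T2 a h1 h2 h3 {e}.
by move: i j; apply: ord2P; apply: ord2P; rewrite //= innerC.
Qed.

Lemma normal_partE p x : O p -> normal_part F p x =
  x - (inner x (du F p) / expR (2 * lam p)) *: du F p
    + (inner x (dv F p) / expR (2 * lam p)) *: dv F p.
Proof.
move=> Op; rewrite /normal_part metricE// invmx_lorentz ?gt_eqF ?expR_gt0//.
have h := lorentz_projection (fun i => dcoord i F p) x (expR (2 * lam p)).
by rewrite -subrBA; congr (x - _); exact: h.
Qed.

Lemma nabla_perpE i V p : O p -> nabla_perp F i V p =
  dcoord i V p - (inner (dcoord i V p) (du F p) / expR (2 * lam p)) *: du F p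
    + (inner (dcoord i V p) (dv F p) / expR (2 * lam p)) *: dv F p
    - (L0 * inner (dcoord i V p) (F p)) *: F p.
Proof.
move=> Op; rewrite /nabla_perp normal_partE// /nabla.
have h1 : L0 * inner (F p) (du F p) = 0 by exact: position_tangent.
have h2 : L0 * inner (F p) (dv F p) = 0 by exact: position_tangent.
have e (c : R) T : L0 * inner (F p) T = 0 -> L0 * c * inner (F p) T = 0.
  by move=> h; rewrite mulrAC h mul0r.
move: (dcoord i V p) (du F p) (dv F p) h1 h2 => x T1 T2 h1 h2.
rewrite !innerBl !innerZl (e _ _ h1) (e _ _ h2) !subr0.
by rewrite -!addrA; congr (_ + _); rewrite addrCA; congr (_ + _); rewrite addrC.
Qed.

Lemma derive_exp2 (p v : plane R) : O p ->
  'D_v (fun q => expR (2 * lam q)) p = 2 * 'D_v lam p * expR (2 * lam p).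
Proof. exact: smooth_derive_exp2. Qed.

Let conf_inner p : O p -> [/\ inner (du F p) (du F p) = expR (2 * lam p),
  inner (dv F p) (dv F p) = - expR (2 * lam p) & inner (du F p) (dv F p) = 0].
Proof. by move=> Op; have [_ _ _ /(_ p Op)] := conf. Qed.

Let derive_cst0 (c : R) (p v : plane R) : 'D_v (fun=> c : R) p = 0 :> R.
Proof. exact: (derive_cst c). Qed.

Lemma derive_scaled_inner0 (V W : plane R -> 'rV[R]_(ambient_dim L0)) p v :
  smooth O V -> smooth O W -> (forall q, O q -> L0 * inner (V q) (W q) = 0) -> O p ->
  L0 * inner ('D_v V p) (W p) = - (L0 * inner (V p) ('D_v W p)).
Proof.
move=> sV sW VW Op; have [L00|L0n] := eqVneq L0 0.
  by rewrite [X in X * _]L00 [in RHS](_ : _ * _ = 0) ?mul0r ?oppr0// [X in X * _]L00 mul0r.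
have VW0 q : O q -> inner (V q) (W q) = 0.
  by move=> Oq; apply: (mulfI L0n); rewrite VW// mulr0.
have := derive_inner_cst v sV sW VW0 Op; rewrite derive_cst0 => h.
by rewrite -mulrN; congr (_ * _); apply/eqP; rewrite -addr_eq0; apply/eqP.
Qed.

Lemma inner_derive_normal N V p v : normal_field O F N -> smooth O V -> O p ->
  (forall q, O q -> inner (N q) (V q) = 0) ->
  inner ('D_v N p) (V p) = - inner (N p) ('D_v V p).
Proof.
move=> [sN _] sV Op NV; have := derive_inner_cst v sN sV NV Op.
by rewrite derive_cst0 => h; apply/eqP; rewrite -addr_eq0; apply/eqP.
Qed.

Lemma du_inner_cst (V W : plane R -> 'rV[R]_(ambient_dim L0)) (c : plane R -> R) p :
  smooth O V -> smooth O W -> (forall q, O q -> inner (V q) (W q) = c q) -> O p ->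
  inner (du V p) (W p) + inner (V p) (du W p) = du c p.
Proof. exact: derive_inner_cst. Qed.

Lemma du_cst (c : R) (p : plane R) : du (fun=> c) p = 0.
Proof. exact: derive_cst0. Qed.

Lemma du_exp2 p : O p ->
  du (fun q => expR (2 * lam q)) p = 2 * du lam p * expR (2 * lam p).
Proof. exact: derive_exp2. Qed.

Lemma duN f p : smooth O f -> O p -> du (fun q => - f q) p = - du f p :> R.
Proof.
by move=> sf Op; apply: derive_val; apply: is_deriveN; exact: smooth_is_derive sf Op.
Qed.

Lemma du_scaled_inner0 (V W : plane R -> 'rV[R]_(ambient_dim L0)) p :
  smooth O V -> smooth O W -> (forall q, O q -> L0 * inner (V q) (W q) = 0) -> O p ->
  L0 * inner (du V p) (W p) = - (L0 * inner (V p) (du W p)).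
Proof. exact: derive_scaled_inner0. Qed.

Lemma du_inner_normal N V p : normal_field O F N -> smooth O V -> O p ->
  (forall q, O q -> inner (N q) (V q) = 0) ->
  inner (du N p) (V p) = - inner (N p) (du V p).
Proof. exact: inner_derive_normal. Qed.

Lemma du_position_tangent p : O p -> L0 * inner (F p) (du F p) = 0.
Proof. exact: position_tangent. Qed.

Lemma dv_inner_cst (V W : plane R -> 'rV[R]_(ambient_dim L0)) (c : plane R -> R) p :
  smooth O V -> smooth O W -> (forall q, O q -> inner (V q) (W q) = c q) -> O p ->
  inner (dv V p) (W p) + inner (V p) (dv W p) = dv c p.
Proof. exact: derive_inner_cst. Qed.

Lemma dv_cst (c : R) (p : plane R) : dv (fun=> c) p = 0.
Proof. exact: derive_cst0. Qed.

Lemma dv_exp2 p : O p ->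
  dv (fun q => expR (2 * lam q)) p = 2 * dv lam p * expR (2 * lam p).
Proof. exact: derive_exp2. Qed.

Lemma dvN f p : smooth O f -> O p -> dv (fun q => - f q) p = - dv f p :> R.
Proof.
by move=> sf Op; apply: derive_val; apply: is_deriveN; exact: smooth_is_derive sf Op.
Qed.

Lemma dv_scaled_inner0 (V W : plane R -> 'rV[R]_(ambient_dim L0)) p :
  smooth O V -> smooth O W -> (forall q, O q -> L0 * inner (V q) (W q) = 0) -> O p ->
  L0 * inner (dv V p) (W p) = - (L0 * inner (V p) (dv W p)).
Proof. exact: derive_scaled_inner0. Qed.

Lemma dv_inner_normal N V p : normal_field O F N -> smooth O V -> O p ->
  (forall q, O q -> inner (N q) (V q) = 0) ->
  inner (dv N p) (V p) = - inner (N p) (dv V p).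
Proof. exact: inner_derive_normal. Qed.

Lemma dv_position_tangent p : O p -> L0 * inner (F p) (dv F p) = 0.
Proof. exact: position_tangent. Qed.

Lemma nabla_perp_uE V p : O p -> nabla_perp F ord0 V p =
  du V p - (inner (du V p) (du F p) / expR (2 * lam p)) *: du F p
    + (inner (du V p) (dv F p) / expR (2 * lam p)) *: dv F p
    - (L0 * inner (du V p) (F p)) *: F p.
Proof. exact: nabla_perpE. Qed.

Lemma nabla_perp_vE V p : O p -> nabla_perp F ord_max V p =
  dv V p - (inner (dv V p) (du F p) / expR (2 * lam p)) *: du F p
    + (inner (dv V p) (dv F p) / expR (2 * lam p)) *: dv F p
    - (L0 * inner (dv V p) (F p)) *: F p.
Proof. exact: nabla_perpE. Qed.

(** The tangential components of the second derivatives, obtained by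
    differentiating the conformality relations and < F, dF > = 0. *)
Lemma inner_second p : O p ->
  [/\ [/\ inner (du (du F) p) (du F p) = du lam p * expR (2 * lam p),
          inner (du (du F) p) (dv F p) = - (dv lam p * expR (2 * lam p)) &
          L0 * inner (du (du F) p) (F p) = - (L0 * expR (2 * lam p))],
      [/\ inner (dv (du F) p) (du F p) = dv lam p * expR (2 * lam p),
          inner (dv (du F) p) (dv F p) = - (du lam p * expR (2 * lam p)) &
          L0 * inner (dv (du F) p) (F p) = 0] &
      [/\ inner (dv (dv F) p) (du F p) = du lam p * expR (2 * lam p),
          inner (dv (dv F) p) (dv F p) = - (dv lam p * expR (2 * lam p)) &
          L0 * inner (dv (dv F) p) (F p) = L0 * expR (2 * lam p)]].
Proof.
move=> Op; have [TT1 TT2 TT3] := conf_inner Op.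
have g11 q : O q -> inner (du F q) (du F q) = expR (2 * lam q) by case/conf_inner.
have g22 q : O q -> inner (dv F q) (dv F q) = - expR (2 * lam q) by case/conf_inner.
have g12 q : O q -> inner (du F q) (dv F q) = 0 by case/conf_inner.
have sE : smooth O (fun q => expR (2 * lam q)) by apply: smooth_expR => //; exact: smoothZ.
have t1 q : O q -> L0 * inner (du F q) (F q) = 0.
  by move=> Oq; rewrite innerC; exact: du_position_tangent.
have t2 q : O q -> L0 * inner (dv F q) (F q) = 0.
  by move=> Oq; rewrite innerC; exact: dv_position_tangent.
exact: (gauss_formula_algebra (row_du_dvC openO sF Op) TT1 TT2 TT3
  (etrans (du_inner_cst sdu sdu g11 Op) (du_exp2 Op))
  (etrans (dv_inner_cst sdu sdu g11 Op) (dv_exp2 Op))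
  (etrans (du_inner_cst sdv sdv g22 Op) (etrans (duN sE Op) (congr1 -%R (du_exp2 Op))))
  (etrans (dv_inner_cst sdv sdv g22 Op) (etrans (dvN sE Op) (congr1 -%R (dv_exp2 Op))))
  (etrans (du_inner_cst sdu sdv g12 Op) (du_cst 0 p))
  (etrans (dv_inner_cst sdu sdv g12 Op) (dv_cst 0 p))
  (du_scaled_inner0 sdu sF t1 Op) (dv_scaled_inner0 sdu sF t1 Op)
  (dv_scaled_inner0 sdv sF t2 Op)).
Qed.

Variables (N1 N2 : plane R -> 'rV[R]_(ambient_dim L0)).
Hypothesis nf : normal_frame O F lam N1 N2.

(** The Gauss and Weingarten formulas. *)
Record frame_equations (D : coeffs R) : Prop := FrameEquations {
  frame_uu : forall p, O p -> du (du F) p = du lam p *: du F p + dv lam p *: dv F p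
    + (al1 D p *: N1 p + be1 D p *: N2 p) + (L0 * - expR (2 * lam p)) *: F p;
  frame_vu : forall p, O p -> dv (du F) p = dv lam p *: du F p + du lam p *: dv F p
    + (al2 D p *: N1 p + be2 D p *: N2 p);
  frame_vv : forall p, O p -> dv (dv F) p = du lam p *: du F p + dv lam p *: dv F p
    + (al3 D p *: N1 p + be3 D p *: N2 p) + (L0 * expR (2 * lam p)) *: F p;
  frame_uN1 : forall p, O p -> du N1 p = - al1 D p *: du F p + al2 D p *: dv F p
    + (du lam p *: N1 p + mu1 D p *: N2 p);
  frame_vN1 : forall p, O p -> dv N1 p = - al2 D p *: du F p + al3 D p *: dv F p
    + (dv lam p *: N1 p + mu2 D p *: N2 p);
  frame_uN2 : forall p, O p -> du N2 p = be1 D p *: du F p + - be2 D p *: dv F p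
    + (mu1 D p *: N1 p + du lam p *: N2 p);
  frame_vN2 : forall p, O p -> dv N2 p = be2 D p *: du F p + - be3 D p *: dv F p
    + (mu2 D p *: N1 p + dv lam p *: N2 p) }.

(** The components of the derivatives of N1 and N2 along dF are those of the
    second derivatives of F along N1 and N2 up to sign. *)
Lemma attached_frame_equations D : coeffs_of O F lam N1 N2 D -> frame_equations D.
Proof.
move=> [sff npc].
have E0 p : expR (2 * lam p) != 0 by rewrite gt_eqF ?expR_gt0.
have uu p : O p -> du (du F) p = du lam p *: du F p + dv lam p *: dv F p
    + (al1 D p *: N1 p + be1 D p *: N2 p) + (L0 * - expR (2 * lam p)) *: F p.
  move=> Op; have [h _ _] := sff p Op; have [[h1 h2 h3] _ _] := inner_second Op.
  exact: (solve_frame (E0 p) (etrans (esym h) (nabla_perp_uE (du F) Op)) h1 h2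
    (etrans h3 (esym (mulrN _ _)))).
have vu p : O p -> dv (du F) p = dv lam p *: du F p + du lam p *: dv F p
    + (al2 D p *: N1 p + be2 D p *: N2 p).
  move=> Op; have [_ h _] := sff p Op; have [_ [h1 h2 h3] _] := inner_second Op.
  have sch := row_du_dvC openO sF Op.
  have hS := etrans (esym h) (nabla_perp_uE (dv F) Op).
  have {}hS := etrans hS (congr1 (fun x => x - (inner x (du F p) / expR (2 * lam p)) *: du F p
    + (inner x (dv F p) / expR (2 * lam p)) *: dv F p - (L0 * inner x (F p)) *: F p) sch).
  exact: (solve_frame0 (E0 p) hS h1 h2 h3).
have vv p : O p -> dv (dv F) p = du lam p *: du F p + dv lam p *: dv F p
    + (al3 D p *: N1 p + be3 D p *: N2 p) + (L0 * expR (2 * lam p)) *: F p.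
  move=> Op; have [_ _ h] := sff p Op; have [_ _ [h1 h2 h3]] := inner_second Op.
  exact: (solve_frame (E0 p) (etrans (esym h) (nabla_perp_vE (dv F) Op)) h1 h2 h3).
have [nf1 nf2 gram] := nf.
have orthF N p : normal_field O F N -> O p -> L0 * inner (F p) (N p) = 0.
  by move=> [_ h] Op; have [] := h p Op.
have orthT1 N p : normal_field O F N -> O p -> inner (N p) (du F p) = 0.
  by move=> [_ h] Op; have [_ h1 _] := h p Op; exact: etrans (innerC _ _) h1.
have orthT2 N p : normal_field O F N -> O p -> inner (N p) (dv F p) = 0.
  by move=> [_ h] Op; have [_ _ h1] := h p Op; exact: etrans (innerC _ _) h1.
have orthF' N p : normal_field O F N -> O p -> L0 * inner (N p) (F p) = 0.
  by move=> nN Op; exact: etrans (congr1 _ (innerC _ _)) (orthF N p nN Op).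
have Nuu N p : normal_field O F N -> O p -> inner (N p) (du (du F) p) =
    al1 D p * inner (N p) (N1 p) + be1 D p * inner (N p) (N2 p).
  move=> nN Op; exact: (inner_normal_frame (orthT1 N p nN Op) (orthT2 N p nN Op)
    (orthF N p nN Op) (uu p Op)).
have Nvv N p : normal_field O F N -> O p -> inner (N p) (dv (dv F) p) =
    al3 D p * inner (N p) (N1 p) + be3 D p * inner (N p) (N2 p).
  move=> nN Op; exact: (inner_normal_frame (orthT1 N p nN Op) (orthT2 N p nN Op)
    (orthF N p nN Op) (vv p Op)).
have Nvu N p : normal_field O F N -> O p -> inner (N p) (dv (du F) p) =
    al2 D p * inner (N p) (N1 p) + be2 D p * inner (N p) (N2 p).
  move=> nN Op; apply: (inner_normal_frame (c := 0) (f := F p) (orthT1 N p nN Op) (orthT2 N p nN Op)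
    (orthF N p nN Op)).
  by apply: etrans (vu p Op) _; rewrite mulr0 scale0r addr0.
have nsm N : normal_field O F N -> smooth O N by case.
have duT1 N p (nN : normal_field O F N) (Op : O p) :=
  du_inner_normal nN sdu Op (fun q Oq => orthT1 N q nN Oq).
have duT2 N p (nN : normal_field O F N) (Op : O p) :=
  etrans (du_inner_normal nN sdv Op (fun q Oq => orthT2 N q nN Oq))
    (congr1 (fun w => - inner (N p) w) (row_du_dvC openO sF Op)).
have dvT1 N p (nN : normal_field O F N) (Op : O p) :=
  dv_inner_normal nN sdu Op (fun q Oq => orthT1 N q nN Oq).
have dvT2 N p (nN : normal_field O F N) (Op : O p) :=
  dv_inner_normal nN sdv Op (fun q Oq => orthT2 N q nN Oq).
have duF N p : normal_field O F N -> O p -> L0 * inner (du N p) (F p) = 0.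
  move=> nN Op; apply: etrans (du_scaled_inner0 (nsm N nN) sF (fun q Oq => orthF' N q nN Oq) Op) _.
  by have := orthT1 N p nN Op => h; apply/eqP; rewrite oppr_eq0; apply/eqP;
    exact: etrans (congr1 _ h) (mulr0 _).
have dvF N p : normal_field O F N -> O p -> L0 * inner (dv N p) (F p) = 0.
  move=> nN Op; apply: etrans (dv_scaled_inner0 (nsm N nN) sF (fun q Oq => orthF' N q nN Oq) Op) _.
  by have := orthT2 N p nN Op => h; apply/eqP; rewrite oppr_eq0; apply/eqP;
    exact: etrans (congr1 _ h) (mulr0 _).
have on1 (x al be E : R) n1 n2 : x = - (al * n1 + be * n2) -> n1 = E -> n2 = 0 -> x = - (al * E).
  by move=> -> -> ->; rewrite mulr0 addr0.
have on1' (x al be E : R) n1 n2 : x = - (al * n1 + be * n2) -> n1 = E -> n2 = 0 -> x = - al * E.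
  by move=> -> -> ->; rewrite mulr0 addr0 mulNr.
have on2 (x al be E : R) n1 n2 : x = - (al * n1 + be * n2) -> n1 = 0 -> n2 = - E -> x = be * E.
  by move=> -> -> ->; rewrite mulr0 add0r mulrN opprK.
have on2' (x al be E : R) n1 n2 : x = - (al * n1 + be * n2) -> n1 = 0 -> n2 = - E -> x = - (- be * E).
  by move=> -> -> ->; rewrite mulr0 add0r mulrN opprK mulNr opprK.
split; [exact: uu|exact: vu|exact: vv|move=> p Op..].
- have [h _ _ _] := npc p Op; have [g1 g2 g3] := gram p Op.
  apply: (solve_frame0 (E0 p) (etrans (esym h) (nabla_perp_uE N1 Op))); last exact: duF.
    exact: (on1' _ _ _ _ _ _ (etrans (duT1 _ _ nf1 Op) (congr1 -%R (Nuu _ _ nf1 Op))) g1 g3).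
  exact: (on1 _ _ _ _ _ _ (etrans (duT2 _ _ nf1 Op) (congr1 -%R (Nvu _ _ nf1 Op))) g1 g3).
- have [_ _ h _] := npc p Op; have [g1 g2 g3] := gram p Op.
  apply: (solve_frame0 (E0 p) (etrans (esym h) (nabla_perp_vE N1 Op))); last exact: dvF.
    exact: (on1' _ _ _ _ _ _ (etrans (dvT1 _ _ nf1 Op) (congr1 -%R (Nvu _ _ nf1 Op))) g1 g3).
  exact: (on1 _ _ _ _ _ _ (etrans (dvT2 _ _ nf1 Op) (congr1 -%R (Nvv _ _ nf1 Op))) g1 g3).
- have [_ h _ _] := npc p Op; have [g1 g2 g3] := gram p Op.
  have g3' := etrans (innerC _ _) g3.
  apply: (solve_frame0 (E0 p) (etrans (esym h) (nabla_perp_uE N2 Op))); last exact: duF.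
    exact: (on2 _ _ _ _ _ _ (etrans (duT1 _ _ nf2 Op) (congr1 -%R (Nuu _ _ nf2 Op))) g3' g2).
  exact: (on2' _ _ _ _ _ _ (etrans (duT2 _ _ nf2 Op) (congr1 -%R (Nvu _ _ nf2 Op))) g3' g2).
- have [_ _ _ h] := npc p Op; have [g1 g2 g3] := gram p Op.
  have g3' := etrans (innerC _ _) g3.
  apply: (solve_frame0 (E0 p) (etrans (esym h) (nabla_perp_vE N2 Op))); last exact: dvF.
    exact: (on2 _ _ _ _ _ _ (etrans (dvT1 _ _ nf2 Op) (congr1 -%R (Nvu _ _ nf2 Op))) g3' g2).
  exact: (on2' _ _ _ _ _ _ (etrans (dvT2 _ _ nf2 Op) (congr1 -%R (Nvv _ _ nf2 Op))) g3' g2).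
Qed.

End conformal.

(** * Adapted frames and the curvature of a conformal metric *)

(** The relations between the values at one point of the position vector f,
    the coordinate fields T1, T2 and the normal fields n1, n2. The factors L0
    make the conditions on f void in the flat case, where f is not normal. *)
Record adapted (R : realType) (L0 : R) (E : R)
    (f T1 T2 n1 n2 : 'rV[R]_(ambient_dim L0)) : Prop := Adapted {
  adapted_T : [/\ inner T1 T1 = E, inner T2 T2 = - E & inner T1 T2 = 0];
  adapted_N : [/\ inner n1 n1 = E, inner n2 n2 = - E & inner n1 n2 = 0];
  adapted_TN : [/\ inner T1 n1 = 0, inner T1 n2 = 0, inner T2 n1 = 0 & inner T2 n2 = 0];
  adapted_f : [/\ L0 * inner f T1 = 0, L0 * inner f T2 = 0, L0 * inner f n1 = 0 &
                  L0 * inner f n2 = 0];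
  adapted_ff : L0 * (L0 * inner f f) = L0 }.

Section adapted_frame.
Variables (R : realType) (L0 : R).
Local Notation vec := 'rV[R]_(ambient_dim L0).
Variables (f T1 T2 n1 n2 : vec) (E : R).
Hypothesis ad : adapted E f T1 T2 n1 n2.
Variables (a b c d e : R).
Let x := a *: T1 + b *: T2 + (c *: n1 + d *: n2) + (L0 * e) *: f.

Lemma adapted_inner1 : inner x T1 = a * E.
Proof.
case: ad => [[t1 t2 t3] _ [m1 m2 m3 m4] [h1 h2 h3 h4] _].
rewrite /x !innerE (innerC T2 T1) (innerC n1) (innerC n2) t1 t3 m1 m2 -mulrA (mulrCA L0) h1.
by rewrite !mulr0 !addr0.
Qed.

Lemma adapted_inner2 : inner x T2 = - (b * E).
Proof.
case: ad => [[t1 t2 t3] _ [m1 m2 m3 m4] [h1 h2 h3 h4] _].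
rewrite /x !innerE (innerC n1) (innerC n2) t2 t3 m3 m4 -mulrA (mulrCA L0) h2.
by rewrite !mulr0 !addr0 add0r mulrN.
Qed.

Lemma adapted_innerN1 : inner x n1 = c * E.
Proof.
case: ad => [_ [t1 t2 t3] [m1 m2 m3 m4] [h1 h2 h3 h4] _].
rewrite /x !innerE (innerC n2 n1) t1 t3 m1 m3 -mulrA (mulrCA L0) h3.
by rewrite !mulr0 !addr0 add0r.
Qed.

Lemma adapted_innerN2 : inner x n2 = - (d * E).
Proof.
case: ad => [_ [t1 t2 t3] [m1 m2 m3 m4] [h1 h2 h3 h4] _].
rewrite /x !innerE t2 t3 m2 m4 -mulrA (mulrCA L0) h4.
by rewrite !mulr0 !addr0 !add0r mulrN.
Qed.

Lemma adapted_innerf : L0 * inner x f = L0 * e.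
Proof.
case: ad => [_ _ _ [h1 h2 h3 h4] ff].
rewrite /x !innerE !(innerC _ f).
rewrite (_ : L0 * _ = a * (L0 * inner f T1) + b * (L0 * inner f T2) + (c * (L0 * inner f n1)
  + d * (L0 * inner f n2)) + e * (L0 * (L0 * inner f f))); last by ring.
by rewrite h1 h2 h3 h4 ff !mulr0 !add0r mulrC.
Qed.

Lemma adapted_residue : E != 0 ->
  x - (inner x T1 / E) *: T1 + (inner x T2 / E) *: T2 - (L0 * inner x f) *: f
  = c *: n1 + d *: n2.
Proof.
move=> E0; rewrite adapted_inner1 adapted_inner2 adapted_innerf mulNr !mulfK//.
by rewrite /x; apply/rowP => j; rewrite !mxE; ring.
Qed.

End adapted_frame.

Lemma adapted_inner_pair (R : realType) (L0 : R) (E : R)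
    (f T1 T2 n1 n2 : 'rV[R]_(ambient_dim L0)) (a b c d a' b' c' d' e : R) :
  adapted E f T1 T2 n1 n2 ->
  inner (a *: T1 + b *: T2 + (c *: n1 + d *: n2))
    (a' *: T1 + b' *: T2 + (c' *: n1 + d' *: n2) + (L0 * e) *: f) =
  E * (a * a' - b * b' + (c * c' - d * d')).
Proof.
move=> ad; rewrite innerC 2!innerDr !(innerDr _ (_ *: n1)) !innerZr.
rewrite (adapted_inner1 ad) (adapted_inner2 ad) (adapted_innerN1 ad) (adapted_innerN2 ad).
by ring.
Qed.

Section curvature.
Variables (R : realType) (L0 : R) (O : set (plane R)).
Hypothesis openO : open O.
Variables (F : plane R -> 'rV[R]_(ambient_dim L0)) (lam : plane R -> R).
Hypothesis conf : conformal_immersion O F lam.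
Let E (p : plane R) := expR (2 * lam p).
Let slam : smooth O lam. Proof. by have [] := conf. Qed.
Let sE : smooth O E.
Proof. by apply: smooth_expR => //; exact: smoothZ. Qed.
Let E0 p : E p != 0. Proof. by rewrite gt_eqF ?expR_gt0. Qed.

Let g : 'M[R]_2 := lorentz_mx 1.

Let metric_entry i j p : O p -> metric F p i j = g i j * E p.
Proof.
move=> Op; rewrite (metricE conf Op) !mxE -/(E p).
by move: i j; apply: ord2P; apply: ord2P; rewrite ?mul1r ?mulN1r ?mul0r.
Qed.

Let dcoord_metric k i j p : O p ->
  dcoord k (fun q => metric F q i j) p = g i j * (2 * dcoord k lam p * E p).
Proof.
move=> Op; have e v : 'D_v (fun q => metric F q i j) p = g i j * (2 * 'D_v lam p * E p).
  apply: etrans (derive_ext v openO (fun q Oq => metric_entry i j Oq) Op) _.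
  apply: etrans (smooth_deriveZ openO _ v sE Op) _.
  by rewrite (derive_exp2 openO conf _ Op).
by move: k; apply: ord2P; exact: e.
Qed.

Lemma christoffel_algebra (d : 'I_2 -> R) (c : R) (i j l : 'I_2) : c != 0 ->
  2^-1 * (\sum_(m < 2) lorentz_mx c^-1 l m *
    (g j m * (2 * d i * c) + g i m * (2 * d j * c) - g i j * (2 * d m * c))) =
  d (if odd (i + j + l) then ord_max else ord0).
Proof.
move=> c0; rewrite sum2E !mxE.
by move: i j l; apply: ord2P; apply: ord2P; apply: ord2P; rewrite /=; field.
Qed.

(** For g = e^(2 lam) (du^2 - dv^2) every Christoffel symbol is lam_u or lam_v,
    according to the parity of the number of indices equal to v. *)
Lemma christoffel_conformal i j l p : O p -> christoffel (metric F) i j l p =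
  dcoord (if odd (i + j + l) then ord_max else ord0) lam p.
Proof.
move=> Op; rewrite -(christoffel_algebra (fun k => dcoord k lam p) i j l (E0 p)).
rewrite /christoffel (metricE conf Op) invmx_lorentz ?E0//.
congr (_ * _); apply: eq_bigr => m _; congr (_ * _).
by rewrite !dcoord_metric.
Qed.

Lemma gauss_curvature_conformal p : O p -> gauss_curvature (metric F) p =
  - ((du (du lam) p - dv (dv lam) p) / E p).
Proof.
move=> Op; have ch j k l q : O q -> christoffel (metric F) j k l q =
    dcoord (if odd (j + k + l) then ord_max else ord0) lam q :> R.
  by move=> Oq; exact: christoffel_conformal.
have dch i j k l : dcoord i (christoffel (metric F) j k l) p =
    dcoord i (dcoord (if odd (j + k + l) then ord_max else ord0) lam) p :> R.
  have e v : 'D_v (christoffel (metric F) j k l) p =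
      'D_v (dcoord (if odd (j + k + l) then ord_max else ord0) lam) p.
    by apply: (derive_ext v openO _ Op) => q Oq; exact: ch.
  by move: i; apply: ord2P; exact: e.
rewrite /gauss_curvature !sum2E !metric_entry// (metricE conf Op) det_lorentz -/(E p).
rewrite /riemann !sum2E !dch !ch// /= !mxE /= mul0r mulr0 addr0 mul1r.
rewrite -/(E p) -[dcoord ord0 (dcoord ord0 lam) p]/(du (du lam) p).
rewrite -[dcoord ord_max (dcoord ord_max lam) p]/(dv (dv lam) p).
move: (dcoord _ _ _) (dcoord _ _ _) (du _ _) (dv _ _) (E p) (E0 p) => a b c d e e0.
by field.
Qed.

End curvature.

(** * Codazzi equations *)

Section frame_fields.
Variables (R : realType) (L0 : R) (O : set (plane R)).
Hypothesis openO : open O.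
Variables (F : plane R -> 'rV[R]_(ambient_dim L0)) (lam : plane R -> R).
Hypothesis conf : conformal_immersion O F lam.
Variables (N1 N2 : plane R -> 'rV[R]_(ambient_dim L0)).
Hypothesis nf : normal_frame O F lam N1 N2.
Let E (p : plane R) := expR (2 * lam p).
Let sF : smooth O F. Proof. by have [] := conf. Qed.
Let slam : smooth O lam. Proof. by have [] := conf. Qed.
Let sdv : smooth O (dv F). Proof. exact: smooth_row_derive sF. Qed.
Let sdu : smooth O (du F). Proof. exact: smooth_row_derive sF. Qed.
Let sN1 : smooth O N1. Proof. by have [[]] := nf. Qed.
Let sN2 : smooth O N2. Proof. by have [_ []] := nf. Qed.
Let sE : smooth O E.
Proof. by apply: smooth_expR => //; exact: smoothZ. Qed.
Let E0 p : E p != 0. Proof. by rewrite gt_eqF ?expR_gt0. Qed.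

Lemma adapted_at p : O p -> adapted (E p) (F p) (du F p) (dv F p) (N1 p) (N2 p).
Proof.
move=> Op; have [_ _ _ /(_ p Op) hT] := conf.
have [[_ /(_ p Op)[a1 a2 a3]] [_ /(_ p Op)[b1 b2 b3]] /(_ p Op) hN] := nf.
have f1 := du_position_tangent openO conf Op.
have f2 := dv_position_tangent openO conf Op.
have ff := spaceform_norm conf Op.
exact: (Adapted hT hN (And4 a2 b2 a3 b3) (And4 f1 f2 a1 b1) ff).
Qed.

Let residue p (x : 'rV[R]_(ambient_dim L0)) (a b c d e : R) : O p ->
  x = a *: du F p + b *: dv F p + (c *: N1 p + d *: N2 p) + (L0 * e) *: F p ->
  x - (inner x (du F p) / E p) *: du F p + (inner x (dv F p) / E p) *: dv F p
    - (L0 * inner x (F p)) *: F p = c *: N1 p + d *: N2 p.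
Proof. by move=> Op ->; exact: (adapted_residue (adapted_at Op)). Qed.

Let add_f0 p (x y : 'rV[R]_(ambient_dim L0)) : x = y -> x = y + (L0 * 0) *: F p.
Proof. by move=> ->; rewrite mulr0 scale0r addr0. Qed.

(** The converse of [attached_frame_equations]. *)
Lemma frame_equations_coeffs D : frame_equations O F lam N1 N2 D ->
  coeffs_of O F lam N1 N2 D.
Proof.
move=> fe; split=> p Op; split.
- exact: etrans (nabla_perp_uE openO conf (du F) Op) (residue Op (frame_uu fe Op)).
- apply: etrans (nabla_perp_uE openO conf (dv F) Op) (residue Op _).
  exact: etrans (row_du_dvC openO sF Op) (add_f0 p (frame_vu fe Op)).
- exact: etrans (nabla_perp_vE openO conf (dv F) Op) (residue Op (frame_vv fe Op)).
- exact: etrans (nabla_perp_uE openO conf N1 Op) (residue Op (add_f0 p (frame_uN1 fe Op))).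
- exact: etrans (nabla_perp_uE openO conf N2 Op) (residue Op (add_f0 p (frame_uN2 fe Op))).
- exact: etrans (nabla_perp_vE openO conf N1 Op) (residue Op (add_f0 p (frame_vN1 fe Op))).
- exact: etrans (nabla_perp_vE openO conf N2 Op) (residue Op (add_f0 p (frame_vN2 fe Op))).
Qed.

(** Equality of mixed derivatives of V, tested against T: only first
    derivatives of V and T are left. *)
Lemma mixed_derivatives_inner (V T : plane R -> 'rV[R]_(ambient_dim L0))
    (cu cv : plane R -> R) p : smooth O V -> smooth O T ->
  (forall q, O q -> inner (du V q) (T q) = cu q) ->
  (forall q, O q -> inner (dv V q) (T q) = cv q) -> O p ->
  inner (dv V p) (du T p) - inner (du V p) (dv T p) = du cv p - dv cu p.
Proof.
move=> sV sT hu hv Op.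
have h1 := dv_inner_cst openO (smooth_row_derive _ sV) sT hu Op.
have h2 := du_inner_cst openO (smooth_row_derive _ sV) sT hv Op.
have alg (x y a b c d : R) : a + b = c -> x + y = d -> a = x -> y - b = d - c.
  by move=> <- <- ->; ring.
exact: (alg _ _ _ _ _ _ h1 h2 (congr1 (fun z => inner z (T p)) (esym (row_du_dvC openO sV Op)))).
Qed.

Let inner1 p x (a b c d : R) : O p ->
  x = a *: du F p + b *: dv F p + (c *: N1 p + d *: N2 p) -> inner x (du F p) = a * E p.
Proof. by move=> Op /(add_f0 p) ->; exact: adapted_inner1 (adapted_at Op) _ _ _ _ _. Qed.

Let inner2 p x (a b c d : R) : O p ->
  x = a *: du F p + b *: dv F p + (c *: N1 p + d *: N2 p) -> inner x (dv F p) = - (b * E p).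
Proof. by move=> Op /(add_f0 p) ->; exact: adapted_inner2 (adapted_at Op) _ _ _ _ _. Qed.

Let inner_pair p x y (a b c d a' b' c' d' e : R) : O p ->
  x = a *: du F p + b *: dv F p + (c *: N1 p + d *: N2 p) ->
  y = a' *: du F p + b' *: dv F p + (c' *: N1 p + d' *: N2 p) + (L0 * e) *: F p ->
  inner x y = E p * (a * a' - b * b' + (c * c' - d * d')).
Proof. by move=> Op -> ->; exact: adapted_inner_pair (adapted_at Op). Qed.

Let derive_scaledE (f : plane R -> R) (p w : plane R) : smooth O f -> O p ->
  'D_w (fun q => f q * E q) p = 'D_w f p * E p + f p * (2 * 'D_w lam p * E p).
Proof.
move=> sf Op; have h1 := smooth_deriveM w sf sE Op.
have h2 := derive_exp2 openO conf w Op.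
exact: (etrans h1 (congr1 (fun z => 'D_w f p * E p + f p * z) h2)).
Qed.

Let derive_scaledNE (f : plane R -> R) (p w : plane R) : smooth O f -> O p ->
  'D_w (fun q => - (f q * E q)) p = - ('D_w f p * E p + f p * (2 * 'D_w lam p * E p)).
Proof.
move=> sf Op; rewrite -(derive_scaledE w sf Op); apply: derive_val; apply: is_deriveN.
by apply: smooth_is_derive Op; exact: smoothM.
Qed.

Let eq_sub0 (x y z : R) : x = y -> z = x - y -> z = 0.
Proof. by move=> -> ->; rewrite subrr. Qed.

(** Two of the Codazzi equations: compatibility of the Weingarten formulas
    for N1 along dv F, and for N2 along du F. *)
Lemma codazzi1 D p : frame_equations O F lam N1 N2 D ->
  smooth O (al2 D) -> smooth O (al3 D) -> O p ->
  du (al3 D) p - dv (al2 D) p + al1 D p * du lam p - al2 D p * dv lam p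
    - mu2 D p * be2 D p + mu1 D p * be3 D p = 0.
Proof.
move=> fe s2 s3 Op.
have h := mixed_derivatives_inner sN1 sdv
  (fun q Oq => inner2 Oq (frame_uN1 fe Oq)) (fun q Oq => inner2 Oq (frame_vN1 fe Oq)) Op.
have e1 := inner_pair Op (frame_vN1 fe Op)
  (etrans (row_du_dvC openO sF Op) (add_f0 p (frame_vu fe Op))).
have e2 := inner_pair Op (frame_uN1 fe Op) (frame_vv fe Op).
have d1 := derive_scaledNE (1, 0) s3 Op.
have d2 := derive_scaledNE (0, 1) s2 Op.
have alg (x y g1 g2 e lu lv du3 dv2 a1 a2 a3 b2 b3 m1 m2 : R) : e != 0 -> x - y = g1 - g2 ->
  x = e * (- a2 * lv - a3 * lu + (lv * a2 - m2 * b2)) ->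
  y = e * (- a1 * lu - a2 * lv + (lu * a3 - m1 * b3)) ->
  g1 = - (du3 * e + a3 * (2 * lu * e)) ->
  g2 = - (dv2 * e + a2 * (2 * lv * e)) ->
  du3 - dv2 + a1 * lu - a2 * lv - m2 * b2 + m1 * b3 = 0.
  by move=> e0 k kx ky k1 k2; move: k; rewrite kx ky k1 k2 => k; apply: (mulfI e0); rewrite mulr0;
    apply: (eq_sub0 k); ring.
exact: (alg _ _ _ _ _ _ _ _ _ _ _ _ _ _ _ _ (E0 p) h e1 e2 d1 d2).
Qed.

Lemma codazzi2 D p : frame_equations O F lam N1 N2 D ->
  smooth O (be1 D) -> smooth O (be2 D) -> O p ->
  du (be2 D) p - dv (be1 D) p + be2 D p * du lam p - be3 D p * dv lam p
    - mu2 D p * al1 D p + mu1 D p * al2 D p = 0.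
Proof.
move=> fe s1 s2 Op.
have h := mixed_derivatives_inner sN2 sdu
  (fun q Oq => inner1 Oq (frame_uN2 fe Oq)) (fun q Oq => inner1 Oq (frame_vN2 fe Oq)) Op.
have e1 := inner_pair Op (frame_vN2 fe Op) (frame_uu fe Op).
have e2 := inner_pair Op (frame_uN2 fe Op) (add_f0 p (frame_vu fe Op)).
have d1 := derive_scaledE (1, 0) s2 Op.
have d2 := derive_scaledE (0, 1) s1 Op.
have alg (x y g1 g2 e lu lv du2 dv1 a1 a2 b1 b2 b3 m1 m2 : R) : e != 0 -> x - y = g1 - g2 ->
  x = e * (b2 * lu - - b3 * lv + (m2 * a1 - lv * b1)) ->
  y = e * (b1 * lv - - b2 * lu + (m1 * a2 - lu * b2)) ->
  g1 = du2 * e + b2 * (2 * lu * e) ->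
  g2 = dv1 * e + b1 * (2 * lv * e) ->
  du2 - dv1 + b2 * lu - b3 * lv - m2 * a1 + m1 * a2 = 0.
  by move=> e0 k kx ky k1 k2; move: k; rewrite kx ky k1 k2 => k; apply: (mulfI e0); rewrite mulr0;
    apply: (eq_sub0 (esym k)); ring.
exact: (alg _ _ _ _ _ _ _ _ _ _ _ _ _ _ _ _ (E0 p) h e1 e2 d1 d2).
Qed.

End frame_fields.

(** * Algebra at a point *)

Lemma sign_sqr (R : realType) (d : R) : d = 1 \/ d = -1 -> d * d = 1.
Proof. by case=> ->; rewrite ?mulr1// mulrNN mulr1. Qed.

Lemma sign_norm (R : realType) (d : R) : d = 1 \/ d = -1 -> `|d| = 1.
Proof. by case=> ->; rewrite ?normrN1 ?normr1. Qed.

Lemma sign_neq0 (R : realType) (d : R) : d = 1 \/ d = -1 -> d != 0.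
Proof. by case=> ->; rewrite ?oppr_eq0 oner_eq0. Qed.

Lemma hyperbolicD (R : realType) (d x : R) : d = 1 \/ d = -1 ->
  d * cosh x + sinh x = d * expR (d * x).
Proof.
by case=> ->; rewrite /cosh /sinh ?mul1r ?mulN1r; move: (expR _) (expR _) => a b; field.
Qed.

Lemma hyperbolicB (R : realType) (d x : R) : d = 1 \/ d = -1 ->
  d * cosh x - sinh x = d * expR (- (d * x)).
Proof.
case=> ->; rewrite /cosh /sinh ?mul1r ?mulN1r ?opprK;
  by move: (expR _) (expR _) => a b; field.
Qed.

Section pointwise.
Variable R : realType.
Implicit Types a b c d k l s r m e : R.

Lemma eq_of_sub (x y z t : R) : x = y -> z - t = x - y -> z = t.
Proof. by move=> -> /eqP; rewrite subrr subr_eq0 => /eqP. Qed.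

Lemma null_coordinates a b c d (C S : R) :
  (c = C * a + S * - b /\ d = S * a + C * - b) <->
  (c + d = (C + S) * (a - b) /\ c - d = (C - S) * (a + b)).
Proof.
split=> [[-> ->]|[h1 h2]]; first by split; ring.
by split; lra.
Qed.

Lemma null_coordinates_swapped a b c d (C S : R) :
  (c = C * b + S * - a /\ d = S * b + C * - a) <->
  (c + d = - ((C + S) * (a - b)) /\ c - d = (C - S) * (a + b)).
Proof.
split=> [[-> ->]|[h1 h2]]; first by split; ring.
by split; lra.
Qed.

(** Both families of quantities come from the same alpha, beta, which gives
    two relations; they decouple in the null coordinates. *)
Lemma null_compatibility (Xp Xm Yp Ym : R) a b c d k l s r :
  Xp + Xm = k * Yp + l * Ym -> Yp + Ym = k * Xp + l * Xm ->
  Xp = b / s -> Yp = a / s -> Xm = - (d / r) -> Ym = c / r ->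
  (k + 1) * ((a - b) / s) = - ((l + 1) * ((c + d) / r)) /\
  (k - 1) * ((a + b) / s) = - ((l - 1) * ((c - d) / r)).
Proof.
move=> h1 h2 e1 e2 e3 e4; move: h1 h2; rewrite e1 e2 e3 e4.
rewrite !mulrDl !mulNr; move: (a / s) (b / s) (c / r) (d / r) => A B C D h1 h2.
by split; lra.
Qed.

(** If one null derivative of f_+ vanishes then so does the corresponding one
    of f_-, and with them A. *)
Lemma null_nonzero a b c d k l s r : s != 0 -> r != 0 ->
  k != 1 -> k != -1 -> l != 1 -> l != -1 ->
  (k + 1) * ((a - b) / s) = - ((l + 1) * ((c + d) / r)) ->
  (k - 1) * ((a + b) / s) = - ((l - 1) * ((c - d) / r)) ->
  (b * c + d * a) * (b * c - d * a) != 0 ->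
  [/\ a - b != 0, a + b != 0, c + d != 0 & c - d != 0].
Proof.
move=> s0 r0 k1 k2 l1 l2 h1 h2 nz.
have k1' : k - 1 != 0 by rewrite subr_eq0.
have l1' : l - 1 != 0 by rewrite subr_eq0.
have k2' : k + 1 != 0 by rewrite addr_eq0.
have l2' : l + 1 != 0 by rewrite addr_eq0.
have s0' : s^-1 != 0 by rewrite invr_eq0.
have r0' : r^-1 != 0 by rewrite invr_eq0.
have iff1 : (a - b == 0) = (c + d == 0).
  apply/idP/idP => /eqP e; move: h1; rewrite e mul0r mulr0 => /eqP.
    by rewrite eq_sym oppr_eq0 !mulf_eq0 (negPf l2') (negPf r0') orbF.
  by rewrite oppr0 !mulf_eq0 (negPf k2') (negPf s0') orbF.
have iff2 : (a + b == 0) = (c - d == 0).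
  apply/idP/idP => /eqP e; move: h2; rewrite e mul0r mulr0 => /eqP.
    by rewrite eq_sym oppr_eq0 !mulf_eq0 (negPf l1') (negPf r0') orbF.
  by rewrite oppr0 !mulf_eq0 (negPf k1') (negPf s0') orbF.
have A0 : b * c + d * a != 0 by apply: contra nz => /eqP ->; rewrite mul0r.
have P0 : a - b != 0.
  apply/negP => h; move: (h); rewrite iff1 => /eqP h'; move/eqP: h => h.
  move/eqP: A0; apply; have -> : b * c + d * a = a * (c + d) - (a - b) * c by ring.
  by rewrite h h' mulr0 mul0r subrr.
have Q0 : a + b != 0.
  apply/negP => h; move: (h); rewrite iff2 => /eqP h'; move/eqP: h => h.
  move/eqP: A0; apply; have -> : b * c + d * a = b * (c - d) + (a + b) * d by ring.
  by rewrite h h' mulr0 mul0r addr0.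
by split=> //; rewrite -?iff1 -?iff2.
Qed.

Definition tval (k : R) : R := 2^-1 * ln `|(k - 1) / (k + 1)|.

(** Since ln 0 = 0 and x / 0 = 0, the value also vanishes at k = 1 and
    k = -1. *)
Lemma tval_eq0 k : (tval k == 0) = [|| k == 0, k == 1 | k == -1].
Proof.
rewrite /tval mulf_eq0 invr_eq0 pnatr_eq0 /=.
have [->|k1] := eqVneq k 1; first by rewrite subrr mul0r normr0 ln0 ?eqxx ?orbT.
have [->|k2] := eqVneq k (-1); first by rewrite addNr invr0 mulr0 normr0 ln0 ?eqxx ?orbT.
have k1' : k - 1 != 0 by rewrite subr_eq0.
have k2' : k + 1 != 0 by rewrite addr_eq0.
rewrite !orbF ln_eq0 ?normr_gt0 ?mulf_neq0 ?invr_eq0//.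
apply/eqP/eqP => [|->]; last by rewrite sub0r add0r divr1 normrN1.
move/eqP; rewrite -[X in _ == X]normr1 eqr_norm2 => /orP[]/eqP h.
  have : k - 1 = k + 1 by rewrite -[LHS](divfK k2') h mul1r.
  by move=> h3; lra.
have : k - 1 = - (k + 1) by rewrite -[LHS](divfK k2') h mulN1r.
 by move=> h3; lra.
Qed.

(** The relation between t_+ and t_-: the quotient of the two null
    compatibility conditions. *)
Lemma tval_relation a b c d k l s r m e : s != 0 -> r != 0 ->
  k != 1 -> k != -1 -> l != 1 -> l != -1 ->
  (k + 1) * ((a - b) / s) = - ((l + 1) * ((c + d) / r)) ->
  (k - 1) * ((a + b) / s) = - ((l - 1) * ((c - d) / r)) ->
  a - b != 0 -> a + b != 0 -> m != 0 -> e = 1 \/ e = -1 ->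
  c + d = e * (m * (a - b)) -> c - d = m^-1 * (a + b) ->
  tval k = tval l - ln `|m|.
Proof.
move=> s0 r0 k1 k2 l1 l2 h1 h2 P0 Q0 m0 he e1 e2; move: h1 h2; rewrite e1 e2 => h1 h2.
have k1' : k - 1 != 0 by rewrite subr_eq0.
have l1' : l - 1 != 0 by rewrite subr_eq0.
have k2' : k + 1 != 0 by rewrite addr_eq0.
have l2' : l + 1 != 0 by rewrite addr_eq0.
have e0 := sign_neq0 he; have ee := sign_sqr he.
have k2e : k + 1 = - ((l + 1) * e * m * s / r).
  by apply: (mulIf P0); apply: (mulIf (_ : s^-1 != 0)); [rewrite invr_eq0|rewrite -mulrA h1; field; apply/andP].
have k1e : k - 1 = - ((l - 1) * s / (m * r)).
  by apply: (mulIf Q0); apply: (mulIf (_ : s^-1 != 0)); [rewrite invr_eq0|rewrite -mulrA h2; field; do ?[apply/andP; split=> //]].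
have -> : tval k = 2^-1 * ln `|(l - 1) / (l + 1) / (e * m ^+ 2)|.
  by rewrite /tval k1e k2e; congr (_ * ln `|_|); field; do ?[apply/andP; split=> //].
have ne : `|e| = 1 by case: he => ->; rewrite ?normrN1 ?normr1.
have m1 : 0 < `|m| by rewrite normr_gt0.
have l3 : 0 < `|(l - 1) / (l + 1)| by rewrite normr_gt0 mulf_neq0 ?invr_eq0.
rewrite normrM normfV (normrM e) ne mul1r normrX lnM ?posrE ?invr_gt0 ?exprn_gt0//.
rewrite lnV ?posrE ?exprn_gt0// expr2 lnM ?posrE// /tval.
by move: (ln _) (ln _) => A B; field.
Qed.

Lemma norm_quadratic (Xp Xm Yp Ym : R) a b c d s r : s != 0 -> r != 0 ->
  Xp = b / s -> Yp = a / s -> Xm = - (d / r) -> Ym = c / r ->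
  (Xp ^+ 2 * Ym ^+ 2 - Xm ^+ 2 * Yp ^+ 2 == 0) =
  ((b * c + d * a) * (b * c - d * a) == 0).
Proof.
move=> s0 r0 -> -> -> ->.
rewrite (_ : _ - _ = (b * c + d * a) * (b * c - d * a) * ((s * r) ^- 2)); last first.
  by field; apply/andP.
have sr : (s * r) ^- 2 != 0 by rewrite invr_eq0 sqrf_eq0 mulf_neq0.
by rewrite mulf_eq0 (negPf sr) orbF.
Qed.

(** The two Codazzi equations form a linear system for d gamma with determinant
    - A'. *)
Lemma solve_connection a b c d (x y tu tv ru rv lu lv A A' J Jr de : R) :
  A = b * c + d * a -> A' = b * c - d * a -> J = a * d - b * c -> Jr = a * rv - b * ru ->
  A' != 0 ->
  (b * (x - (tu - de * ru)) - a * (y - (tv - de * rv)) = - (lu * a - lv * b) /\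
   d * (x - tu) - c * (y - tv) = lu * c - lv * d) <->
  (x = tu - de * (Jr / J) * c - A'^-1 * (2 * a * c * lu - A * lv) /\
   y = tv - de * (Jr / J) * d - A'^-1 * (A * lu - 2 * b * d * lv)).
Proof.
move=> -> -> -> -> A0.
have J0 : a * d - b * c != 0 by rewrite -oppr_eq0 opprB (mulrC a).
split=> [[h1 h2]|[-> ->]]; last by split; field; apply/andP.
have h1' : b * (x - tu) - a * (y - tv) = - (lu * a - lv * b) - de * (b * ru - a * rv).
  by apply: (eq_of_sub h1); ring.
have ex : x = tu + (- c * (- (lu * a - lv * b) - de * (b * ru - a * rv)) + a * (lu * c - lv * d)) / (a * d - b * c).
  by rewrite -h1' -h2; field.
have ey : y = tv + (b * (lu * c - lv * d) - d * (- (lu * a - lv * b) - de * (b * ru - a * rv))) / (a * d - b * c).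
  by rewrite -h1' -h2; field.
by rewrite ex ey; split; field; apply/andP.
Qed.

End pointwise.

(** * Division by the square root of the norm of k^2 - 1 *)

Section sqrt_factor.
Variables (R : realType) (O : set (plane R)).
Hypothesis openO : open O.
Variable k : plane R -> R.
Hypothesis sk : smooth O k.
Hypothesis k1 : forall p, O p -> k p != 1.
Hypothesis k2 : forall p, O p -> k p != -1.
Implicit Types (g : plane R -> R) (p w : plane R).

Lemma sqrB1_neq0 p : O p -> k p ^+ 2 - 1 != 0.
Proof.
move=> Op; rewrite subr_sqr_1 mulf_neq0 ?subr_eq0 ?k1//.
by rewrite addr_eq0 k2.
Qed.

Let sk1 : smooth O (fun p => k p - 1).
Proof. by apply: smoothB => //; exact: smooth_cst. Qed.

Let sk2 : smooth O (fun p => k p + 1).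
Proof. by apply: smoothD => //; exact: smooth_cst. Qed.

Let k1' p : O p -> k p - 1 != 0. Proof. by move=> Op; rewrite subr_eq0 k1. Qed.
Let k2' p : O p -> k p + 1 != 0. Proof. by move=> Op; rewrite addr_eq0 k2. Qed.

Lemma smooth_sqrB1 : smooth O (fun p => k p ^+ 2 - 1).
Proof.
apply: (smooth_ext openO _ (smoothM openO sk1 sk2)) => p Op.
by rewrite subr_sqr_1.
Qed.

Lemma smooth_sqrt_factor : smooth O (fun p => Num.sqrt `|k p ^+ 2 - 1|).
Proof. by apply: (smooth_sqrt_norm openO smooth_sqrB1) => p Op; exact: sqrB1_neq0. Qed.

Lemma sqrt_factor_gt0 p : O p -> 0 < Num.sqrt `|k p ^+ 2 - 1|.
Proof. by move=> Op; rewrite sqrtr_gt0 normr_gt0 sqrB1_neq0. Qed.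

Lemma sqrt_factor_neq0 p : O p -> Num.sqrt `|k p ^+ 2 - 1| != 0.
Proof. by move=> Op; rewrite gt_eqF ?sqrt_factor_gt0. Qed.

Lemma smooth_over_sqrt g : smooth O g ->
  smooth O (fun q => g q / Num.sqrt `|k q ^+ 2 - 1|).
Proof. by move=> sg; exact: (smooth_div openO sg smooth_sqrt_factor sqrt_factor_neq0). Qed.

Lemma derive_ln_norm (f : plane R -> R) p w : smooth O f -> (forall q, O q -> f q != 0) -> O p ->
  'D_w (fun q => ln `|f q|) p = (f p)^-1 * 'D_w f p.
Proof.
move=> sf f0 Op; apply: derive_val.
exact: (is_derive_comp1 w (is_derive_ln_norm (f0 p Op)) (smooth_differentiable sf Op)).
Qed.

Let tfun_ln q : O q -> tfun k q = 2^-1 * (ln `|k q - 1| - ln `|k q + 1|).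
Proof.
move=> Oq; rewrite /tfun normrM normfV lnM ?posrE ?invr_gt0 ?normr_gt0 ?k1' ?k2'//.
by rewrite lnV ?posrE ?normr_gt0 ?k2'.
Qed.

Lemma smooth_tfun : smooth O (tfun k).
Proof.
apply: (smooth_ext openO (fun q Oq => esym (tfun_ln Oq))).
by apply: (smoothZ openO); apply: smoothB => //; apply: smooth_ln_norm.
Qed.

Lemma derive_tfun p w : O p -> 'D_w k p = (k p ^+ 2 - 1) * 'D_w (tfun k) p.
Proof.
move=> Op; have sl1 := smooth_ln_norm openO sk1 k1'; have sl2 := smooth_ln_norm openO sk2 k2'.
have d1 := derive_ln_norm w sk1 k1' Op; have d2 := derive_ln_norm w sk2 k2' Op.
have s1 : smooth O (fun=> 1 : R) by exact: smooth_cst.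
have c0 : 'D_w (fun=> 1 : R) p = 0 by exact: (derive_cst (1 : R)).
have e1 : 'D_w (fun q => k q - 1) p = 'D_w k p.
  have sN1 : smooth O (fun=> - 1 : R) by exact: smooth_cst.
  have c1 : 'D_w (fun=> - 1 : R) p = 0 by exact: (derive_cst (- 1 : R)).
  exact: (etrans (smooth_deriveD w sk sN1 Op) (etrans (congr1 _ c1) (addr0 _))).
have e2 : 'D_w (fun q => k q + 1) p = 'D_w k p.
  exact: (etrans (smooth_deriveD w sk s1 Op) (etrans (congr1 _ c0) (addr0 _))).
have dB : 'D_w (fun q => ln `|k q - 1| - ln `|k q + 1|) p =
    'D_w (fun q => ln `|k q - 1|) p - 'D_w (fun q => ln `|k q + 1|) p.
  by apply: derive_val; apply: is_deriveB; exact: smooth_is_derive.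
have t1 := etrans (derive_ext w openO tfun_ln Op)
  (smooth_deriveZ openO (2^-1) w (smoothB openO sl1 sl2) Op).
have alg (T L L1 L2 K K1 K2 x : R) : x - 1 != 0 -> x + 1 != 0 ->
    T = 2^-1 * L -> L = L1 - L2 -> L1 = (x - 1)^-1 * K1 -> L2 = (x + 1)^-1 * K2 ->
    K1 = K -> K2 = K -> K = (x ^+ 2 - 1) * T.
  by move=> h1 h2 -> -> -> -> -> ->; field; apply/andP.
exact: (alg _ _ _ _ _ _ _ _ (k1' Op) (k2' Op) t1 dB d1 d2 e1 e2).
Qed.

(** The square root is written as an exponential, so that its derivative needs
    no case distinction on the sign of k^2 - 1. *)
Lemma derive_inv_sqrt p w : O p ->
  'D_w (fun q => (Num.sqrt `|k q ^+ 2 - 1|)^-1) p =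
  - (k p * 'D_w (tfun k) p) / Num.sqrt `|k p ^+ 2 - 1|.
Proof.
move=> Op; have om0 q (Oq : O q) := sqrB1_neq0 Oq.
pose h q := - 2^-1 * ln `|k q ^+ 2 - 1|.
have inv q : O q -> (Num.sqrt `|k q ^+ 2 - 1|)^-1 = expR (h q).
  by move=> Oq; rewrite sqrt_norm_expR ?om0// /h mulNr expRN.
have sl := smooth_ln_norm openO smooth_sqrB1 om0.
have sh : smooth O h by exact: smoothZ.
have d1 := derive_ext w openO inv Op.
have d2 : 'D_w (fun q => expR (h q)) p = expR (h p) * 'D_w h p.
  apply: derive_val.
  exact: (is_derive_comp1 w (is_derive_expR (h p)) (smooth_differentiable sh Op)).
have d3 := smooth_deriveZ openO (- 2^-1) w sl Op.
have d4 := derive_ln_norm w smooth_sqrB1 om0 Op.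
have d5 : 'D_w (fun q => k q ^+ 2 - 1) p = 2 * k p * 'D_w k p.
  have := derive_ext w openO (f := fun q => k q ^+ 2 - 1) (g := fun q => k q * k q + - 1)
    (fun q _ => erefl) Op.
  have sN1 : smooth O (fun=> - 1 : R) by exact: smooth_cst.
  have c1 : 'D_w (fun=> - 1 : R) p = 0 by exact: (derive_cst (- 1 : R)).
  have e1 := smooth_deriveD w (smoothM openO sk sk) sN1 Op.
  have e2 := smooth_deriveM w sk sk Op.
  have alg (A B C K x : R) : A = B + C -> B = K * x + x * K -> C = 0 -> A = 2 * x * K.
    by move=> -> -> ->; ring.
  by move=> ->; exact: (alg _ _ _ _ _ e1 e2 c1).
have d6 := derive_tfun w Op.
have alg (D e H L M K T x o : R) : o != 0 -> D = e * H -> H = - 2^-1 * L -> L = o^-1 * M ->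
    M = 2 * x * K -> K = o * T -> D = - (x * T) * e.
  by move=> o0 -> -> -> -> ->; field.
rewrite inv//.
exact: (alg _ _ _ _ _ _ _ _ _ (om0 p Op) (etrans d1 d2) d3 d4 d5 d6).
Qed.

Lemma derive_over_sqrt g p w : smooth O g -> O p ->
  'D_w (fun q => g q / Num.sqrt `|k q ^+ 2 - 1|) p =
  ('D_w g p - k p * 'D_w (tfun k) p * g p) / Num.sqrt `|k p ^+ 2 - 1|.
Proof.
move=> sg Op; have si := smoothV openO smooth_sqrt_factor sqrt_factor_neq0.
have e1 := smooth_deriveM w sg si Op; have e2 := derive_inv_sqrt w Op.
have alg (D a b x y s : R) : D = a / s + x * b -> b = - y / s -> D = (a - y * x) / s.
  by move=> -> ->; ring.
exact: (alg _ _ _ _ _ _ e1 e2).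
Qed.

Lemma derive_scaled_over_sqrt g p w : smooth O g -> O p ->
  'D_w (fun q => k q * (g q / Num.sqrt `|k q ^+ 2 - 1|)) p =
  (k p * 'D_w g p - 'D_w (tfun k) p * g p) / Num.sqrt `|k p ^+ 2 - 1|.
Proof.
move=> sg Op.
have e1 := smooth_deriveM w sk (smooth_over_sqrt sg) Op.
have e2 := derive_over_sqrt w sg Op; have e3 := derive_tfun w Op.
have alg (D K G dg T x y s : R) : D = K * (x / s) + y * G -> G = (dg - y * T * x) / s ->
    K = (y ^+ 2 - 1) * T -> D = (y * dg - T * x) / s.
  by move=> -> -> ->; ring.
exact: (alg _ _ _ _ _ _ _ _ e1 e2 e3).
Qed.

End sqrt_factor.

(** * The Codazzi equations in terms of a potential *)

Section signed_codazzi.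
Variables (R : realType) (L0 : R) (O : set (plane R)).
Hypothesis openO : open O.
Variables (D : coeffs R) (s : R) (k f : plane R -> R).
Hypothesis sign_s : s = 1 \/ s = -1.
Hypothesis data : signed_data s O D k f.
Hypothesis k1 : forall p, O p -> k p != 1.
Hypothesis k2 : forall p, O p -> k p != -1.
Variable lam : plane R -> R.

Let sk : smooth O k. Proof. by case: data. Qed.
Let sf : smooth O f. Proof. by case: data. Qed.

Let XE p : O p -> Xpm s D p = s * (dv f p / Num.sqrt `|k p ^+ 2 - 1|).
Proof. by move=> Op; case: data => _ _ _ /(_ p Op)[]. Qed.
Let YE p : O p -> Ypm s D p = du f p / Num.sqrt `|k p ^+ 2 - 1|.
Proof. by move=> Op; case: data => _ _ _ /(_ p Op)[]. Qed.
Let WE p : O p -> Wpm s D p = k p * (du f p / Num.sqrt `|k p ^+ 2 - 1|).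
Proof. by move=> Op; case: data => _ _ /(_ p Op)[-> _] _; rewrite YE. Qed.
Let ZE p : O p -> Zpm s D p = s * (k p * (dv f p / Num.sqrt `|k p ^+ 2 - 1|)).
Proof. by move=> Op; case: data => _ _ /(_ p Op)[_ ->] _; rewrite XE// mulrCA. Qed.

Let su : smooth O (fun q => du f q / Num.sqrt `|k q ^+ 2 - 1|).
Proof. exact: (smooth_over_sqrt openO sk k1 k2 (smooth_du sf)). Qed.
Let sv : smooth O (fun q => dv f q / Num.sqrt `|k q ^+ 2 - 1|).
Proof. exact: (smooth_over_sqrt openO sk k1 k2 (smooth_dv sf)). Qed.

Lemma smooth_Xpm : smooth O (Xpm s D).
Proof. by apply: (smooth_ext openO (fun p Op => esym (XE Op))); exact: smoothZ. Qed.
Lemma smooth_Ypm : smooth O (Ypm s D).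
Proof. by apply: (smooth_ext openO (fun p Op => esym (YE Op))). Qed.
Lemma smooth_Wpm : smooth O (Wpm s D).
Proof. by apply: (smooth_ext openO (fun p Op => esym (WE Op))); exact: smoothM. Qed.
Lemma smooth_Zpm : smooth O (Zpm s D).
Proof.
apply: (smooth_ext openO (fun p Op => esym (ZE Op))).
by apply: (smoothZ openO); exact: smoothM.
Qed.

Section derivatives.
Variables (p : plane R) (Op : O p).

Let sq := Num.sqrt `|k p ^+ 2 - 1|.

Lemma du_Xpm : du (Xpm s D) p =
  s * ((du (dv f) p - k p * du (tfun k) p * dv f p) / sq).
Proof.
have e1 := etrans (derive_ext (1, 0) openO XE Op) (smooth_deriveZ openO s (1, 0) sv Op).
exact: (etrans e1 (congr1 _ (derive_over_sqrt openO sk k1 k2 (1, 0) (smooth_dv sf) Op))).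
Qed.

Lemma dv_Ypm : dv (Ypm s D) p = (dv (du f) p - k p * dv (tfun k) p * du f p) / sq.
Proof.
have e1 := derive_ext (0, 1) openO YE Op.
exact: (etrans e1 (derive_over_sqrt openO sk k1 k2 (0, 1) (smooth_du sf) Op)).
Qed.

Lemma dv_Wpm : dv (Wpm s D) p = (k p * dv (du f) p - dv (tfun k) p * du f p) / sq.
Proof.
have e1 := derive_ext (0, 1) openO WE Op.
exact: (etrans e1 (derive_scaled_over_sqrt openO sk k1 k2 (0, 1) (smooth_du sf) Op)).
Qed.

Lemma du_Zpm : du (Zpm s D) p =
  s * ((k p * du (dv f) p - du (tfun k) p * dv f p) / sq).
Proof.
have e1 := etrans (derive_ext (1, 0) openO ZE Op)
  (smooth_deriveZ openO s (1, 0) (smoothM openO sk sv) Op).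
exact: (etrans e1 (congr1 _ (derive_scaled_over_sqrt openO sk k1 k2 (1, 0) (smooth_dv sf) Op))).
Qed.

(** The second Codazzi equation in terms of the potential f: the derivatives
    of the square root and the second derivatives of f cancel, and only the
    derivatives of t survive. *)
Lemma codazzi_potential (m1 m2 : R) :
  (du (Zpm s D) p - s * dv (Wpm s D) p + du lam p * Ypm s D p
     - s * dv lam p * Xpm s D p - s * m2 * Ypm s D p + m1 * Xpm s D p = 0) <->
  (dv f p * (m1 - du (tfun k) p) - du f p * (m2 - dv (tfun k) p) =
   - s * (du lam p * du f p - dv lam p * dv f p)).
Proof.
have e1 := du_Zpm; have e2 := dv_Wpm; have e3 := XE Op; have e4 := YE Op.
have e5 := du_dvC openO sf Op; have s0 := sqrt_factor_neq0 k1 k2 Op.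
have ss := sign_sqr sign_s.
have alg (Zu Wv Y X r lu lv x fu fv fuv fvu tu tv : R) : r != 0 ->
    Zu = s * ((x * fuv - tu * fv) / r) -> Wv = (x * fvu - tv * fu) / r ->
    X = s * (fv / r) -> Y = fu / r -> fuv = fvu ->
    (Zu - s * Wv + lu * Y - s * lv * X - s * m2 * Y + m1 * X = 0) <->
    (fv * (m1 - tu) - fu * (m2 - tv) = - s * (lu * fu - lv * fv)).
  move=> r0 -> -> -> -> ->.
  rewrite (_ : _ - _ + _ - _ - _ + _ = s / r * (fv * (m1 - tu) - fu * (m2 - tv)
     + s * (lu * fu - lv * fv)) + (1 - s * s) * (lu * fu) / r); last by field.
  rewrite ss subrr !mul0r addr0; split=> [/eqP|->]; last by rewrite mulNr addNr mulr0.
  rewrite mulf_eq0 mulf_eq0 invr_eq0 (negPf r0) (negPf (sign_neq0 sign_s)) /= addr_eq0.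
  by move/eqP => ->; rewrite mulNr.
exact: (alg _ _ _ _ _ _ _ _ _ _ _ _ _ _ s0 e1 e2 e3 e4 e5).
Qed.

(** The first Codazzi equation is the same relation multiplied by k. *)
Lemma codazzi_potential_dual (m1 m2 : R) :
  dv f p * (m1 - du (tfun k) p) - du f p * (m2 - dv (tfun k) p) =
   - s * (du lam p * du f p - dv lam p * dv f p) ->
  dv (Ypm s D) p - s * du (Xpm s D) p - s * du lam p * Wpm s D p
     + dv lam p * Zpm s D p + m2 * Wpm s D p - s * m1 * Zpm s D p = 0.
Proof.
have e1 := du_Xpm; have e2 := dv_Ypm; have e3 := WE Op; have e4 := ZE Op.
have e5 := du_dvC openO sf Op; have s0 := sqrt_factor_neq0 k1 k2 Op.
have ss := sign_sqr sign_s.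
have alg (Xu Yv W Z r lu lv x fu fv fuv fvu tu tv : R) : r != 0 ->
    Xu = s * ((fuv - x * tu * fv) / r) -> Yv = (fvu - x * tv * fu) / r ->
    W = x * (fu / r) -> Z = s * (x * (fv / r)) -> fuv = fvu ->
    fv * (m1 - tu) - fu * (m2 - tv) = - s * (lu * fu - lv * fv) ->
    Yv - s * Xu - s * lu * W + lv * Z + m2 * W - s * m1 * Z = 0.
  move=> r0 -> -> -> -> -> h.
  rewrite (_ : _ - _ - _ + _ + _ - _ = (1 - s * s) * (fvu - x * tv * fu + m2 * x * fu) / r
    - x / r * (s * s * (fv * (m1 - tu) - fu * (m2 - tv)) + s * (lu * fu - lv * fv))); last by field.
  by rewrite ss subrr !mul0r mul1r h mulNr addNr mulr0 subr0.
exact: (alg _ _ _ _ _ _ _ _ _ _ _ _ _ _ s0 e1 e2 e3 e4 e5).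
Qed.

End derivatives.
End signed_codazzi.

(** * Characterization by the structure equations *)

Section smooth_coeffs.
Variables (R : realType) (O : set (plane R)).
Hypothesis openO : open O.
Variables (D : coeffs R) (kp km fp fm : plane R -> R).
Hypothesis dp : signed_data 1 O D kp fp.
Hypothesis dm : signed_data (-1) O D km fm.
Hypothesis kp1 : forall p, O p -> kp p != 1.
Hypothesis kp2 : forall p, O p -> kp p != -1.
Hypothesis km1 : forall p, O p -> km p != 1.
Hypothesis km2 : forall p, O p -> km p != -1.

Let half_sum (g h1 h2 : plane R -> R) : smooth O h1 -> smooth O h2 ->
  (forall p, g p = 2^-1 * (h1 p + h2 p)) -> smooth O g.
Proof.
move=> s1 s2 e; apply: (smooth_ext openO (fun p _ => esym (e p))).
by apply: (smoothZ openO); exact: smoothD.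
Qed.

Let half_diff (g h1 h2 : plane R -> R) : smooth O h1 -> smooth O h2 ->
  (forall p, g p = 2^-1 * (h1 p - h2 p)) -> smooth O g.
Proof.
move=> s1 s2 e; apply: (smooth_ext openO (fun p _ => esym (e p))).
by apply: (smoothZ openO); exact: smoothB.
Qed.

Lemma smooth_coeffs :
  [/\ smooth O (al1 D), smooth O (al2 D) & smooth O (al3 D)] /\
  [/\ smooth O (be1 D), smooth O (be2 D) & smooth O (be3 D)].
Proof.
have Xp := smooth_Xpm openO dp kp1 kp2; have Xm := smooth_Xpm openO dm km1 km2.
have Yp := smooth_Ypm openO dp kp1 kp2; have Ym := smooth_Ypm openO dm km1 km2.
have Wp := smooth_Wpm openO dp kp1 kp2; have Wm := smooth_Wpm openO dm km1 km2.
have Zp := smooth_Zpm openO dp kp1 kp2; have Zm := smooth_Zpm openO dm km1 km2.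
split; split.
- by apply: (half_diff Yp Ym) => p; rewrite /Ypm; field.
- by apply: (half_sum Xp Xm) => p; rewrite /Xpm; field.
- by apply: (half_diff Zp Zm) => p; rewrite /Zpm; field.
- by apply: (half_diff Wp Wm) => p; rewrite /Wpm; field.
- by apply: (half_sum Yp Ym) => p; rewrite /Ypm; field.
- by apply: (half_diff Xp Xm) => p; rewrite /Xpm; field.
Qed.

End smooth_coeffs.

Section null_relations.
Variables (R : realType) (O : set (plane R)) (D : coeffs R) (kp km fp fm : plane R -> R).
Hypothesis dp : signed_data 1 O D kp fp.
Hypothesis dm : signed_data (-1) O D km fm.
Variables (p : plane R) (Op : O p).
Let s := Num.sqrt `|kp p ^+ 2 - 1|.
Let r := Num.sqrt `|km p ^+ 2 - 1|.

Lemma signed_values :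
  [/\ Xpm 1 D p = dv fp p / s, Ypm 1 D p = du fp p / s,
      Xpm (-1) D p = - (dv fm p / r) & Ypm (-1) D p = du fm p / r].
Proof.
case: dp => _ _ _ /(_ p Op)[h1 h2]; case: dm => _ _ _ /(_ p Op)[h3 h4].
by split=> //; [rewrite h1 mul1r|rewrite h3 mulN1r].
Qed.

Lemma signed_relations :
  Xpm 1 D p + Xpm (-1) D p = kp p * Ypm 1 D p + km p * Ypm (-1) D p /\
  Ypm 1 D p + Ypm (-1) D p = kp p * Xpm 1 D p + km p * Xpm (-1) D p.
Proof.
case: dp => _ _ /(_ p Op)[<- <-] _; case: dm => _ _ /(_ p Op)[<- <-] _.
by rewrite /Xpm /Ypm /Wpm /Zpm; split; ring.
Qed.

Lemma null_relations :
  (kp p + 1) * ((du fp p - dv fp p) / s) = - ((km p + 1) * ((du fm p + dv fm p) / r)) /\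
  (kp p - 1) * ((du fp p + dv fp p) / s) = - ((km p - 1) * ((du fm p - dv fm p) / r)).
Proof.
have [h1 h2] := signed_relations; have [e1 e2 e3 e4] := signed_values.
exact: (null_compatibility h1 h2 e1 e2 e3 e4).
Qed.

End null_relations.

(** The product of the two null relations, with the absolute values resolved by
    the sign e of (k^2 - 1) (l^2 - 1). *)
Lemma null_product (R : realType) (k l s r P Q P' Q' e : R) :
  k != 1 -> k != -1 -> l != 1 -> l != -1 -> e = 1 \/ e = -1 ->
  s = Num.sqrt `|k ^+ 2 - 1| -> r = Num.sqrt `|l ^+ 2 - 1| ->
  (k + 1) * (P / s) = - ((l + 1) * (P' / r)) ->
  (k - 1) * (Q / s) = - ((l - 1) * (Q' / r)) ->
  0 < e * ((k ^+ 2 - 1) * (l ^+ 2 - 1)) -> P' * Q' = e * (P * Q).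
Proof.
move=> k1 k2 l1 l2 he hs hr h1 h2 xy.
have x0 : k ^+ 2 - 1 != 0 by rewrite subr_sqr_1 mulf_neq0 ?subr_eq0// addr_eq0.
have y0 : l ^+ 2 - 1 != 0 by rewrite subr_sqr_1 mulf_neq0 ?subr_eq0// addr_eq0.
have s2 : s ^+ 2 = `|k ^+ 2 - 1| by rewrite hs sqr_sqrtr.
have r2 : r ^+ 2 = `|l ^+ 2 - 1| by rewrite hr sqr_sqrtr.
have s0 : s != 0 by rewrite hs gt_eqF// sqrtr_gt0 normr_gt0.
have r0 : r != 0 by rewrite hr gt_eqF// sqrtr_gt0 normr_gt0.
have sr : s ^+ 2 * r ^+ 2 = e * ((k ^+ 2 - 1) * (l ^+ 2 - 1)).
  rewrite s2 r2 -normrM -(gtr0_norm xy) [RHS]normrM.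
  by case: he => ->; rewrite ?normrN1 ?normr1 mul1r.
have x2 : s ^+ 2 * s ^+ 2 = (k ^+ 2 - 1) ^+ 2 by rewrite s2 -expr2 real_normK ?num_real.
have hh : (k ^+ 2 - 1) * (P * Q) * r ^+ 2 = (l ^+ 2 - 1) * (P' * Q') * s ^+ 2.
  have e1 : (k + 1) * P * r = - ((l + 1) * P' * s).
    by move: h1 => /(congr1 (fun z => z * (s * r))); rewrite /= => h; apply: (eq_of_sub h); field; apply/andP.
  have e2 : (k - 1) * Q * r = - ((l - 1) * Q' * s).
    by move: h2 => /(congr1 (fun z => z * (s * r))); rewrite /= => h; apply: (eq_of_sub h); field; apply/andP.
  transitivity (((k + 1) * P * r) * ((k - 1) * Q * r)); first by ring.
  by rewrite e1 e2; ring.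
apply: (mulfI y0); apply: (mulfI (expf_neq0 2 x0)).
rewrite -x2.
transitivity (s ^+ 2 * ((l ^+ 2 - 1) * (P' * Q') * s ^+ 2)); first by ring.
rewrite -hh.
transitivity ((k ^+ 2 - 1) * (P * Q) * (s ^+ 2 * r ^+ 2)); first by ring.
by rewrite sr x2; ring.
Qed.

Lemma constant_sign (R : realType) (O : set (plane R)) (g : plane R -> R) :
  propagates O -> smooth O g -> (forall p, O p -> g p != 0) ->
  exists2 e : R, e = 1 \/ e = -1 & forall p, O p -> 0 < e * g p.
Proof.
move=> prop sg g0.
have [[p0 Op0]|noO] := pselect (exists p, O p); last first.
  by exists 1; [left|move=> p Op; exfalso; apply: noO; exists p].
have [gp|gp|/eqP] := ltgtP (g p0) 0; last by rewrite (negPf (g0 _ Op0)).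
  exists (-1); [by right|move=> p Op; rewrite mulN1r].
  apply: (propagates_sign (g := fun q => - g q) prop _ _ Op0 Op).
  - by move=> x Ox; apply: cvgN; exact: smooth_continuous sg Ox.
  - by move=> x Ox; rewrite oppr_eq0 g0.
  - by rewrite oppr_gt0.
exists 1; [by left|move=> p Op; rewrite mul1r].
by apply: (propagates_sign prop _ g0 Op0 Op gp) => x Ox; exact: smooth_continuous sg Ox.
Qed.

Section ratio.
Variables (R : realType) (delta : R).
Hypothesis hde : delta = 1 \/ delta = -1.

(** The number m with P' = e m P and Q' = Q / m for the null derivatives P, Q
    of f_+ and P', Q' of f_-. *)
Definition ratio (x : R) : R := delta * expR (delta * x).

Lemma ratio_neq0 x : ratio x != 0.
Proof. by apply: mulf_neq0; [exact: sign_neq0|rewrite gt_eqF ?expR_gt0]. Qed.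

Lemma ratioV x : delta * expR (- (delta * x)) = (ratio x)^-1.
Proof.
rewrite /ratio invfM expRN; congr (_ * _).
by case: hde => ->; rewrite ?invr1 ?invrN1.
Qed.

Lemma ln_ratio x : ln `|ratio x| = delta * x.
Proof. by rewrite /ratio normrM (gtr0_norm (expR_gt0 _)) (sign_norm hde) mul1r expRK. Qed.

Lemma ratio_relations (O : set (plane R)) (rho fp fm : plane R -> R) :
  (forall p, O p ->
     du fm p = delta * cosh (rho p) * du fp p + sinh (rho p) * - dv fp p /\
     dv fm p = sinh (rho p) * du fp p + delta * cosh (rho p) * - dv fp p)
  \/
  (forall p, O p ->
     du fm p = delta * cosh (rho p) * dv fp p + sinh (rho p) * - du fp p /\
     dv fm p = sinh (rho p) * dv fp p + delta * cosh (rho p) * - du fp p) ->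
  exists2 e : R, e = 1 \/ e = -1 & forall p, O p ->
    du fm p + dv fm p = e * (ratio (rho p) * (du fp p - dv fp p)) /\
    du fm p - dv fm p = (ratio (rho p))^-1 * (du fp p + dv fp p).
Proof.
case=> iv; [exists 1; first by left|exists (-1); first by right]; move=> p Op; have := iv p Op.
  move=> /null_coordinates; rewrite (hyperbolicD _ hde) (hyperbolicB _ hde) ratioV => -[k1 k2].
  by split=> //; exact: (etrans k1 (esym (mul1r _))).
move=> /null_coordinates_swapped; rewrite (hyperbolicD _ hde) (hyperbolicB _ hde) ratioV => -[k1 k2].
by split=> //; exact: (etrans k1 (esym (mulN1r _))).
Qed.

End ratio.

Section characterization.
Variables (R : realType) (L0 : R) (O : set (plane R)).
Variables (F N1 N2 : plane R -> 'rV[R]_(ambient_dim L0)).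
Variables (lam gam kp km fp fm : plane R -> R) (D : coeffs R).
Hypothesis openO : open O.
Hypothesis at_ : attached O F lam N1 N2 D gam kp km fp fm.

Let conf : conformal_immersion O F lam. Proof. by case: at_. Qed.
Let nf : normal_frame O F lam N1 N2. Proof. by case: at_. Qed.
Let dp : signed_data 1 O D kp fp. Proof. by case: at_. Qed.
Let dm : signed_data (-1) O D km fm. Proof. by case: at_. Qed.
Let slam : smooth O lam. Proof. by case: conf. Qed.

Lemma gauss_equation p : O p -> gauss_curvature (metric F) p = L0 ->
  du (du lam) p - dv (dv lam) p + L0 * expR (2 * lam p) = 0.
Proof.
move=> Op; have e := gauss_curvature_conformal openO conf Op.
have E0 : expR (2 * lam p) != 0 by rewrite gt_eqF ?expR_gt0.
have alg (K x y : R) : y != 0 -> K = - (x / y) -> K = L0 -> x + L0 * y = 0.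
  by move=> y0 -> <-; rewrite mulNr divfK// subrr.
exact: alg E0 e.
Qed.

Section regular.
Hypothesis kp1 : forall p, O p -> kp p != 1.
Hypothesis kp2 : forall p, O p -> kp p != -1.
Hypothesis km1 : forall p, O p -> km p != 1.
Hypothesis km2 : forall p, O p -> km p != -1.

(** The Codazzi equations enter only through these relations. *)
Lemma connection_equation s k f p : s = 1 \/ s = -1 -> signed_data s O D k f ->
  (forall q, O q -> k q != 1) -> (forall q, O q -> k q != -1) -> O p ->
  dv f p * (du gam p - du (tfun k) p) - du f p * (dv gam p - dv (tfun k) p) =
   - s * (du lam p * du f p - dv lam p * dv f p).
Proof.
move=> hs ds h1 h2 Op.
have fe : frame_equations O F lam N1 N2 D.
  by apply: (attached_frame_equations openO conf nf); case: at_.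
have [[s1 s2 s3] [t1 t2 t3]] := smooth_coeffs openO dp dm kp1 kp2 km1 km2.
have c1 := codazzi1 openO conf nf fe s2 s3 Op.
have c2 := codazzi2 openO conf nf fe t1 t2 Op.
have [-> ->] : du gam p = mu1 D p /\ dv gam p = mu2 D p by case: at_ => _ _ _ _ + _ _; apply.
apply/(codazzi_potential openO hs ds h1 h2 lam Op).
have dZ : du (Zpm s D) p = du (be2 D) p + s * du (al3 D) p.
  exact: (etrans (smooth_deriveD (1, 0) t2 (smoothZ openO s s3) Op)
    (congr1 _ (smooth_deriveZ openO s (1, 0) s3 Op))).
have dW : dv (Wpm s D) p = dv (al2 D) p + s * dv (be1 D) p.
  exact: (etrans (smooth_deriveD (0, 1) s2 (smoothZ openO s t1) Op)
    (congr1 _ (smooth_deriveZ openO s (0, 1) t1 Op))).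
have alg (Zu Wv a3u a2v b2u b1v a1 a2 b2 b3 lu lv m1 m2 : R) :
    Zu = b2u + s * a3u -> Wv = a2v + s * b1v ->
    a3u - a2v + a1 * lu - a2 * lv - m2 * b2 + m1 * b3 = 0 ->
    b2u - b1v + b2 * lu - b3 * lv - m2 * a1 + m1 * a2 = 0 ->
    Zu - s * Wv + lu * (b2 + s * a1) - s * lv * (a2 + s * b3) - s * m2 * (b2 + s * a1)
      + m1 * (a2 + s * b3) = 0.
  move=> -> -> h3 h4; have ss := sign_sqr hs.
  rewrite (_ : _ - _ + _ - _ - _ + _ =
    s * (a3u - a2v + a1 * lu - a2 * lv - m2 * b2 + m1 * b3)
    + (b2u - b1v + b2 * lu - b3 * lv - m2 * a1 + m1 * a2)
    + (1 - s * s) * (b1v + lv * b3 + m2 * a1)); last by ring.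
  by rewrite h3 h4 ss subrr mulr0 mul0r !addr0.
exact: (alg _ _ _ _ _ _ _ _ _ _ _ _ _ _ dZ dW c1 c2).
Qed.

End regular.

(** The ratio P' / P of null derivatives never vanishes; up to the sign e it is
    delta e^(delta rho), which defines delta and rho. *)
Lemma frame_to_structure : connected O ->
  (forall p, O p -> gauss_curvature (metric F) p = L0) ->
  (forall p, O p ->
      [/\ kp p != 0 /\ km p != 0, kp p != 1 /\ km p != 1,
          kp p != -1 /\ km p != -1 &
          Xpm 1 D p ^+ 2 * Ypm (-1) D p ^+ 2
          - Xpm (-1) D p ^+ 2 * Ypm 1 D p ^+ 2 != 0]) ->
  exists (delta : R) (rho : plane R -> R),
     [/\ delta = 1 \/ delta = -1, smooth O rho,
         structure_equations L0 O delta lam gam (tfun km) rho fp fm &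
         forall p, O p -> tfun km p != delta * rho p].
Proof.
move=> connO gauss reg; have prop := connected_propagates openO connO.
have kp0 p : O p -> kp p != 0 by case/reg => [[]].
have km0 p : O p -> km p != 0 by case/reg => [[]].
have kp1 p : O p -> kp p != 1 by case/reg => _ [].
have km1 p : O p -> km p != 1 by case/reg => _ [].
have kp2 p : O p -> kp p != -1 by case/reg => _ _ [].
have km2 p : O p -> km p != -1 by case/reg => _ _ [].
have skp : smooth O kp by case: dp.
have skm : smooth O km by case: dm.
have sfp : smooth O fp by case: dp.
have sfm : smooth O fm by case: dm.
have s0 p : O p -> Num.sqrt `|kp p ^+ 2 - 1| != 0 by exact: sqrt_factor_neq0.
have r0 p : O p -> Num.sqrt `|km p ^+ 2 - 1| != 0 by exact: sqrt_factor_neq0.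
have AA p : O p -> Defs.coefA fp fm p * coefA' fp fm p != 0.
  move=> Op; have [_ _ _ h] := reg p Op; have [e1 e2 e3 e4] := signed_values dp dm Op.
  by rewrite -(norm_quadratic (s0 p Op) (r0 p Op) e1 e2 e3 e4).
have nulls p : O p -> [/\ du fp p - dv fp p != 0, du fp p + dv fp p != 0,
    du fm p + dv fm p != 0 & du fm p - dv fm p != 0].
  move=> Op; have [n1 n2] := null_relations dp dm Op.
  exact: (null_nonzero (s0 p Op) (r0 p Op) (kp1 p Op) (kp2 p Op) (km1 p Op) (km2 p Op)
    n1 n2 (AA p Op)).
have sprod : smooth O (fun p => (kp p ^+ 2 - 1) * (km p ^+ 2 - 1)).
  by apply: (smoothM openO); exact: smooth_sqrB1.
have prod0 p : O p -> (kp p ^+ 2 - 1) * (km p ^+ 2 - 1) != 0.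
  by move=> Op; apply: mulf_neq0; [exact: (sqrB1_neq0 kp1 kp2 Op)|exact: (sqrB1_neq0 km1 km2 Op)].
have [e he epos] := constant_sign prop sprod prod0.
pose m p := e * ((du fm p + dv fm p) / (du fp p - dv fp p)).
have e0 := sign_neq0 he; have ee := sign_sqr he.
have sm : smooth O m.
  apply: (smoothZ openO); apply: (smooth_div openO).
  - by apply: (smoothD openO); [exact: smooth_du|exact: smooth_dv].
  - by apply: (smoothB openO); [exact: smooth_du|exact: smooth_dv].
  - by move=> p /nulls[].
have m0 p : O p -> m p != 0.
  by move=> /nulls[h1 h2 h3 h4]; rewrite /m !mulf_neq0 ?invr_eq0.
have [de hde dpos] := constant_sign prop sm m0.
have de0 := sign_neq0 hde; have dede := sign_sqr hde.
pose rho p := de * ln `|m p|.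
have derho p : de * rho p = ln `|m p| by rewrite /rho mulrA dede mul1r.
have srho : smooth O rho by apply: (smoothZ openO); exact: smooth_ln_norm.
have mE p : O p -> de * expR (de * rho p) = m p.
  move=> Op; rewrite derho lnK ?posrE ?normr_gt0 ?m0//.
  have -> : `|m p| = de * m p.
    by rewrite -[RHS](gtr0_norm (dpos p Op)) (normrM de) (sign_norm hde) mul1r.
  by rewrite mulrA dede mul1r.
have miE p : O p -> de * expR (- (de * rho p)) = (m p)^-1.
  move=> Op; rewrite -(mE p Op) invfM expRN; congr (_ * _).
  by case: hde => ->; rewrite ?invr1 ?invrN1.
have nP p : O p -> du fm p + dv fm p = e * (m p * (du fp p - dv fp p)).
  move=> /nulls[h1 _ _ _]; rewrite /m.
  move: (du fm p + dv fm p) (du fp p - dv fp p) h1 => x y y0.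
  by rewrite mulrA mulrA ee mul1r divfK.
have nQ p : O p -> du fm p - dv fm p = (m p)^-1 * (du fp p + dv fp p).
  move=> Op; have [h1 h2 h3 h4] := nulls p Op; have [n1 n2] := null_relations dp dm Op.
  have h := null_product (kp1 p Op) (kp2 p Op) (km1 p Op) (km2 p Op) he erefl erefl n1 n2 (epos p Op).
  have alg (P Q P' Q' : R) : P != 0 -> P' != 0 -> P' * Q' = e * (P * Q) ->
      Q' = (e * (P' / P))^-1 * Q.
    move=> P0 P'0 h'; apply: (mulfI P'0); rewrite h'.
    have eV : e^-1 = e by apply: (mulfI e0); rewrite mulfV// ee.
    rewrite -[in LHS]eV; field; do ?[apply/andP; split=> //].
  exact: (alg _ _ _ _ h1 h3 h).
have trel p : O p -> tfun kp p = tfun km p - de * rho p.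
  move=> Op; have [h1 h2 h3 h4] := nulls p Op; have [n1 n2] := null_relations dp dm Op.
  rewrite derho; exact: (tval_relation (s0 p Op) (r0 p Op) (kp1 p Op) (kp2 p Op)
    (km1 p Op) (km2 p Op) n1 n2 h1 h2 (m0 p Op) he (nP p Op) (nQ p Op)).
have t0 k : k != 0 -> k != 1 -> k != -1 -> tval k != 0.
  by move=> h1 h2 h3; rewrite tval_eq0 (negPf h1) (negPf h2) (negPf h3).
exists de, rho; split=> //; last first.
  move=> p Op; rewrite -subr_eq0 -trel//.
  by apply: t0; [exact: kp0|exact: kp1|exact: kp2].
split.
- by move=> p Op; exact: (gauss_equation Op (gauss p Op)).
- by move=> p Op; apply: t0; [exact: km0|exact: km1|exact: km2].
- exact: AA.
- case: he => e1; [left|right] => p Op.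
    apply/null_coordinates; rewrite (hyperbolicD _ hde) (hyperbolicB _ hde).
    split; last exact: (etrans (nQ p Op) (congr1 (fun z => z * _) (esym (miE p Op)))).
    apply: etrans (nP p Op) _; rewrite e1 mul1r.
    exact: (congr1 (fun z => z * _) (esym (mE p Op))).
  apply/null_coordinates_swapped; rewrite (hyperbolicD _ hde) (hyperbolicB _ hde).
  split; last exact: (etrans (nQ p Op) (congr1 (fun z => z * _) (esym (miE p Op)))).
  apply: etrans (nP p Op) _; rewrite e1 mulN1r.
  exact: (congr1 (fun z => - (z * _)) (esym (mE p Op))).
- move=> p Op.
  have dtrel (w : plane R) : 'D_w (tfun kp) p = 'D_w (tfun km) p - de * 'D_w rho p.
    have st := smooth_tfun openO skm km1 km2.
    have d1 := derive_ext w openO trel Op.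
    have d2 : 'D_w (fun q => tfun km q - de * rho q) p = 'D_w (tfun km) p - 'D_w (fun q => de * rho q) p.
      apply: derive_val; apply: is_deriveB; apply: smooth_is_derive Op => //.
      exact: smoothZ.
    exact: (etrans d1 (etrans d2 (congr1 (fun z => _ - z) (smooth_deriveZ openO de w srho Op)))).
  have c1 := connection_equation kp1 kp2 km1 km2 (or_introl erefl) dp kp1 kp2 Op.
  have c2 := connection_equation kp1 kp2 km1 km2 (or_intror erefl) dm km1 km2 Op.
  have A0 : coefA' fp fm p != 0.
    by have := AA p Op; apply: contraNneq => ->; rewrite mulr0.
  apply/(solve_connection _ _ _ _ _ _ _ erefl erefl erefl erefl A0); split.
    have du_t := dtrel (1, 0); have dv_t := dtrel (0, 1).
    have alg (a b x y T1 T2 U1 U2 z : R) : b * (x - T1) - a * (y - T2) = - 1 * z ->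
      T1 = U1 -> T2 = U2 -> b * (x - U1) - a * (y - U2) = - z.
      by move=> + <- <- => ->; rewrite mulN1r.
    exact: (alg _ _ _ _ _ _ _ _ _ c1 du_t dv_t).
  have alg (x y : R) : x = - -1 * y -> x = y by move=> ->; rewrite opprK mul1r.
  exact: (alg _ _ c2).
Qed.

(** The argument is algebra at each point. If k_+ were 1 or -1, then X_+ and Y_+
    would vanish by the convention on division, hence also X_- and Y_-, and A. *)
Lemma structure_to_frame (delta : R) (rho : plane R -> R) :
  delta = 1 \/ delta = -1 ->
  structure_equations L0 O delta lam gam (tfun km) rho fp fm ->
  (forall p, O p -> tfun km p != delta * rho p) ->
  forall p, O p ->
      [/\ kp p != 0 /\ km p != 0, kp p != 1 /\ km p != 1,
          kp p != -1 /\ km p != -1 &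
          Xpm 1 D p ^+ 2 * Ypm (-1) D p ^+ 2
          - Xpm (-1) D p ^+ 2 * Ypm 1 D p ^+ 2 != 0].
Proof.
move=> hde [_ t0 AA iv _] tr p Op.
have [km0 km1 km2] : [/\ km p != 0, km p != 1 & km p != -1].
  by have := t0 p Op; rewrite -[tfun km p]/(tval (km p)) tval_eq0 !negb_or => /and3P[].
have r0 : Num.sqrt `|km p ^+ 2 - 1| != 0.
  rewrite gt_eqF// sqrtr_gt0 normr_gt0 subr_sqr_1 mulf_neq0 ?subr_eq0//.
  by rewrite addr_eq0.
have [e1 e2 e3 e4] := signed_values dp dm Op.
have [kp1 kp2] : kp p != 1 /\ kp p != -1.
  apply/andP; rewrite -negb_or; apply/negP => kp1.
  have k2 : kp p ^+ 2 = 1 by case/orP: kp1 => /eqP ->; rewrite ?sqrrN expr1n.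
  have sq0 : Num.sqrt `|kp p ^+ 2 - 1| = 0 by rewrite k2 subrr normr0 sqrtr0.
  have [h1 h2] := signed_relations dp dm Op.
  have h := AA p Op.
  have alg (Xp Xm Yp Ym a b c d k l s r : R) : Xp + Xm = k * Yp + l * Ym ->
      Yp + Ym = k * Xp + l * Xm ->
      Xp = b / s -> Yp = a / s -> Xm = - (d / r) -> Ym = c / r ->
      s = 0 -> r != 0 -> l != 1 -> l != -1 -> b * c + d * a = 0.
    move=> + + h3 h4 h5 h6 s0 r1 l1 l2; rewrite h3 h4 s0 invr0 !mulr0 !add0r => k3 k4.
    have l0 : l ^+ 2 - 1 != 0 by rewrite subr_sqr_1 mulf_neq0 ?subr_eq0// addr_eq0.
    have Y0 : Ym = 0.
      apply: (mulfI l0); rewrite mulr0 (_ : _ * Ym = l * (l * Ym) - Ym); last by ring.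
      by rewrite -k3 -k4 subrr.
    have X0 : Xm = 0 by rewrite k3 Y0 mulr0.
    have c0 : c = 0 by apply: (mulIf (_ : r^-1 != 0)); rewrite ?invr_eq0// -h6 Y0 mul0r.
    have d0 : d = 0.
      by apply: (mulIf (_ : r^-1 != 0)); rewrite ?invr_eq0// mul0r -[LHS]opprK -h5 X0 oppr0.
    by rewrite c0 d0 mulr0 mul0r addr0.
  have := alg _ _ _ _ _ _ _ _ _ _ _ _ h1 h2 e1 e2 e3 e4 sq0 r0 km1 km2 => A0.
  by move: h; rewrite /Defs.coefA A0 mul0r eqxx.
have s0 : Num.sqrt `|kp p ^+ 2 - 1| != 0.
  rewrite gt_eqF// sqrtr_gt0 normr_gt0 subr_sqr_1 mulf_neq0 ?subr_eq0//.
  by rewrite addr_eq0.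
have [n1 n2] := null_relations dp dm Op.
have [h1 h2 h3 h4] := null_nonzero s0 r0 kp1 kp2 km1 km2 n1 n2 (AA p Op).
have [e he /(_ p Op)[eP eQ]] := ratio_relations hde iv.
have trel := tval_relation s0 r0 kp1 kp2 km1 km2 n1 n2 h1 h2 (ratio_neq0 hde (rho p)) he eP eQ.
have kp0 : kp p != 0.
  have : tval (kp p) != 0 by rewrite trel (ln_ratio hde) subr_eq0; exact: tr.
  by rewrite tval_eq0 !negb_or => /and3P[].
split=> //.
by rewrite (norm_quadratic s0 r0 e1 e2 e3 e4); exact: AA.
Qed.

End characterization.

(** * The connection matrices and their flatness *)

(** The common shape of the two matrices of the Gauss-Weingarten system; rows
    and columns are indexed by F, T1, T2, N1, N2. *)
Definition connection_table (R : realType) (c1 c2 x y p q a b c d m : R) (i j : 'I_5) : R :=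
  nth 0 (nth [::]
    [:: [:: 0; c1; c2; 0; 0];
        [:: x; p; q; a; b];
        [:: y; q; p; c; d];
        [:: 0; - a; c; p; m];
        [:: 0; b; - d; m; p]] i) j.

Local Notation i0 := (Ordinal (isT : 0 < 5)%N).
Local Notation i1 := (Ordinal (isT : 1 < 5)%N).
Local Notation i2 := (Ordinal (isT : 2 < 5)%N).
Local Notation i3 := (Ordinal (isT : 3 < 5)%N).
Local Notation i4 := (Ordinal (isT : 4 < 5)%N).

Lemma ord5P (P : 'I_5 -> Prop) :
  P i0 -> P i1 -> P i2 ->
  P i3 -> P i4 -> forall i, P i.
Proof.
move=> P0 P1 P2 P3 P4 [[|[|[|[|[|//]]]]] h];
  by rewrite (bool_irrelevance h isT).
Qed.

Lemma sum5E (V : nmodType) (f : 'I_5 -> V) :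
  \sum_i f i = f i0 + (f i1 +
    (f i2 + (f i3 + f i4))).
Proof.
rewrite !big_ord_recl big_ord0 addr0.
by do ?congr (_ + _); congr f; exact: val_inj.
Qed.

(** Entrywise differentiation; the derivation D is abstract, which keeps the
    25 cases free of derivatives. *)
Lemma connection_table_map (R : realType) (D : (plane R -> R) -> R)
    (c1 c2 x y p q a b c d m : plane R -> R) :
  D (fun=> 0) = 0 -> D (fun z => - a z) = - D a -> D (fun z => - d z) = - D d ->
  forall i j, D (fun z => connection_table (c1 z) (c2 z) (x z) (y z) (p z) (q z)
      (a z) (b z) (c z) (d z) (m z) i j) =
    connection_table (D c1) (D c2) (D x) (D y) (D p) (D q) (D a) (D b) (D c) (D d) (D m) i j.
Proof.
move=> D0 Da Dd; apply: ord5P; apply: ord5P; by [exact: D0|exact: Da|exact: Dd|].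
Qed.

Lemma connection_table_flat (R : realType)
    (c x xu xv lu lv luu luv lvv a1 b1 a2 b2 a3 b3 m1 m2 a1v b1v a2u a2v b2u b2v a3u b3u m12 : R) :
  xu = 2 * lu * x -> xv = 2 * lv * x -> luu - lvv = c * x ->
  a1 * a3 + b2 * b2 = a2 * a2 + b1 * b3 -> a2 * b3 + b1 * a2 = b2 * a3 + a1 * b2 ->
  a1v - a2u - a2 * lu + a3 * lv + m2 * b1 - m1 * b2 = 0 ->
  a3u - a2v + a1 * lu - a2 * lv - m2 * b2 + m1 * b3 = 0 ->
  b2u - b1v + b2 * lu - b3 * lv - m2 * a1 + m1 * a2 = 0 ->
  b2v - b3u - b1 * lu + b2 * lv + m2 * a2 - m1 * a3 = 0 ->
  forall i j,
  connection_table 0 0 xv 0 luv lvv a1v b1v a2v b2v m12 i j +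
    \sum_k connection_table c 0 x 0 lu lv a1 b1 a2 b2 m1 i k *
           connection_table 0 c 0 (- x) lv lu a2 b2 a3 b3 m2 k j =
  connection_table 0 0 0 (- xu) luv luu a2u b2u a3u b3u m12 i j +
    \sum_k connection_table 0 c 0 (- x) lv lu a2 b2 a3 b3 m2 i k *
           connection_table c 0 x 0 lu lv a1 b1 a2 b2 m1 k j.
Proof.
move=> -> -> g1 g2 r c1 c2 c3 c4.
have fin (u v w z : R) : u = v -> w - z = u - v -> w = z.
  by move=> -> /eqP; rewrite subrr subr_eq0 => /eqP.
have fin2 (u v u' v' w z : R) : u = v -> u' = v' -> w - z = (u - v) + (u' - v') -> w = z.
  by move=> -> -> /eqP; rewrite !subrr addr0 subr_eq0 => /eqP.
(* the Codazzi equations occur in the entries between dF and N, the Gauss and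
   Ricci equations in the two diagonal blocks *)
apply: ord5P; apply: ord5P; rewrite !sum5E /connection_table /=; first
  [ by ring
  | by apply: (fin _ _ _ _ c1); ring | by apply: (fin _ _ _ _ (esym c1)); ring
  | by apply: (fin _ _ _ _ c2); ring | by apply: (fin _ _ _ _ (esym c2)); ring
  | by apply: (fin _ _ _ _ c3); ring | by apply: (fin _ _ _ _ (esym c3)); ring
  | by apply: (fin _ _ _ _ c4); ring | by apply: (fin _ _ _ _ (esym c4)); ring
  | by apply: (fin _ _ _ _ r); ring | by apply: (fin _ _ _ _ (esym r)); ring
  | by apply: (fin2 _ _ _ _ _ _ (esym g1) g2); ring
  | by apply: (fin2 _ _ _ _ _ _ g1 (esym g2)); ring ].
Qed.

Lemma connection_table_closed (R : realType) (S : (plane R -> R) -> Prop)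
    (c1 c2 x y p q a b c d m : plane R -> R) :
  S (fun=> 0) -> S c1 -> S c2 -> S x -> S y -> S p -> S q -> S a -> S b -> S c -> S d -> S m ->
  S (fun z => - a z) -> S (fun z => - d z) ->
  forall i j, S (fun z => connection_table (c1 z) (c2 z) (x z) (y z) (p z) (q z)
      (a z) (b z) (c z) (d z) (m z) i j).
Proof. by do 14 move=> ?; apply: ord5P; apply: ord5P; assumption. Qed.

(** The factors w and k allow for two normalisations of the same system:
    w = 1 and k = L0 is the one satisfied by the frame, w = L0 and k = 1 governs
    the weighted Gram matrix. *)
Definition conn_u (R : realType) (w k : R) (lam : plane R -> R) (D : coeffs R)
    (i j : 'I_5) (z : plane R) : R :=
  connection_table w 0 (- (k * expR (2 * lam z))) 0 (du lam z) (dv lam z)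
    (al1 D z) (be1 D z) (al2 D z) (be2 D z) (mu1 D z) i j.

Definition conn_v (R : realType) (w k : R) (lam : plane R -> R) (D : coeffs R)
    (i j : 'I_5) (z : plane R) : R :=
  connection_table 0 w 0 (k * expR (2 * lam z)) (dv lam z) (du lam z)
    (al2 D z) (be2 D z) (al3 D z) (be3 D z) (mu2 D z) i j.

Record smooth_data (R : realType) (O : set (plane R)) (D : coeffs R) : Prop := {
  smooth_al : [/\ smooth O (al1 D), smooth O (al2 D) & smooth O (al3 D)];
  smooth_be : [/\ smooth O (be1 D), smooth O (be2 D) & smooth O (be3 D)];
  smooth_mu : smooth O (mu1 D) /\ smooth O (mu2 D) }.

Section connection.
Variables (R : realType) (O : set (plane R)).
Hypothesis openO : open O.
Variables (lam : plane R -> R) (D : coeffs R) (w k : R).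
Hypothesis slam : smooth O lam.
Hypothesis sD : smooth_data O D.

Let sx (c : R) : smooth O (fun z => c * expR (2 * lam z)).
Proof. by apply: smoothZ => //; apply: smooth_expR => //; exact: smoothZ. Qed.

Lemma smooth_conn_u i j : smooth O (conn_u w k lam D i j).
Proof.
have [a1 a2 a3] := smooth_al sD; have [b1 b2 b3] := smooth_be sD; have [m1 m2] := smooth_mu sD.
apply: (connection_table_closed (S := fun f => smooth O f)); rewrite //.
- exact: smooth_cst.
- exact: smooth_cst.
- exact: smooth_cst.
- by apply: smoothN => //; exact: sx.
- exact: smooth_cst.
- exact: smooth_du.
- exact: smooth_dv.
- exact: smoothN.
- exact: smoothN.
Qed.

Lemma smooth_conn_v i j : smooth O (conn_v w k lam D i j).
Proof.
have [a1 a2 a3] := smooth_al sD; have [b1 b2 b3] := smooth_be sD; have [m1 m2] := smooth_mu sD.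
apply: (connection_table_closed (S := fun f => smooth O f)); rewrite //.
- exact: smooth_cst.
- exact: smooth_cst.
- exact: smooth_cst.
- exact: smooth_cst.
- exact: smooth_dv.
- exact: smooth_du.
- exact: smoothN.
- exact: smoothN.
Qed.

(** The Gauss equation is split into its intrinsic and its algebraic part, the
    second fundamental form contributing nothing to the curvature; likewise
    for the Ricci equation. *)
Record compatibility (p : plane R) : Prop := Compatibility {
  gauss_eq : du (du lam) p - dv (dv lam) p = - (w * k * expR (2 * lam p));
  gauss_alg : al1 D p * al3 D p + be2 D p * be2 D p = al2 D p * al2 D p + be1 D p * be3 D p;
  ricci_alg : al2 D p * be3 D p + be1 D p * al2 D p = be2 D p * al3 D p + al1 D p * be2 D p;
  ricci_eq : dv (mu1 D) p = du (mu2 D) p;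
  codazzi_eq1 : dv (al1 D) p - du (al2 D) p - al2 D p * du lam p + al3 D p * dv lam p
    + mu2 D p * be1 D p - mu1 D p * be2 D p = 0;
  codazzi_eq2 : du (al3 D) p - dv (al2 D) p + al1 D p * du lam p - al2 D p * dv lam p
    - mu2 D p * be2 D p + mu1 D p * be3 D p = 0;
  codazzi_eq3 : du (be2 D) p - dv (be1 D) p + be2 D p * du lam p - be3 D p * dv lam p
    - mu2 D p * al1 D p + mu1 D p * al2 D p = 0;
  codazzi_eq4 : dv (be2 D) p - du (be3 D) p - be1 D p * du lam p + be2 D p * dv lam p
    + mu2 D p * al2 D p - mu1 D p * al3 D p = 0 }.

Lemma conn_flat p i j : O p -> compatibility p ->
  dv (conn_u w k lam D i j) p + \sum_l conn_u w k lam D i l p * conn_v w k lam D l j p =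
  du (conn_v w k lam D i j) p + \sum_l conn_v w k lam D i l p * conn_u w k lam D l j p.
Proof.
move=> Op [g1 g2 r1 r2 c1 c2 c3 c4].
have [sa1 sa2 sa3] := smooth_al sD; have [sb1 sb2 sb3] := smooth_be sD.
pose x z := - (k * expR (2 * lam z)).
have sxx : smooth O x by apply: smoothN => //; exact: sx.
have sE : smooth O (fun z => expR (2 * lam z)).
  by apply: smooth_expR => //; exact: smoothZ.
have dE (v : plane R) := smooth_derive_exp2 openO v slam Op.
have dN (f : plane R -> R) (v : plane R) : smooth O f -> 'D_v (fun z => - f z) p = - 'D_v f p.
  by move=> sf; apply: derive_val; apply: is_deriveN; exact: smooth_is_derive.
have dx (v : plane R) : 'D_v x p = 2 * 'D_v lam p * x p.
  have e1 := dN _ v (sx k); have e2 := smooth_deriveZ openO k v sE Op; have e3 := dE v.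
  have alg (A B C L e : R) : A = - B -> B = k * C -> C = 2 * L * e -> A = 2 * L * - (k * e).
    by move=> -> -> ->; ring.
  exact: (alg _ _ _ _ _ e1 e2 e3).
have c0 (v : plane R) (c : R) : 'D_v (fun=> c : R) p = 0 by exact: (derive_cst c).
have du0 (c : R) : du (fun=> c : R) p = 0 by exact: c0.
have dv0 (c : R) : dv (fun=> c : R) p = 0 by exact: c0.
have ev : dv (conn_u w k lam D i j) p = connection_table 0 0 (dv x p) 0 (dv (du lam) p) (dv (dv lam) p)
    (dv (al1 D) p) (dv (be1 D) p) (dv (al2 D) p) (dv (be2 D) p) (dv (mu1 D) p) i j.
  have := connection_table_map (D := fun f => dv f p) (fun=> w) (fun=> 0) x (fun=> 0)
    (du lam) (dv lam) (be1 D) (al2 D) (mu1 D) (dv0 0) (dN _ (0, 1) sa1) (dN _ (0, 1) sb2) i j.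
  by rewrite !dv0; apply.
have eu : du (conn_v w k lam D i j) p = connection_table 0 0 0 (- du x p) (du (dv lam) p) (du (du lam) p)
    (du (al2 D) p) (du (be2 D) p) (du (al3 D) p) (du (be3 D) p) (du (mu2 D) p) i j.
  have := connection_table_map (D := fun f => du f p) (fun=> 0) (fun=> w) (fun=> 0) (fun z => - x z)
    (dv lam) (du lam) (be2 D) (al3 D) (mu2 D) (du0 0) (dN _ (1, 0) sa2) (dN _ (1, 0) sb3) i j.
  have cvE : conn_v w k lam D i j = fun z => connection_table 0 w 0 (- x z) (dv lam z) (du lam z)
      (al2 D z) (be2 D z) (al3 D z) (be3 D z) (mu2 D z) i j.
    by apply/funext => z; rewrite /conn_v /x opprK.
  have e : du (fun z => - x z) p = - du x p by exact: (dN _ (1, 0) sxx).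
  have congr_table (k1 k2 x1 y1 y1' p1 q a b c d m : R) : k1 = 0 -> k2 = 0 -> x1 = 0 -> y1 = y1' ->
      connection_table k1 k2 x1 y1 p1 q a b c d m i j = connection_table 0 0 0 y1' p1 q a b c d m i j.
    by move=> -> -> -> ->.
  move=> h; exact: (etrans (congr1 (fun f => du f p) cvE)
    (etrans h (congr_table _ _ _ _ _ _ _ _ _ _ _ _ (du0 0) (du0 w) (du0 0) e))).
have sch := du_dvC openO slam Op.
rewrite ev eu r2 sch.
have ey : k * expR (2 * lam p) = - x p by rewrite /x opprK.
have g1' : du (du lam) p - dv (dv lam) p = w * x p.
  by rewrite g1 /x mulrN mulrA.
rewrite /conn_u /conn_v -/(x p) ey.
exact: (connection_table_flat (dv (du lam) p) (du (mu2 D) p) (dx (1, 0)) (dx (0, 1)) g1' g2 r1 c1 c2 c3 c4).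
Qed.

End connection.

(** * The Gram matrix of a solution *)

(** The row and the column of F in the Gram matrix are multiplied by L0. The
    weighted matrix satisfies the same homogeneous system whether L0 vanishes
    or not, and records exactly what is required of F in either case. *)
Definition weight (R : realType) (L0 : R) (i : 'I_5) : R := if i == ord0 then L0 else 1.

Definition gram_diag (R : realType) (L0 E : R) (i : 'I_5) : R :=
  nth 0 [:: L0^-1; E; - E; E; - E] i.

Definition gram_target (R : realType) (L0 E : R) (i j : 'I_5) : R :=
  if i == j then gram_diag L0 E i else 0.

Section gram_algebra.
Variables (R : realType) (L0 : R).
Let wt := @weight R L0.

Lemma weight_table (c1 c2 x y p q a b c d m : R) (i j : 'I_5) :
  wt i * connection_table c1 c2 (L0 * x) (L0 * y) p q a b c d m i j =
  connection_table (L0 * c1) (L0 * c2) x y p q a b c d m i j * wt j.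
Proof.
by move: i j; apply: ord5P; apply: ord5P; rewrite /wt /weight /connection_table /=; ring.
Qed.

(** The two products of L0 and its inverse that occur here are harmless for
    L0 = 0, since they are multiplied by L0 once more. *)
Lemma residual_table (c1 c2 E p q a b c d m : R) (i j : 'I_5) :
  let O := connection_table c1 c2 (L0 * - (c1 * E)) (L0 * (c2 * E)) p q a b c d m in
  wt i * wt j * (O i j * gram_diag L0 E j + O j i * gram_diag L0 E i) =
  wt i * wt j * (if i == j then nth 0 [:: 0; 2 * p * E; - (2 * p * E); 2 * p * E; - (2 * p * E)] i
                 else 0).
Proof.
have L : L0 * (L0 * L0^-1) = L0.
  by have [->|L00] := eqVneq L0 0; rewrite ?mul0r// divff// mulr1.
have fin (z u t : R) : z - u = t * (L0 * (L0 * L0^-1) - L0) -> z = u.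
  by rewrite L subrr mulr0 => /eqP; rewrite subr_eq0 => /eqP.
move=> /=; move: i j; apply: ord5P; apply: ord5P;
  rewrite /wt /weight /connection_table /gram_diag /=; try ring.
- by apply: (fin _ _ (- (c1 * E))); ring.
- by apply: (fin _ _ (c2 * E)); ring.
- by apply: (fin _ _ (- (c1 * E))); ring.
- by apply: (fin _ _ (c2 * E)); ring.
Qed.

(** The target T solves the same equations as the Gram matrix, so that their
    weighted difference satisfies a homogeneous system. *)
Lemma weighted_defect (Om Oh G T dT : 'I_5 -> 'I_5 -> R) (t : 'I_5 -> R) (i j : 'I_5) :
  (forall i j, wt i * Om i j = Oh i j * wt j) ->
  (forall i j, T i j = if i == j then t i else 0) ->
  wt i * wt j * (Om i j * t j + Om j i * t i) = wt i * wt j * dT i j ->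
  wt i * wt j * (\sum_k Om i k * G k j + \sum_k Om j k * G i k - dT i j) =
  \sum_k Oh i k * (wt k * wt j * (G k j - T k j)) +
  \sum_k Oh j k * (wt i * wt k * (G i k - T i k)).
Proof.
move=> hw hT hd; rewrite mulrBr -hd.
have e1 : \sum_k Oh i k * (wt k * wt j * (G k j - T k j)) =
    wt i * wt j * (\sum_k Om i k * G k j - Om i j * t j).
  have -> : Om i j * t j = \sum_k Om i k * T k j.
    rewrite (bigD1 j)//= hT eqxx big1 ?addr0// => k kj.
    by rewrite hT (negPf kj) mulr0.
  rewrite -sumrB mulr_sumr; apply: eq_bigr => k _.
  by rewrite !mulrA -hw; ring.
have e2 : \sum_k Oh j k * (wt i * wt k * (G i k - T i k)) =
    wt i * wt j * (\sum_k Om j k * G i k - Om j i * t i).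
  have -> : Om j i * t i = \sum_k Om j k * T i k.
    rewrite (bigD1 i)//= hT eqxx big1 ?addr0// => k kj.
    by rewrite hT eq_sym (negPf kj) mulr0.
  rewrite -sumrB mulr_sumr; apply: eq_bigr => k _.
  by rewrite (mulrA (Oh j k)) (mulrCA (Oh j k)) -hw; ring.
by rewrite e1 e2; ring.
Qed.

End gram_algebra.

Lemma inner_suml (R : realType) (L0 : R) (I : finType) (a : I -> R)
    (V : I -> 'rV[R]_(ambient_dim L0)) x :
  inner (\sum_k a k *: V k) x = \sum_k a k * inner (V k) x.
Proof.
elim/big_rec2 : _ => [|k y1 y2 _ IH]; first by rewrite inner0l.
by rewrite innerDl innerZl IH.
Qed.

Lemma inner_sumr (R : realType) (L0 : R) (I : finType) (a : I -> R)
    (V : I -> 'rV[R]_(ambient_dim L0)) x :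
  inner x (\sum_k a k *: V k) = \sum_k a k * inner x (V k).
Proof. by rewrite innerC inner_suml; apply: eq_bigr => k _; rewrite innerC. Qed.

Section gram.
Variables (R : realType) (L0 : R) (O : set (plane R)).
Hypothesis openO : open O.
Hypothesis prop : propagates O.
Variables (lam : plane R -> R) (D : coeffs R).
Hypothesis slam : smooth O lam.
Hypothesis sD : smooth_data O D.
Variable V : 'I_5 -> plane R -> 'rV[R]_(ambient_dim L0).
Hypothesis sV : forall i, smooth O (V i).
Hypothesis duV : forall i p, O p -> du (V i) p = \sum_j conn_u 1 L0 lam D i j p *: V j p.
Hypothesis dvV : forall i p, O p -> dv (V i) p = \sum_j conn_v 1 L0 lam D i j p *: V j p.

Let wt := @weight R L0.
Let E (p : plane R) := expR (2 * lam p).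
Let T i j p := gram_target L0 (E p) i j.
Let defect (ij : 'I_5 * 'I_5) p := wt ij.1 * wt ij.2 * (inner (V ij.1 p) (V ij.2 p) - T ij.1 ij.2 p).

Let M1 (ij kl : 'I_5 * 'I_5) p := conn_u L0 1 lam D ij.1 kl.1 p * (kl.2 == ij.2)%:R +
  conn_u L0 1 lam D ij.2 kl.2 p * (kl.1 == ij.1)%:R.
Let M2 (ij kl : 'I_5 * 'I_5) p := conn_v L0 1 lam D ij.1 kl.1 p * (kl.2 == ij.2)%:R +
  conn_v L0 1 lam D ij.2 kl.2 p * (kl.1 == ij.1)%:R.

Let sum_pair (A B : 'I_5 -> R) (Y : 'I_5 * 'I_5 -> R) (ij : 'I_5 * 'I_5) :
  \sum_kl (A kl.1 * (kl.2 == ij.2)%:R + B kl.2 * (kl.1 == ij.1)%:R) * Y kl =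
  \sum_k A k * Y (k, ij.2) + \sum_k B k * Y (ij.1, k).
Proof.
have pick (f : 'I_5 -> R) i : \sum_k f k * (k == i)%:R = f i.
  rewrite (bigD1 i)//= eqxx mulr1 big1 ?addr0// => k ki.
  by rewrite (negPf ki) mulr0.
transitivity (\sum_k \sum_l (A k * (l == ij.2)%:R + B l * (k == ij.1)%:R) * Y (k, l)).
  by rewrite pair_bigA; apply: eq_bigr => -[k l] _.
transitivity (\sum_k \sum_l A k * Y (k, l) * (l == ij.2)%:R +
              \sum_k \sum_l B l * Y (k, l) * (k == ij.1)%:R).
  rewrite -big_split; apply: eq_bigr => k _; rewrite -big_split; apply: eq_bigr => l _ /=.
  by ring.
congr (_ + _); first by apply: eq_bigr => k _; exact: pick.
by rewrite exchange_big; apply: eq_bigr => l _; exact: (pick (fun k => B l * Y (k, l))).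
Qed.

Let sE : smooth O E. Proof. by apply: smooth_expR => //; exact: smoothZ. Qed.

Let target_diag i : exists c0 c1 : R, (forall p, T i i p = c0 + c1 * E p) /\
  forall z p0 : R, (nth 0 [:: 0; 2 * p0 * z; - (2 * p0 * z); 2 * p0 * z; - (2 * p0 * z)] i = c1 * (2 * p0 * z)).
Proof.
move: i; apply: ord5P.
- by exists L0^-1, 0; split=> [p|*]; rewrite /T /gram_target /gram_diag /=; ring.
- by exists 0, 1; split=> [p|*]; rewrite /T /gram_target /gram_diag /=; ring.
- by exists 0, (-1); split=> [p|*]; rewrite /T /gram_target /gram_diag /=; ring.
- by exists 0, 1; split=> [p|*]; rewrite /T /gram_target /gram_diag /=; ring.
- by exists 0, (-1); split=> [p|*]; rewrite /T /gram_target /gram_diag /=; ring.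
Qed.

Let dtarget (p0 z : R) (i j : 'I_5) := if i == j then
  nth 0 [:: 0; 2 * p0 * z; - (2 * p0 * z); 2 * p0 * z; - (2 * p0 * z)] i else 0.

Let smooth_target i j : smooth O (T i j).
Proof.
have [->|ij] := eqVneq i j.
  have [c0 [c1 [h _]]] := target_diag j.
  apply: (smooth_ext openO (fun p _ => esym (h p))).
  by apply: (smoothD openO); [exact: smooth_cst|exact: smoothZ].
have h p : T i j p = 0 by rewrite /T /gram_target (negPf ij).
by apply: (smooth_ext openO (fun p _ => esym (h p))); exact: smooth_cst.
Qed.

Let derive_target i j p w : O p -> 'D_w (T i j) p = dtarget ('D_w lam p) (E p) i j.
Proof.
move=> Op.
have dE : 'D_w E p = 2 * 'D_w lam p * E p by exact: (smooth_derive_exp2 openO w slam Op).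
have cst (c : R) : 'D_w (fun=> c : R) p = 0 by exact: (derive_cst c).
have [->|ij] := eqVneq i j.
  have [c0 [c1 [h1 h2]]] := target_diag j; rewrite /dtarget eqxx h2 -dE.
  have e1 := derive_ext w openO (fun q _ => h1 q) Op.
  have sc : smooth O (fun=> c0 : R) by exact: smooth_cst.
  have e2 := smooth_deriveD w sc (smoothZ openO c1 sE) Op.
  have e3 := smooth_deriveZ openO c1 w sE Op.
  exact: (etrans e1 (etrans e2 (etrans (congr2 +%R (cst c0) e3) (add0r _)))).
have h p' : T i j p' = 0 by rewrite /T /gram_target (negPf ij).
rewrite /dtarget (negPf ij).
exact: (etrans (derive_ext w openO (fun q _ => h q) Op) (cst 0)).
Qed.

Let smooth_gram i j : smooth O (fun p => inner (V i p) (V j p)).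
Proof. exact: smooth_inner. Qed.

Let smooth_defect ij : smooth O (defect ij).
Proof. by apply: (smoothZ openO); apply: smoothB. Qed.

Let derive_defect ij p w (Om : 'I_5 -> 'I_5 -> R) : O p ->
  (forall i, 'D_w (V i) p = \sum_j Om i j *: V j p) ->
  'D_w (defect ij) p = wt ij.1 * wt ij.2 * (\sum_k Om ij.1 k * inner (V k p) (V ij.2 p) +
     \sum_k Om ij.2 k * inner (V ij.1 p) (V k p) - dtarget ('D_w lam p) (E p) ij.1 ij.2).
Proof.
move=> Op dV; have e1 := smooth_deriveZ openO (wt ij.1 * wt ij.2) w
  (smoothB openO (smooth_gram ij.1 ij.2) (smooth_target ij.1 ij.2)) Op.
have e2 : 'D_w (fun q => inner (V ij.1 q) (V ij.2 q) - T ij.1 ij.2 q) p =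
    'D_w (fun q => inner (V ij.1 q) (V ij.2 q)) p - 'D_w (T ij.1 ij.2) p.
  by apply: derive_val; apply: is_deriveB; exact: smooth_is_derive.
have e3 := derive_inner w (smooth_row_differentiable (sV ij.1) Op)
  (smooth_row_differentiable (sV ij.2) Op).
have e4 := congr2 (fun x y => inner x (V ij.2 p) + inner (V ij.1 p) y) (dV ij.1) (dV ij.2).
have e5 := derive_target ij.1 ij.2 w Op.
have e6 := congr2 +%R (inner_suml (Om ij.1) (fun k => V k p) (V ij.2 p))
  (inner_sumr (Om ij.2) (fun k => V k p) (V ij.1 p)).
exact: (etrans e1 (congr1 _ (etrans e2 (congr2 (fun x y => x - y) (etrans e3 (etrans e4 e6)) e5)))).
Qed.

Let defect_system ij p : O p ->
  du (defect ij) p = \sum_kl M1 ij kl p * defect kl p /\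
  dv (defect ij) p = \sum_kl M2 ij kl p * defect kl p.
Proof.
move=> Op; split.
  have e := derive_defect ij Op (fun i => duV i Op).
  apply: etrans e _; apply: etrans (esym (sum_pair (fun k => conn_u L0 1 lam D ij.1 k p)
    (fun k => conn_u L0 1 lam D ij.2 k p) (fun kl => defect kl p) ij)).
  apply: (weighted_defect (Om := fun i j => conn_u 1 L0 lam D i j p)
    (Oh := fun i j => conn_u L0 1 lam D i j p)
    (T := fun i j => T i j p) (dT := dtarget (du lam p) (E p)) (t := gram_diag L0 (E p))
    (fun i j => inner (V i p) (V j p))).
  - move=> i j; have := weight_table L0 1 0 (- E p) 0 (du lam p) (dv lam p) (al1 D p) (be1 D p)
      (al2 D p) (be2 D p) (mu1 D p) i j.
    by rewrite !mulr0 mulr1 mulrN /conn_u mul1r.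
  - by move=> i j; exact: erefl.
  - have := residual_table L0 1 0 (E p) (du lam p) (dv lam p) (al1 D p) (be1 D p) (al2 D p)
      (be2 D p) (mu1 D p) ij.1 ij.2.
    by rewrite /= mul0r mulr0 mul1r mulrN.
have e := derive_defect ij Op (fun i => dvV i Op).
apply: etrans e _; apply: etrans (esym (sum_pair (fun k => conn_v L0 1 lam D ij.1 k p)
  (fun k => conn_v L0 1 lam D ij.2 k p) (fun kl => defect kl p) ij)).
apply: (weighted_defect (Om := fun i j => conn_v 1 L0 lam D i j p)
  (Oh := fun i j => conn_v L0 1 lam D i j p)
  (T := fun i j => T i j p) (dT := dtarget (dv lam p) (E p)) (t := gram_diag L0 (E p))
  (fun i j => inner (V i p) (V j p))).
- move=> i j; have := weight_table L0 0 1 0 (E p) (dv lam p) (du lam p) (al2 D p) (be2 D p)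
    (al3 D p) (be3 D p) (mu2 D p) i j.
  by rewrite !mulr0 mulr1 /conn_v mul1r.
- by move=> i j; exact: erefl.
- have := residual_table L0 0 1 (E p) (dv lam p) (du lam p) (al2 D p) (be2 D p) (al3 D p)
    (be3 D p) (mu2 D p) ij.1 ij.2.
  by rewrite /= mul0r oppr0 mulr0 mul1r.
Qed.

Lemma gram_propagates p0 : O p0 ->
  (forall i j, inner (V i p0) (V j p0) = gram_target L0 (E p0) i j \/ wt i * wt j = 0) ->
  forall p, O p -> forall i j,
  wt i * wt j * inner (V i p) (V j p) = wt i * wt j * gram_target L0 (E p) i j.
Proof.
move=> Op0 h0 p Op i j.
have smul (f : plane R -> R) (b : bool) : smooth O f -> smooth O (fun q => f q * b%:R).
  by move=> sf; apply: (smoothM openO) => //; exact: smooth_cst.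
have sM1 ij kl : smooth O (M1 ij kl).
  by apply: (smoothD openO); apply: smul; exact: smooth_conn_u.
have sM2 ij kl : smooth O (M2 ij kl).
  by apply: (smoothD openO); apply: smul; exact: smooth_conn_v.
have hy := smooth_solution smooth_defect (fun ij q Oq => defect_system ij Oq).
have hz : solution_on M1 M2 O (fun _ _ => 0).
  apply: smooth_solution => [k|k q Oq]; first exact: smooth_cst.
  have z : 'D_(1, 0) (fun=> 0 : R) q = 0 /\ 'D_(0, 1) (fun=> 0 : R) q = 0.
    by split; exact: (derive_cst (0 : R)).
  by split; [apply: etrans z.1 _|apply: etrans z.2 _];
    rewrite big1// => l _; rewrite mulr0.
have init ij : defect ij p0 = 0.
  by rewrite /defect; case: (h0 ij.1 ij.2) => ->; rewrite ?mul0r// subrr mulr0.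
have := solution_unique openO sM1 sM2 prop hy hz Op0 Op init (i, j).
by rewrite /defect /= mulrBr => /eqP; rewrite subr_eq0 => /eqP.
Qed.

End gram.

(** * Linear isometries of the space form *)

Section ambient_matrices.
Variables (R : realType) (L0 : R).
Local Notation n := (ambient_dim L0).
Local Notation vec := 'rV[R]_(ambient_dim L0).
Implicit Types (A B : 'M[R]_(ambient_dim L0)) (x y : vec).

Definition sign_mx : 'M[R]_(ambient_dim L0) :=
  diag_mx (\row_i (-1) ^+ (i < ambient_index L0)%N).

Lemma inner_mx m k (X : 'M[R]_(m, n)) (Y : 'M[R]_(k, n)) i j :
  inner (row i X) (row j Y) = (X *m sign_mx *m Y^T) i j.
Proof.
rewrite /inner !mxE; apply: eq_bigr => l _.
rewrite mul_mx_diag !mxE; congr (_ * _).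
by rewrite mulrC.
Qed.

Lemma innerE_mx x y : inner x y = (x *m sign_mx *m y^T) ord0 ord0.
Proof. by rewrite -inner_mx; congr inner; apply/rowP => j; rewrite !mxE. Qed.

Lemma unit_diag (d : 'rV[R]_n) : (forall i, d ord0 i != 0) -> diag_mx d \in unitmx.
Proof.
move=> d0; rewrite unitmxE det_diag unitfE.
by apply/prodf_neq0 => i _; exact: d0.
Qed.

Lemma unit_sign_mx : sign_mx \in unitmx.
Proof. by apply: unit_diag => i; rewrite mxE signr_eq0. Qed.

Lemma same_gram_isometry B B' : B \in unitmx ->
  B *m sign_mx *m B^T = B' *m sign_mx *m B'^T -> forall x y,
  inner (x *m (invmx B *m B')) (y *m (invmx B *m B')) = inner x y.
Proof.
move=> uB h x y; rewrite !innerE_mx; congr (fun_of_matrix _ _ _).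
set A := invmx B *m B'.
have hA : A *m sign_mx *m A^T = sign_mx.
  have uBT : B^T \in unitmx by rewrite unitmx_tr.
  rewrite /A trmx_mul !mulmxA -(mulmxA _ _ (B'^T)) -(mulmxA (invmx B)) mulmxA.
  rewrite -(mulmxA (invmx B)) (mulmxA B') -h.
  rewrite -(mulmxA B) mulKmx// trmx_inv mulmxK//.
by rewrite trmx_mul -[in RHS]hA !mulmxA.
Qed.

Section affine.
Variables (A : 'M[R]_n) (b : vec).
Let phi := fun x : vec => x *m A + b.

Let linear_part : {linear vec -> vec} := mulmxr A.

Lemma differentiable_linear_part x : differentiable linear_part x.
Proof.
have -> : (linear_part : vec -> vec) = \sum_j (fun x : vec => x ord0 j *: row j A).
  by apply/funext => y; rewrite fct_sumE /= mulmx_sum_row.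
by apply: differentiable_sum => j; apply: differentiableZl; exact: differentiable_coord.
Qed.

Let continuous_linear_part : continuous linear_part.
Proof. by move=> x; apply: differentiable_continuous; exact: differentiable_linear_part. Qed.

Lemma differentiable_affine x : differentiable phi x.
Proof.
apply: (@differentiableD _ _ _ (linear_part : vec -> vec) (cst b)).
  exact: differentiable_linear_part.
exact: differentiable_cst.
Qed.

Lemma derive_affine x v : 'D_v phi x = v *m A.
Proof.
have d1 : 'D_v (linear_part : vec -> vec) x = v *m A.
  have e := @deriveE _ _ _ (linear_part : vec -> vec) x v (differentiable_linear_part x).
  exact: (etrans e (congr1 (fun g : vec -> vec => g v) (diff_lin x continuous_linear_part))).
have d2 : 'D_v (cst b : vec -> vec) x = 0 by exact: (derive_cst b).
have e := @deriveD _ _ _ (linear_part : vec -> vec) (cst b) x v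
  (diff_derivable (differentiable_linear_part x)) (derivable_cst b x v).
exact: (etrans e (etrans (congr2 +%R d1 d2) (addr0 _))).
Qed.

Lemma smooth_affine : smooth setT phi.
Proof.
have Ck_const (c : vec) k : Ck k setT (fun _ : vec => c).
  elim: k c => [|k IH] c; first by move=> x _; exact: cst_continuous.
  split=> [x _|v]; first exact: differentiable_cst.
  have -> : 'D_v (fun _ : vec => c) = fun=> 0.
    by apply/funext => x; exact: (derive_cst c).
  exact: IH.
case=> [|k]; first by move=> x _; apply: differentiable_continuous; exact: differentiable_affine.
split=> [x _|v]; first exact: differentiable_affine.
have -> : 'D_v phi = fun=> v *m A by apply/funext => x; exact: derive_affine.
exact: Ck_const.
Qed.

End affine.

(** Translations are isometries only of the flat space form. *)
Lemma affine_isometry A (b : vec) : A \in unitmx ->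
  (forall x y, inner (x *m A) (y *m A) = inner x y) -> (L0 != 0 -> b = 0) ->
  spaceform_isometry (fun x : vec => x *m A + b).
Proof.
move=> uA hA hb.
have hAi x y : inner (x *m invmx A) (y *m invmx A) = inner x y.
  by rewrite -hA !mulmxKV.
split; first exact: smooth_affine.
- move=> x; rewrite /spaceform; have [//|L00 /= hx] := eqVneq L0 0.
  by rewrite hb// addr0 hA.
- exists (fun x => x *m invmx A + - (b *m invmx A)); first exact: smooth_affine.
  move=> x hx; split.
  + move: hx; rewrite /spaceform; have [//|L00 /= hx] := eqVneq L0 0.
    by rewrite hb// mul0mx oppr0 addr0 hAi.
  + by rewrite mulmxDl mulmxK// addrK.
  + by rewrite mulmxDl mulNmx !mulmxKV// addrNK.
- by move=> x xi eta _ _ _; rewrite !derive_affine.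
Qed.

Section frame_matrix.
Variables (E : R) (f T1 T2 n1 n2 : vec).
Hypothesis E0 : E != 0.
Hypothesis ad : adapted E f T1 T2 n1 n2.

(** The position vector comes last, so that it drops out when the space form
    is flat and the ambient dimension is 4. *)
Definition frame_mx : 'M[R]_n :=
  \matrix_(i, j) (nth 0 [:: T1; T2; n1; n2; f] i : vec) ord0 j.

Lemma row_frame_mx i : row i frame_mx = nth 0 [:: T1; T2; n1; n2; f] i.
Proof. by apply/rowP => j; rewrite !mxE. Qed.

Lemma frame_gram : frame_mx *m sign_mx *m frame_mx^T =
  diag_mx (\row_i nth 0 [:: E; - E; E; - E; L0^-1] i).
Proof.
have rows (i j : nat) : (i < n)%N -> (j < n)%N ->
    inner (nth 0 [:: T1; T2; n1; n2; f] i) (nth 0 [:: T1; T2; n1; n2; f] j) =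
    nth 0 [:: E; - E; E; - E; L0^-1] i *+ (i == j).
  case: ad => [[t1 t2 t3] [m1 m2 m3] [c1 c2 c3 c4] [f1 f2 f3 f4] ff].
  have t3' := etrans (innerC _ _) t3; have m3' := etrans (innerC _ _) m3.
  have c1' := etrans (innerC _ _) c1; have c2' := etrans (innerC _ _) c2.
  have c3' := etrans (innerC _ _) c3; have c4' := etrans (innerC _ _) c4.
  have [L00|L00] := eqVneq L0 0.
    have e4 : n = 4%N by rewrite /ambient_dim L00 eqxx.
    move=> hi hj; rewrite e4 in hi; rewrite e4 in hj; move: hi hj.
    by case: i => [|[|[|[|//]]]]; case: j => [|[|[|[|//]]]].
  have cancel0 z : L0 * z = 0 -> z = 0.
    by move/eqP; rewrite mulf_eq0 (negPf L00) => /eqP.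
  have [g1 g2 g3 g4] : [/\ inner f T1 = 0, inner f T2 = 0, inner f n1 = 0 & inner f n2 = 0].
    by split; apply: cancel0.
  have g1' := etrans (innerC _ _) g1; have g2' := etrans (innerC _ _) g2.
  have g3' := etrans (innerC _ _) g3; have g4' := etrans (innerC _ _) g4.
  have gf : inner f f = L0^-1.
    by apply: (mulfI L00); apply: (mulfI L00); rewrite ff divff// mulr1.
  have e5 : n = 5%N by rewrite /ambient_dim (negPf L00).
  move=> hi hj; rewrite e5 in hi; rewrite e5 in hj; move: hi hj.
  by case: i => [|[|[|[|[|//]]]]]; case: j => [|[|[|[|[|//]]]]].
apply/matrixP => i j; rewrite -inner_mx !row_frame_mx rows//.
by rewrite !mxE.
Qed.

Lemma unit_frame_mx : frame_mx \in unitmx.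
Proof.
have : frame_mx *m sign_mx *m frame_mx^T \in unitmx.
  rewrite frame_gram; apply: unit_diag => i; rewrite mxE.
  have : (i < 5)%N.
    by apply: leq_trans (ltn_ord i) _; rewrite /ambient_dim; case: ifP.
  have i4 : i = 4%N :> nat -> L0 != 0.
    move=> e; apply/eqP => L00; have := ltn_ord i.
    by rewrite e /ambient_dim L00 eqxx.
  case: (nat_of_ord i) i4 => [|[|[|[|[|//]]]]] //= i4 _; rewrite ?oppr_eq0//.
  by rewrite invr_eq0; exact: i4.
by rewrite !unitmx_mul => /andP[/andP[]].
Qed.

(** The frame spans the ambient space, on which the inner product is
    nondegenerate. *)
Lemma frame_complete (z : vec) : inner z T1 = 0 -> inner z T2 = 0 ->
  inner z n1 = 0 -> inner z n2 = 0 -> L0 * inner z f = 0 -> z = 0.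
Proof.
move=> h1 h2 h3 h4 h5.
have z0 : z *m sign_mx *m frame_mx^T = 0.
  apply/rowP => j; rewrite [RHS]mxE.
  have -> : (z *m sign_mx *m frame_mx^T) ord0 j = inner z (row j frame_mx).
    by rewrite -inner_mx; congr inner; apply/rowP => k; rewrite !mxE.
  rewrite row_frame_mx.
  have j5 : (j < 5)%N.
    by apply: leq_trans (ltn_ord j) _; rewrite /ambient_dim; case: ifP.
  have j4 : j = 4%N :> nat -> L0 != 0.
    move=> e; apply/eqP => L00; have := ltn_ord j.
    by rewrite e /ambient_dim L00 eqxx.
  case: (nat_of_ord j) j4 j5 => [|[|[|[|[|//]]]]] //= j4 _.
  by apply: (mulfI (j4 erefl)); rewrite h5 mulr0.
have uT : frame_mx^T \in unitmx by rewrite unitmx_tr unit_frame_mx.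
have := congr1 (fun m => m *m invmx frame_mx^T *m invmx sign_mx) z0.
by rewrite mulmxK// mulmxK ?unit_sign_mx// !mul0mx.
Qed.

End frame_matrix.
End ambient_matrices.

(** * Frames and solutions of the linear system *)

Lemma connection_table_rows (R : realType) (V : lmodType R) (w : 'I_5 -> V)
    (c1 c2 x y p q a b c d m : R) i :
  \sum_j connection_table c1 c2 x y p q a b c d m i j *: w j =
  nth 0 [:: c1 *: w i1 + c2 *: w i2;
            p *: w i1 + q *: w i2 + (a *: w i3 + b *: w i4) + x *: w i0;
            q *: w i1 + p *: w i2 + (c *: w i3 + d *: w i4) + y *: w i0;
            - a *: w i1 + c *: w i2 + (p *: w i3 + m *: w i4);
            b *: w i1 + - d *: w i2 + (m *: w i3 + p *: w i4)] i.
Proof.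
rewrite sum5E; move: i; apply: ord5P; rewrite /connection_table /= ?scale0r ?add0r ?addr0 //.
- by rewrite addrC !addrA.
- by rewrite addrC !addrA.
- by rewrite !addrA.
- by rewrite !addrA.
Qed.

Definition frame_field (R : realType) (L0 : R) (F N1 N2 : plane R -> 'rV[R]_(ambient_dim L0))
    (i : 'I_5) (p : plane R) : 'rV[R]_(ambient_dim L0) :=
  nth 0 [:: F p; du F p; dv F p; N1 p; N2 p] i.

Section frame_system.
Variables (R : realType) (L0 : R) (O : set (plane R)).
Hypothesis openO : open O.
Variables (F : plane R -> 'rV[R]_(ambient_dim L0)) (lam : plane R -> R).
Variables (N1 N2 : plane R -> 'rV[R]_(ambient_dim L0)) (D : coeffs R).
Hypothesis sF : smooth O F.
Hypothesis fe : frame_equations O F lam N1 N2 D.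

Let drop_f (x y z : 'rV[R]_(ambient_dim L0)) : x = y -> x = y + 0 *: z.
Proof. by move=> ->; rewrite scale0r addr0. Qed.

Let drop_2 (x y : 'rV[R]_(ambient_dim L0)) : x = 1 *: x + 0 *: y.
Proof. by rewrite scale0r addr0 scale1r. Qed.

Let drop_1 (x y : 'rV[R]_(ambient_dim L0)) : y = 0 *: x + 1 *: y.
Proof. by rewrite scale0r add0r scale1r. Qed.

Lemma frame_field_u i p : O p ->
  du (frame_field F N1 N2 i) p = \sum_j conn_u 1 L0 lam D i j p *: frame_field F N1 N2 j p.
Proof.
move=> Op; apply: etrans (esym (connection_table_rows (fun j => frame_field F N1 N2 j p) _ _ _ _ _ _ _ _ _ _ _ _)).
move: i; apply: ord5P.
- exact: (drop_2 (du F p) (dv F p)).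
- by apply: etrans (frame_uu fe Op) _; rewrite mulrN.
- exact: (etrans (row_du_dvC openO sF Op) (drop_f _ (frame_vu fe Op))).
- exact: (frame_uN1 fe Op).
- exact: (frame_uN2 fe Op).
Qed.

Lemma frame_field_v i p : O p ->
  dv (frame_field F N1 N2 i) p = \sum_j conn_v 1 L0 lam D i j p *: frame_field F N1 N2 j p.
Proof.
move=> Op; apply: etrans (esym (connection_table_rows (fun j => frame_field F N1 N2 j p) _ _ _ _ _ _ _ _ _ _ _ _)).
move: i; apply: ord5P.
- exact: (drop_1 (du F p) (dv F p)).
- exact: (drop_f _ (frame_vu fe Op)).
- exact: (frame_vv fe Op).
- exact: (frame_vN1 fe Op).
- exact: (frame_vN2 fe Op).
Qed.

End frame_system.

Section system_frame.
Variables (R : realType) (L0 : R) (O : set (plane R)).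
Hypothesis openO : open O.
Hypothesis prop : propagates O.
Variables (lam : plane R -> R) (D : coeffs R).
Hypothesis slam : smooth O lam.
Hypothesis sD : smooth_data O D.
Variable V : 'I_5 -> plane R -> 'rV[R]_(ambient_dim L0).
Hypothesis sV : forall i, smooth O (V i).
Hypothesis duV : forall i p, O p -> du (V i) p = \sum_j conn_u 1 L0 lam D i j p *: V j p.
Hypothesis dvV : forall i p, O p -> dv (V i) p = \sum_j conn_v 1 L0 lam D i j p *: V j p.

Let rows_u i p (Op : O p) := etrans (duV i Op)
  (connection_table_rows (fun j => V j p) _ _ _ _ _ _ _ _ _ _ _ _).
Let rows_v i p (Op : O p) := etrans (dvV i Op)
  (connection_table_rows (fun j => V j p) _ _ _ _ _ _ _ _ _ _ _ _).

Let T1E p : O p -> du (V i0) p = V i1 p.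
Proof. by move=> Op; apply: etrans (rows_u i0 Op) _; rewrite /= scale1r scale0r addr0. Qed.

Let T2E p : O p -> dv (V i0) p = V i2 p.
Proof. by move=> Op; apply: etrans (rows_v i0 Op) _; rewrite /= scale1r scale0r add0r. Qed.

Lemma system_frame_equations : frame_equations O (V i0) lam (V i3) (V i4) D.
Proof.
have c5 (a b c d e : R) p (Op : O p) := congr2
  (fun x y => a *: x + b *: y + (c *: V i3 p + d *: V i4 p) + e *: V i0 p)
  (esym (T1E Op)) (esym (T2E Op)).
have c4 (a b c d : R) p (Op : O p) := congr2
  (fun x y => a *: x + b *: y + (c *: V i3 p + d *: V i4 p)) (esym (T1E Op)) (esym (T2E Op)).
have z (x y : 'rV[R]_(ambient_dim L0)) : x + 0 *: y = x by rewrite scale0r addr0.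
split=> p Op.
- have h := etrans (derive_ext (1, 0) openO T1E Op) (rows_u i1 Op).
  by apply: etrans (etrans h (c5 _ _ _ _ _ p Op)) _; rewrite mulrN.
- have h := etrans (derive_ext (0, 1) openO T1E Op) (rows_v i1 Op).
  exact: (etrans (etrans h (z _ _)) (c4 _ _ _ _ p Op)).
- have h := etrans (derive_ext (0, 1) openO T2E Op) (rows_v i2 Op).
  exact: (etrans h (c5 _ _ _ _ _ p Op)).
- exact: (etrans (rows_u i3 Op) (c4 _ _ _ _ p Op)).
- exact: (etrans (rows_v i3 Op) (c4 _ _ _ _ p Op)).
- exact: (etrans (rows_u i4 Op) (c4 _ _ _ _ p Op)).
- exact: (etrans (rows_v i4 Op) (c4 _ _ _ _ p Op)).
Qed.

Variable p0 : plane R.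
Hypothesis Op0 : O p0.
Hypothesis init : adapted (expR (2 * lam p0)) (V i0 p0) (V i1 p0) (V i2 p0) (V i3 p0) (V i4 p0).

Let gram0 i j : inner (V i p0) (V j p0) = gram_target L0 (expR (2 * lam p0)) i j \/
  weight L0 i * weight L0 j = 0.
Proof.
case: init => [[t1 t2 t3] [m1 m2 m3] [c1 c2 c3 c4] [f1 f2 f3 f4] ff].
have [L00|L00] := eqVneq L0 0.
  move: i j; apply: ord5P; apply: ord5P;
    try by [left|left; apply: etrans (innerC _ _) _|right; rewrite /weight /= L00 ?mul0r ?mulr0].
have cancel0 z : L0 * z = 0 -> z = 0.
  by move/eqP; rewrite mulf_eq0 (negPf L00) => /eqP.
have gf : inner (V i0 p0) (V i0 p0) = L0^-1.
  by apply: (mulfI L00); apply: (mulfI L00); rewrite ff divff// mulr1.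
move: (cancel0 _ f1) (cancel0 _ f2) (cancel0 _ f3) (cancel0 _ f4) => g1 g2 g3 g4.
by left; move: i j; apply: ord5P; apply: ord5P; try by [|apply: etrans (innerC _ _) _].
Qed.

Let gram p (Op : O p) := gram_propagates openO prop slam sD sV duV dvV Op0 gram0 Op.

Lemma system_adapted p : O p ->
  adapted (expR (2 * lam p)) (V i0 p) (V i1 p) (V i2 p) (V i3 p) (V i4 p).
Proof.
move=> Op.
have g11 i j : i != ord0 -> j != ord0 -> inner (V i p) (V j p) = gram_target L0 (expR (2 * lam p)) i j.
  by move=> i0' j0'; have := gram Op i j; rewrite /weight (negPf i0') (negPf j0') !mul1r.
have g01 j : j != ord0 -> L0 * inner (V i0 p) (V j p) = 0.
  move=> j0'; have := gram Op i0 j; rewrite /weight (negPf j0') /= !mulr1 => ->.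
  have j0 : (i0 == j) = false by apply/negbTE; rewrite eq_sym; exact: j0'.
  by rewrite /gram_target j0 mulr0.
split.
- by split; exact: g11.
- by split; exact: g11.
- by split; exact: g11.
- by split; exact: g01.
- have := gram Op i0 i0; rewrite /weight /gram_target /gram_diag /= !mulrA => ->.
  have [L00|L00] := eqVneq L0 0; first by rewrite L00 !mul0r.
  by rewrite mulfK.
Qed.

Lemma system_conformal : conformal_immersion O (V i0) lam.
Proof.
split=> // p Op; have [[t1 t2 t3] _ _ _ ff] := system_adapted Op.
  rewrite /spaceform; have [//|L00 /=] := eqVneq L0 0.
  by apply: (mulfI L00); apply: (mulfI L00); rewrite ff divff// mulr1.
have c (f : 'rV[R]_(ambient_dim L0) -> 'rV[R]_(ambient_dim L0) -> Prop) :
    f (V i1 p) (V i2 p) -> f (du (V i0) p) (dv (V i0) p).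
  move=> h; exact: (eq_ind_r (fun z => f z (dv (V i0) p))
    (eq_ind_r (fun z => f (V i1 p) z) h (T2E Op)) (T1E Op)).
apply: (c (fun x y => [/\ inner x x = _, inner y y = _ & inner x y = 0])).
by split.
Qed.

Lemma system_normal_frame : normal_frame O (V i0) lam (V i3) (V i4).
Proof.
split=> [||p Op]; last by have [_ [m1 m2 m3] _ _ _] := system_adapted Op.
  split=> // p Op; have [_ _ [c1 c2 c3 c4] [f1 f2 f3 f4] _] := system_adapted Op.
  split=> //.
    exact: (etrans (congr1 (fun x => inner x (V i3 p)) (T1E Op)) c1).
  exact: (etrans (congr1 (fun x => inner x (V i3 p)) (T2E Op)) c3).
split=> // p Op; have [_ _ [c1 c2 c3 c4] [f1 f2 f3 f4] _] := system_adapted Op.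
split=> //.
  exact: (etrans (congr1 (fun x => inner x (V i4 p)) (T1E Op)) c2).
exact: (etrans (congr1 (fun x => inner x (V i4 p)) (T2E Op)) c4).
Qed.

End system_frame.

(** * Flatness of the normal connection *)

Section normal_bundle.
Variables (R : realType) (L0 : R) (O : set (plane R)).
Hypothesis openO : open O.
Variables (F : plane R -> 'rV[R]_(ambient_dim L0)) (lam : plane R -> R).
Hypothesis conf : conformal_immersion O F lam.
Variables (N1 N2 : plane R -> 'rV[R]_(ambient_dim L0)).
Hypothesis nf : normal_frame O F lam N1 N2.
Variable D : coeffs R.
Hypothesis fe : frame_equations O F lam N1 N2 D.
Hypothesis sm1 : smooth O (mu1 D).
Hypothesis sm2 : smooth O (mu2 D).
Let sF : smooth O F. Proof. by have [] := conf. Qed.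
Let slam : smooth O lam. Proof. by have [] := conf. Qed.
Let sN1 : smooth O N1. Proof. by have [[]] := nf. Qed.
Let sN2 : smooth O N2. Proof. by have [_ []] := nf. Qed.
Let E (p : plane R) := expR (2 * lam p).
Let sE : smooth O E.
Proof. by apply: smooth_expR => //; exact: smoothZ. Qed.
Let E0 p : E p != 0. Proof. by rewrite gt_eqF ?expR_gt0. Qed.

Let field (x y : plane R -> R) q := x q *: N1 q + y q *: N2 q.

Let derive_field (x y : plane R -> R) (p w : plane R) : smooth O x -> smooth O y -> O p ->
  'D_w (field x y) p = ('D_w x p *: N1 p + x p *: 'D_w N1 p) + ('D_w y p *: N2 p + y p *: 'D_w N2 p).
Proof.
move=> sx sy Op.
have dx := smooth_differentiable sx Op; have dy := smooth_differentiable sy Op.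
have d1 := smooth_row_differentiable sN1 Op; have d2 := smooth_row_differentiable sN2 Op.
have e := derive_rowD w (smooth_row_differentiable (smooth_rowZ openO sx sN1) Op)
  (smooth_row_differentiable (smooth_rowZ openO sy sN2) Op).
exact: (etrans e (congr2 +%R (derive_rowZ w dx d1) (derive_rowZ w dy d2))).
Qed.

Let field_expand (T1 T2 n1 n2 f X Y : 'rV[R]_(ambient_dim L0)) (x y dx dy a b c d l m : R) :
  X = a *: T1 + b *: T2 + (l *: n1 + m *: n2) ->
  Y = c *: T1 + d *: T2 + (m *: n1 + l *: n2) ->
  (dx *: n1 + x *: X) + (dy *: n2 + y *: Y) =
  (x * a + y * c) *: T1 + (x * b + y * d) *: T2 +
    ((dx + l * x + m * y) *: n1 + (dy + m * x + l * y) *: n2) + (L0 * 0) *: f.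
Proof. by move=> -> ->; apply/rowP => j; rewrite !mxE; ring. Qed.

Let residue p (X : 'rV[R]_(ambient_dim L0)) (a b c d e : R) : O p ->
  X = a *: du F p + b *: dv F p + (c *: N1 p + d *: N2 p) + (L0 * e) *: F p ->
  X - (inner X (du F p) / E p) *: du F p + (inner X (dv F p) / E p) *: dv F p
    - (L0 * inner X (F p)) *: F p = c *: N1 p + d *: N2 p.
Proof. by move=> Op ->; exact: (adapted_residue (adapted_at openO conf nf Op) _ _ _ _ _ (E0 p)). Qed.

Lemma nabla_perp_u (x y : plane R -> R) p : smooth O x -> smooth O y -> O p ->
  nabla_perp F ord0 (field x y) p =
  (du x p + du lam p * x p + mu1 D p * y p) *: N1 p +
  (du y p + mu1 D p * x p + du lam p * y p) *: N2 p.
Proof.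
move=> sx sy Op; apply: etrans (nabla_perp_uE openO conf _ Op) (residue Op _).
exact: (etrans (derive_field (1, 0) sx sy Op)
  (field_expand _ _ _ _ _ (frame_uN1 fe Op) (frame_uN2 fe Op))).
Qed.

Lemma nabla_perp_v (x y : plane R -> R) p : smooth O x -> smooth O y -> O p ->
  nabla_perp F ord_max (field x y) p =
  (dv x p + dv lam p * x p + mu2 D p * y p) *: N1 p +
  (dv y p + mu2 D p * x p + dv lam p * y p) *: N2 p.
Proof.
move=> sx sy Op; apply: etrans (nabla_perp_vE openO conf _ Op) (residue Op _).
exact: (etrans (derive_field (0, 1) sx sy Op)
  (field_expand _ _ _ _ _ (frame_vN1 fe Op) (frame_vN2 fe Op))).
Qed.

Let congr_part p (X Y : 'rV[R]_(ambient_dim L0)) : X = Y ->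
  X - (inner X (du F p) / E p) *: du F p + (inner X (dv F p) / E p) *: dv F p
    - (L0 * inner X (F p)) *: F p =
  Y - (inner Y (du F p) / E p) *: du F p + (inner Y (dv F p) / E p) *: dv F p
    - (L0 * inner Y (F p)) *: F p.
Proof. by move=> ->. Qed.

Lemma nabla_perp_ext i (V W : plane R -> 'rV[R]_(ambient_dim L0)) p :
  (forall q, O q -> V q = W q) -> O p -> nabla_perp F i V p = nabla_perp F i W p.
Proof.
move=> VW Op; move: i; apply: ord2P.
  exact: (etrans (nabla_perp_uE openO conf V Op) (etrans
    (congr_part p (derive_ext (1, 0) openO VW Op)) (esym (nabla_perp_uE openO conf W Op)))).
exact: (etrans (nabla_perp_vE openO conf V Op) (etrans
  (congr_part p (derive_ext (0, 1) openO VW Op)) (esym (nabla_perp_vE openO conf W Op)))).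
Qed.

Lemma normal_field_coordinates xi : normal_field O F xi -> exists x y : plane R -> R,
  [/\ smooth O x, smooth O y & forall p, O p -> xi p = x p *: N1 p + y p *: N2 p].
Proof.
move=> [sxi nxi].
exists (fun p => inner (xi p) (N1 p) / E p), (fun p => - (inner (xi p) (N2 p) / E p)).
have s1 : smooth O (fun p => inner (xi p) (N1 p) / E p).
  by apply: (smooth_div openO) => [||p _]; [exact: smooth_inner|exact: sE|exact: E0].
have s2 : smooth O (fun p => inner (xi p) (N2 p) / E p).
  by apply: (smooth_div openO) => [||p _]; [exact: smooth_inner|exact: sE|exact: E0].
split=> //; first exact: smoothN.
move=> p Op; have ad := adapted_at openO conf nf Op; have [h1 h2 h3] := nxi p Op.
have alg (f T1 T2 n1 n2 z : 'rV[R]_(ambient_dim L0)) e : e != 0 -> adapted e f T1 T2 n1 n2 ->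
    tangent f z -> inner T1 z = 0 -> inner T2 z = 0 ->
    z = (inner z n1 / e) *: n1 + - (inner z n2 / e) *: n2.
  move=> e0 ad' tz z1 z2; apply/eqP; rewrite -subr_eq0; apply/eqP.
  case: (ad') => [[t1 t2 t3] [m1 m2 m3] [c1 c2 c3 c4] [f1 f2 f3 f4] ff].
  apply: (frame_complete e0 ad').
  - by rewrite !innerE (innerC z) z1 !(innerC _ T1) c1 c2 !mulr0 addr0 subr0.
  - by rewrite !innerE (innerC z) z2 !(innerC _ T2) c3 c4 !mulr0 addr0 subr0.
  - by rewrite !innerE m1 (innerC n2) m3 mulr0 addr0 divfK// subrr.
  - by rewrite !innerE m2 m3 mulr0 add0r mulrNN divfK// subrr.
  - rewrite !innerE (innerC z f) !(innerC _ f) mulrBr tz sub0r mulrDr.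
    by rewrite !(mulrCA L0) f3 f4 !mulr0 addr0 oppr0.
exact: (alg _ _ _ _ _ _ _ (E0 p) ad h1 h2 h3).
Qed.

(** With respect to the frame the normal connection is given by the form mu
    and the scalar form d lam, both closed. *)
Lemma closed_flat_normal : (forall p, O p -> dv (mu1 D) p = du (mu2 D) p) -> flat_normal O F.
Proof.
move=> ricci xi nxi p Op; have [x [y [sx sy xiE]]] := normal_field_coordinates nxi.
have [slu slv] : smooth O (du lam) /\ smooth O (dv lam) by split; [exact: smooth_du|exact: smooth_dv].
have [sxu sxv] : smooth O (du x) /\ smooth O (dv x) by split; [exact: smooth_du|exact: smooth_dv].
have [syu syv] : smooth O (du y) /\ smooth O (dv y) by split; [exact: smooth_du|exact: smooth_dv].
pose xv q := dv x q + dv lam q * x q + mu2 D q * y q.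
pose yv q := dv y q + mu2 D q * x q + dv lam q * y q.
pose xu q := du x q + du lam q * x q + mu1 D q * y q.
pose yu q := du y q + mu1 D q * x q + du lam q * y q.
have s3 (f g h f' h' : plane R -> R) : smooth O f -> smooth O g -> smooth O h -> smooth O f' ->
    smooth O h' -> smooth O (fun q => f q + g q * h q + f' q * h' q).
  by move=> *; apply: (smoothD openO); [apply: (smoothD openO) => //|]; exact: smoothM.
have d3 (f g h f' h' : plane R -> R) (w : plane R) : smooth O f -> smooth O g -> smooth O h ->
    smooth O f' -> smooth O h' -> 'D_w (fun q => f q + g q * h q + f' q * h' q) p =
    'D_w f p + ('D_w g p * h p + g p * 'D_w h p) + ('D_w f' p * h' p + f' p * 'D_w h' p).
  move=> sf sg sh sf' sh'.
  have e1 := smooth_deriveD w (smoothD openO sf (smoothM openO sg sh)) (smoothM openO sf' sh') Op.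
  have e2 := smooth_deriveD w sf (smoothM openO sg sh) Op.
  have e3 := smooth_deriveM w sg sh Op; have e4 := smooth_deriveM w sf' sh' Op.
  exact: (etrans e1 (congr2 +%R (etrans e2 (congr1 _ e3)) e4)).
have sxv' : smooth O xv by exact: s3.
have syv' : smooth O yv by exact: s3.
have sxu' : smooth O xu by exact: s3.
have syu' : smooth O yu by exact: s3.
have eu q (Oq : O q) := etrans (nabla_perp_ext ord0 xiE Oq) (nabla_perp_u sx sy Oq).
have ev q (Oq : O q) := etrans (nabla_perp_ext ord_max xiE Oq) (nabla_perp_v sx sy Oq).
have euv := etrans (nabla_perp_ext ord0 ev Op) (nabla_perp_u sxv' syv' Op).
have evu := etrans (nabla_perp_ext ord_max eu Op) (nabla_perp_v sxu' syu' Op).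
have a1 := d3 _ _ _ _ _ (1, 0) sxv slv sx sm2 sy.
have a2 := d3 _ _ _ _ _ (1, 0) syv sm2 sx slv sy.
have b1 := d3 _ _ _ _ _ (0, 1) sxu slu sx sm1 sy.
have b2 := d3 _ _ _ _ _ (0, 1) syu sm1 sx slu sy.
have l := du_dvC openO slam Op; have xx := du_dvC openO sx Op; have yy := du_dvC openO sy Op.
have r := ricci p Op.
have alg (U W n1 n2 : 'rV[R]_(ambient_dim L0))
   (lu lv luv lvu x0 x_u x_v xuv xvu y0 y_u y_v yuv yvu m1 m2 m1v m2u XV YV XU YU : R) :
   U = (XV + lu * (x_v + lv * x0 + m2 * y0) + m1 * (y_v + m2 * x0 + lv * y0)) *: n1 +
       (YV + m1 * (x_v + lv * x0 + m2 * y0) + lu * (y_v + m2 * x0 + lv * y0)) *: n2 ->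
   W = (XU + lv * (x_u + lu * x0 + m1 * y0) + m2 * (y_u + m1 * x0 + lu * y0)) *: n1 +
       (YU + m2 * (x_u + lu * x0 + m1 * y0) + lv * (y_u + m1 * x0 + lu * y0)) *: n2 ->
   XV = xuv + (luv * x0 + lv * x_u) + (m2u * y0 + m2 * y_u) ->
   YV = yuv + (m2u * x0 + m2 * x_u) + (luv * y0 + lv * y_u) ->
   XU = xvu + (lvu * x0 + lu * x_v) + (m1v * y0 + m1 * y_v) ->
   YU = yvu + (m1v * x0 + m1 * x_v) + (lvu * y0 + lu * y_v) ->
   luv = lvu -> xuv = xvu -> yuv = yvu -> m1v = m2u -> U - W = 0.
  move=> -> -> -> -> -> -> -> -> -> ->.
  apply/eqP; rewrite subr_eq0; apply/eqP.
  by congr (_ *: _ + _ *: _); ring.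
exact: (alg _ _ _ _ _ _ _ _ _ _ _ _ _ _ _ _ _ _ _ _ _ _ _ _ _ _ euv evu a1 a2 b1 b2 l xx yy r).
Qed.

End normal_bundle.

(** * Congruence *)

Lemma smooth_derive_sum (R : realType) (O : set (plane R)) n (f : 'I_n -> plane R -> R)
    (p w : plane R) : open O -> (forall i, smooth O (f i)) -> O p ->
  'D_w (fun q => \sum_i f i q) p = \sum_i 'D_w (f i) p.
Proof.
move=> openO sf Op; apply: derive_val; apply: is_derive_sumr => i.
by apply: smooth_is_derive Op.
Qed.

Section congruence.
Variables (R : realType) (L0 : R) (O : set (plane R)).
Hypothesis openO : open O.
Hypothesis prop : propagates O.
Variables (lam : plane R -> R) (D : coeffs R).
Hypothesis sD : smooth_data O D.
Variables (F N1 N2 F' N1' N2' : plane R -> 'rV[R]_(ambient_dim L0)).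
Hypothesis conf : conformal_immersion O F lam.
Hypothesis conf' : conformal_immersion O F' lam.
Hypothesis nf : normal_frame O F lam N1 N2.
Hypothesis nf' : normal_frame O F' lam N1' N2'.
Hypothesis fe : frame_equations O F lam N1 N2 D.
Hypothesis fe' : frame_equations O F' lam N1' N2' D.
Let slam : smooth O lam. Proof. by have [] := conf. Qed.

Lemma smooth_frame_field (G M1 M2 : plane R -> 'rV[R]_(ambient_dim L0)) : conformal_immersion O G lam ->
  normal_frame O G lam M1 M2 -> forall i, smooth O (frame_field G M1 M2 i).
Proof.
move=> [sG _ _ _] [[sM1 _] [sM2 _] _]; apply: ord5P.
- exact: sG.
- exact: (smooth_row_derive (1, 0) sG).
- exact: (smooth_row_derive (0, 1) sG).
- exact: sM1.
- exact: sM2.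
Qed.

Variable p0 : plane R.
Hypothesis Op0 : O p0.

Let V := frame_field F N1 N2.
Let V' := frame_field F' N1' N2'.
Let B := frame_mx (F p0) (du F p0) (dv F p0) (N1 p0) (N2 p0).
Let B' := frame_mx (F' p0) (du F' p0) (dv F' p0) (N1' p0) (N2' p0).
(* the linear part of the isometry carries one frame at p0 to the other; the
   translation b only matters when F is not part of the frame *)
Let A := invmx B *m B'.
Let b := F' p0 - F p0 *m A.
Let E0 : expR (2 * lam p0) != 0. Proof. by rewrite gt_eqF ?expR_gt0. Qed.
Let ad := adapted_at openO conf nf Op0.
Let ad' := adapted_at openO conf' nf' Op0.
Let uB : B \in unitmx. Proof. exact: (unit_frame_mx E0 ad). Qed.
Let uB' : B' \in unitmx. Proof. exact: (unit_frame_mx E0 ad'). Qed.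

Let transport k : (k < ambient_dim L0)%N ->
  nth 0 [:: du F p0; dv F p0; N1 p0; N2 p0; F p0] k *m A =
  nth 0 [:: du F' p0; dv F' p0; N1' p0; N2' p0; F' p0] k.
Proof.
move=> hk; have e1 := row_frame_mx (F p0) (du F p0) (dv F p0) (N1 p0) (N2 p0) (Ordinal hk).
have e2 := row_frame_mx (F' p0) (du F' p0) (dv F' p0) (N1' p0) (N2' p0) (Ordinal hk).
have h : row (Ordinal hk) B *m A = row (Ordinal hk) B'.
  by rewrite -row_mul /A mulmxA mulmxV// mul1mx.
exact: (etrans (congr1 (fun z => z *m A) (esym e1)) (etrans h e2)).
Qed.

Let dim4 : (3 < ambient_dim L0)%N.
Proof. by rewrite /ambient_dim; case: ifP. Qed.

Let b0 : L0 != 0 -> b = 0.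
Proof.
move=> L00; have h4 : (4 < ambient_dim L0)%N by rewrite /ambient_dim (negPf L00).
by rewrite /b (transport h4) subrr.
Qed.

Let c (i : 'I_5) : 'rV[R]_(ambient_dim L0) := if i == ord0 then b else 0.

Let init i : V i p0 *m A + c i = V' i p0.
Proof.
have h0 := @transport 0%N (leq_trans (isT : 0 < 4)%N dim4).
have h1 := @transport 1%N (leq_trans (isT : 1 < 4)%N dim4).
have h2 := @transport 2%N (leq_trans (isT : 2 < 4)%N dim4).
have h3 := @transport 3%N dim4.
move: i; apply: ord5P; rewrite /c /=.
- by rewrite /b addrCA subrr addr0.
- exact: (etrans (addr0 _) h0).
- exact: (etrans (addr0 _) h1).
- exact: (etrans (addr0 _) h2).
- exact: (etrans (addr0 _) h3).
Qed.

Let coordinate_system (Om : 'I_5 -> 'I_5 -> plane R -> R) (G : 'I_5 -> plane R -> 'rV[R]_(ambient_dim L0))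
    i l w p : (forall i, smooth O (G i)) -> O p ->
  'D_w (G i) p = \sum_j Om i j p *: G j p ->
  'D_w (fun q => G i q ord0 l) p = \sum_j Om i j p * G j p ord0 l.
Proof.
move=> sG Op h; have e := derive_coordinate w l (smooth_row_differentiable (sG i) Op).
apply: etrans (esym e) _; rewrite h summxE.
by apply: eq_bigr => j _; rewrite mxE.
Qed.

Let sV := smooth_frame_field conf nf.
Let sV' := smooth_frame_field conf' nf'.

Let y k i p := \sum_l V i p ord0 l * A l k + c i ord0 k.

Let smooth_y k i : smooth O (y k i).
Proof.
apply: (smoothD openO); last exact: smooth_cst.
apply: (smooth_sum openO) => l; apply: (smoothM openO); last exact: smooth_cst.
exact: ((smooth_rowP openO _).1 (sV i) l).
Qed.

Let derive_y (Om : 'I_5 -> 'I_5 -> plane R -> R) k i w p : O p ->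
  'D_w (V i) p = \sum_j Om i j p *: V j p -> Om i ord0 p * b ord0 k = 0 ->
  'D_w (y k i) p = \sum_j Om i j p * y k j p.
Proof.
move=> Op h z.
have sVl l : smooth O (fun q => V i q ord0 l) by exact: ((smooth_rowP openO _).1 (sV i) l).
have sA l : smooth O (fun=> A l k : R) by exact: smooth_cst.
have sVA l : smooth O (fun q => V i q ord0 l * A l k) by exact: smoothM.
have sc : smooth O (fun=> c i ord0 k : R) by exact: smooth_cst.
have cst (a : R) : 'D_w (fun=> a : R) p = 0 by exact: (derive_cst a).
have e1 := smooth_deriveD w (smooth_sum openO sVA) sc Op.
have e2 := smooth_derive_sum w openO sVA Op.
have e3 l : 'D_w (fun q => V i q ord0 l * A l k) p = (\sum_j Om i j p * V j p ord0 l) * A l k.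
  have e := smooth_deriveM w (sVl l) (sA l) Op.
  have e' := coordinate_system l sV Op h.
  apply: etrans e _; rewrite cst mulr0 addr0.
  exact: (congr1 (fun z => z * _) e').
apply: etrans e1 _; rewrite cst addr0; apply: etrans e2 _.
apply: etrans (eq_bigr _ (fun l _ => e3 l)) _.
transitivity (\sum_j Om i j p * (\sum_l V j p ord0 l * A l k)).
  under eq_bigr => l _ do rewrite mulr_suml.
  rewrite exchange_big; apply: eq_bigr => j _; rewrite mulr_sumr.
  by apply: eq_bigr => l _; rewrite mulrA.
have -> : \sum_j Om i j p * y k j p =
    \sum_j (Om i j p * (\sum_l V j p ord0 l * A l k) + Om i j p * c j ord0 k).
  by apply: eq_bigr => j _; rewrite -mulrDr.
rewrite big_split /= [X in _ + X](bigD1 ord0)//= /c eqxx z add0r.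
rewrite [X in _ + X]big1 ?addr0// => j j0.
by rewrite (negPf j0) mxE mulr0.
Qed.

Let conn_u0 i p k : conn_u 1 L0 lam D i ord0 p * b ord0 k = 0.
Proof.
have [L00|/b0 ->] := eqVneq L0 0; last by rewrite mxE mulr0.
move: i; apply: ord5P; rewrite /conn_u /connection_table /= ?mul0r//.
by rewrite [X in X * expR _]L00 mul0r oppr0 mul0r.
Qed.

Let conn_v0 i p k : conn_v 1 L0 lam D i ord0 p * b ord0 k = 0.
Proof.
have [L00|/b0 ->] := eqVneq L0 0; last by rewrite mxE mulr0.
move: i; apply: ord5P; rewrite /conn_v /connection_table /= ?mul0r//.
by rewrite [X in X * expR _]L00 mul0r mul0r.
Qed.

(** Moving the first frame by the isometry gives a solution of the linear system
    with the initial values of the second frame. *)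
Lemma frame_congruence : congruent_on O F F'.
Proof.
exists (fun x => x *m A + b).
  apply: affine_isometry b0; first by rewrite unitmx_mul unitmx_inv uB uB'.
  apply: same_gram_isometry uB _.
  exact: (etrans (frame_gram ad) (esym (frame_gram ad'))).
move=> p Op; apply/rowP => k.
have sF : smooth O F by have [] := conf.
have sF' : smooth O F' by have [] := conf'.
have s1 := fun i j => smooth_conn_u openO 1 L0 slam sD i j.
have s2 := fun i j => smooth_conn_v openO 1 L0 slam sD i j.
have hy : solution_on (conn_u 1 L0 lam D) (conn_v 1 L0 lam D) O (y k).
  apply: smooth_solution (smooth_y k) _ => i q Oq; split.
    exact: (derive_y Oq (frame_field_u openO sF fe i Oq) (conn_u0 i q k)).
  exact: (derive_y Oq (frame_field_v fe i Oq) (conn_v0 i q k)).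
have hz : solution_on (conn_u 1 L0 lam D) (conn_v 1 L0 lam D) O (fun i q => V' i q ord0 k).
  apply: smooth_solution => [i|i q Oq]; first exact: ((smooth_rowP openO _).1 (sV' i) k).
  split.
    exact: (coordinate_system k sV' Oq (frame_field_u openO sF' fe' i Oq)).
  exact: (coordinate_system k sV' Oq (frame_field_v fe' i Oq)).
have yE i q : y k i q = (V i q *m A + c i) ord0 k by rewrite !mxE.
have h0 i : y k i p0 = V' i p0 ord0 k by rewrite yE init.
have := solution_unique openO s1 s2 prop hy hz Op0 Op h0 ord0.
by rewrite yE => e; rewrite -[LHS]/(V' ord0 p ord0 k) -e.
Qed.

End congruence.

(** * Construction of the second fundamental form from the potentials *)

Section potential_algebra.
Variable R : realType.
Implicit Types a b c d k l s r m e t w : R.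

Lemma null_potentials a b c d m e : m != 0 ->
  c + d = e * (m * (a - b)) -> c - d = m^-1 * (a + b) ->
  (b * c + d * a) * (b * c - d * a) != 0 -> a - b != 0 /\ a + b != 0.
Proof.
move=> m0 h1 h2 nz; have A2 : 2 * (b * c + d * a) = (a - b) * (a + b) * (e * m - m^-1).
  transitivity ((a + b) * (c + d) - (a - b) * (c - d)); first by ring.
  by rewrite h1 h2; ring.
have : 2 * (b * c + d * a) != 0.
  by rewrite mulf_neq0// ?pnatr_eq0//; apply: contra nz => /eqP ->; rewrite mul0r.
by rewrite A2 !mulf_eq0 !negb_or => /andP[/andP[]].
Qed.

(** The two solutions k of t = tfun k, one for each sign e' = - e. *)
Definition k_of_t t e : R := (1 - e * expR (2 * t)) / (1 + e * expR (2 * t)).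

Lemma k_of_t_denom t e : e = 1 \/ e = -1 -> t != 0 -> 1 + e * expR (2 * t) != 0.
Proof.
case=> -> t0; first by rewrite mul1r gt_eqF// addr_gt0// expR_gt0.
rewrite mulN1r subr_eq0 eq_sym; apply: contra t0 => /eqP h.
have := congr1 (@ln R) h; rewrite expRK ln1 => /eqP.
by rewrite mulf_eq0 pnatr_eq0.
Qed.

Lemma tval_k_of_t t e : e = 1 \/ e = -1 -> t != 0 -> tval (k_of_t t e) = t.
Proof.
move=> he t0; have := k_of_t_denom he t0; have E0 := expR_gt0 (2 * t).
rewrite /tval /k_of_t; set E := expR (2 * t) in E0 *; move=> d0.
have -> : ((1 - e * E) / (1 + e * E) - 1) / ((1 - e * E) / (1 + e * E) + 1) = - e * E.
  have two : (2 : R) != 0 by rewrite pnatr_eq0.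
  have -> : (1 - e * E) / (1 + e * E) + 1 = 2 / (1 + e * E) by field.
  by field.
rewrite mulNr normrN normrM sign_norm// mul1r gtr0_norm// /E expRK.
by field.
Qed.

(** A k + B is a multiple of m + E / m with E = e^(2 t) > 0, for the sign of k
    opposite to the sign e of P' Q' = e P Q. *)
Lemma k_of_t_regular t e a b c d m A B : e = 1 \/ e = -1 -> t != 0 -> m != 0 ->
  c + d = e * (m * (a - b)) -> c - d = m^-1 * (a + b) -> a - b != 0 -> a + b != 0 ->
  A = b * c + d * a -> B = a * c + b * d ->
  A * k_of_t t e + B != 0.
Proof.
move=> he t0 m0 h1 h2 P0 Q0 hA hB; have := k_of_t_denom he t0.
have E0 := expR_gt0 (2 * t); rewrite /k_of_t; set E := expR (2 * t) in E0 *; move=> d0.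
have e0 := sign_neq0 he.
have -> : A * ((1 - e * E) / (1 + e * E)) + B =
    (a - b) * (a + b) * (e * (m ^+ 2 + E) / m) / (1 + e * E).
  transitivity (((a + b) * (c + d) + e * E * ((a - b) * (c - d))) / (1 + e * E)).
    by rewrite hA hB; field.
  by rewrite h1 h2; field; apply/andP.
have mE : m ^+ 2 + E != 0 by rewrite gt_eqF// ltr_wpDl// sqr_ge0.
by rewrite !mulf_neq0// invr_eq0.
Qed.

Section kplus_algebra.
Variables (a b c d l A B w : R).
Hypothesis hA : A = b * c + d * a.
Hypothesis hB : B = a * c + b * d.
Hypothesis hw : w = A * l + B.
Hypothesis w0 : w != 0.
Let k := (B * l + A) / w.

(** The numbers B - A and B + A factor into null derivatives, and k_+ is the
    image of k_- under the corresponding hyperbolic rotation. *)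
Lemma kplusB1 : k - 1 = (a - b) * (c - d) * (l - 1) / w.
Proof.
rewrite -[in LHS](divff w0) -mulrBl; congr (_ / _).
by rewrite hw hA hB; ring.
Qed.

Lemma kplusD1 : k + 1 = (a + b) * (c + d) * (l + 1) / w.
Proof.
rewrite -[in LHS](divff w0) -mulrDl; congr (_ / _).
by rewrite hw hA hB; ring.
Qed.

Lemma kplus_null_relations s r sg e m :
  e = 1 \/ e = -1 -> m != 0 -> l != 1 -> l != -1 ->
  c + d = e * (m * (a - b)) -> c - d = m^-1 * (a + b) -> a - b != 0 -> a + b != 0 ->
  s = Num.sqrt `|k ^+ 2 - 1| -> r = Num.sqrt `|l ^+ 2 - 1| ->
  sg = 1 \/ sg = -1 -> 0 < sg * - ((a - b) * (a + b) * w) ->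
  [/\ k != 1, k != -1,
      (k + 1) * ((a - b) / s) = - ((l + 1) * ((sg * c + sg * d) / r)) &
      (k - 1) * ((a + b) / s) = - ((l - 1) * ((sg * c - sg * d) / r))].
Proof.
move=> he m0 l1 l2 h1 h2 P0 Q0 hs hr hsg pos.
have e0 := sign_neq0 he; have sg0 := sign_neq0 hsg; have sgsg := sign_sqr hsg.
have l1' : l - 1 != 0 by rewrite subr_eq0.
have l2' : l + 1 != 0 by rewrite addr_eq0.
have P'0 : c + d != 0 by rewrite h1 !mulf_neq0.
have Q'0 : c - d != 0 by rewrite h2 !mulf_neq0 ?invr_eq0.
have k1 : k - 1 != 0 by rewrite kplusB1 !mulf_neq0 ?invr_eq0.
have k2 : k + 1 != 0 by rewrite kplusD1 !mulf_neq0 ?invr_eq0.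
have l0 : l ^+ 2 - 1 != 0 by rewrite subr_sqr_1 mulf_neq0.
have r0 : r != 0 by rewrite hr gt_eqF// sqrtr_gt0 normr_gt0.
have sE : s = `|(a - b) * (a + b)| / `|w| * r.
  have -> : s = Num.sqrt (`|(a - b) * (a + b) / w| ^+ 2 * `|l ^+ 2 - 1|).
    rewrite hs subr_sqr_1 kplusB1 kplusD1; congr Num.sqrt.
    have -> : (a - b) * (c - d) * (l - 1) / w * ((a + b) * (c + d) * (l + 1) / w) =
        e * (((a - b) * (a + b) / w) ^+ 2 * (l ^+ 2 - 1)).
      by rewrite h1 h2; field; apply/andP.
    by rewrite normrM sign_norm// mul1r normrM normrX.
  by rewrite sqrtrM ?sqr_ge0// sqrtr_sqr normr_id -hr normrM normfV.
have nw : `|(a - b) * (a + b)| * `|w| = - (sg * ((a - b) * (a + b) * w)).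
  have := gtr0_norm pos.
  rewrite (normrM sg) (sign_norm hsg) mul1r normrN (normrM _ w) => ->.
  by rewrite mulrN.
have w1 : `|w| != 0 by rewrite normr_eq0.
have sinv : s^-1 = - (sg * w) / ((a - b) * (a + b) * r).
  have s0 : s != 0.
    by rewrite sE !mulf_neq0 ?invr_eq0// normr_eq0 mulf_neq0.
  apply: (mulfI s0); rewrite divff//.
  have PQ : s * (- (sg * w)) = (a - b) * (a + b) * r.
    rewrite sE; apply: (mulIf w1).
    have ww : `|w| * `|w| = w * w by rewrite -!expr2 real_normK ?num_real.
    transitivity (- (sg * w) * r * `|(a - b) * (a + b)|); first by field.
    apply: (mulIf w1).
    transitivity (- (sg * w) * r * (`|(a - b) * (a + b)| * `|w|)); first by ring.
    transitivity ((a - b) * (a + b) * r * (`|w| * `|w|)); last by ring.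
    rewrite nw ww; transitivity (sg * sg * ((a - b) * (a + b) * r * (w * w))); first by ring.
    by rewrite sgsg mul1r.
  by rewrite mulrA PQ divff// !mulf_neq0.
split.
- by rewrite -subr_eq0.
- by rewrite -addr_eq0.
- by rewrite sinv kplusD1; field; do ?[apply/andP; split=> //].
- by rewrite sinv kplusB1; field; do ?[apply/andP; split=> //].
Qed.

End kplus_algebra.

Lemma null_compatibility_converse (Xp Xm Yp Ym : R) a b c d k l s r :
  (k + 1) * ((a - b) / s) = - ((l + 1) * ((c + d) / r)) ->
  (k - 1) * ((a + b) / s) = - ((l - 1) * ((c - d) / r)) ->
  Xp = b / s -> Yp = a / s -> Xm = - (d / r) -> Ym = c / r ->
  Xp + Xm = k * Yp + l * Ym /\ Yp + Ym = k * Xp + l * Xm.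
Proof.
move=> h1 h2 -> -> -> ->; move: h1 h2; rewrite !mulrDl !mulNr.
move: (a / s) (b / s) (c / r) (d / r) => A B C D h1 h2.
by split; lra.
Qed.

(** The Gauss and Ricci equations of the second fundamental form, from
    W X = Y Z for both signs. *)
Lemma gauss_ricci_algebra (a1 a2 a3 b1 b2 b3 : R) :
  (a2 + 1 * b1) * (a2 + 1 * b3) = (b2 + 1 * a1) * (b2 + 1 * a3) ->
  (a2 + -1 * b1) * (a2 + -1 * b3) = (b2 + -1 * a1) * (b2 + -1 * a3) ->
  a1 * a3 + b2 * b2 = a2 * a2 + b1 * b3 /\ a2 * b3 + b1 * a2 = b2 * a3 + a1 * b2.
Proof. by move=> h1 h2; split; lra. Qed.

(** If alpha = u beta with u^2 <> 1, the Gauss equation leaves b_2^2 = b_1 b_3,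
    which is a factor of X_+^2 Y_-^2 - X_-^2 Y_+^2; if u^2 = 1, then k_+ <> u
    forces X_+ and Y_+ to vanish. *)
Lemma independent_forms (a1 a2 a3 b1 b2 b3 kp km x y : R) :
  kp != 1 -> kp != -1 ->
  a2 + b1 = kp * (b2 + a1) -> b2 + a3 = kp * (a2 + b3) ->
  (a2 + b3) ^+ 2 * (b2 - a1) ^+ 2 - (a2 - b3) ^+ 2 * (b2 + a1) ^+ 2 != 0 ->
  a1 * a3 + b2 * b2 = a2 * a2 + b1 * b3 ->
  x * a1 + y * b1 = 0 -> x * a2 + y * b2 = 0 -> x * a3 + y * b3 = 0 ->
  x != 0 \/ y != 0 -> False.
Proof.
move=> k1 k2 hW hZ nz g e1 e2 e3 xy; move/eqP: nz; apply.
have [x0|x0] := eqVneq x 0.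
  have y0 : y != 0 by case: xy; rewrite ?x0 ?eqxx.
  have bz a b : x * a + y * b = 0 -> b = 0.
    by rewrite x0 mul0r add0r => /eqP; rewrite mulf_eq0 (negPf y0) => /eqP.
  by rewrite (bz _ _ e2) (bz _ _ e3); ring.
pose u := - y / x.
have au a b : x * a + y * b = 0 -> a = u * b.
  by move=> /eqP; rewrite addr_eq0 => /eqP h; apply: (mulfI x0); rewrite h /u; field.
move: (au _ _ e1) (au _ _ e2) (au _ _ e3) => h1 h2 h3; rewrite h1 h2 h3 in hW hZ g *.
have [uu|uu] := eqVneq (u ^+ 2) 1.
  have uk : kp != u.
    apply/eqP => ku; have : kp ^+ 2 = 1 by rewrite ku.
    by move/eqP; rewrite sqrf_eq1 (negPf k1) (negPf k2).
  have ku : kp - u != 0 by rewrite subr_eq0.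
  have Y0 : b2 + u * b1 = 0.
    apply: (mulfI ku); rewrite mulr0 mulrBl -hW.
    transitivity ((1 - u ^+ 2) * b1); first by ring.
    by rewrite uu subrr mul0r.
  have X0 : u * b2 + b3 = 0.
    apply: (mulfI ku); rewrite mulr0 mulrBl -hZ.
    transitivity ((1 - u ^+ 2) * b2); first by ring.
    by rewrite uu subrr mul0r.
  by rewrite Y0 X0; ring.
have bb : b2 * b2 = b1 * b3.
  have uu1 : u ^+ 2 - 1 != 0 by rewrite subr_eq0.
  apply: (mulfI uu1); apply: (eq_of_sub (esym g)); ring.
rewrite (_ : _ - _ = (2 * u * (b2 * b2 - b1 * b3)) * (2 * (b2 * b3 - u ^+ 2 * b1 * b2))); last by ring.
by rewrite bb subrr mulr0 mul0r.
Qed.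

End potential_algebra.

Lemma both_signs (R : realType) (x y : R) : x + 1 * y = 0 -> x + -1 * y = 0 -> x = 0 /\ y = 0.
Proof. by move=> h1 h2; split; lra. Qed.

Section construction.
Variables (R : realType) (L0 : R) (O : set (plane R)) (delta : R).
Variables (lam gam t rho fp fm : plane R -> R).
Hypothesis openO : open O.
Hypothesis prop : propagates O.
Hypothesis hde : delta = 1 \/ delta = -1.
Hypothesis sgam : smooth O gam.
Hypothesis st : smooth O t.
Hypothesis srho : smooth O rho.
Hypothesis sfp : smooth O fp.
Hypothesis sfm : smooth O fm.
Hypothesis se : structure_equations L0 O delta lam gam t rho fp fm.

Let relations := ratio_relations hde (eq_iv se).

Let nonzero e p : O p -> du fm p + dv fm p = e * (ratio delta (rho p) * (du fp p - dv fp p)) ->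
  du fm p - dv fm p = (ratio delta (rho p))^-1 * (du fp p + dv fp p) ->
  du fp p - dv fp p != 0 /\ du fp p + dv fp p != 0.
Proof.
move=> Op h1 h2.
exact: (null_potentials (ratio_neq0 hde (rho p)) h1 h2 (eq_iii se Op)).
Qed.

Lemma admissible_exists : exists km, admissible O t km fp fm.
Proof.
have [e he rel] := relations; have e0 := sign_neq0 he.
exists (fun p => k_of_t (t p) e); split.
  have sE : smooth O (fun p => e * expR (2 * t p)).
    by apply: (smoothZ openO); apply: (smooth_expR openO); exact: smoothZ.
  have s1 : smooth O (fun=> 1 : R) by exact: smooth_cst.
  apply: (smooth_div openO (smoothB openO s1 sE) (smoothD openO s1 sE)) => p Op.
  exact: (k_of_t_denom he (eq_ii se Op)).
move=> p Op; have [h1 h2] := rel p Op; have [P0 Q0] := nonzero Op h1 h2.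
split; first exact: (esym (tval_k_of_t he (eq_ii se Op))).
exact: (k_of_t_regular he (eq_ii se Op) (ratio_neq0 hde (rho p)) h1 h2 P0 Q0 erefl erefl).
Qed.

Variable km : plane R -> R.
Hypothesis adm : admissible O t km fp fm.
Let kp := kplus km fp fm.
Let den p := Defs.coefA fp fm p * km p + Defs.coefB fp fm p.

Let skm : smooth O km. Proof. by case: adm. Qed.
Let tE p : O p -> t p = tfun km p. Proof. by move=> Op; case: adm => _ /(_ p Op)[]. Qed.
Let den0 p : O p -> den p != 0. Proof. by move=> Op; case: adm => _ /(_ p Op)[]. Qed.

Lemma km_regular p : O p -> km p != 1 /\ km p != -1.
Proof.
move=> Op; have : tval (km p) != 0 by rewrite -[tval _]/(tfun km p) -(tE Op); exact: (eq_ii se Op).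
by rewrite tval_eq0 !negb_or => /and3P[].
Qed.

Let km1 p (Op : O p) := (km_regular Op).1.
Let km2 p (Op : O p) := (km_regular Op).2.

Let sdup : smooth O (du fp). Proof. exact: smooth_du. Qed.
Let sdvp : smooth O (dv fp). Proof. exact: smooth_dv. Qed.
Let sdum : smooth O (du fm). Proof. exact: smooth_du. Qed.
Let sdvm : smooth O (dv fm). Proof. exact: smooth_dv. Qed.

Let smooth_A : smooth O (Defs.coefA fp fm).
Proof. exact: (smoothD openO (smoothM openO sdvp sdum) (smoothM openO sdvm sdup)). Qed.

Let smooth_B : smooth O (Defs.coefB fp fm).
Proof. exact: (smoothD openO (smoothM openO sdup sdum) (smoothM openO sdvp sdvm)). Qed.

Let smooth_den : smooth O den.
Proof. by apply: (smoothD openO) => //; exact: smoothM. Qed.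

Lemma smooth_kplus : smooth O kp.
Proof.
apply: (smooth_div openO _ smooth_den den0).
by apply: (smoothD openO) => //; exact: smoothM.
Qed.

(** The relations between alpha and beta force a sign on f_-, because the square
    roots in the definition of the potentials are positive: it is the constant
    sign of - ((f_+)_u^2 - (f_+)_v^2) (A k_- + B). *)
Lemma kplus_sign : exists2 sg : R, sg = 1 \/ sg = -1 & forall p, O p ->
  [/\ kp p != 1, kp p != -1,
      (kp p + 1) * ((du fp p - dv fp p) / Num.sqrt `|kp p ^+ 2 - 1|) =
        - ((km p + 1) * ((sg * du fm p + sg * dv fm p) / Num.sqrt `|km p ^+ 2 - 1|)) &
      (kp p - 1) * ((du fp p + dv fp p) / Num.sqrt `|kp p ^+ 2 - 1|) =
        - ((km p - 1) * ((sg * du fm p - sg * dv fm p) / Num.sqrt `|km p ^+ 2 - 1|))].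
Proof.
have [e he rel] := relations.
pose g p := - ((du fp p - dv fp p) * (du fp p + dv fp p) * den p).
have sg : smooth O g.
  exact: (smoothN openO (smoothM openO (smoothM openO (smoothB openO sdup sdvp)
    (smoothD openO sdup sdvp)) smooth_den)).
have g0 p : O p -> g p != 0.
  move=> Op; have [h1 h2] := rel p Op; have [P0 Q0] := nonzero Op h1 h2.
  have alg (x y z : R) : x != 0 -> y != 0 -> z != 0 -> - (x * y * z) != 0.
    by move=> x0 y0 z0; rewrite oppr_eq0 !mulf_neq0.
  exact: (alg _ _ _ P0 Q0 (den0 Op)).
have [s hs pos] := constant_sign prop sg g0.
exists s => // p Op; have [h1 h2] := rel p Op; have [P0 Q0] := nonzero Op h1 h2.
exact: (kplus_null_relations (A := Defs.coefA fp fm p) (B := Defs.coefB fp fm p) erefl erefl erefl (den0 Op)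
  he (ratio_neq0 hde (rho p)) (km1 Op) (km2 Op) h1 h2 P0 Q0 erefl erefl hs (pos p Op)).
Qed.

Variable sg : R.
Hypothesis hsg : sg = 1 \/ sg = -1.
Hypothesis rel : forall p, O p ->
  [/\ kp p != 1, kp p != -1,
      (kp p + 1) * ((du fp p - dv fp p) / Num.sqrt `|kp p ^+ 2 - 1|) =
        - ((km p + 1) * ((sg * du fm p + sg * dv fm p) / Num.sqrt `|km p ^+ 2 - 1|)) &
      (kp p - 1) * ((du fp p + dv fp p) / Num.sqrt `|kp p ^+ 2 - 1|) =
        - ((km p - 1) * ((sg * du fm p - sg * dv fm p) / Num.sqrt `|km p ^+ 2 - 1|))].

Let kp1 p (Op : O p) : kp p != 1. Proof. by have [] := rel Op. Qed.
Let kp2 p (Op : O p) : kp p != -1. Proof. by have [] := rel Op. Qed.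

Let f p := sg * fm p.
Let sf : smooth O f. Proof. exact: smoothZ. Qed.
Let duf p (Op : O p) : du f p = sg * du fm p.
Proof. exact: (smooth_deriveZ openO sg (1, 0) sfm Op). Qed.
Let dvf p (Op : O p) : dv f p = sg * dv fm p.
Proof. exact: (smooth_deriveZ openO sg (0, 1) sfm Op). Qed.

Definition sqrt_k (k : plane R -> R) p := Num.sqrt `|k p ^+ 2 - 1|.

(** The inverse of the passage from alpha, beta to W, X, Y, Z, with
    W = k Y and Z = k X. *)
Definition data_coeffs (Xp Xm Yp Ym kp km m1 m2 : plane R -> R) : coeffs R :=
  Coeffs (fun p => (Yp p - Ym p) / 2) (fun p => (Xp p + Xm p) / 2)
         (fun p => (kp p * Xp p - km p * Xm p) / 2)
         (fun p => (kp p * Yp p - km p * Ym p) / 2) (fun p => (Yp p + Ym p) / 2)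
         (fun p => (Xp p - Xm p) / 2) m1 m2.

Definition built_coeffs : coeffs R := data_coeffs
  (fun p => dv fp p / sqrt_k kp p) (fun p => - (dv f p / sqrt_k km p))
  (fun p => du fp p / sqrt_k kp p) (fun p => du f p / sqrt_k km p)
  kp km (du gam) (dv gam).
Let D := built_coeffs.

Let built_relations p : O p ->
  dv fp p / sqrt_k kp p + - (dv f p / sqrt_k km p) =
    kp p * (du fp p / sqrt_k kp p) + km p * (du f p / sqrt_k km p) /\
  du fp p / sqrt_k kp p + du f p / sqrt_k km p =
    kp p * (dv fp p / sqrt_k kp p) + km p * - (dv f p / sqrt_k km p).
Proof.
move=> Op; have [_ _ h1 h2] := rel Op; rewrite (duf Op) (dvf Op).
exact: (null_compatibility_converse h1 h2 erefl erefl erefl erefl).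
Qed.

Let data_algebra (X X' Y Y' k l : R) : X + X' = k * Y + l * Y' -> Y + Y' = k * X + l * X' ->
  [/\ [/\ (X + X') / 2 + 1 * ((k * Y - l * Y') / 2) = k * Y,
          (Y + Y') / 2 + 1 * ((k * X - l * X') / 2) = k * X,
          (X + X') / 2 + 1 * ((X - X') / 2) = X & (Y + Y') / 2 + 1 * ((Y - Y') / 2) = Y] &
      [/\ (X + X') / 2 + -1 * ((k * Y - l * Y') / 2) = l * Y',
          (Y + Y') / 2 + -1 * ((k * X - l * X') / 2) = l * X',
          (X + X') / 2 + -1 * ((X - X') / 2) = X' & (Y + Y') / 2 + -1 * ((Y - Y') / 2) = Y']].
Proof. by move=> h1 h2; split; split; lra. Qed.

Lemma built_plus : signed_data 1 O D kp fp.
Proof.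
split=> [||p Op|p Op]; [exact: smooth_kplus|exact: sfp|..];
  have [h1 h2] := built_relations Op; have [[e1 e2 e3 e4] _] := data_algebra h1 h2.
  split; first exact: (etrans e1 (congr1 _ (esym e4))).
  exact: (etrans e2 (congr1 _ (esym e3))).
by split; [exact: (etrans e3 (esym (mul1r _)))|exact: e4].
Qed.

Lemma built_minus : signed_data (-1) O D km f.
Proof.
split=> [||p Op|p Op]; [exact: skm|exact: sf|..];
  have [h1 h2] := built_relations Op; have [_ [e1 e2 e3 e4]] := data_algebra h1 h2.
  split; first exact: (etrans e1 (congr1 _ (esym e4))).
  exact: (etrans e2 (congr1 _ (esym e3))).
by split; [exact: (etrans e3 (esym (mulN1r _)))|exact: e4].
Qed.

Lemma built_smooth : smooth_data O D.
Proof.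
have [a b] := smooth_coeffs openO built_plus built_minus kp1 kp2 km1 km2.
by split=> //; split; [exact: smooth_du|exact: smooth_dv].
Qed.

Let trel p : O p -> tfun kp p = t p - delta * rho p.
Proof.
move=> Op; have [e he rl] := relations; have [h1 h2] := rl p Op.
have [P0 Q0] := nonzero Op h1 h2; have [_ _ n1 n2] := rel Op.
have s0 := sqrt_factor_neq0 kp1 kp2 Op; have r0 := sqrt_factor_neq0 km1 km2 Op.
have m0 := ratio_neq0 hde (rho p).
have sg0 := sign_neq0 hsg; have sgsg := sign_sqr hsg.
have alg1 (c d x y m : R) : c + d = e * (m * x) -> sg * c + sg * d = e * (sg * m * x).
  by rewrite -mulrDr => ->; ring.
have alg2 (c d x m : R) : c - d = m^-1 * x -> sg * c - sg * d = (sg * m)^-1 * x.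
  rewrite -mulrBr => ->; rewrite invfM mulrA; congr (_ * _ * _).
  by apply: (mulIf sg0); rewrite sgsg mulVf.
have e1 := tval_relation s0 r0 (kp1 Op) (kp2 Op) (km1 Op) (km2 Op) n1 n2 P0 Q0
  (mulf_neq0 sg0 m0) he (alg1 _ _ _ 0 _ h1) (alg2 _ _ _ _ h2).
have e2 : ln `|sg * ratio delta (rho p)| = delta * rho p.
  by rewrite normrM (sign_norm hsg) mul1r ln_ratio.
exact: (etrans e1 (congr2 (fun x y => x - y) (esym (tE Op)) e2)).
Qed.

Lemma built_codazzi_plus p : O p ->
  dv fp p * (du gam p - du (tfun kp) p) - du fp p * (dv gam p - dv (tfun kp) p) =
  - 1 * (du lam p * du fp p - dv lam p * dv fp p) /\
  dv f p * (du gam p - du (tfun km) p) - du f p * (dv gam p - dv (tfun km) p) =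
  - -1 * (du lam p * du f p - dv lam p * dv f p).
Proof.
move=> Op; have A0 : coefA' fp fm p != 0.
  by have := eq_iii se Op; apply: contraNneq => ->; rewrite mulr0.
have [h1 h2] := (solve_connection _ _ _ _ _ _ _ erefl erefl erefl erefl A0).2 (eq_v se Op).
have dtp (w : plane R) : 'D_w (tfun kp) p = 'D_w t p - delta * 'D_w rho p.
  have d1 := derive_ext w openO trel Op.
  have d2 : 'D_w (fun q => t q - delta * rho q) p = 'D_w t p - 'D_w (fun q => delta * rho q) p.
    apply: derive_val; apply: is_deriveB; apply: smooth_is_derive Op => //.
    exact: smoothZ.
  exact: (etrans d1 (etrans d2 (congr1 (fun z => _ - z) (smooth_deriveZ openO delta w srho Op)))).
have dtm (w : plane R) : 'D_w (tfun km) p = 'D_w t p.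
  exact: (esym (derive_ext w openO tE Op)).
have alg1 (a b x y T1 T2 U1 U2 z : R) : b * (x - U1) - a * (y - U2) = - z ->
    T1 = U1 -> T2 = U2 -> b * (x - T1) - a * (y - T2) = - 1 * z.
  by move=> + -> -> => ->; rewrite mulN1r.
have alg2 (c d c' d' x y T1 T2 U1 U2 lu lv : R) : d * (x - U1) - c * (y - U2) = lu * c - lv * d ->
    T1 = U1 -> T2 = U2 -> c' = sg * c -> d' = sg * d ->
    d' * (x - T1) - c' * (y - T2) = - -1 * (lu * c' - lv * d').
  move=> h -> -> -> ->; transitivity (sg * (d * (x - U1) - c * (y - U2))); first by ring.
  by rewrite h; ring.
split; first exact: (alg1 _ _ _ _ _ _ _ _ _ h1 (dtp (1, 0)) (dtp (0, 1))).
exact: (alg2 _ _ _ _ _ _ _ _ _ _ _ _ h2 (dtm (1, 0)) (dtm (0, 1)) (duf Op) (dvf Op)).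
Qed.

Let codazzi_signed s k h p : s = 1 \/ s = -1 -> signed_data s O D k h ->
  (forall q, O q -> k q != 1) -> (forall q, O q -> k q != -1) -> O p ->
  dv h p * (du gam p - du (tfun k) p) - du h p * (dv gam p - dv (tfun k) p) =
   - s * (du lam p * du h p - dv lam p * dv h p) ->
  (du (be2 D) p - dv (be1 D) p + be2 D p * du lam p - be3 D p * dv lam p
    - mu2 D p * al1 D p + mu1 D p * al2 D p) +
  s * (du (al3 D) p - dv (al2 D) p + al1 D p * du lam p - al2 D p * dv lam p
    - mu2 D p * be2 D p + mu1 D p * be3 D p) = 0 /\
  (dv (be2 D) p - du (be3 D) p - be1 D p * du lam p + be2 D p * dv lam p
    + mu2 D p * al2 D p - mu1 D p * al3 D p) +
  s * (dv (al1 D) p - du (al2 D) p - al2 D p * du lam p + al3 D p * dv lam p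
    + mu2 D p * be1 D p - mu1 D p * be2 D p) = 0.
Proof.
move=> hs ds h1 h2 Op c.
have [a1 a2 a3] := smooth_al built_smooth; have [b1 b2 b3] := smooth_be built_smooth.
have E2 := (codazzi_potential openO hs ds h1 h2 lam Op (du gam p) (dv gam p)).2 c.
have E1 := codazzi_potential_dual openO hs ds h1 h2 Op c.
have dsum w x y : smooth O x -> smooth O y ->
    'D_w (fun q => x q + s * y q) p = 'D_w x p + s * 'D_w y p.
  move=> sx sy; exact: (etrans (smooth_deriveD w sx (smoothZ openO s sy) Op)
    (congr1 _ (smooth_deriveZ openO s w sy Op))).
have dZ := dsum (1, 0) _ _ b2 a3; have dW := dsum (0, 1) _ _ a2 b1.
have dY := dsum (0, 1) _ _ b2 a1; have dX := dsum (1, 0) _ _ a2 b3.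
have ss := sign_sqr hs.
have alg (Zu Wv Yv Xu a1v a2u a3u a2v b2u b1v b2v b3u x1 x2 x3 y1 y2 y3 lu lv m1 m2 : R) :
    Zu = b2u + s * a3u -> Wv = a2v + s * b1v -> Yv = b2v + s * a1v -> Xu = a2u + s * b3u ->
    Zu - s * Wv + lu * (y2 + s * x1) - s * lv * (x2 + s * y3) - s * m2 * (y2 + s * x1)
      + m1 * (x2 + s * y3) = 0 ->
    Yv - s * Xu - s * lu * (x2 + s * y1) + lv * (y2 + s * x3) + m2 * (x2 + s * y1)
      - s * m1 * (y2 + s * x3) = 0 ->
    (b2u - b1v + y2 * lu - y3 * lv - m2 * x1 + m1 * x2)
      + s * (a3u - a2v + x1 * lu - x2 * lv - m2 * y2 + m1 * y3) = 0 /\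
    (b2v - b3u - y1 * lu + y2 * lv + m2 * x2 - m1 * x3)
      + s * (a1v - a2u - x2 * lu + x3 * lv + m2 * y1 - m1 * y2) = 0.
  have mod_sign (z u K : R) : u = 0 -> z = u + (s * s - 1) * K -> z = 0.
    by move=> -> ->; rewrite ss subrr mul0r addr0.
  move=> -> -> -> -> g1 g2; split.
    by apply: (mod_sign _ _ (b1v + lv * y3 + m2 * x1) g1); ring.
  by apply: (mod_sign _ _ (b3u + lu * y1 + m1 * x3) g2); ring.
exact: (alg _ _ _ _ _ _ _ _ _ _ _ _ _ _ _ _ _ _ _ _ _ _ dZ dW dY dX E2 E1).
Qed.

Lemma built_compatibility p : O p -> compatibility lam D 1 L0 p.
Proof.
move=> Op; have [cp cm] := built_codazzi_plus Op.
have [p1 p2] := codazzi_signed (or_introl erefl) built_plus kp1 kp2 Op cp.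
have [m1 m2] := codazzi_signed (or_intror erefl) built_minus km1 km2 Op cm.
have [c3 c2] := both_signs p1 m1; have [c4 c1] := both_signs p2 m2.
have prod s k h : signed_data s O D k h -> Wpm s D p * Xpm s D p = Ypm s D p * Zpm s D p.
  by case=> _ _ /(_ p Op)[-> ->] _; rewrite mulrCA mulrA.
have [g r] := gauss_ricci_algebra (prod _ _ _ built_plus) (prod _ _ _ built_minus).
have gs : du (du lam) p - dv (dv lam) p = - (1 * L0 * expR (2 * lam p)).
  have alg (x y : R) : x + L0 * y = 0 -> x = - (1 * L0 * y).
    by move=> h; rewrite mul1r; apply/eqP; rewrite -addr_eq0 h.
  exact: (alg _ _ (eq_i se Op)).
exact: (Compatibility gs g r (esym (du_dvC openO sgam Op)) c1 c2 c3 c4).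
Qed.

Lemma built_independent p : O p -> ~ linearly_dependent O D.
Proof.
move=> Op dep.
have s0 := sqrt_factor_neq0 kp1 kp2 Op; have r0 := sqrt_factor_neq0 km1 km2 Op.
have [e1 e2 e3 e4] := signed_values built_plus built_minus Op.
have AA : Defs.coefA fp f p * coefA' fp f p != 0.
  have alg (a b c d c' d' : R) : (b * c + d * a) * (b * c - d * a) != 0 -> c' = sg * c -> d' = sg * d ->
      (b * c' + d' * a) * (b * c' - d' * a) != 0.
    move=> nz -> ->; rewrite (_ : _ * _ = sg * sg * ((b * c + d * a) * (b * c - d * a))); last by ring.
    by rewrite (sign_sqr hsg) mul1r.
  exact: (alg _ _ _ _ _ _ (eq_iii se Op) (duf Op) (dvf Op)).
have nz : Xpm 1 D p ^+ 2 * Ypm (-1) D p ^+ 2 - Xpm (-1) D p ^+ 2 * Ypm 1 D p ^+ 2 != 0.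
  by rewrite (norm_quadratic s0 r0 e1 e2 e3 e4).
have [_ g _ _ _ _ _ _] := built_compatibility Op.
have [hW hZ] : Wpm 1 D p = kp p * Ypm 1 D p /\ Zpm 1 D p = kp p * Xpm 1 D p.
  by case: built_plus => _ _ /(_ p Op).
move: hW hZ nz; rewrite /Wpm /Xpm /Ypm /Zpm !mul1r !mulN1r => hW hZ nz.
have fin x y : x * al1 D p + y * be1 D p = 0 -> x * al2 D p + y * be2 D p = 0 ->
    x * al3 D p + y * be3 D p = 0 -> x != 0 \/ y != 0 -> False.
  move=> d1 d2 d3.
  exact: (independent_forms (km p) (kp1 Op) (kp2 Op) hW hZ nz g d1 d2 d3).
have cosh0 (x : R) : cosh x != 0 by rewrite gt_eqF// divr_gt0// addr_gt0 ?expR_gt0.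
case: dep => [[s /(_ p Op)[d1 d2 d3]]|[s /(_ p Op)[d1 d2 d3]]|[e he /(_ p Op)[d1 d2 d3]]].
- by apply: (fin _ _ d1 d2 d3); left.
- by apply: (fin _ _ d1 d2 d3); right.
- by apply: (fin _ _ d1 d2 d3); left; exact: oner_neq0.
Qed.

End construction.

(** * Existence and uniqueness of the immersion *)

Section initial_frame.
Variables (R : realType) (L0 : R).

Let basis (k : nat) : 'rV[R]_(ambient_dim L0) := \row_j (j == k :> nat)%:R.

Let inner_basis k l (a b : R) : (k < ambient_dim L0)%N ->
  inner (a *: basis k) (b *: basis l) = a * b * (k == l)%:R * (-1) ^+ (k < ambient_index L0)%N.
Proof.
move=> hk; rewrite /inner (bigD1 (Ordinal hk))//= big1 ?addr0.
  by rewrite !mxE /= eqxx mulr1 mulrC; ring.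
move=> i ik; rewrite !mxE; have -> : (i == k :> nat) = false.
  by apply: contraNF ik => /eqP e; apply/eqP/val_inj.
by rewrite mulr0 mulr0 mul0r.
Qed.

(** T2 and n2 are the first two coordinate vectors, which are time-like in all
    cases; f is a multiple of the third one if L0 <> 0, which is space-like or
    time-like according to the sign of L0. *)
Lemma initial_frame (e : R) : exists f T1 T2 n1 n2 : 'rV[R]_(ambient_dim L0),
  adapted (e * e) f T1 T2 n1 n2.
Proof.
have sq (k l : nat) : (k < ambient_dim L0)%N ->
    inner (e *: basis k) (e *: basis l) = e * e * (k == l)%:R * (-1) ^+ (k < ambient_index L0)%N.
  exact: inner_basis.
have [L00|L00] := eqVneq L0 0.
  have hd : ambient_dim L0 = 4%N by rewrite /ambient_dim L00 eqxx.
  have hi : ambient_index L0 = 2%N by rewrite /ambient_index L00 ltxx.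
  have lz (x : R) : L0 * x = 0 by rewrite L00 mul0r.
  exists 0, (e *: basis 2), (e *: basis 0), (e *: basis 3), (e *: basis 1).
  by split; rewrite ?lz ?L00//; split; rewrite sq ?hd// hi /= ?mulr0 ?mul0r ?expr0 ?expr1 ?mulr1 ?mulrN1.
have hd : ambient_dim L0 = 5%N by rewrite /ambient_dim (negPf L00).
have [hi0 hi1 hi3 hi4] : [/\ (0 < ambient_index L0)%N, (1 < ambient_index L0)%N,
    (3 < ambient_index L0)%N = false & (4 < ambient_index L0)%N = false].
  by rewrite /ambient_index; case: ifP.
pose c := (Num.sqrt `|L0|)^-1.
have cc : c * c = `|L0|^-1 by rewrite /c -invfM -expr2 sqr_sqrtr.
exists (c *: basis 2), (e *: basis 3), (e *: basis 0), (e *: basis 4), (e *: basis 1).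
split.
- by split; rewrite sq ?hd// ?hi0 ?hi1 ?hi3 ?hi4 /= ?mulr0 ?mul0r ?expr0 ?expr1 ?mulr1 ?mulrN1.
- by split; rewrite sq ?hd// ?hi0 ?hi1 ?hi3 ?hi4 /= ?mulr0 ?mul0r ?expr0 ?expr1 ?mulr1 ?mulrN1.
- by split; rewrite sq ?hd// ?hi0 ?hi1 ?hi3 ?hi4 /= ?mulr0 ?mul0r ?expr0 ?expr1 ?mulr1 ?mulrN1.
- by split; rewrite inner_basis ?hd//= mulr0 mul0r mulr0.
rewrite inner_basis ?hd// eqxx mulr1 cc.
suff -> : `|L0|^-1 * (-1) ^+ (2 < ambient_index L0)%N = L0^-1 by rewrite mulrA mulfK.
rewrite /ambient_index; case: (ltrP L0 0) => h /=.
  by rewrite expr1 mulrN1 ltr0_norm// invrN opprK.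
by rewrite expr0 mulr1 ger0_norm.
Qed.

End initial_frame.

Lemma frame_existence (R : realType) (L0 : R) (O : set (plane R)) (lam : plane R -> R)
    (D : coeffs R) : open O -> simply_connected O -> smooth O lam -> smooth_data O D ->
  (forall p, O p -> compatibility lam D 1 L0 p) ->
  exists F N1 N2 : plane R -> 'rV[R]_(ambient_dim L0),
    [/\ conformal_immersion O F lam, normal_frame O F lam N1 N2 & frame_equations O F lam N1 N2 D].
Proof.
move=> openO sc slam sD comp; have [[p0 Op0] pc _] := sc.
have prop := path_connected_propagates pc.
have [f [T1 [T2 [n1 [n2 ad]]]]] := initial_frame L0 (expR (lam p0)).
pose y0 (k : 'I_(ambient_dim L0)) (i : 'I_5) : R :=
  (nth 0 [:: f; T1; T2; n1; n2] i : 'rV[R]_(ambient_dim L0)) ord0 k.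
have s1 := fun i j => smooth_conn_u openO 1 L0 slam sD i j.
have s2 := fun i j => smooth_conn_v openO 1 L0 slam sD i j.
have flat i j p (Op : O p) := conn_flat openO slam sD i j Op (comp p Op).
have sol k := flat_system_solution openO s1 s2 (y0 k) sc flat Op0.
have [y hy] := choice sol.
pose V (i : 'I_5) p : 'rV[R]_(ambient_dim L0) := \row_k y k i p.
have VE i k : (fun p => V i p ord0 k) = y k i by apply/funext => p; rewrite mxE.
have sV i : smooth O (V i).
  by apply/(smooth_rowP openO) => k; rewrite VE; have [sy _ _] := hy k.
have derive_V (w : plane R) (Om : 'I_5 -> 'I_5 -> plane R -> R) i p : O p ->
    (forall k, 'D_w (y k i) p = \sum_j Om i j p * y k j p) ->
    'D_w (V i) p = \sum_j Om i j p *: V j p.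
  move=> Op h; apply/rowP => k.
  have e := derive_coordinate w k (smooth_row_differentiable (sV i) Op).
  apply: etrans e _; rewrite VE h summxE.
  by apply: eq_bigr => j _; rewrite !mxE.
have duV i p : O p -> du (V i) p = \sum_j conn_u 1 L0 lam D i j p *: V j p.
  by move=> Op; apply: (derive_V _ _ _ _ Op) => k; have [_ /(_ i p Op)[+ _] _] := hy k.
have dvV i p : O p -> dv (V i) p = \sum_j conn_v 1 L0 lam D i j p *: V j p.
  by move=> Op; apply: (derive_V _ _ _ _ Op) => k; have [_ /(_ i p Op)[_ +] _] := hy k.
have V0 i : V i p0 = nth 0 [:: f; T1; T2; n1; n2] i.
  by apply/rowP => k; rewrite mxE; have [_ _ ->] := hy k.
have init : adapted (expR (2 * lam p0)) (V i0 p0) (V i1 p0) (V i2 p0) (V i3 p0) (V i4 p0).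
  by rewrite !V0 /= mulr_natl mulr2n expRD.
exists (V i0), (V i3), (V i4); split.
- exact: (system_conformal openO prop slam sD sV duV dvV Op0 init).
- exact: (system_normal_frame openO prop slam sD sV duV dvV Op0 init).
- exact: (system_frame_equations openO duV dvV).
Qed.

Lemma signed_data_agree (R : realType) (s : R) (O : set (plane R)) (D D' : coeffs R)
    (k f : plane R -> R) p : signed_data s O D k f -> signed_data s O D' k f -> O p ->
  [/\ Xpm s D p = Xpm s D' p, Ypm s D p = Ypm s D' p, Wpm s D p = Wpm s D' p &
      Zpm s D p = Zpm s D' p].
Proof.
case=> _ _ /(_ p)h1 /(_ p)h2 [_ _ /(_ p)h3 /(_ p)h4] Op.
have [[w1 z1] [x1 y1] [w2 z2] [x2 y2]] := And4 (h1 Op) (h2 Op) (h3 Op) (h4 Op).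
by rewrite w1 z1 w2 z2 x1 y1 x2 y2.
Qed.

Lemma coeffs_agree (R : realType) (O : set (plane R)) (D D' : coeffs R)
    (kp km fp fm : plane R -> R) p :
  signed_data 1 O D kp fp -> signed_data (-1) O D km fm ->
  signed_data 1 O D' kp fp -> signed_data (-1) O D' km fm -> O p ->
  [/\ al1 D p = al1 D' p, al2 D p = al2 D' p & al3 D p = al3 D' p] /\
  [/\ be1 D p = be1 D' p, be2 D p = be2 D' p & be3 D p = be3 D' p].
Proof.
move=> p1 m1 p2 m2 Op.
have [x1 y1 w1 z1] := signed_data_agree p1 p2 Op.
have [x2 y2 w2 z2] := signed_data_agree m1 m2 Op.
have alg (a b a' b' : R) : a + 1 * b = a' + 1 * b' -> a + -1 * b = a' + -1 * b' -> a = a' /\ b = b'.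
  by move=> h1 h2; split; lra.
have [e1 e2] := alg _ _ _ _ x1 x2; have [e3 e4] := alg _ _ _ _ y1 y2.
have [_ e5] := alg _ _ _ _ w1 w2; have [_ e6] := alg _ _ _ _ z1 z2.
by [].
Qed.

Lemma frame_equations_agree (R : realType) (L0 : R) (O : set (plane R))
    (F N1 N2 : plane R -> 'rV[R]_(ambient_dim L0)) lam (D D' : coeffs R) :
  (forall p, O p -> [/\ al1 D' p = al1 D p, al2 D' p = al2 D p & al3 D' p = al3 D p] /\
     [/\ be1 D' p = be1 D p, be2 D' p = be2 D p & be3 D' p = be3 D p] /\
     (mu1 D' p = mu1 D p /\ mu2 D' p = mu2 D p)) ->
  frame_equations O F lam N1 N2 D -> frame_equations O F lam N1 N2 D'.
Proof.
move=> agree fe; split=> p Op; have [[e1 e2 e3] [[e4 e5 e6] [e7 e8]]] := agree p Op;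
  rewrite ?e1 ?e2 ?e3 ?e4 ?e5 ?e6 ?e7 ?e8.
- exact: (frame_uu fe Op).
- exact: (frame_vu fe Op).
- exact: (frame_vv fe Op).
- exact: (frame_uN1 fe Op).
- exact: (frame_vN1 fe Op).
- exact: (frame_uN2 fe Op).
- exact: (frame_vN2 fe Op).
Qed.

Lemma attached_congruent (R : realType) (L0 : R) (O : set (plane R))
    (F N1 N2 F' N1' N2' : plane R -> 'rV[R]_(ambient_dim L0))
    (lam gam kp km fp fm : plane R -> R) (D D' : coeffs R) :
  open O -> path_connected O -> O !=set0 ->
  (forall p, O p -> kp p != 1 /\ kp p != -1) -> (forall p, O p -> km p != 1 /\ km p != -1) ->
  attached O F lam N1 N2 D gam kp km fp fm ->
  attached O F' lam N1' N2' D' gam kp km fp fm -> congruent_on O F F'.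
Proof.
move=> openO pc [p0 Op0] hp hm at1 at2.
have [c1 n1 co1 sg g1 dp1 dm1] := at1; have [c2 n2 co2 _ g2 dp2 dm2] := at2.
have fe1 := attached_frame_equations openO c1 n1 co1.
have fe2 := attached_frame_equations openO c2 n2 co2.
have smu : smooth O (mu1 D) /\ smooth O (mu2 D).
  split; [apply: (smooth_ext openO (f := du gam))|apply: (smooth_ext openO (f := dv gam))].
  - by move=> p Op; have [] := g1 p Op.
  - exact: smooth_du.
  - by move=> p Op; have [] := g1 p Op.
  - exact: smooth_dv.
have [sa sb] := smooth_coeffs openO dp1 dm1 (fun p Op => (hp p Op).1) (fun p Op => (hp p Op).2)
  (fun p Op => (hm p Op).1) (fun p Op => (hm p Op).2).
have sD : smooth_data O D by split.
have agree p : O p -> [/\ al1 D p = al1 D' p, al2 D p = al2 D' p & al3 D p = al3 D' p] /\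
     [/\ be1 D p = be1 D' p, be2 D p = be2 D' p & be3 D p = be3 D' p] /\
     (mu1 D p = mu1 D' p /\ mu2 D p = mu2 D' p).
  move=> Op; have [h1 h2] := coeffs_agree dp1 dm1 dp2 dm2 Op; split=> //; split=> //.
  have [k1 k2] := g1 p Op; have [k3 k4] := g2 p Op.
  by split; [exact: (etrans (esym k1) k3)|exact: (etrans (esym k2) k4)].
exact: (frame_congruence openO (path_connected_propagates pc) sD c1 c2 n1 n2 fe1
  (frame_equations_agree agree fe2) Op0).
Qed.

Theorem theorem4p7 (R : realType) (L0 : R) :
  (forall (O : set (plane R)) (F N1 N2 : plane R -> 'rV[R]_(ambient_dim L0))
     (lam gam kp km fp fm : plane R -> R) (D : coeffs R),
   open O -> connected O ->
   attached O F lam N1 N2 D gam kp km fp fm ->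
   (forall p, O p -> gauss_curvature (metric F) p = L0) ->
   flat_normal O F ->
   (forall p, O p ->
      [/\ kp p != 0 /\ km p != 0, kp p != 1 /\ km p != 1,
          kp p != -1 /\ km p != -1 &
          Xpm 1 D p ^+ 2 * Ypm (-1) D p ^+ 2
          - Xpm (-1) D p ^+ 2 * Ypm 1 D p ^+ 2 != 0])
   <->
   exists (delta : R) (rho : plane R -> R),
     [/\ delta = 1 \/ delta = -1, smooth O rho,
         structure_equations L0 O delta lam gam (tfun km) rho fp fm &
         forall p, O p -> tfun km p != delta * rho p])
  /\
  (forall (O : set (plane R)) (delta : R)
     (lam gam t rho fp fm : plane R -> R),
   open O -> simply_connected O ->
   delta = 1 \/ delta = -1 ->
   smooth O lam -> smooth O gam -> smooth O t -> smooth O rho ->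
   smooth O fp -> smooth O fm ->
   structure_equations L0 O delta lam gam t rho fp fm ->
   (exists km, admissible O t km fp fm) /\
   forall km, admissible O t km fp fm ->
   exists2 sigma : R, sigma = 1 \/ sigma = -1 &
     (exists (F N1 N2 : plane R -> 'rV[R]_(ambient_dim L0)) (D : coeffs R),
        [/\ attached O F lam N1 N2 D gam (kplus km fp fm) km fp
              (fun p => sigma * fm p),
            forall p, O p -> gauss_curvature (metric F) p = L0,
            flat_normal O F &
            ~ linearly_dependent O D]) /\
     (forall (F N1 N2 F' N1' N2' : plane R -> 'rV[R]_(ambient_dim L0))
        (D D' : coeffs R),
        attached O F lam N1 N2 D gam (kplus km fp fm) km fp
          (fun p => sigma * fm p) ->
        attached O F' lam N1' N2' D' gam (kplus km fp fm) km fp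
          (fun p => sigma * fm p) ->
        congruent_on O F F')).
Proof.
split.
  move=> O F N1 N2 lam gam kp km fp fm D openO connO at_ K _; split=> [reg|[delta [rho [hde srho se tr]]]].
    exact: (frame_to_structure openO at_ connO K reg).
  exact: (structure_to_frame at_ hde se tr).
move=> O delta lam gam t rho fp fm openO sc hde slam sgam st srho sfp sfm se.
split; first exact: (admissible_exists openO hde st se).
move=> km adm; have [[p0 Op0] pc _] := sc.
have prop := path_connected_propagates pc.
have [sg hsg rel] := kplus_sign openO prop hde sfp sfm se adm.
exists sg => //; split.
  pose D := built_coeffs gam fp fm km sg.
  have dplus := built_plus gam openO sfp sfm adm rel.
  have dminus := built_minus gam openO sfm adm rel.
  have sD := built_smooth openO sgam sfp sfm se adm rel.
  have comp p (Op : O p) := built_compatibility openO hde sgam st srho sfp sfm se adm hsg rel Op.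
  have [F [N1 [N2 [conf nf fe]]]] := frame_existence openO sc slam sD comp.
  exists F, N1, N2, D; split.
  - split=> //; exact: (frame_equations_coeffs openO conf nf fe).
  - move=> p Op; apply: etrans (gauss_curvature_conformal openO conf Op) _.
    have E0 : expR (2 * lam p) != 0 by rewrite gt_eqF ?expR_gt0.
    have alg (x y : R) : y != 0 -> x + L0 * y = 0 -> - (x / y) = L0.
      by move=> y0 /eqP; rewrite addr_eq0 => /eqP ->; rewrite mulNr mulfK// opprK.
    exact: alg E0 (eq_i se Op).
  - have [m1 m2] := smooth_mu sD.
    apply: (closed_flat_normal openO conf nf fe m1 m2) => p Op.
    by have [] := comp p Op.
  - exact: (built_independent openO hde sgam st srho sfp sfm se adm hsg rel Op0).
have kpr p : O p -> kplus km fp fm p != 1 /\ kplus km fp fm p != -1.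
  by move=> Op; have [] := rel p Op.
have kmr p (Op : O p) := km_regular se adm Op.
move=> F N1 N2 F' N1' N2' D D'; apply: (attached_congruent openO pc _ kpr kmr).
by exists p0.
Qed.
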